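(* Let $d$ be a real number with $0<d<\pi$, and let $\mu,\nu$ be positive numbers satisfying $\mu/2<\nu<\mu/2+1$. Let $\tilde f_{\nu,N}$ be the $2N$-point approximation formula defined in the context, built from the modified Ganelius sampling points with parameter $r=d\mu/\pi$, and let $E^{\min}_{n}(\boldsymbol{H}^\infty(\Lambda_d,w_\mu))$ be the minimum error norm defined in the context. Then there are positive numbers $c$ and $C$, independent of $N$, such that $$c\,\exp\left(-\sqrt{\pi d\mu N}\right)\le E^{\min}_{2N}(\boldsymbol{H}^{\infty}(\Lambda_d,w_\mu))\le \sup_{\substack{f\in \boldsymbol{H}^{\infty}(\Lambda_d,w_\mu)\\ \|f\|\le 1}}\left(\sup_{x\in(-1,1)}\left|f(x)-\tilde f_{\nu,N}(x)\right|\right)\le C\exp\left(-\sqrt{\pi d\mu N}\right)$$ for every positive integer $N$ for which $\tilde f_{\nu,N}$ is defined (that is, $N_0\ge 1$ and the points $a_1,\dots,a_N$ are pairwise distinct).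
   Context: **Region and space.** $\mathcal{D}_d=\{\zeta\in\mathbf{C}: |\operatorname{Im}\zeta|<d\}$ and $\Lambda_d=\{\tanh(\zeta/2):\zeta\in\mathcal{D}_d\}=\{z\in\mathbf{C}: |\arg((1+z)/(1-z))|<d\}$, so that $\Lambda_d\cap\mathbf{R}=(-1,1)$. Let $w_\mu(z)=(1-z^2)^{\mu/2}$ (principal branch, positive on $(-1,1)$). $\boldsymbol{H}^\infty(\Lambda_d,w_\mu)$ is the space of analytic functions $f:\Lambda_d\to\mathbf{C}$ with $\|f\|:=\sup_{z\in\Lambda_d}|f(z)/w_\mu(z)|<\infty$. **Minimum error norm.** For a positive integer $n$, $$E_n^{\min}(\boldsymbol{H}^\infty(\Lambda_d,w_\mu))=\inf_{1\le\ell\le n}\ \inf_{\substack{m_1,\dots,m_\ell\\ m_1+\cdots+m_\ell=n}}\ \inf_{a_j\in\Lambda_d}\ \inf_{\phi_{jk}}\ \sup_{\substack{f\in \boldsymbol{H}^\infty(\Lambda_d,w_\mu)\\ \|f\|\le1}}\ \sup_{x\in(-1,1)}\left|f(x)-\sum_{j=1}^{\ell}\sum_{k=0}^{m_j-1}f^{(k)}(a_j)\,\phi_{jk}(x)\right|,$$ where the $m_j$ are nonnegative integers, the $a_j$ ($1\le j\le\ell$) here denote arbitrary points of $\Lambda_d$, and the $\phi_{jk}$ are arbitrary analytic functions on $\Lambda_d$. **Modified Ganelius sampling points with parameter $r>0$.** For a positive integer $N$ put $N_0=N-\lceil \frac{\pi}{4}\sqrt{Nr}\rceil$ and $\varphi(x)=\exp(\pi\sqrt{x/r})$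 for $x\ge0$. Define $a_k=\varphi(k-1)/\varphi(N_0)$ for $k=1,\dots,N_0$; $a_{N_0+1}=\varphi(N_0-1/2)/\varphi(N_0)$; and $a_k=1-\frac{k-N_0-1}{5(N-N_0-1)}$ for $k=N_0+2,\dots,N$. These lie in $(0,1)$. **Derived quantities.** $b_k=\sqrt{(1-a_k)/(1+a_k)}$ and $b_{-k}=-b_k$ for $k=1,\dots,N$; $\beta_k=\tanh\left(\frac{2d}{\pi}\operatorname{arctanh} b_k\right)$ for $k=\pm1,\dots,\pm N$. A prime on a sum or product over indices from $-N$ to $N$ means that the index $0$ is excluded. Let $$\sigma_k=\prod_{\substack{\ell=-N\\ \ell\ne k}}^{N}{}^{\prime}\ \frac{1-b_\ell b_k}{b_k-b_\ell},\qquad B_N(z;\boldsymbol\beta,d)=\prod_{k=-N}^{N}{}^{\prime}\ \tanh\left[\frac{\pi}{2d}(\operatorname{arctanh} z-\operatorname{arctanh}\beta_k)\right].$$ **Formula.** For $f\in \boldsymbol{H}^\infty(\Lambda_d,w_\mu)$ and $x\in(-1,1)$, $$\tilde f_{\nu,N}(x)=\sum_{k=-N}^{N}{}^{\prime}\ f(\beta_k)\,\frac{2d\sigma_k}{\pi}\,\frac{(1-x^2)^\nu}{(1-\beta_k^2)^{\nu-1}}\,\frac{B_N(x;\boldsymbol\beta,d)}{x-\beta_k},$$ where $B_N(x;\boldsymbol\beta,d)/(x-\beta_k)$ is extended by continuity to $x=\beta_k$. *)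

(* Defs.v *)
From Stdlib Require Import Reals ZArith List.
From Coquelicot Require Import Coquelicot.

Import ListNotations.
Open Scope R_scope.

(** ** Complex elementary functions *)

Definition Cexp (z : C) : C :=
  (exp (Re z) * cos (Im z), exp (Re z) * sin (Im z)).

Definition Csinh (z : C) : C := ((Cexp z - Cexp (- z)) / 2)%C.
Definition Ccosh (z : C) : C := ((Cexp z + Cexp (- z)) / 2)%C.
Definition Ctanh (z : C) : C := (Csinh z / Ccosh z)%C.

(** Principal argument, in (-PI, PI] for [z <> 0]. *)
Definition Carg (z : C) : R :=
  if Rle_dec 0 (Im z) then acos (Re z / Cmod z) else - acos (Re z / Cmod z).

Definition Clog (z : C) : C := (ln (Cmod z), Carg z).

(** Principal branch of [z ^ s] for a real exponent [s]. *)
Definition Crpow (z : C) (s : R) : C := Cexp (s * Clog z)%C.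

Fixpoint C_derive_n (f : C -> C) (k : nat) : C -> C :=
  match k with
  | O => f
  | S k' => C_derive (C_derive_n f k')
  end.

(** The domains used below are open, so analyticity is complex
    differentiability at each point. *)
Definition analytic_on (D : C -> Prop) (f : C -> C) : Prop :=
  forall z : C, D z -> @ex_derive C_AbsRing C_NormedModule f z.

(** ** Extended-real suprema and infima of indexed families *)

Definition Rbar_sup {T : Type} (P : T -> Prop) (F : T -> Rbar) : Rbar :=
  Rbar_lub (fun y => exists t : T, P t /\ y = F t).

Definition Rbar_inf {T : Type} (P : T -> Prop) (F : T -> Rbar) : Rbar :=
  Rbar_glb (fun y => exists t : T, P t /\ y = F t).

Definition Csum {I : Type} (s : list I) (F : I -> C) : C :=
  fold_right Cplus (RtoC 0) (map F s).

Definition Rprod {I : Type} (s : list I) (F : I -> R) : R :=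
  fold_right Rmult 1 (map F s).

(** ** The region and the weighted Hardy space *)

Definition strip (d : R) (zeta : C) : Prop := Rabs (Im zeta) < d.

Definition Lambda (d : R) (z : C) : Prop :=
  exists zeta : C, strip d zeta /\ z = Ctanh (zeta / 2)%C.

Definition w_mu (mu : R) (z : C) : C := Crpow (1 - z * z)%C (mu / 2).

(** Elements of the space are represented by total functions on [C]; only their
    values on [Lambda d] matter. *)
Definition Hnorm (d mu : R) (f : C -> C) : Rbar :=
  Rbar_sup (Lambda d) (fun z => Finite (Cmod (f z / w_mu mu z)%C)).

Definition Hinf (d mu : R) (f : C -> C) : Prop :=
  analytic_on (Lambda d) f /\ Rbar_lt (Hnorm d mu f) p_infty.

Definition unit_ball (d mu : R) (f : C -> C) : Prop :=
  Hinf d mu f /\ Rbar_le (Hnorm d mu f) (Finite 1).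

(** [sup_{||f|| <= 1} sup_{-1 < x < 1} |f(x) - A(f)(x)|] *)
Definition worst_error (d mu : R) (A : (C -> C) -> R -> C) : Rbar :=
  Rbar_sup (unit_ball d mu) (fun f =>
    Rbar_sup (fun x : R => -1 < x < 1) (fun x =>
      Finite (Cmod (f (RtoC x) - A f x)%C))).

(** ** Minimum error norm *)

Definition Hermite_formula (l : nat) (m : nat -> nat) (a : nat -> C)
    (phi : nat -> nat -> C -> C) (f : C -> C) (x : R) : C :=
  Csum (seq 1 l) (fun j =>
    Csum (seq 0 (m j)) (fun k =>
      (C_derive_n f k (a j) * phi j k (RtoC x))%C)).

(** The families [m], [a], [phi] are total functions; only the indices
    [1 <= j <= l] and [0 <= k < m j] are constrained and used. *)
Definition Emin (n : nat) (d mu : R) : Rbar :=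
  Rbar_inf (fun l : nat => (1 <= l <= n)%nat) (fun l =>
  Rbar_inf (fun m : nat -> nat => list_sum (map m (seq 1 l)) = n) (fun m =>
  Rbar_inf (fun a : nat -> C =>
      forall j : nat, (1 <= j <= l)%nat -> Lambda d (a j)) (fun a =>
  Rbar_inf (fun phi : nat -> nat -> C -> C =>
      forall j k : nat, (1 <= j <= l)%nat -> (k < m j)%nat ->
        analytic_on (Lambda d) (phi j k)) (fun phi =>
  worst_error d mu (Hermite_formula l m a phi))))).

(** ** Modified Ganelius sampling points *)

(** An integer, possibly nonpositive for small [N]. *)
Definition N_0 (r : R) (N : nat) : Z :=
  (Z.of_nat N - Zceil (PI / 4 * sqrt (INR N * r)))%Z.

Definition varphi (r x : R) : R := exp (PI * sqrt (x / r)).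

(** [ganelius r N k] is [a_k], meant for [1 <= k <= N]. *)
Definition ganelius (r : R) (N : nat) (k : Z) : R :=
  let n0 := N_0 r N in
  if (k <=? n0)%Z then varphi r (IZR k - 1) / varphi r (IZR n0)
  else if (k =? n0 + 1)%Z then varphi r (IZR n0 - 1 / 2) / varphi r (IZR n0)
  else 1 - (IZR k - IZR n0 - 1) / (5 * (INR N - IZR n0 - 1)).

Definition formula_defined (r : R) (N : nat) : Prop :=
  (1 <= N_0 r N)%Z /\
  forall j k : Z, (1 <= j <= Z.of_nat N)%Z -> (1 <= k <= Z.of_nat N)%Z ->
    ganelius r N j = ganelius r N k -> j = k.

(** ** The approximation formula *)

Definition arctanh (x : R) : R := / 2 * ln ((1 + x) / (1 - x)).

(** The indices [-N, ..., -1, 1, ..., N] of the primed sums and products. *)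
Definition nonzero_indices (N : nat) : list Z :=
  flat_map (fun k : nat => [- Z.of_nat k; Z.of_nat k]%Z) (seq 1 N).

Definition b_k (r : R) (N : nat) (k : Z) : R :=
  let a := ganelius r N (Z.abs k) in
  IZR (Z.sgn k) * sqrt ((1 - a) / (1 + a)).

Definition beta_k (d r : R) (N : nat) (k : Z) : R :=
  tanh (2 * d / PI * arctanh (b_k r N k)).

Definition sigma_k (r : R) (N : nat) (k : Z) : R :=
  Rprod (filter (fun l => negb (l =? k)%Z) (nonzero_indices N)) (fun l =>
    (1 - b_k r N l * b_k r N k) / (b_k r N k - b_k r N l)).

(** Restriction to (-1, 1) of the transformed Blaschke product; it is real
    there, and the formula evaluates it nowhere else. *)
Definition B_N (d r : R) (N : nat) (x : R) : R :=
  Rprod (nonzero_indices N) (fun k =>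
    tanh (PI / (2 * d) * (arctanh x - arctanh (beta_k d r N k)))).

(** [B_N(x) / (x - beta_k)], extended by continuity to [x = beta_k]. *)
Definition B_quot (d r : R) (N : nat) (k : Z) (x : R) : R :=
  let q := fun y : R => B_N d r N y / (y - beta_k d r N k) in
  if Req_EM_T x (beta_k d r N k) then real (Lim q (beta_k d r N k)) else q x.

Definition f_tilde (d r nu : R) (N : nat) (f : C -> C) (x : R) : C :=
  Csum (nonzero_indices N) (fun k =>
    (f (RtoC (beta_k d r N k)) *
     RtoC (2 * d * sigma_k r N k / PI *
           (Rpower (1 - x ^ 2) nu /
            Rpower (1 - beta_k d r N k ^ 2) (nu - 1)) *
           B_quot d r N k x))%C).

(* Main.v *)
(* Put [z = tanh (zeta / 2)], so that [Lambda_d] becomes the strip [|Im zeta| < d] and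
   [w_mu] becomes [cosh (zeta / 2) ^ (- mu)].

   Upper bound.  By the residue theorem the error [f - f~] at [tanh (s / 2)] is
   [B_N (tanh (s / 2))] times an integral over the boundary of the strip, where the transformed
   Blaschke product has modulus 1; the condition [|2 nu - 1 - mu| < 1] makes that integral
   [O (cosh (s / 2) ^ (- mu))].  It remains to bound the weighted product
   [cosh (s / 2) ^ (- mu) * |B_N|].  In logarithmic form the Ganelius points are [c sqrt k], and
   [- ln |B_N|] is a sum of values of [L w = - ln |tanh (w / 2)|] at [u - c sqrt k].  The
   trapezoidal rule compares it, up to a bounded error, with an integral that equals
   [(PI ^ 2 / c ^ 2) u] because [L] has mass [PI ^ 2 / 4] on a half-line (the Basel sum); this
   cancels the weight.  The defect at the right end of the range is compensated by the points
   near 1.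

   Lower bound.  For nodes [a_j] of total multiplicity [2 N], the weight times the product of the
   Blaschke factors of the [a_j] lies in the unit ball and is annihilated by the Hermite formula.
   The average of its logarithm over [- R0 <= s <= R0] is at least
   [- mu R0 / 4 - PI d N / R0], and [R0 = 2 sqrt (PI d N / mu)] is the optimal choice. *)

Require Import Defs.
From Stdlib Require Import Reals ZArith List Lra Lia Psatz Classical.
From Coquelicot Require Import Coquelicot.
Import ListNotations.
Open Scope R_scope.

(** * The integral of [ln (coth (w / 2))] *)


(** The nodes enter in pairs: [tanh (q + tau) * tanh (q - tau) = (a - t) / (a + t)] with
    [t = 1 / cosh (2 q)] and [a = 1 / cosh (2 tau)], which is the origin of
    [b_k = sqrt ((1 - a_k) / (1 + a_k))]. The weight is at most a constant times [t ^ r], so the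
    upper bound becomes Ganelius's problem for [t ^ r] times the product of [|a_k - t| / (a_k + t)]
    on [(0, 1]]. The obstacle is uniformity in [N]: in the logarithm every error has to be an
    additive constant. This fixes the number of points near 1. With [J] the tail integral of [L],
    the trapezoidal sum falls short by [2 / PI * sqrt (r N_0) * J], each point near 1 restores
    [8 / PI ^ 2 * J], and the quotient is [PI / 4 * sqrt (r N_0)]. Withdrawing about that many
    points costs only a constant, because [sqrt N - sqrt N_0] stays bounded. A function of the unit
    ball is controlled in the open strip only, so the contour runs at a height [eta < d] that
    depends on the number of nodes, while the constants do not. The exponent [2 nu - 1 - mu] is
    compared with 1 because [1 / sinh ((z - s) / 2)] decays like [exp (- |Re z - s| / 2)]. *)

Lemma is_derive_eq (f : R -> R) (x l l' : R) :
  is_derive f x l -> l = l' -> is_derive f x l'.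
Proof. intros H <-. exact H. Qed.

(** [x * PSeries odd_sq_coef (x * x)] is the Legendre chi function of order 2, and
    [x * PSeries odd_coef (x * x)] is the inverse hyperbolic tangent. Writing both as series in
    [x * x] keeps every coefficient nonzero, as the ratio test requires. *)
Definition odd_sq_coef (k : nat) : R := / (2 * INR k + 1) ^ 2.
Definition odd_coef (k : nat) : R := / (2 * INR k + 1).

Lemma odd_pos (k : nat) : 0 < 2 * INR k + 1.
Proof. generalize (pos_INR k); lra. Qed.

Lemma is_lim_seq_odd_ratio :
  is_lim_seq (fun k => (2 * INR k + 1) / (2 * INR (S k) + 1)) 1.
Proof.
  apply is_lim_seq_ext with (fun k => 1 - 2 * / (2 * INR (S k) + 1)).
  - intros k. rewrite S_INR. generalize (pos_INR k); intros; field; lra.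
  - replace (Finite 1) with (Rbar_plus 1 (Finite (- (2 * 0)))) by (simpl; f_equal; ring).
    apply is_lim_seq_minus'. apply is_lim_seq_const.
    apply is_lim_seq_mult'. apply is_lim_seq_const.
    apply is_lim_seq_le_le_loc with (u := fun _ => 0) (w := fun k => / INR (S k)).
    + exists 0%nat. intros k _. rewrite S_INR. generalize (pos_INR k); intros.
      split. left; apply Rinv_0_lt_compat; lra. apply Rinv_le_contravar; lra.
    + apply is_lim_seq_const.
    + apply (is_lim_seq_incr_1 (fun k => / INR k)).
      replace (Finite 0) with (Rbar_inv p_infty) by reflexivity.
      apply is_lim_seq_inv. apply is_lim_seq_INR. discriminate.
Qed.

Lemma CV_radius_odd_sq : CV_radius odd_sq_coef = Finite 1.
Proof.
  replace (Finite 1) with (Finite (/ 1)) by (f_equal; field).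
  apply CV_radius_finite_DAlembert; [| lra |].
  - intros n. unfold odd_sq_coef. apply Rinv_neq_0_compat, pow_nonzero.
    generalize (odd_pos n); lra.
  - apply is_lim_seq_ext with
      (fun k => ((2 * INR k + 1) / (2 * INR (S k) + 1)) * ((2 * INR k + 1) / (2 * INR (S k) + 1))).
    + intros k. unfold odd_sq_coef. generalize (odd_pos k) (odd_pos (S k)); intros.
      rewrite Rabs_pos_eq. field; lra.
      left; apply Rdiv_lt_0_compat; apply Rinv_0_lt_compat, pow_lt; assumption.
    + replace (Finite 1) with (Finite (1 * 1)) by (f_equal; ring).
      apply is_lim_seq_mult'; apply is_lim_seq_odd_ratio.
Qed.

Lemma CV_radius_odd : CV_radius odd_coef = Finite 1.
Proof.
  replace (Finite 1) with (Finite (/ 1)) by (f_equal; field).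
  apply CV_radius_finite_DAlembert; [| lra |].
  - intros n. unfold odd_coef. apply Rinv_neq_0_compat.
    generalize (odd_pos n); lra.
  - apply is_lim_seq_ext with
      (fun k => ((2 * INR k + 1) / (2 * INR (S k) + 1))).
    + intros k. unfold odd_coef. generalize (odd_pos k) (odd_pos (S k)); intros.
      rewrite Rabs_pos_eq. field; lra.
      left; apply Rdiv_lt_0_compat; apply Rinv_0_lt_compat; assumption.
    + apply is_lim_seq_odd_ratio.
Qed.

(** Each [x ^ (2 k + 1)] brings down the factor [2 k + 1]. Used once to turn [odd_coef] into a
    geometric series and once to turn [odd_sq_coef] into [odd_coef]. *)
Lemma is_derive_odd_series (a : nat -> R) (s : R) :
  Rbar_lt (s * s) (CV_radius a) ->
  is_derive (fun x => x * PSeries a (x * x)) s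
    (PSeries (fun k => (2 * INR k + 1) * a k) (s * s)).
Proof.
  intros H.
  assert (Habs : Rabs (s * s) = s * s) by (apply Rabs_pos_eq; nra).
  assert (E1 : PSeries (fun k => (2 * INR k + 1) * a k) (s * s) =
     PSeries a (s * s) + 2 * ((s * s) * PSeries (PS_derive a) (s * s))).
  { rewrite <- PSeries_incr_1, <- PSeries_scal, <- PSeries_plus.
    - apply PSeries_ext. intros [|n].
      + unfold PS_plus, PS_scal, PS_incr_1, plus, scal, zero; simpl.
        unfold mult; simpl. ring.
      + unfold PS_plus, PS_scal, PS_incr_1, PS_derive, plus, scal; cbn -[INR].
        unfold mult; cbn -[INR]. ring.
    - apply CV_radius_inside. rewrite Habs; exact H.
    - apply ex_pseries_scal. intros; apply Rmult_comm.
      apply ex_pseries_incr_1. apply ex_pseries_derive. rewrite Habs; exact H. }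
  rewrite E1.
  assert (D : is_derive (PSeries a) (s * s) (PSeries (PS_derive a) (s * s))).
  { apply is_derive_PSeries. rewrite Habs; exact H. }
  auto_derive.
  - exists (PSeries (PS_derive a) (s * s)). exact D.
  - change (fun x => PSeries a x) with (PSeries a). rewrite (is_derive_unique (PSeries a) _ _ D). ring.
Qed.

Lemma PSeries_odd_eq (s : R) : 0 <= s < 1 ->
  s * PSeries odd_coef (s * s) = / 2 * ln ((1 + s) / (1 - s)).
Proof.
  intros Hs.
  set (D := fun x => x * PSeries odd_coef (x * x) - / 2 * (ln (1 + x) - ln (1 - x))).
  assert (HD : forall x, 0 <= x <= s -> is_derive D x 0).
  { intros x Hx. unfold D.
    apply is_derive_eq with (/ (1 - x * x) - / 2 * (1 / (1 + x) - (- 1) / (1 - x)));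
      [|field; nra].
    apply (is_derive_minus (fun x => x * PSeries odd_coef (x * x))
             (fun x => / 2 * (ln (1 + x) - ln (1 - x)))).
    - replace (/ (1 - x * x)) with (PSeries (fun k => (2 * INR k + 1) * odd_coef k) (x * x)).
      apply is_derive_odd_series. rewrite CV_radius_odd. simpl. nra.
      apply is_series_unique.
      apply is_series_ext with (fun n => (x * x) ^ n).
      + intros n. unfold odd_coef. generalize (odd_pos n); intros.
        match goal with |- ?a = ?b => change (@eq R a b) end. field. lra.
      + apply is_series_geom. rewrite Rabs_pos_eq; nra.
    - auto_derive. lra. field. lra. }
  destruct (MVT_gen D 0 s (fun _ => 0)) as [c [_ Hc]].
  - rewrite Rmin_left, Rmax_right by lra. intros x Hx. apply HD. lra.
  - rewrite Rmin_left, Rmax_right by lra. intros x Hx.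
    apply derivable_continuous_pt, ex_derive_Reals_0. exists 0. apply HD. lra.
  - unfold D in Hc. rewrite ln_div by lra.
    replace (1 + 0) with 1 in Hc by ring. replace (1 - 0) with 1 in Hc by ring.
    rewrite ln_1 in Hc. lra.
Qed.

(** This is [1 = sin ^ 2 + cos ^ 2] divided by [4 sin ^ 2 cos ^ 2] at the half angle. It drives the
    elementary evaluation of the sum of [1 / (2 k + 1) ^ 2]. *)
Lemma inv_sin_sq_double (x : R) : 0 < x < PI ->
  / sin x ^ 2 = / 4 * (/ sin (x / 2) ^ 2 + / sin (PI / 2 - x / 2) ^ 2).
Proof.
  intros Hx. rewrite sin_shift.
  assert (0 < sin (x / 2)) by (apply sin_gt_0; lra).
  assert (0 < cos (x / 2)) by (apply cos_gt_0; lra).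
  assert (E : sin x = 2 * sin (x / 2) * cos (x / 2)).
  { rewrite <- sin_2a. f_equal. field. }
  rewrite E. assert (E2 := sin2_cos2 (x / 2)). unfold Rsqr in E2.
  transitivity ((sin (x/2) * sin (x/2) + cos (x/2) * cos (x/2)) / (4 * sin (x/2) ^ 2 * cos (x/2)^2)).
  - rewrite E2. field. lra.
  - field. lra.
Qed.

Lemma sum_f_R0_rev (f : nat -> R) (n : nat) :
  sum_f_R0 f n = sum_f_R0 (fun k => f (n - k)%nat) n.
Proof.
  rewrite <- !sum_n_Reals. unfold sum_n. symmetry.
  induction n as [|n IH] in f |- *.
  - reflexivity.
  - rewrite sum_n_Sm by lia. rewrite (sum_Sn_m f) by lia.
    rewrite <- sum_n_m_S. rewrite <- (IH (fun k => f (S k))).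
    rewrite Nat.sub_diag, plus_comm. f_equal.
    apply sum_n_m_ext_loc. intros k Hk. f_equal. lia.
Qed.

Lemma INR_pow2 (n : nat) : INR (2 ^ n) = 2 ^ n.
Proof. rewrite pow_INR. reflexivity. Qed.

Definition odd_angle (n k : nat) : R := (2 * INR k + 1) * PI / (4 * 2 ^ n).

Lemma odd_angle_bound (n k : nat) : (k < 2 ^ n)%nat -> 0 < odd_angle n k < PI / 2.
Proof.
  intros Hk. unfold odd_angle. assert (0 < PI) by apply PI_RGT_0.
  assert (0 < 2 ^ n) by (apply pow_lt; lra).
  assert (2 * INR k + 1 < 2 * 2 ^ n).
  { apply Nat.le_succ_l, le_INR in Hk. rewrite S_INR, INR_pow2 in Hk. lra. }
  generalize (odd_pos k); intros. split.
  - apply Rdiv_lt_0_compat; nra.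
  - apply Rmult_lt_reg_r with (4 * 2 ^ n); [lra|]. field_simplify; [|lra].  nra.
Qed.

(** By [inv_sin_sq_double] each angle of level [n] gives its half and the complement of its half,
    and together these are all the angles of level [n + 1]; the sum is therefore multiplied by 4. It
    starts at [1 / sin (PI / 4) ^ 2 = 2]. *)
Lemma sum_inv_sin_sq (n : nat) :
  sum_f_R0 (fun k => / sin (odd_angle n k) ^ 2) (2 ^ n - 1) = 2 * 4 ^ n.
Proof.
  induction n as [|n IH].
  - simpl. unfold odd_angle. simpl. replace ((2 * 0 + 1) * PI / (4 * 1)) with (PI / 4) by field.
    rewrite sin_PI4. field_simplify.
    replace (sqrt 2 ^ 2) with 2. field. symmetry; apply pow2_sqrt; lra.
    apply Rgt_not_eq, sqrt_lt_R0; lra.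
  - assert (P2 : (1 <= 2 ^ n)%nat) by (apply Nat.pow_lower_bound; lia).
    assert (Hp : 0 < 2 ^ n) by (apply pow_lt; lra).
    replace (2 ^ S n - 1)%nat with (S (2 ^ n - 1) + (2 ^ n - 1))%nat by (simpl; lia).
    rewrite (tech2 _ (2 ^ n - 1)) by lia.
    replace (S (2 ^ n - 1) + (2 ^ n - 1) - S (2 ^ n - 1))%nat with (2 ^ n - 1)%nat by lia.
    (* Reversing the upper half places, opposite the index [k], the complement to [PI / 2] of the
       angle with index [k]. *)
    rewrite (sum_f_R0_rev (fun i => / sin (odd_angle (S n) (S (2 ^ n - 1) + i)) ^ 2)).
    rewrite <- plus_sum.
    transitivity (sum_f_R0 (fun k => / sin (odd_angle n k) ^ 2 * 4) (2 ^ n - 1)).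
    + apply sum_eq. intros k Hk.
      destruct (odd_angle_bound n k) as [A1 A2]; [lia|].
      rewrite (inv_sin_sq_double (odd_angle n k)) by lra.
      replace (odd_angle n k / 2) with (odd_angle (S n) k)
        by (unfold odd_angle; simpl; field; lra).
      replace (PI / 2 - odd_angle (S n) k) with
        (odd_angle (S n) (S (2 ^ n - 1) + (2 ^ n - 1 - k))).
      field. split; apply Rgt_not_eq.
      * apply sin_gt_0; destruct (odd_angle_bound (S n) (S (2 ^ n - 1) + (2 ^ n - 1 - k)));
          simpl Nat.pow in *; try lia; lra.
      * apply sin_gt_0; destruct (odd_angle_bound (S n) k);
          simpl Nat.pow in *; try lia; lra.
      * unfold odd_angle. rewrite plus_INR, S_INR, !minus_INR, INR_pow2 by lia.
        simpl. field. lra.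
    + rewrite <- scal_sum, IH. simpl. ring.
Qed.

(** Both sides come from [x cos x <= sin x <= x], the upper one through
    [1 / sin ^ 2 = 1 + cot ^ 2]. *)
Lemma inv_sin_sq_bounds (x : R) : 0 < x < PI / 2 ->
  / x ^ 2 <= / sin x ^ 2 <= / x ^ 2 + 1.
Proof.
  intros Hx.
  assert (S0 : 0 < sin x) by (apply sin_gt_0; lra).
  assert (C0 : 0 < cos x) by (apply cos_gt_0; lra).
  assert (S1 : sin x < x) by (apply sin_lt_x; lra).
  assert (T1 : x * cos x <= sin x).
  { destruct (MVT_gen (fun y => sin y - y * cos y) 0 x (fun y => y * sin y)) as [c [Hc E]].
    - intros y _. auto_derive. trivial. ring.
    - intros y _. apply derivable_continuous_pt, ex_derive_Reals_0. auto_derive. trivial.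
    - rewrite Rmin_left, Rmax_right in Hc by lra. rewrite sin_0 in E.
      assert (0 <= sin c) by (apply sin_ge_0; lra).
      assert (0 <= c * sin c * (x - 0)). { repeat apply Rmult_le_pos; lra. } lra. }
  assert (0 < x ^ 2) by (apply pow_lt; lra).
  assert (0 < sin x ^ 2) by (apply pow_lt; lra).
  split.
  - apply Rinv_le_contravar. assumption. apply pow_incr; lra.
  - assert (E2 := sin2_cos2 x). rewrite !Rsqr_pow2 in E2.
    assert (x ^ 2 * cos x ^ 2 <= sin x ^ 2).
    { rewrite <- Rpow_mult_distr. apply pow_incr. split. apply Rmult_le_pos; lra. lra. }
    apply Rmult_le_reg_r with (x ^ 2 * sin x ^ 2). nra. field_simplify; nra.
Qed.

(** Replacing [1 / sin ^ 2] by [1 / x ^ 2] loses at most 1 in each of the [2 ^ n] terms of a sum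
    worth [2 * 4 ^ n], so the relative error is of order [2 ^ (- n)]. *)
Lemma sum_odd_sq_bounds (n : nat) :
  PI ^ 2 / 8 - PI ^ 2 / 16 * / 2 ^ n <= sum_f_R0 odd_sq_coef (2 ^ n - 1) <= PI ^ 2 / 8.
Proof.
  assert (Hp : 0 < 2 ^ n) by (apply pow_lt; lra).
  assert (Hpi : 0 < PI) by apply PI_RGT_0.
  assert (P2 : (1 <= 2 ^ n)%nat) by (apply Nat.pow_lower_bound; lia).
  assert (E4 : 4 ^ n = 2 ^ n * 2 ^ n) by (rewrite <- Rpow_mult_distr; f_equal; ring).
  assert (E : sum_f_R0 (fun k => / odd_angle n k ^ 2) (2 ^ n - 1) =
     sum_f_R0 odd_sq_coef (2 ^ n - 1) * (16 * 4 ^ n / PI ^ 2)).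
  { rewrite Rmult_comm, scal_sum. apply sum_eq. intros k _. rewrite E4.
    unfold odd_angle, odd_sq_coef. generalize (odd_pos k); intros. field. lra. }
  assert (U : sum_f_R0 (fun k => / odd_angle n k ^ 2) (2 ^ n - 1) <= 2 * 4 ^ n).
  { rewrite <- sum_inv_sin_sq. apply sum_Rle. intros k Hk.
    apply inv_sin_sq_bounds, odd_angle_bound. lia. }
  assert (V : 2 * 4 ^ n <= sum_f_R0 (fun k => / odd_angle n k ^ 2) (2 ^ n - 1) + 2 ^ n).
  { rewrite <- sum_inv_sin_sq.
    apply Rle_trans with (sum_f_R0 (fun k => / odd_angle n k ^ 2 + 1) (2 ^ n - 1)).
    - apply sum_Rle. intros k Hk. apply inv_sin_sq_bounds, odd_angle_bound. lia.
    - rewrite plus_sum, sum_cte. replace (S (2 ^ n - 1)) with (2 ^ n)%nat by lia.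
      rewrite INR_pow2. lra. }
  rewrite E, E4 in U, V.
  set (s := sum_f_R0 odd_sq_coef (2 ^ n - 1)) in *. set (q := 2 ^ n) in *.
  assert (K : 0 < 16 * (q * q) / PI ^ 2).
  { apply Rdiv_lt_0_compat. nra. apply pow_lt; lra. }
  split; apply Rmult_le_reg_r with (16 * (q * q) / PI ^ 2); auto.
  - replace ((PI ^ 2 / 8 - PI ^ 2 / 16 * / q) * (16 * (q * q) / PI ^ 2)) with (2 * (q * q) - q)
      by (field; lra). lra.
  - replace (PI ^ 2 / 8 * (16 * (q * q) / PI ^ 2)) with (2 * (q * q)) by (field; lra). lra.
Qed.

Lemma is_series_odd_sq : is_series odd_sq_coef (PI ^ 2 / 8).
Proof.
  assert (Hmono : forall n m, (n <= m)%nat -> sum_f_R0 odd_sq_coef n <= sum_f_R0 odd_sq_coef m).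
  { intros n m H. induction H. lra. simpl.
    assert (0 < odd_sq_coef (S m)) by (apply Rinv_0_lt_compat, pow_lt, odd_pos). lra. }
  apply is_series_Reals. intros eps He.
  destruct (pow_lt_1_zero (/ 2)) with (y := eps / PI ^ 2) as [M HM].
  { rewrite Rabs_pos_eq; lra. }
  { apply Rdiv_lt_0_compat. lra. apply pow_lt, PI_RGT_0. }
  exists (2 ^ M - 1)%nat. intros m Hm.
  assert (HM' := HM M (le_n _)). rewrite Rabs_pos_eq in HM' by (apply pow_le; lra).
  rewrite pow_inv in HM'.
  assert (0 < PI ^ 2) by (apply pow_lt, PI_RGT_0).
  assert (PI ^ 2 * / 2 ^ M < eps).
  { apply Rmult_lt_compat_l with (r := PI ^ 2) in HM'; auto.
    replace (PI ^ 2 * (eps / PI ^ 2)) with eps in HM' by (field; apply PI_neq0). exact HM'. }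
  assert (0 < / 2 ^ M) by (apply Rinv_0_lt_compat, pow_lt; lra).
  assert (B1 := proj1 (sum_odd_sq_bounds M)). assert (B2 := Hmono _ _ Hm).
  assert (B3 := proj2 (sum_odd_sq_bounds m)).
  assert (B4 := Hmono m (2 ^ m - 1)%nat).
  assert (m < 2 ^ m)%nat by (apply Nat.pow_gt_lin_r; lia).
  specialize (B4 ltac:(lia)).
  unfold Rdist. rewrite Rabs_left1 by lra. nra.
Qed.
(** The interval is cut at the listed points, across which continuity is enough. That is all the
    primitives built from [A] have at their logarithmic singularities. *)
Lemma mean_value_except (l : list R) (f : R -> R) (a b M : R) :
  a <= b ->
  (forall x, a <= x <= b -> continuity_pt f x) ->
  (forall x, a < x < b -> ~ In x l -> exists d, is_derive f x d /\ d <= M) ->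
  f b - f a <= M * (b - a).
Proof.
  revert a b. induction l as [|p l IH]; intros a b Hab Hc Hd.
  - destruct (Req_dec a b) as [->|Hne]; [lra|].
    assert (pr1 : forall c, a < c < b -> derivable_pt f c).
    { intros c Hc'. apply ex_derive_Reals_0. destruct (Hd c Hc' (fun h => h)) as [e [He _]].
      exists e; exact He. }
    destruct (MVT f id a b pr1 (fun c _ => derivable_pt_id c)) as [c [P E]].
    + lra.
    + exact Hc.
    + intros; apply derivable_continuous_pt, derivable_pt_id.
    + destruct (Hd c P (fun h => h)) as [e [He Hle]].
      unfold id in E.
      rewrite (derive_pt_eq_0 _ _ 1 _ (derivable_pt_lim_id c)) in E.
      rewrite (derive_pt_eq_0 _ _ e _ (proj1 (is_derive_Reals _ _ _) He)) in E. nra.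
  - destruct (Rlt_dec a p) as [H1|H1]; [destruct (Rlt_dec p b) as [H2|H2]|].
    + assert (A1 := IH a p). assert (A2 := IH p b).
      assert (f p - f a <= M * (p - a)).
      { apply A1. lra. intros; apply Hc; lra. intros x Hx Hn. apply Hd. lra.
        simpl. intros [->|h]; [lra|tauto]. }
      assert (f b - f p <= M * (b - p)).
      { apply A2. lra. intros; apply Hc; lra. intros x Hx Hn. apply Hd. lra.
        simpl. intros [->|h]; [lra|tauto]. }
      lra.
    + apply IH; auto. intros x Hx Hn. apply Hd; auto. simpl. intros [->|h]; [lra|tauto].
    + apply IH; auto. intros x Hx Hn. apply Hd; auto. simpl. intros [->|h]; [lra|tauto].
Qed.

Lemma mean_value_le (f f' : R -> R) (a b M : R) :
  a <= b ->
  (forall x, a <= x <= b -> is_derive f x (f' x)) ->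
  (forall x, a < x < b -> f' x <= M) ->
  f b - f a <= M * (b - a).
Proof.
  intros Hab Hd HM. apply mean_value_except with nil; auto.
  - intros x Hx. apply derivable_continuous_pt, ex_derive_Reals_0. exists (f' x); auto.
  - intros x Hx _. exists (f' x). split. apply Hd; lra. auto.
Qed.

(* [L w = - ln |tanh (w / 2)|], with a junk value at [0], where it should be infinite. *)
Definition L (w : R) : R := ln ((1 + exp (- Rabs w)) / (1 - exp (- Rabs w))).

(* The tail integral of [L] over [[w, +oo)]. *)
Definition J (w : R) : R := 2 * (exp (- w) * PSeries odd_sq_coef (exp (- w) * exp (- w))).

Lemma exp_opp_lt_1 (w : R) : 0 < w -> 0 < exp (- w) < 1.
Proof.
  intros Hw. split. apply exp_pos. rewrite <- exp_0. apply exp_increasing. lra.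
Qed.

Lemma exp_opp_le_1 (w : R) : 0 <= w -> 0 < exp (- w) <= 1.
Proof.
  intros [Hw| <-]. generalize (exp_opp_lt_1 w Hw); lra. rewrite Ropp_0, exp_0. lra.
Qed.

(** Termwise differentiation in [exp (- w)] lowers [1 / (2 k + 1) ^ 2] to [1 / (2 k + 1)], and [L w]
    is twice the inverse hyperbolic tangent of [exp (- w)]. *)
Lemma is_derive_J (w : R) : 0 < w -> is_derive J w (- L w).
Proof.
  intros Hw. assert (Hs := exp_opp_lt_1 w Hw). unfold J, L. rewrite Rabs_pos_eq by lra.
  assert (HP := PSeries_odd_eq (exp (- w)) ltac:(lra)).
  apply is_derive_eq with (2 * ((- exp (- w)) *
    PSeries (fun k => (2 * INR k + 1) * odd_sq_coef k) (exp (- w) * exp (- w)))).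
  - apply (is_derive_scal (fun w => exp (- w) * PSeries odd_sq_coef (exp (- w) * exp (- w)))).
    apply (is_derive_comp (fun x => x * PSeries odd_sq_coef (x * x)) (fun w => exp (- w))).
    + apply is_derive_odd_series. rewrite CV_radius_odd_sq. simpl. nra.
    + auto_derive. trivial. ring.
  - rewrite (PSeries_ext _ odd_coef).
    + lra.
    + intros n. unfold odd_sq_coef, odd_coef. generalize (odd_pos n); intros. field. lra.
Qed.

Lemma odd_series_cv (s : R) : 0 <= s <= 1 -> ex_series (fun k => odd_sq_coef k * (s * s) ^ k).
Proof.
  intros Hs. apply (ex_series_le (V := R_CompleteNormedModule)) with odd_sq_coef.
  - intros n. assert (0 < odd_sq_coef n) by (apply Rinv_0_lt_compat, pow_lt, odd_pos).
    unfold norm; simpl; unfold abs; simpl.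
    assert (0 <= (s * s) ^ n <= 1).
    { split. apply pow_le; nra. rewrite <- (pow1 n). apply pow_incr; nra. }
    rewrite Rabs_pos_eq by nra. nra.
  - exists (PI ^ 2 / 8). apply is_series_odd_sq.
Qed.

Lemma PSeries_odd_sq_bounds (s : R) : 0 <= s <= 1 ->
  0 <= PSeries odd_sq_coef (s * s) <= PI ^ 2 / 8.
Proof.
  intros Hs.
  assert (P : forall n, 0 <= odd_sq_coef n * (s * s) ^ n <= odd_sq_coef n).
  { intros n. assert (0 < odd_sq_coef n) by (apply Rinv_0_lt_compat, pow_lt, odd_pos).
    assert (0 <= (s * s) ^ n <= 1).
    { split. apply pow_le; nra. rewrite <- (pow1 n). apply pow_incr; nra. }
    nra. }
  unfold PSeries. split.
  - rewrite <- (Rmult_0_l (Series (fun k => odd_sq_coef k * (s * s) ^ k))), <- Series_scal_l.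
    apply Series_le. 2: apply odd_series_cv; auto.
    intros n; specialize (P n); lra.
  - rewrite <- (is_series_unique _ _ is_series_odd_sq). apply Series_le. exact P.
    exists (PI ^ 2 / 8). apply is_series_odd_sq.
Qed.

Lemma J_bounds (w : R) : 0 <= w -> 0 <= J w <= PI ^ 2 / 4 * exp (- w).
Proof.
  intros Hw. assert (Hs := exp_opp_le_1 w Hw). unfold J.
  assert (B := PSeries_odd_sq_bounds (exp (- w)) ltac:(lra)). split; nra.
Qed.

(** Termwise, [1 / (2 k + 1) ^ 2 <= 1 / (2 k + 1)]. This lets a factor [exp (- L)] stand in for the
    required power of [exp (- J)] when [t] is away from 1. *)
Lemma J_le_L (w : R) : 0 < w -> J w <= L w.
Proof.
  intros Hw. assert (Hs := exp_opp_lt_1 w Hw). unfold J, L. rewrite Rabs_pos_eq by lra.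
  assert (HP := PSeries_odd_eq (exp (- w)) ltac:(lra)).
  assert (PSeries odd_sq_coef (exp (- w) * exp (- w)) <= PSeries odd_coef (exp (- w) * exp (- w))).
  { apply Series_le.
    - intros n. assert (Hn := odd_pos n). generalize (pos_INR n); intros Hn'.
      assert (0 <= (exp (- w) * exp (- w)) ^ n) by (apply pow_le; nra).
      assert (0 < / (2 * INR n + 1) <= 1).
      { split. apply Rinv_0_lt_compat; lra. rewrite <- Rinv_1. apply Rinv_le_contravar; lra. }
      assert (E : odd_sq_coef n = / (2 * INR n + 1) * / (2 * INR n + 1)).
      { unfold odd_sq_coef. field. lra. }
      unfold odd_coef. rewrite E. split.
      + apply Rmult_le_pos. nra. auto.
      + apply Rmult_le_compat_r. auto. nra.
    - apply (proj1 (ex_pseries_R odd_coef (exp (- w) * exp (- w)))). apply CV_radius_inside. rewrite CV_radius_odd. simpl.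
      rewrite Rabs_pos_eq; nra. }
  nra.
Qed.

Lemma J_0 : J 0 = PI ^ 2 / 4.
Proof.
  unfold J. rewrite Ropp_0, exp_0.
  assert (E : PSeries odd_sq_coef (1 * 1) = PI ^ 2 / 8).
  { apply is_series_unique. apply is_series_ext with odd_sq_coef.
    - intros n. rewrite Rmult_1_l, pow1. symmetry; apply Rmult_1_r.
    - apply is_series_odd_sq. }
  rewrite E. field.
Qed.

(** At [w = 0] the argument [exp (- w)] reaches the boundary of the disc of convergence, so Abel's
    theorem is used. The result is the continuity of [A] at its gluing point. *)
Lemma J_right_continuous (eps : R) : 0 < eps ->
  exists delta, 0 < delta /\ forall w, 0 <= w < delta -> Rabs (PI ^ 2 / 4 - J w) < eps.
Proof.
  intros He.
  assert (Ab : filterlim (PSeries odd_sq_coef) (at_left 1) (locally (PSeries odd_sq_coef 1))).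
  { assert (A := Abel odd_sq_coef). rewrite CV_radius_odd_sq in A. simpl in A. apply A.
    lra. trivial. exists (PI ^ 2 / 8). apply is_pseries_R.
    apply is_series_ext with odd_sq_coef.
    - intros n. rewrite pow1. symmetry; apply Rmult_1_r.
    - apply is_series_odd_sq. }
  assert (E1 : PSeries odd_sq_coef 1 = PI ^ 2 / 8).
  { assert (E := J_0). unfold J in E. rewrite Ropp_0, exp_0, Rmult_1_l in E. rewrite Rmult_1_r in E. lra. }
  rewrite E1 in Ab.
  assert (Hpi : 0 < PI ^ 2) by apply pow_lt, PI_RGT_0.
  destruct (Ab _ (locally_ball (PI ^ 2 / 8) (mkposreal (eps / 4) ltac:(lra)))) as [d Hd].
  assert (Ce : continuity_pt (fun w => exp (- w)) 0).
  { apply derivable_continuous_pt, ex_derive_Reals_0. auto_derive. trivial. }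
  (* [d / 2] suffices because [1 - s ^ 2 <= 2 (1 - s)]; [eps / PI ^ 2] controls the outer factor [s]
     in [J]. *)
  set (e2 := Rmin (d / 2) (eps / (PI ^ 2))).
  assert (He2 : 0 < e2).
  { apply Rmin_pos. destruct d; simpl; lra. apply Rdiv_lt_0_compat; lra. }
  destruct (Ce e2 He2) as [r [Hr HC]].
  exists r. split; [exact Hr|]. intros w [[Hw|<-] Hwr].
  2:{ rewrite J_0, Rminus_diag, Rabs_R0. exact He. }
  assert (Hs := exp_opp_lt_1 w Hw).
  assert (Hc : Rabs (exp (- w) - 1) < e2).
  { assert (h := HC w). simpl in h. unfold R_dist, Rdist, D_x, no_cond in h.
    rewrite Ropp_0, exp_0 in h. apply h. split. lra. rewrite Rminus_0_r, Rabs_pos_eq; lra. }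
  set (s := exp (- w)) in *.
  rewrite Rabs_left in Hc by lra.
  assert (e2 <= d / 2) by apply Rmin_l. assert (e2 <= eps / PI ^ 2) by apply Rmin_r.
  assert (Hb : ball 1 d (s * s)).
  { unfold ball; simpl; unfold AbsRing_ball, abs, minus, plus, opp; simpl.
    rewrite Rabs_left; nra. }
  assert (Hq := Hd (s * s) Hb ltac:(nra)).
  unfold ball in Hq; simpl in Hq; unfold AbsRing_ball, abs, minus, plus, opp in Hq; simpl in Hq.
  apply Rabs_def2 in Hq.
  unfold J. fold s. assert (B := PSeries_odd_sq_bounds s ltac:(lra)).
  set (P := PSeries odd_sq_coef (s * s)) in *.
  assert ((1 - s) * PI ^ 2 <= eps).
  { apply Rle_trans with (eps / PI ^ 2 * PI ^ 2). nra. right; field. apply PI_neq0. }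
  rewrite Rabs_pos_eq by nra. nra.
Qed.

(* The odd antiderivative of [L]; its limit at infinity is the integral of [L] over [[0, +oo)]. *)
Definition A (w : R) : R :=
  if Rle_dec 0 w then PI ^ 2 / 4 - J w else - (PI ^ 2 / 4 - J (- w)).

Lemma A_nonneg_eq (w : R) : 0 <= w -> A w = PI ^ 2 / 4 - J w.
Proof. intros H. unfold A. destruct Rle_dec; [reflexivity|lra]. Qed.

Lemma A_opp (w : R) : A (- w) = - A w.
Proof.
  unfold A. destruct (Rle_dec 0 w), (Rle_dec 0 (- w)); try lra.
  - replace w with 0 by lra. rewrite Ropp_0, J_0. ring.
  - rewrite Ropp_involutive. ring.
Qed.

Lemma L_opp (w : R) : L (- w) = L w.
Proof. unfold L. rewrite Rabs_Ropp. reflexivity. Qed.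

Lemma is_derive_A (w : R) : w <> 0 -> is_derive A w (L w).
Proof.
  assert (Pos : forall v, 0 < v -> is_derive A v (L v)).
  { intros v Hv. apply is_derive_ext_loc with (fun x => PI ^ 2 / 4 - J x).
    - exists (mkposreal v Hv). intros y Hy. simpl in Hy.
      unfold ball in Hy; simpl in Hy; unfold AbsRing_ball, abs, minus, plus, opp in Hy; simpl in Hy.
      apply Rabs_def2 in Hy. rewrite A_nonneg_eq by lra. reflexivity.
    - apply is_derive_eq with (0 - - L v); [|ring].
      apply (is_derive_minus (fun _ => PI ^ 2 / 4) J). apply @is_derive_const. apply is_derive_J; auto. }
  intros Hw. destruct (Rlt_dec 0 w) as [H|H]; [auto|].
  apply is_derive_ext with (fun x => - A (- x)).
  - intros t. rewrite A_opp. apply Ropp_involutive.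
  - apply is_derive_eq with (- (- 1 * L (- w))).
    + apply (is_derive_opp (fun x => A (- x))).
      apply (is_derive_comp A (fun x => - x)). apply Pos; lra. auto_derive; auto.
    + rewrite L_opp. ring.
Qed.

Lemma A_bounds (w : R) : Rabs (A w) <= PI ^ 2 / 4.
Proof.
  unfold A. destruct (Rle_dec 0 w).
  - assert (B := J_bounds w r). assert (E := exp_opp_le_1 w r).
    assert (0 < PI ^ 2) by apply pow_lt, PI_RGT_0. apply Rabs_le. nra.
  - assert (h : 0 <= - w) by lra. assert (B := J_bounds _ h). assert (E := exp_opp_le_1 _ h).
    assert (0 < PI ^ 2) by apply pow_lt, PI_RGT_0. apply Rabs_le. nra.
Qed.

Lemma A_continuous (w : R) : continuity_pt A w.
Proof.
  destruct (Req_dec w 0) as [->|Hw].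
  - intros eps He. destruct (J_right_continuous eps He) as [d [Hd H]].
    exists d. split; [exact Hd|]. intros x [_ Hx]. simpl in *. unfold Rdist in *.
    rewrite Rminus_0_r in Hx. apply Rabs_def2 in Hx.
    rewrite (A_nonneg_eq 0), J_0, Rminus_diag, Rminus_0_r by lra.
    unfold A. destruct (Rle_dec 0 x).
    + apply H; lra.
    + rewrite Rabs_Ropp. apply H; lra.
  - apply derivable_continuous_pt, ex_derive_Reals_0. exists (L w). apply is_derive_A; auto.
Qed.

(** A second antiderivative is needed because [L (u - c sqrt x)] is integrated by parts after the
    substitution [w = u - c sqrt x], whose Jacobian is linear in [w]. *)
Definition A2 (w : R) : R := RInt A 0 w.

Lemma is_derive_A2 (w : R) : is_derive A2 w (A w).
Proof.
  apply (is_derive_RInt A A2 0).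
  - exists (mkposreal 1 Rlt_0_1). intros y _. apply (RInt_correct A).
    apply (ex_RInt_continuous A). intros z _. apply continuity_pt_filterlim, A_continuous.
  - apply continuity_pt_filterlim, A_continuous.
Qed.

(** [A] approaches [PI ^ 2 / 4] with deficit [J x <= PI ^ 2 / 4 * exp (- x)], whose integral over
    the half-line is at most [PI ^ 2 / 4]. Negative arguments follow because [A] is odd and so [A2]
    is even. *)
Lemma A2_bounds (w : R) :
  PI ^ 2 / 4 * Rabs w - PI ^ 2 / 4 <= A2 w <= PI ^ 2 / 4 * Rabs w.
Proof.
  assert (A20 : A2 0 = 0) by (apply (RInt_point 0 A)).
  assert (Hpi : 0 < PI ^ 2) by apply pow_lt, PI_RGT_0.
  assert (Pos : forall v, 0 <= v -> PI ^ 2 / 4 * v - PI ^ 2 / 4 <= A2 v <= PI ^ 2 / 4 * v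
     /\ A2 (- v) = A2 v).
  { intros v Hv. split; [split|].
    - assert (M := mean_value_le (fun x => PI ^ 2 / 4 * x - A2 x + PI ^ 2 / 4 * exp (- x))
        (fun x => PI ^ 2 / 4 - A x + PI ^ 2 / 4 * - exp (- x)) 0 v 0 Hv).
      cbv beta in M. rewrite Ropp_0, exp_0, A20 in M.
      assert (0 < exp (- v)) by apply exp_pos.
      assert (X : forall x, 0 <= x -> PI ^ 2 / 4 - A x + PI ^ 2 / 4 * - exp (- x) <= 0).
      { intros x Hx. rewrite A_nonneg_eq by lra. generalize (J_bounds x Hx). lra. }
      specialize (fun h => M h ltac:(intros; apply X; lra)).
      assert (Y : forall x, 0 <= x <= v -> is_derive (fun x => PI ^ 2 / 4 * x - A2 x + PI ^ 2 / 4 * exp (- x)) x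
        (PI ^ 2 / 4 - A x + PI ^ 2 / 4 * - exp (- x))).
      { intros x _. apply (is_derive_plus (fun x => PI ^ 2 / 4 * x - A2 x)).
        apply (is_derive_minus (fun x => PI ^ 2 / 4 * x) A2).
        apply is_derive_eq with (PI ^ 2 / 4 * 1); [auto_derive; auto|apply Rmult_1_r].
        apply is_derive_A2.
        apply is_derive_eq with (PI ^ 2 / 4 * (- 1 * exp (- x))); [auto_derive; auto; field|field]. }
      specialize (M Y). nra.
    - assert (M := mean_value_le A2 A 0 v (PI ^ 2 / 4) Hv).
      rewrite A20 in M. rewrite <- (Rminus_0_r v) at 2. rewrite <- (Rminus_0_r (A2 v)). apply M.
      intros; apply is_derive_A2. intros x _. generalize (A_bounds x) (Rle_abs (A x)); lra.
    - assert (Y : forall x, is_derive (fun x => A2 (- x) - A2 x) x (- 1 * A (- x) - A x)).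
      { intros x. apply (is_derive_minus (fun x => A2 (- x)) A2).
        apply (is_derive_comp A2 (fun x => - x)). apply is_derive_A2. auto_derive; auto.
        apply is_derive_A2. }
      assert (M1 := mean_value_le _ _ 0 v 0 Hv (fun x _ => Y x)).
      assert (Y' : forall x, is_derive (fun x => - (A2 (- x) - A2 x)) x (- (- 1 * A (- x) - A x))).
      { intros x. apply (is_derive_opp (fun x => A2 (- x) - A2 x)). apply Y. }
      assert (M2 := mean_value_le _ _ 0 v 0 Hv (fun x _ => Y' x)).
      cbv beta in M1, M2. rewrite Ropp_0, A20 in M1, M2.
      specialize (M1 ltac:(intros; rewrite A_opp; lra)).
      specialize (M2 ltac:(intros; rewrite A_opp; lra)). lra. }
  unfold Rabs. destruct (Rcase_abs w).
  - destruct (Pos (- w)) as [P1 P2]; [lra|]. rewrite Ropp_involutive in P2. rewrite P2. exact P1.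
  - apply Pos; lra.
Qed.


(** * The kernel [L (u - c sqrt x)] against the trapezoidal rule *)

Lemma L_pos_eq (w : R) : 0 < w -> L w = ln ((1 + exp (- w)) / (1 - exp (- w))).
Proof. intros H. unfold L. rewrite Rabs_pos_eq by lra. reflexivity. Qed.

Lemma L_abs (w : R) : L (Rabs w) = L w.
Proof. unfold L. rewrite Rabs_Rabsolu. reflexivity. Qed.

Lemma L_nonneg (w : R) : 0 <= L w.
Proof.
  destruct (Req_dec w 0) as [->|Hw].
  (* Division by zero returns 0 and [ln 0] is 0, so the value at the singularity is 0. *)
  - unfold L. rewrite Rabs_R0, Ropp_0, exp_0, Rminus_diag. unfold Rdiv. rewrite Rinv_0, Rmult_0_r.
    unfold ln. destruct (Rlt_dec 0 0); [exfalso; lra|right; reflexivity].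
  - rewrite <- L_abs. assert (0 < Rabs w) by (apply Rabs_pos_lt; auto).
    rewrite L_pos_eq by auto. assert (E := exp_opp_lt_1 _ H).
    rewrite <- ln_1. apply ln_le. lra.
    apply Rmult_le_reg_r with (1 - exp (- Rabs w)). lra. field_simplify; lra.
Qed.

Lemma L_decr (a b : R) : 0 < a <= b -> L b <= L a.
Proof.
  intros H. rewrite !L_pos_eq by lra.
  assert (E := exp_opp_lt_1 a ltac:(lra)). assert (E' := exp_opp_lt_1 b ltac:(lra)).
  assert (exp (- b) <= exp (- a)) by (destruct H as [_ [H|<-]]; [left; apply exp_increasing|]; lra).
  apply ln_le.
  - apply Rdiv_lt_0_compat; lra.
  - apply Rmult_le_reg_r with ((1 - exp (- b)) * (1 - exp (- a))). nra.
    field_simplify; nra.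
Qed.

(** The comparison fails when the nearer point is the singularity itself, where [L] takes the value
    0; hence [a <> 0]. *)
Lemma L_decr_abs (a b : R) : a <> 0 -> Rabs a <= Rabs b -> L b <= L a.
Proof.
  intros Ha H. rewrite <- (L_abs a), <- (L_abs b). apply L_decr. split; auto.
  apply Rabs_pos_lt; auto.
Qed.

Lemma ln_2_le_1 : ln 2 <= 1.
Proof. generalize ln_lt_2. generalize (exp_ineq1 1 ltac:(lra)). intros.
  apply Rle_trans with (ln (exp 1)). apply ln_le; lra. rewrite ln_exp; lra. Qed.

(** By convexity [exp (- s w) <= s exp (- w) + 1 - s], so the denominator [1 - exp (- w)] shrinks at
    most by the factor [s], while the numerator stays between 1 and 2. This makes the logarithmic
    singularity quantitative. *)
Lemma L_scale (w s : R) : 0 < w -> 0 < s <= 1 -> L (s * w) <= L w - ln s + ln 2.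
Proof.
  intros Hw Hs. assert (Hsw : 0 < s * w) by nra. rewrite !L_pos_eq by auto.
  assert (E := exp_opp_lt_1 w Hw). assert (E' := exp_opp_lt_1 (s * w) Hsw).
  assert (K : exp (- (s * w)) <= s * exp (- w) + (1 - s)).
  { assert (K1 : exp (- w) >= exp (- (s * w)) * (1 - (1 - s) * w)).
    { replace (- w) with (- (s * w) + - ((1 - s) * w)) by ring. rewrite exp_plus.
      generalize (exp_ineq1_le (- ((1 - s) * w))). intros. nra. }
    assert (K2 : 1 >= exp (- (s * w)) * (1 + s * w)).
    { replace 1 with (exp (- (s * w)) * exp (s * w)) at 1.
      generalize (exp_ineq1_le (s * w)). intros. nra.
      rewrite <- exp_plus. replace (- (s * w) + s * w) with 0 by ring. apply exp_0. }
    assert (s * exp (- w) >= s * (exp (- (s * w)) * (1 - (1 - s) * w))) by (apply Rmult_ge_compat_l; lra).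
    assert ((1 - s) * 1 >= (1 - s) * (exp (- (s * w)) * (1 + s * w))).
    { apply Rmult_ge_compat_l; [lra|]. exact K2. }
    nra. }
  replace (ln ((1 + exp (- w)) / (1 - exp (- w))) - ln s + ln 2) with
    (ln (((1 + exp (- w)) / (1 - exp (- w))) / s * 2)).
  - apply ln_le. apply Rdiv_lt_0_compat; lra.
    apply Rmult_le_reg_r with ((1 - exp (- (s * w))) * (1 - exp (- w)) * s).
    repeat apply Rmult_lt_0_compat; lra.
    replace ((1 + exp (- (s * w))) / (1 - exp (- (s * w))) *
      ((1 - exp (- (s * w))) * (1 - exp (- w)) * s)) with ((1 + exp (- (s * w))) * ((1 - exp (- w)) * s))
      by (field; lra).
    replace ((1 + exp (- w)) / (1 - exp (- w)) / s * 2 *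
      ((1 - exp (- (s * w))) * (1 - exp (- w)) * s)) with ((1 + exp (- w)) * 2 * (1 - exp (- (s * w))))
      by (field; lra).
    apply Rmult_le_compat; try nra.
  - assert (0 < (1 + exp (- w)) / (1 - exp (- w))) by (apply Rdiv_lt_0_compat; lra).
    rewrite ln_mult, (ln_div _ s); try lra. apply Rdiv_lt_0_compat; lra.
Qed.

Definition sqrt_kernel (c u x : R) : R := L (u - c * sqrt x).

(** With [w = u - c sqrt x] one has [dx = - 2 / c ^ 2 * (u - w) dw]; one integration by parts
    against [L], whose successive antiderivatives are [A] and [A2], gives this expression. *)
Definition sqrt_primitive (c u x : R) : R :=
  2 / c ^ 2 * (- (c * sqrt x) * A (u - c * sqrt x) - A2 (u - c * sqrt x)).

Lemma is_derive_sqrt_primitive (c u x : R) : 0 < c -> 0 < x -> u <> c * sqrt x ->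
  is_derive (sqrt_primitive c u) x (sqrt_kernel c u x).
Proof.
  intros Hc Hx Hu. unfold sqrt_primitive, sqrt_kernel.
  assert (Hs : 0 < sqrt x) by (apply sqrt_lt_R0; auto).
  assert (DA := is_derive_A (u - c * sqrt x) ltac:(lra)).
  assert (DA2 := is_derive_A2 (u - c * sqrt x)).
  auto_derive.
  - repeat split; auto. exists (L (u - c * sqrt x)); exact DA.
    exists (A (u - c * sqrt x)); exact DA2.
  - change (fun x => A x) with A. change (fun x => A2 x) with A2.
    change (u + - (c * sqrt x)) with (u - c * sqrt x).
    rewrite (is_derive_unique A _ _ DA), (is_derive_unique A2 _ _ DA2). field. lra.
Qed.

Lemma continuity_sqrt_primitive (c u x : R) : 0 <= x ->
  continuity_pt (sqrt_primitive c u) x.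
Proof.
  intros Hx. unfold sqrt_primitive.
  assert (Cs : continuity_pt (fun x => c * sqrt x) x).
  { apply continuity_pt_scal. apply continuity_pt_sqrt; auto. }
  assert (Cd : continuity_pt (fun x => u - c * sqrt x) x).
  { apply (continuity_pt_minus (fun _ => u)); auto. apply continuity_pt_const. intros a b; reflexivity. }
  assert (CA2 : forall y, continuity_pt A2 y).
  { intros y. apply derivable_continuous_pt, ex_derive_Reals_0. exists (A y). apply is_derive_A2. }
  apply (continuity_pt_scal (fun x => - (c * sqrt x) * A (u - c * sqrt x) - A2 (u - c * sqrt x))).
  apply (continuity_pt_minus (fun x => - (c * sqrt x) * A (u - c * sqrt x)) (fun x => A2 (u - c * sqrt x))).
  - apply (continuity_pt_mult (fun x => - (c * sqrt x)) (fun x => A (u - c * sqrt x))).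
    + apply (continuity_pt_opp (fun x => c * sqrt x)); auto.
    + apply (continuity_pt_comp (fun x => u - c * sqrt x) A); auto. apply A_continuous.
  - apply (continuity_pt_comp (fun x => u - c * sqrt x) A2); auto.
Qed.

Definition sqrt_kernel' (c u x : R) : R := c / 2 * / (sqrt x * sinh (u - c * sqrt x)).

Lemma sinh_neg (x : R) : x < 0 -> sinh x < 0.
Proof. intros H. rewrite <- sinh_0. apply sinh_lt; auto. Qed.
Lemma sinh_pos (x : R) : 0 < x -> 0 < sinh x.
Proof. intros H. rewrite <- sinh_0. apply sinh_lt; auto. Qed.

Lemma is_derive_L (w : R) : w <> 0 -> is_derive L w (- / sinh w).
Proof.
  assert (Pos : forall v, 0 < v -> is_derive L v (- / sinh v)).
  { intros v Hv. assert (E := exp_opp_lt_1 v Hv).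
    apply is_derive_ext_loc with (fun w => ln ((1 + exp (- w)) / (1 - exp (- w)))).
    - exists (mkposreal v Hv). intros y Hy.
      unfold ball in Hy; simpl in Hy; unfold AbsRing_ball, abs, minus, plus, opp in Hy; simpl in Hy.
      apply Rabs_def2 in Hy. symmetry; apply L_pos_eq; lra.
    - auto_derive. repeat split; try lra. apply Rdiv_lt_0_compat; lra.
      unfold sinh. assert (Ev : exp v = / exp (- v)) by (rewrite exp_Ropp, Rinv_inv; reflexivity).
      rewrite Ev. field. repeat split; try lra. nra. }
  intros Hw. destruct (Rlt_dec 0 w) as [H|H]; [auto|].
  apply is_derive_ext with (fun x => L (- x)). apply L_opp.
  apply is_derive_eq with (- 1 * (- / sinh (- w))).
  - apply (is_derive_comp L (fun x => - x)). apply Pos; lra. auto_derive; auto.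
  - assert (sinh w < 0) by (apply sinh_neg; lra).
    replace (sinh (- w)) with (- sinh w). field. lra.
    unfold sinh. rewrite Ropp_involutive. field.
Qed.

Lemma is_derive_sqrt_kernel (c u x : R) : 0 < c -> 0 < x -> u <> c * sqrt x ->
  is_derive (sqrt_kernel c u) x (sqrt_kernel' c u x).
Proof.
  intros Hc Hx Hu. assert (Hs : 0 < sqrt x) by (apply sqrt_lt_R0; auto).
  assert (sinh (u - c * sqrt x) <> 0).
  { destruct (Rlt_dec u (c * sqrt x)).
    generalize (sinh_neg (u - c * sqrt x)); lra. generalize (sinh_pos (u - c * sqrt x)); lra. }
  apply is_derive_eq with ((- (c / (2 * sqrt x))) * (- / sinh (u - c * sqrt x))).
  - apply (is_derive_comp L (fun x => u - c * sqrt x)). apply is_derive_L. lra.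
    auto_derive; auto. field. lra.
  - unfold sqrt_kernel'. field. split; auto. lra.
Qed.

(* Where [c * sqrt x >= 1] the kernel is convex in [x] on either side of its singularity. *)
Lemma sqrt_sinh_decr (c u x y : R) : 0 < c -> 0 < x <= y -> 1 <= c * sqrt x ->
  sqrt y * sinh (u - c * sqrt y) <= sqrt x * sinh (u - c * sqrt x).
Proof.
  intros Hc Hxy H1. assert (Hs : sqrt x <= sqrt y) by (apply sqrt_le_1_alt; lra).
  set (p := sqrt x) in *. set (q := sqrt y) in *.
  assert (M := mean_value_le (fun v => v * sinh (u - c * v))
     (fun v => sinh (u - c * v) - c * v * cosh (u - c * v)) p q 0 Hs).
  assert (q * sinh (u - c * q) - p * sinh (u - c * p) <= 0 * (q - p)); [|lra].
  apply M.
  - intros v _. unfold sinh, cosh. auto_derive; auto. unfold Rminus. field.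
  - intros v Hv.
    assert (sinh (u - c * v) <= cosh (u - c * v)).
    { unfold sinh, cosh. generalize (exp_pos (- (u - c * v))); lra. }
    assert (0 < cosh (u - c * v)).
    { unfold cosh. generalize (exp_pos (- (u - c * v))), (exp_pos (u - c * v)); lra. }
    assert (1 <= c * v) by nra.
    assert (0 <= (c * v - 1) * cosh (u - c * v)) by (apply Rmult_le_pos; lra). lra.
Qed.

(** A convex function lies below its chords, so its integral is at most the trapezoidal value. *)
Lemma trapezoid_regular (c u a b : R) : 0 < c -> 0 < a <= b -> 1 <= c * sqrt a ->
  u < c * sqrt a \/ c * sqrt b < u ->
  sqrt_primitive c u b - sqrt_primitive c u a <=
    (b - a) * (sqrt_kernel c u a + sqrt_kernel c u b) / 2.
Proof.
  intros Hc Hab H1 Hu.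
  assert (Hs : forall x, a <= x <= b -> 0 < sqrt x /\ sqrt a <= sqrt x <= sqrt b).
  { intros x Hx. split. apply sqrt_lt_R0; lra. split; apply sqrt_le_1_alt; lra. }
  assert (Hne : forall x, a <= x <= b -> u <> c * sqrt x).
  { intros x Hx. destruct (Hs x Hx) as [? []]. nra. }
  assert (Mono : forall s x, a <= s <= x -> x <= b -> sqrt_kernel' c u s <= sqrt_kernel' c u x).
  { intros s x Hsx Hxb. destruct (Hs s) as [S1 [S2 S3]]; [lra|]. destruct (Hs x) as [X1 [X2 X3]]; [lra|].
    assert (K := sqrt_sinh_decr c u s x Hc ltac:(lra) ltac:(nra)).
    unfold sqrt_kernel'. apply Rmult_le_compat_l. lra.
    destruct Hu as [Hu|Hu].
    - assert (sqrt x * sinh (u - c * sqrt x) < 0).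
      { assert (sinh (u - c * sqrt x) < 0) by (apply sinh_neg; nra). nra. }
      assert (sqrt s * sinh (u - c * sqrt s) < 0).
      { assert (sinh (u - c * sqrt s) < 0) by (apply sinh_neg; nra). nra. }
      apply Ropp_le_cancel. rewrite <- !Rinv_opp. apply Rinv_le_contravar; lra.
    - assert (0 < sqrt x * sinh (u - c * sqrt x)).
      { assert (0 < sinh (u - c * sqrt x)) by (apply sinh_pos; nra). nra. }
      apply Rinv_le_contravar; lra. }
  (* With the right end [x] moving and [k] for the kernel, the difference has derivative
     [(k x - k a - (x - a) k' x) / 2], which is nonpositive because [k'] is nondecreasing on the
     cell. *)
  set (D := fun x => sqrt_primitive c u x - (x - a) * (sqrt_kernel c u a + sqrt_kernel c u x) / 2).
  set (D' := fun x => sqrt_kernel c u x - ((sqrt_kernel c u a + sqrt_kernel c u x) / 2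
    + (x - a) * sqrt_kernel' c u x / 2)).
  assert (M := mean_value_le D D' a b 0 ltac:(lra)).
  assert (X : D b - D a <= 0 * (b - a)); [|unfold D in X; lra].
  apply M.
  - intros x Hx. unfold D, D'.
    apply (is_derive_minus (sqrt_primitive c u)
      (fun x => (x - a) * (sqrt_kernel c u a + sqrt_kernel c u x) / 2)).
    + apply is_derive_sqrt_primitive; auto; lra.
    + assert (DK := is_derive_sqrt_kernel c u x Hc ltac:(lra) (Hne x Hx)).
      auto_derive. exists (sqrt_kernel' c u x); exact DK.
      change (fun x => sqrt_kernel c u x) with (sqrt_kernel c u).
      rewrite (is_derive_unique (sqrt_kernel c u) _ _ DK). field.
  - intros x Hx. unfold D'.
    assert (N := mean_value_le (sqrt_kernel c u) (sqrt_kernel' c u) a x (sqrt_kernel' c u x) ltac:(lra)).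
    assert (sqrt_kernel c u x - sqrt_kernel c u a <= sqrt_kernel' c u x * (x - a)); [|lra].
    apply N.
    + intros y Hy. apply is_derive_sqrt_kernel; auto; try lra. apply Hne; lra.
    + intros y Hy. apply Mono; lra.
Qed.

Lemma sqrt_diff_le (x y m : R) : 0 <= x -> 0 <= y -> x <= m -> y <= m -> 0 < m ->
  Rabs (x - y) <= Rabs (sqrt x - sqrt y) * (2 * sqrt m).
Proof.
  intros. assert (E : x - y = (sqrt x - sqrt y) * (sqrt x + sqrt y)).
  { ring_simplify. rewrite !pow2_sqrt by auto. reflexivity. }
  rewrite E, Rabs_mult. apply Rmult_le_compat_l. apply Rabs_pos.
  assert (sqrt x <= sqrt m) by (apply sqrt_le_1_alt; lra).
  assert (sqrt y <= sqrt m) by (apply sqrt_le_1_alt; lra).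
  rewrite Rabs_pos_eq. lra. generalize (sqrt_pos x), (sqrt_pos y); lra.
Qed.

(** Near [y] the kernel is at most [L g + 1 - ln |x - y|], and [- ln |x - y|] is replaced by
    [2 / sqrt |x - y|], which has an explicit primitive. The 11 collects 2 for passing from [g] to
    the cell width, 1 for [ln 2], and 4 for each side of [y]. *)
Lemma singular_cell (c y j : R) : 0 < c -> 1 <= j -> j < y <= j + 1 ->
  sqrt_primitive c (c * sqrt y) (j + 1) - sqrt_primitive c (c * sqrt y) j <=
  L (c * (sqrt (j + 1) - sqrt j)) + 11.
Proof.
  intros Hc Hj Hy. set (u := c * sqrt y).
  assert (Hm : 0 < sqrt (j + 1)) by (apply sqrt_lt_R0; lra).
  (* The least slope of [c sqrt x] on the cell, attained at its right end. *)
  set (g := c / (2 * sqrt (j + 1))). assert (Hg : 0 < g) by (apply Rdiv_lt_0_compat; lra).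
  assert (K : forall x, j <= x <= j + 1 -> x <> y ->
     sqrt_kernel c u x <= L g + 1 + 2 / sqrt (Rabs (x - y))).
  { intros x Hx Hxy. unfold sqrt_kernel, u.
    set (s := Rabs (x - y)). assert (Hs : 0 < s) by (apply Rabs_pos_lt; lra).
    assert (Hs1 : s <= 1) by (unfold s; apply Rabs_le; lra).
    assert (D := sqrt_diff_le x y (j + 1) ltac:(lra) ltac:(lra) ltac:(lra) ltac:(lra) ltac:(lra)).
    fold s in D.
    assert (Hgs : s * g <= Rabs (c * sqrt y - c * sqrt x)).
    { replace (c * sqrt y - c * sqrt x) with (c * - (sqrt x - sqrt y)) by ring.
      rewrite Rabs_mult, Rabs_Ropp, (Rabs_pos_eq c) by lra.
      apply Rmult_le_reg_r with (2 * sqrt (j + 1)). lra.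
      unfold g. replace (s * (c / (2 * sqrt (j + 1))) * (2 * sqrt (j + 1))) with (s * c) by (field; lra).
      nra. }
    rewrite <- L_abs. apply Rle_trans with (L (s * g)). apply L_decr. nra.
    assert (LS := L_scale g s Hg ltac:(lra)).
    assert (- ln s <= 2 / sqrt s).
    { assert (Hq : 0 < sqrt s) by (apply sqrt_lt_R0; auto).
      assert (E : s = sqrt s * sqrt s) by (rewrite sqrt_sqrt; lra).
      rewrite E at 1. rewrite ln_mult by auto.
      assert (I := exp_ineq1_le (- ln (sqrt s))). rewrite exp_Ropp, exp_ln in I by auto.
      unfold Rdiv. lra. }
    generalize ln_2_le_1; lra. }
  assert (Lg : L g <= L (c * (sqrt (j + 1) - sqrt j)) + 2).
  { assert (Hj0 : 0 < sqrt j) by (apply sqrt_lt_R0; lra).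
    assert (Hjj : sqrt j < sqrt (j + 1)) by (apply sqrt_lt_1_alt; lra).
    assert (L g <= L (2 * g) - ln (/ 2) + ln 2).
    { replace g with (/ 2 * (2 * g)) at 1 by field. apply L_scale; lra. }
    rewrite ln_Rinv in H by lra.
    assert (L (2 * g) <= L (c * (sqrt (j + 1) - sqrt j))).
    { apply L_decr. split. nra.
      unfold g. replace (2 * (c / (2 * sqrt (j + 1)))) with (c * / sqrt (j + 1)) by (field; lra).
      apply Rmult_le_compat_l. lra.
      assert ((sqrt (j + 1) - sqrt j) * (sqrt (j + 1) + sqrt j) = 1).
      { ring_simplify. rewrite !pow2_sqrt by lra. ring. }
      apply Rmult_le_reg_r with (sqrt (j + 1)). lra. rewrite Rinv_l by lra. nra. }
    generalize ln_2_le_1; lra. }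
  assert (Hdom : forall x, 0 < x -> x <> y -> u <> c * sqrt x).
  { intros x Hx Hxy E. unfold u in E. apply Rmult_eq_reg_l in E; [|lra].
    apply sqrt_inj in E; lra. }
  assert (P1 : sqrt_primitive c u y - sqrt_primitive c u j <= (L g + 1) * (y - j) + 4 * sqrt (y - j)).
  { set (D := fun x => sqrt_primitive c u x + 4 * sqrt (y - x)).
    assert (X : D y - D j <= (L g + 1) * (y - j)).
    { apply mean_value_except with nil. lra.
      - intros x Hx. unfold D.
        apply (continuity_pt_plus (sqrt_primitive c u) (fun x => 4 * sqrt (y - x))).
        apply continuity_sqrt_primitive; lra.
        apply continuity_pt_scal. apply (continuity_pt_comp (fun x => y - x) sqrt).
        apply derivable_continuous_pt, ex_derive_Reals_0. auto_derive; auto.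
        apply continuity_pt_sqrt; lra.
      - intros x Hx _. exists (sqrt_kernel c u x + 4 * (- / (2 * sqrt (y - x)))). split.
        + apply (is_derive_plus (sqrt_primitive c u) (fun x => 4 * sqrt (y - x))).
          apply is_derive_sqrt_primitive; auto; try lra. apply Hdom; lra.
          auto_derive. lra. assert (0 < sqrt (y - x)) by (apply sqrt_lt_R0; lra).
          unfold Rminus in *. field. lra.
        + assert (Kx := K x ltac:(lra) ltac:(lra)). rewrite Rabs_left in Kx by lra.
          replace (- (x - y)) with (y - x) in Kx by ring.
          assert (0 < sqrt (y - x)) by (apply sqrt_lt_R0; lra).
          replace (4 * - / (2 * sqrt (y - x))) with (- (2 / sqrt (y - x))) by (field; lra). lra. }
    unfold D in X. rewrite Rminus_diag, sqrt_0 in X. lra. }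
  assert (P2 : sqrt_primitive c u (j + 1) - sqrt_primitive c u y <=
     (L g + 1) * (j + 1 - y) + 4 * sqrt (j + 1 - y)).
  { set (D := fun x => sqrt_primitive c u x - 4 * sqrt (x - y)).
    assert (X : D (j + 1) - D y <= (L g + 1) * (j + 1 - y)).
    { apply mean_value_except with nil. lra.
      - intros x Hx. unfold D.
        apply (continuity_pt_minus (sqrt_primitive c u) (fun x => 4 * sqrt (x - y))).
        apply continuity_sqrt_primitive; lra.
        apply continuity_pt_scal. apply (continuity_pt_comp (fun x => x - y) sqrt).
        apply derivable_continuous_pt, ex_derive_Reals_0. auto_derive; auto.
        apply continuity_pt_sqrt; lra.
      - intros x Hx _. exists (sqrt_kernel c u x - 4 * (/ (2 * sqrt (x - y)))). split.
        + apply (is_derive_minus (sqrt_primitive c u) (fun x => 4 * sqrt (x - y))).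
          apply is_derive_sqrt_primitive; auto; try lra. apply Hdom; lra.
          auto_derive. lra. assert (0 < sqrt (x - y)) by (apply sqrt_lt_R0; lra).
          unfold Rminus in *. field. lra.
        + assert (Kx := K x ltac:(lra) ltac:(lra)). rewrite Rabs_pos_eq in Kx by lra.
          assert (0 < sqrt (x - y)) by (apply sqrt_lt_R0; lra).
          replace (4 * / (2 * sqrt (x - y))) with (2 / sqrt (x - y)) by (field; lra). lra. }
    unfold D in X. rewrite Rminus_diag, sqrt_0 in X. lra. }
  assert (sqrt (y - j) <= 1) by (rewrite <- sqrt_1; apply sqrt_le_1_alt; lra).
  assert (sqrt (j + 1 - y) <= 1) by
    (apply Rle_trans with (sqrt 1); [apply sqrt_le_1_alt; lra|rewrite sqrt_1; lra]).
  lra.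
Qed.

Fixpoint rsum (f : nat -> R) (n : nat) : R :=
  match n with O => 0 | S n' => rsum f n' + f n' end.

Lemma rsum_nonneg (f : nat -> R) (n : nat) : (forall k, 0 <= f k) -> 0 <= rsum f n.
Proof. intros H. induction n as [|n IH]; simpl. lra. generalize (H n); lra. Qed.

(** The cells below [m] are left out, since convexity is available only where [c sqrt x >= 1]. At
    most one later cell contains [y], and the conditional charges its 11 once. *)
Lemma sqrt_kernel_sum_primitive (c u y : R) (m n : nat) :
  0 < c -> u = c * sqrt y -> (1 <= m)%nat -> 1 <= c * sqrt (INR m) -> (m <= n)%nat ->
  (forall k, (k <= n)%nat -> y <> INR k) ->
  sqrt_primitive c u (INR n) - sqrt_primitive c u (INR m) <=
  rsum (fun k => sqrt_kernel c u (INR k)) n + sqrt_kernel c u (INR n) / 2 +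
  (if Rlt_dec y (INR n) then 11 else 0).
Proof.
  intros Hc Hu Hm H1 Hmn Hy. induction Hmn as [|n Hmn IH].
  - rewrite Rminus_diag. assert (N1 := rsum_nonneg (fun k => sqrt_kernel c u (INR k)) m (fun k => L_nonneg _)).
    assert (N2 : 0 <= sqrt_kernel c u (INR m)) by apply L_nonneg.
    destruct Rlt_dec; lra.
  - assert (IH' : forall k, (k <= n)%nat -> y <> INR k) by (intros; apply Hy; lia).
    specialize (IH IH'). simpl rsum.
    assert (Hm1 : 1 <= INR m) by (apply (le_INR 1); auto).
    assert (Hmn' : INR m <= INR n) by (apply le_INR; auto).
    assert (Hsq : sqrt (INR m) <= sqrt (INR n)) by (apply sqrt_le_1_alt; lra).
    assert (Yn := Hy n ltac:(lia)). assert (YSn := Hy (S n) ltac:(lia)).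
    rewrite S_INR in *.
    assert (N1 : 0 <= sqrt_kernel c u (INR n)) by apply L_nonneg.
    assert (N2 : 0 <= sqrt_kernel c u (INR n + 1)) by apply L_nonneg.
    assert (Reg : u < c * sqrt (INR n) \/ c * sqrt (INR n + 1) < u ->
      sqrt_primitive c u (INR n + 1) - sqrt_primitive c u (INR n) <=
      (sqrt_kernel c u (INR n) + sqrt_kernel c u (INR n + 1)) / 2).
    { intros H. assert (T := trapezoid_regular c u (INR n) (INR n + 1) Hc ltac:(lra) ltac:(nra) H). lra. }
    destruct (Rlt_dec y (INR n)) as [C1|C1].
    + destruct (Rlt_dec y (INR n + 1)); [|lra].
      assert (u < c * sqrt (INR n)).
      { destruct (Rle_dec 0 y).
        - rewrite Hu. apply Rmult_lt_compat_l; auto. apply sqrt_lt_1_alt; lra.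
        - rewrite Hu, (sqrt_neg_0 y) by lra. assert (0 < sqrt (INR n)) by (apply sqrt_lt_R0; lra). nra. }
      specialize (Reg (or_introl H)). lra.
    + destruct (Rlt_dec y (INR n + 1)) as [C2|C2].
      * assert (S := singular_cell c y (INR n) Hc ltac:(lra) ltac:(lra)). rewrite <- Hu in S.
        assert (s1 : sqrt (INR n) < sqrt y) by (apply sqrt_lt_1_alt; lra).
        assert (s2 : sqrt y < sqrt (INR n + 1)) by (apply sqrt_lt_1_alt; lra).
        (* Both ends of the cell are within its width of [u], so each end value is at least [L] of
           the width, and one half of each pays for the singular cell. *)
        assert (L (c * (sqrt (INR n + 1) - sqrt (INR n))) <= sqrt_kernel c u (INR n)).
        { apply L_decr_abs; rewrite Hu. nra. rewrite !Rabs_pos_eq; nra. }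
        assert (L (c * (sqrt (INR n + 1) - sqrt (INR n))) <= sqrt_kernel c u (INR n + 1)).
        { apply L_decr_abs; rewrite Hu. nra. rewrite Rabs_left, Rabs_pos_eq; nra. }
        lra.
      * assert (c * sqrt (INR n + 1) < u).
        { rewrite Hu. apply Rmult_lt_compat_l; auto. apply sqrt_lt_1_alt; lra. }
        specialize (Reg (or_intror H)). lra.
Qed.

(** [A2] grows by [PI ^ 2 / 4] per unit length on either side of the origin, up to a constant. The
    boundary term with [A] at the right end misses its limit by [J (c sqrt n - u)], the mass of [L]
    beyond the range; this is the defect at the right end. *)
Lemma sqrt_primitive_lower (c u n : R) : 0 < c -> 0 <= n -> 0 <= u <= c * sqrt n ->
  PI ^ 2 / c ^ 2 * u - 2 / c ^ 2 * (c * sqrt n) * J (c * sqrt n - u) - PI ^ 2 / (2 * c ^ 2) <=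
  sqrt_primitive c u n - sqrt_primitive c u 0.
Proof.
  intros Hc Hn Hu. unfold sqrt_primitive. rewrite sqrt_0, Rmult_0_r, Ropp_0, Rmult_0_l, Rminus_0_r.
  set (U := c * sqrt n) in *.
  replace (u - U) with (- (U - u)) at 1 by ring. rewrite A_opp, A_nonneg_eq by lra.
  assert (B1 := A2_bounds u). assert (B2 := A2_bounds (u - U)).
  rewrite Rabs_pos_eq in B1 by lra. rewrite Rabs_left1 in B2 by lra.
  assert (0 < 2 / c ^ 2) by (apply Rdiv_lt_0_compat; [lra|apply pow_lt; lra]).
  replace (PI ^ 2 / c ^ 2 * u - 2 / c ^ 2 * U * J (U - u) - PI ^ 2 / (2 * c ^ 2)) with
    (2 / c ^ 2 * (PI ^ 2 / 2 * u - U * J (U - u) - PI ^ 2 / 4)) by (field; lra).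
  rewrite <- Rmult_minus_distr_l. apply Rmult_le_compat_l; lra.
Qed.

(** A crude bound for the integral over the initial cells, which the comparison with the sum leaves
    out. *)
Lemma sqrt_primitive_upper (c u n : R) : 0 < c -> 0 <= n ->
  sqrt_primitive c u n - sqrt_primitive c u 0 <= PI ^ 2 / c * sqrt n.
Proof.
  intros Hc Hn. unfold sqrt_primitive. rewrite sqrt_0, Rmult_0_r, Ropp_0, Rmult_0_l, Rminus_0_r.
  assert (Hs := sqrt_pos n). set (U := c * sqrt n) in *. assert (HU : 0 <= U) by (apply Rmult_le_pos; lra).
  assert (M := mean_value_le A2 A (u - U) u (PI ^ 2 / 4) ltac:(lra) (fun x _ => is_derive_A2 x)).
  specialize (M ltac:(intros x _; generalize (A_bounds x) (Rle_abs (A x)); lra)).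
  assert (B : - A (u - U) <= PI ^ 2 / 4).
  { generalize (A_bounds (u - U)) (Rle_abs (- A (u - U))). rewrite Rabs_Ropp. lra. }
  assert (0 < 2 / c ^ 2) by (apply Rdiv_lt_0_compat; [lra|apply pow_lt; lra]).
  replace (PI ^ 2 / c * sqrt n) with (2 / c ^ 2 * (PI ^ 2 / 2 * U)) by (unfold U; field; lra).
  rewrite <- Rmult_minus_distr_l. apply Rmult_le_compat_l; nra.
Qed.

(* The extra term at [n - 1/2], from the point [a_(N_0 + 1)], replaces the missing half term at [n]. *)
Lemma sqrt_kernel_sum_lower (c : R) : 0 < c -> exists K, forall (n : nat) (u : R),
  (1 <= n)%nat -> 0 <= u <= c * sqrt (INR n) ->
  (forall k, (k < n)%nat -> u <> c * sqrt (INR k)) ->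
  u <> c * sqrt (INR n - / 2) ->
  PI ^ 2 / c ^ 2 * u - 2 / c ^ 2 * (c * sqrt (INR n)) * J (c * sqrt (INR n) - u) - K <=
  rsum (fun k => L (u - c * sqrt (INR k))) n + L (u - c * sqrt (INR n - / 2)).
Proof.
  intros Hc.
  destruct (INR_archimed 1 (/ (c * c) + 1)) as [m Hm]; [lra|]. rewrite Rmult_1_r in Hm.
  assert (Hcc : 0 < / (c * c)) by (apply Rinv_0_lt_compat; nra).
  assert (Hpi : 0 < PI ^ 2) by apply pow_lt, PI_RGT_0.
  assert (Hm1 : 1 <= c * sqrt (INR m)).
  { apply Rsqr_incr_0_var. 2: apply Rmult_le_pos; [lra|apply sqrt_pos].
    unfold Rsqr. replace (c * sqrt (INR m) * (c * sqrt (INR m))) with (c * c * (sqrt (INR m) * sqrt (INR m))) by ring.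
    rewrite sqrt_sqrt by apply pos_INR.
    apply Rle_trans with (c * c * / (c * c)). rewrite Rinv_r by nra. lra.
    apply Rmult_le_compat_l. nra. lra. }
  assert (Hm0 : (1 <= m)%nat). { destruct m. simpl in Hm. lra. lia. }
  (* The three terms pay for the cells below [m], for the loss in [sqrt_primitive_lower], and for
     the singular cell. *)
  exists (PI ^ 2 / c * sqrt (INR m) + PI ^ 2 / (2 * c ^ 2) + 11).
  intros n u Hn Hu Hne Hne2.
  assert (Hn1 : 1 <= INR n) by (apply (le_INR 1); auto).
  assert (HJ := proj1 (J_bounds (c * sqrt (INR n) - u) ltac:(lra))).
  assert (S1 := rsum_nonneg (fun k => L (u - c * sqrt (INR k))) n (fun k => L_nonneg _)).
  assert (S2 := L_nonneg (u - c * sqrt (INR n - / 2))).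
  assert (C1 : 0 < PI ^ 2 / (2 * c ^ 2)) by (apply Rdiv_lt_0_compat; nra).
  assert (C2 : 0 < 2 / c ^ 2) by (apply Rdiv_lt_0_compat; nra).
  assert (Hsn := sqrt_pos (INR n)).
  assert (C3 : 0 <= 2 / c ^ 2 * (c * sqrt (INR n)) * J (c * sqrt (INR n) - u))
    by (apply Rmult_le_pos; [apply Rmult_le_pos; [lra|apply Rmult_le_pos; lra]|lra]).
  destruct (le_lt_dec n m) as [Hnm|Hnm].
  - assert (PI ^ 2 / c ^ 2 * u <= PI ^ 2 / c * sqrt (INR m)).
    { replace (PI ^ 2 / c * sqrt (INR m)) with (PI ^ 2 / c ^ 2 * (c * sqrt (INR m))) by (field; lra).
      apply Rmult_le_compat_l. left; apply Rdiv_lt_0_compat; nra.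
      apply Rle_trans with (1 := proj2 Hu). apply Rmult_le_compat_l. lra.
      apply sqrt_le_1_alt, le_INR; auto. }
    lra.
  - destruct n as [|p]; [lia|].
    set (y := (u / c) ^ 2).
    assert (Huy : u = c * sqrt y).
    { unfold y. rewrite sqrt_pow2. field; lra. apply Rdiv_le_0_compat; lra. }
    assert (Hy0 : 0 <= y) by (unfold y; apply pow2_ge_0).
    assert (Hyk : forall k, (k <= p)%nat -> y <> INR k).
    { intros k Hk E. apply (Hne k). lia. rewrite <- E. exact Huy. }
    assert (T := sqrt_kernel_sum_primitive c u y m p Hc Huy Hm0 Hm1 ltac:(lia) Hyk).
    assert (P0 := sqrt_primitive_upper c u (INR m) Hc (pos_INR m)).
    assert (PL := sqrt_primitive_lower c u (INR (S p)) Hc (pos_INR _) Hu).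
    simpl rsum in *. fold (sqrt_kernel c u (INR p)) in *.
    change (fun k => L (u - c * sqrt (INR k))) with (fun k => sqrt_kernel c u (INR k)) in *.
    rewrite S_INR in *. fold (sqrt_kernel c u (INR p + 1 - / 2)) in *.
    assert (Hpm : INR m <= INR p) by (apply le_INR; lia).
    assert (Hp1 : 1 <= INR p) by (generalize (le_INR 1 m Hm0); simpl; lra).
    assert (Hsq : sqrt (INR m) <= sqrt (INR p)) by (apply sqrt_le_1_alt; lra).
    assert (Yp := Hyk p (le_n _)).
    assert (Hyn : y <= INR p + 1).
    { assert (sqrt y <= sqrt (INR p + 1)) by (apply Rmult_le_reg_l with c; lra).
      apply sqrt_le_0; lra. }
    assert (sh : sqrt (INR p + 1 - / 2) <= sqrt (INR p + 1)) by (apply sqrt_le_1_alt; lra).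
    assert (sh' : sqrt (INR p) <= sqrt (INR p + 1 - / 2)) by (apply sqrt_le_1_alt; lra).
    (* The last cell is [[p, p + 1]]. If [y] lies before it, [p + 1/2] is at least as near as
       [p + 1], and its value dominates the missing half term. If [y] lies inside, [p] and [p + 1/2]
       are both within the cell width of [u] and pay for the singular cell. *)
    destruct (Rlt_dec y (INR p)) as [Y|Y].
    + assert (sy : sqrt y < sqrt (INR p)) by (apply sqrt_lt_1_alt; lra).
      assert (T2 := trapezoid_regular c u (INR p) (INR p + 1) Hc ltac:(lra) ltac:(nra) ltac:(left; nra)).
      assert (sqrt_kernel c u (INR p + 1) <= sqrt_kernel c u (INR p + 1 - / 2)).
      { apply L_decr_abs. nra. rewrite !Rabs_left1; nra. }
      assert (0 <= sqrt_kernel c u (INR p + 1 - / 2)) by apply L_nonneg.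
      lra.
    + assert (S := singular_cell c y (INR p) Hc ltac:(lra) ltac:(lra)). rewrite <- Huy in S.
      assert (s1 : sqrt (INR p) < sqrt y) by (apply sqrt_lt_1_alt; lra).
      assert (s2 : sqrt y <= sqrt (INR p + 1)) by (apply sqrt_le_1_alt; lra).
      assert (L (c * (sqrt (INR p + 1) - sqrt (INR p))) <= sqrt_kernel c u (INR p)).
      { apply L_decr_abs; rewrite Huy. nra. rewrite !Rabs_pos_eq; nra. }
      assert (L (c * (sqrt (INR p + 1) - sqrt (INR p))) <= sqrt_kernel c u (INR p + 1 - / 2)).
      { apply L_decr_abs. lra. rewrite (Rabs_pos_eq (c * _)) by nra. apply Rabs_le. rewrite Huy. nra. }
      assert (0 <= sqrt_kernel c u (INR p)) by apply L_nonneg.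
      lra.
Qed.


(** * The product over the Ganelius points *)

Lemma exp_le_mono (x y : R) : x <= y -> exp x <= exp y.
Proof. intros [H| <-]. left; apply exp_increasing; auto. right; auto. Qed.

Lemma Rprod_cons {I : Type} (i : I) (s : list I) (F : I -> R) :
  Rprod (i :: s) F = F i * Rprod s F.
Proof. reflexivity. Qed.

Lemma Rprod_app {I : Type} (s s' : list I) (F : I -> R) :
  Rprod (s ++ s') F = Rprod s F * Rprod s' F.
Proof.
  induction s as [|i s IH]; simpl app.
  - unfold Rprod; simpl; ring.
  - rewrite !Rprod_cons, IH; ring.
Qed.

Lemma Rprod_ext {I : Type} (s : list I) (F G : I -> R) :
  (forall i, In i s -> F i = G i) -> Rprod s F = Rprod s G.
Proof.
  intros H. unfold Rprod. f_equal. apply map_ext_in. exact H.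
Qed.

Lemma Rprod_Rabs {I : Type} (s : list I) (F : I -> R) :
  Rabs (Rprod s F) = Rprod s (fun i => Rabs (F i)).
Proof.
  induction s as [|i s IH].
  - unfold Rprod; simpl. apply Rabs_R1.
  - rewrite !Rprod_cons, Rabs_mult, IH. reflexivity.
Qed.

Lemma Rprod_nonneg {I : Type} (s : list I) (F : I -> R) :
  (forall i, In i s -> 0 <= F i) -> 0 <= Rprod s F.
Proof.
  induction s as [|i s IH]; intros H.
  - unfold Rprod; simpl; lra.
  - rewrite Rprod_cons. apply Rmult_le_pos. apply H; left; auto.
    apply IH; intros; apply H; right; auto.
Qed.

Lemma Rprod_le_pow {I : Type} (s : list I) (F : I -> R) (M : R) :
  (forall i, In i s -> 0 <= F i <= M) -> Rprod s F <= M ^ length s.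
Proof.
  induction s as [|i s IH]; intros H.
  - unfold Rprod; simpl; lra.
  - rewrite Rprod_cons. simpl.
    assert (H0 := H i (or_introl eq_refl)).
    assert (H1 : forall j, In j s -> 0 <= F j <= M) by (intros; apply H; right; auto).
    apply Rmult_le_compat; try apply H0. apply Rprod_nonneg; intros; apply H1; auto. auto.
Qed.

Lemma Rprod_eq_0 {I : Type} (s : list I) (F : I -> R) (i : I) :
  In i s -> F i = 0 -> Rprod s F = 0.
Proof.
  intros Hi HF. induction s as [|j s IH]. destruct Hi.
  rewrite Rprod_cons. destruct Hi as [->|Hi]. rewrite HF; ring. rewrite IH by auto; ring.
Qed.

Lemma Rprod_nonzero_indices (N : nat) (F : Z -> R) :
  Rprod (nonzero_indices N) F =
  Rprod (seq 1 N) (fun k => F (- Z.of_nat k)%Z * F (Z.of_nat k)).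
Proof.
  unfold nonzero_indices. induction (seq 1 N) as [|k s IH]. reflexivity.
  simpl flat_map. rewrite !Rprod_cons, IH. ring.
Qed.

(** With [w = ln t - ln a] the factor is [|tanh (w / 2)|], which turns the product into a sum of
    values of [L] at logarithmic distances. *)
Lemma blaschke_factor_L (t a : R) : 0 < t -> 0 < a -> t <> a ->
  Rabs ((a - t) / (a + t)) = exp (- L (ln t - ln a)).
Proof.
  assert (Lt : forall t a, 0 < t < a -> Rabs ((a - t) / (a + t)) = exp (- L (ln t - ln a))).
  { clear. intros t a H. assert (ln t < ln a) by (apply ln_increasing; lra).
    unfold L. rewrite (Rabs_left (ln t - ln a)) by lra.
    replace (- - (ln t - ln a)) with (ln t + - ln a) by ring.
    rewrite exp_plus, (exp_Ropp (ln a)), !exp_ln by lra.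
    replace ((1 + t * / a) / (1 - t * / a)) with ((a + t) / (a - t)) by (field; lra).
    rewrite <- ln_Rinv by (apply Rdiv_lt_0_compat; lra).
    rewrite exp_ln by (apply Rinv_0_lt_compat, Rdiv_lt_0_compat; lra).
    rewrite Rabs_pos_eq by (left; apply Rdiv_lt_0_compat; lra). field. lra. }
  intros Ht Ha Hne. destruct (Rlt_dec t a) as [H|H]. apply Lt; lra.
  replace (ln t - ln a) with (- (ln a - ln t)) by ring. rewrite L_opp, <- Lt by lra.
  replace ((a - t) / (a + t)) with (- ((t - a) / (t + a))) by (field; lra). apply Rabs_Ropp.
Qed.

Lemma Rabs_blaschke_factor_le (t a : R) : 0 < t -> 0 < a -> 0 <= Rabs ((a - t) / (a + t)) <= 1.
Proof.
  intros. split. apply Rabs_pos. apply Rabs_le.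
  split; apply Rmult_le_reg_r with (a + t); try lra; field_simplify; lra.
Qed.

(* The factor [5] in the definition of the points near [1] makes each such factor
   at most [1/8] for [4/5 <= t <= 1], and [ln 8 >= 2 = (8 / PI^2) J 0]. *)
Lemma blaschke_factor_near_1 (t a : R) : 0 < t <= 1 -> 4 / 5 <= a < 1 ->
  Rabs ((a - t) / (a + t)) <= exp (- (8 / PI ^ 2 * J (- ln t))).
Proof.
  intros Ht Ha. assert (0 < PI ^ 2) by apply pow_lt, PI_RGT_0.
  assert (Hl : ln t <= 0) by (rewrite <- ln_1; apply ln_le; lra).
  assert (HJ := J_bounds (- ln t) ltac:(lra)).
  (* For [t < 4/5] the factor grows with [a], so it is at most its value at [a = 1], which is
     [exp (- L (- ln t))]; then [J <= L] and [8 / PI ^ 2 <= 1] finish. *)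
  destruct (Rlt_dec t (4 / 5)) as [H4|H4].
  - assert (Hl' : ln t < 0) by (rewrite <- ln_1; apply ln_increasing; lra).
    assert (E := blaschke_factor_L t 1 ltac:(lra) ltac:(lra) ltac:(lra)).
    rewrite ln_1, Rminus_0_r in E. rewrite <- (Ropp_involutive (ln t)), L_opp in E.
    apply Rle_trans with (Rabs ((1 - t) / (1 + t))).
    + rewrite !Rabs_pos_eq by (apply Rdiv_le_0_compat; lra).
      apply Rmult_le_reg_r with ((a + t) * (1 + t)). nra. field_simplify; nra.
    + rewrite E. apply exp_le_mono. assert (JL := J_le_L (- ln t) ltac:(lra)).
      assert (8 / PI ^ 2 <= 1).
      { apply Rmult_le_reg_r with (PI ^ 2). lra. replace (8 / PI ^ 2 * PI ^ 2) with 8 by (field; apply PI_neq0).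
        assert (3 < PI) by (generalize PI2_3_2; lra). nra. }
      nra.
  - apply Rle_trans with (/ 8).
    + apply Rabs_le. split; apply Rmult_le_reg_r with (a + t); try lra; field_simplify; lra.
    + apply Rle_trans with (exp (- (2))).
      * rewrite exp_Ropp. apply Rinv_le_contravar. apply exp_pos.
        replace 2 with (1 + 1) by ring. rewrite exp_plus. generalize exp_le_3 (exp_pos 1); intros.
        (* [exp 2 <= 8] requires [exp 1 <= sqrt 8], which is just above [2.82]. The bound comes from
           [exp (- 1/4) >= (1 - 1/32) ^ 8]. *)
        assert (exp 1 <= 2.8). {
          replace 1 with (/ 4 + / 4 + / 4 + / 4) by field. rewrite !exp_plus.
          assert (E4 : exp (/ 4) <= 1.29).
          { assert (I := exp_ineq1_le (- / 4)).
            assert (I2 := exp_ineq1_le (- / 32)).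
            assert (J8 : exp (- / 4) = exp (- / 32) ^ 8).
            { simpl. rewrite Rmult_1_r, <- !exp_plus. f_equal. field. }
            assert (0.7755 <= exp (- / 4)).
            { rewrite J8. apply Rle_trans with ((1 - / 32) ^ 8). lra. apply pow_incr. lra. }
            rewrite exp_Ropp in H2. assert (0 < exp (/ 4)) by apply exp_pos.
            assert (exp (/ 4) * / exp (/ 4) = 1) by (field; lra). nra. }
          assert (0 < exp (/ 4)) by apply exp_pos.
          assert (exp (/ 4) * exp (/ 4) <= 1.6641) by nra.
          assert (exp (/ 4) * exp (/ 4) * exp (/ 4) * exp (/ 4) = (exp (/ 4) * exp (/ 4)) * (exp (/ 4) * exp (/ 4))) by ring.
          nra. }
        nra.
      * apply exp_le_mono. assert (E0 : 0 < exp (- - ln t) <= 1) by (apply exp_opp_le_1; lra).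
        assert (J (- ln t) <= PI ^ 2 / 4) by nra.
        assert (8 / PI ^ 2 * J (- ln t) <= 8 / PI ^ 2 * (PI ^ 2 / 4)).
        { apply Rmult_le_compat_l. left; apply Rdiv_lt_0_compat; lra. auto. }
        replace (8 / PI ^ 2 * (PI ^ 2 / 4)) with 2 in * by (field; apply PI_neq0). lra.
Qed.

Lemma exp_opp_pow (x : R) (n : nat) : exp (- x) ^ n = exp (- (x * INR n)).
Proof.
  induction n as [|n IH].
  - simpl. rewrite Rmult_0_r, Ropp_0, exp_0; auto.
  - rewrite S_INR. simpl pow. rewrite IH, <- exp_plus. f_equal. ring.
Qed.

Lemma varphi_eq (r x : R) : 0 < r -> 0 <= x -> varphi r x = exp (PI / sqrt r * sqrt x).
Proof.
  intros Hr Hx. unfold varphi. rewrite sqrt_div by assumption. f_equal.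
  assert (0 < sqrt r) by (apply sqrt_lt_R0; auto). field. lra.
Qed.

Lemma ganelius_low (r : R) (N n k : nat) : 0 < r -> N_0 r N = Z.of_nat n -> (k < n)%nat ->
  ganelius r N (Z.of_nat (S k)) =
  exp (PI / sqrt r * sqrt (INR k) - PI / sqrt r * sqrt (INR n)).
Proof.
  intros Hr Hn Hk. unfold ganelius. rewrite Hn.
  assert (E : (Z.of_nat (S k) <=? Z.of_nat n)%Z = true) by (apply Z.leb_le; lia). rewrite E.
  rewrite <- !INR_IZR_INZ, S_INR. replace (INR k + 1 - 1) with (INR k) by ring.
  rewrite !varphi_eq by (auto; apply pos_INR).
  unfold Rminus. rewrite exp_plus, exp_Ropp. reflexivity.
Qed.

Lemma ganelius_mid (r : R) (N n : nat) : 0 < r -> N_0 r N = Z.of_nat n -> (1 <= n)%nat ->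
  ganelius r N (Z.of_nat (S n)) =
  exp (PI / sqrt r * sqrt (INR n - / 2) - PI / sqrt r * sqrt (INR n)).
Proof.
  intros Hr Hn H1. unfold ganelius. rewrite Hn.
  assert (E : (Z.of_nat (S n) <=? Z.of_nat n)%Z = false) by (apply Z.leb_gt; lia). rewrite E.
  assert (E' : (Z.of_nat (S n) =? Z.of_nat n + 1)%Z = true) by (apply Z.eqb_eq; lia). rewrite E'.
  rewrite <- !INR_IZR_INZ. apply (le_INR 1) in H1. simpl in H1.
  rewrite !varphi_eq by lra.
  unfold Rminus. rewrite exp_plus, exp_Ropp. unfold Rdiv. rewrite (Rmult_1_l (/ 2)). reflexivity.
Qed.

Lemma ganelius_high (r : R) (N n k : nat) : N_0 r N = Z.of_nat n -> (n + 2 <= k <= N)%nat ->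
  4 / 5 <= ganelius r N (Z.of_nat k) < 1.
Proof.
  intros Hn Hk. unfold ganelius. rewrite Hn.
  assert (E : (Z.of_nat k <=? Z.of_nat n)%Z = false) by (apply Z.leb_gt; lia). rewrite E.
  assert (E' : (Z.of_nat k =? Z.of_nat n + 1)%Z = false) by (apply Z.eqb_neq; lia). rewrite E'.
  rewrite <- !INR_IZR_INZ.
  assert (H1 : INR n + 2 <= INR k) by (replace 2 with (INR 2) by reflexivity; rewrite <- plus_INR; apply le_INR; lia).
  assert (H2 : INR k <= INR N) by (apply le_INR; lia).
  set (q := (INR k - INR n - 1) / (5 * (INR N - INR n - 1))).
  assert (0 < q) by (apply Rdiv_lt_0_compat; lra).
  assert (q <= / 5).
  { unfold q. apply Rmult_le_reg_r with (5 * (INR N - INR n - 1)). lra. field_simplify; lra. }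
  lra.
Qed.

Lemma N_0_lt (r : R) (N : nat) : 0 < r -> (0 < N)%nat -> (N_0 r N < Z.of_nat N)%Z.
Proof.
  intros Hr HN. unfold N_0.
  assert (0 < INR N) by (apply lt_0_INR; auto).
  assert (0 < PI / 4 * sqrt (INR N * r)).
  { apply Rmult_lt_0_compat. generalize PI_RGT_0; lra. apply sqrt_lt_R0. nra. }
  assert (B := Zceil_bound (PI / 4 * sqrt (INR N * r))).
  assert (0 < Zceil (PI / 4 * sqrt (INR N * r)))%Z by (apply lt_IZR; lra). lia.
Qed.

Lemma ganelius_bounds (r : R) (N k : nat) : 0 < r -> (1 <= N_0 r N)%Z -> (1 <= k <= N)%nat ->
  0 < ganelius r N (Z.of_nat k) < 1.
Proof.
  intros Hr HN Hk. set (n := Z.to_nat (N_0 r N)).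
  assert (Hn : N_0 r N = Z.of_nat n) by (unfold n; rewrite Z2Nat.id; lia).
  assert (Hc : 0 < PI / sqrt r) by (apply Rdiv_lt_0_compat; [apply PI_RGT_0|apply sqrt_lt_R0; auto]).
  assert (Hn1 : 1 <= INR n) by (apply (le_INR 1); lia).
  assert (X : forall v, 0 <= v < INR n -> 0 < exp (PI / sqrt r * sqrt v - PI / sqrt r * sqrt (INR n)) < 1).
  { intros v Hv. split. apply exp_pos. rewrite <- exp_0. apply exp_increasing.
    assert (sqrt v < sqrt (INR n)) by (apply sqrt_lt_1_alt; lra). nra. }
  destruct (le_lt_dec k n).
  - destruct k as [|k]; [lia|]. rewrite (ganelius_low r N n) by (auto; lia). apply X.
    split. apply pos_INR. apply lt_INR; lia.
  - destruct (Nat.eq_dec k (S n)) as [->|].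
    + rewrite (ganelius_mid r N n) by (auto; lia). apply X. lra.
    + assert (G := ganelius_high r N n k Hn ltac:(lia)). lra.
Qed.

(* The weight [t ^ r] is written [exp (r * ln t)]. *)
Lemma ganelius_product_bound (r : R) : 0 < r -> exists K, 0 < K /\
  forall (N : nat) (t : R), (0 < N)%nat -> (1 <= N_0 r N)%Z -> 0 < t <= 1 ->
  exp (r * ln t) *
    Rprod (seq 1 N) (fun k => Rabs ((ganelius r N (Z.of_nat k) - t) / (ganelius r N (Z.of_nat k) + t)))
  <= K * exp (- (PI * sqrt (r * INR N))).
Proof.
  intros Hr. set (c := PI / sqrt r).
  assert (Hsr : 0 < sqrt r) by (apply sqrt_lt_R0; auto).
  assert (Hpi : 0 < PI) by apply PI_RGT_0.
  assert (Hpi2 : 0 < PI ^ 2) by (apply pow_lt; auto).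
  assert (Hc : 0 < c) by (apply Rdiv_lt_0_compat; auto).
  assert (Err : r = sqrt r * sqrt r) by (rewrite sqrt_sqrt; lra).
  destruct (sqrt_kernel_sum_lower c Hc) as [K1 HK1].
  (* [K1] is the loss of the trapezoidal comparison, 2 is the part of the defect left after
     compensation, and the last summand is the price of having [n] instead of [N] in the leading
     term. *)
  set (K2 := Rmax 0 (K1 + 2) + PI * sqrt r * (PI / 4 * sqrt r + 1)).
  exists (exp K2). split. apply exp_pos.
  intros N t HN HN0 Ht. rewrite <- exp_plus.
  set (n := Z.to_nat (N_0 r N)).
  assert (Hn : N_0 r N = Z.of_nat n) by (unfold n; rewrite Z2Nat.id; lia).
  assert (HnN : (n < N)%nat) by (generalize (N_0_lt r N Hr HN); lia).
  assert (Hn1 : (1 <= n)%nat) by lia.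
  assert (HNR : 1 <= INR N) by (apply (le_INR 1); lia).
  assert (HsN : 1 <= sqrt (INR N)) by (rewrite <- sqrt_1; apply sqrt_le_1_alt; lra).
  set (U := c * sqrt (INR n)).
  assert (HrU : r * U = PI * sqrt r * sqrt (INR n)) by (unfold U, c; rewrite Err at 1; field; lra).
  assert (HsNr : sqrt (INR N * r) = sqrt (INR N) * sqrt r) by (apply sqrt_mult; lra).
  assert (HNn : INR N - INR n <= PI / 4 * (sqrt (INR N) * sqrt r) + 1 /\
    PI / 4 * (sqrt (INR N) * sqrt r) <= INR N - INR n).
  { assert (B := Zceil_bound (PI / 4 * sqrt (INR N * r))). rewrite HsNr in B.
    assert (E : IZR (Zceil (PI / 4 * (sqrt (INR N) * sqrt r))) = INR N - INR n).
    { rewrite (INR_IZR_INZ n), <- Hn. unfold N_0. rewrite minus_IZR, HsNr, <- INR_IZR_INZ. ring. }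
    lra. }
  (* [sqrt N - sqrt n <= (N - n) / sqrt N], and [N - n] is at most [PI / 4 * sqrt (N r) + 1]. *)
  assert (Hgap : r * U >= PI * sqrt (r * INR N) - PI * sqrt r * (PI / 4 * sqrt r + 1)).
  { rewrite HrU, sqrt_mult by lra.
    assert (sqrt (INR N) - sqrt (INR n) <= PI / 4 * sqrt r + 1).
    { apply Rmult_le_reg_r with (sqrt (INR N)). lra.
      assert (E1 := sqrt_sqrt (INR N) ltac:(lra)). assert (E2 := sqrt_sqrt (INR n) (pos_INR n)).
      assert (sqrt (INR n) <= sqrt (INR N)) by (apply sqrt_le_1_alt, le_INR; lia).
      generalize (sqrt_pos (INR n)); intros. nra. }
    assert (0 < PI * sqrt r) by nra. nra. }
  set (pf := fun k => Rabs ((ganelius r N (Z.of_nat k) - t) / (ganelius r N (Z.of_nat k) + t))).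
  assert (Hpf : forall k, In k (seq 1 N) -> 0 <= pf k <= 1).
  { intros k Hk. apply in_seq in Hk. apply Rabs_blaschke_factor_le. lra.
    apply ganelius_bounds; auto; lia. }
  assert (Fin : forall M, exp (r * ln t) * Rprod (seq 1 N) pf <= exp M ->
     M <= K2 + - (PI * sqrt (r * INR N)) ->
     exp (r * ln t) * Rprod (seq 1 N) pf <= exp (K2 + - (PI * sqrt (r * INR N)))).
  { intros M H1 H2. apply Rle_trans with (1 := H1). apply exp_le_mono; auto. }
  assert (Hmax0 := Rmax_l 0 (K1 + 2)). assert (Hmax1 := Rmax_r 0 (K1 + 2)).
  (* For [t] below all the points the weight [t ^ r] alone is small enough. *)
  destruct (Rlt_dec (ln t + U) 0) as [Hu|Hu].
  { apply Fin with (r * - U).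
    - rewrite <- (Rmult_1_r (exp (r * - U))). apply Rmult_le_compat.
      + left; apply exp_pos.
      + apply Rprod_nonneg; intros; apply Hpf; auto.
      + apply exp_le_mono. nra.
      + rewrite <- (pow1 (length (seq 1 N))). apply Rprod_le_pow. exact Hpf.
    - unfold K2. lra. }
  (* At one of the points the product is zero. Otherwise every [L] below is taken off its
     singularity. *)
  destruct (classic (exists k, In k (seq 1 N) /\ t = ganelius r N (Z.of_nat k))) as [[k [Hk Ek]]|Hne].
  { rewrite (Rprod_eq_0 (seq 1 N) pf k), Rmult_0_r. left; apply exp_pos. exact Hk.
    unfold pf. rewrite <- Ek, Rminus_diag. unfold Rdiv. rewrite Rmult_0_l. apply Rabs_R0. }
  (* In this coordinate the logarithm of the point [a_(k + 1)] becomes [c sqrt k], and [t = 1]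
     becomes [U]. *)
  set (u := ln t + U).
  assert (Hlt : ln t <= 0) by (rewrite <- ln_1; apply ln_le; lra).
  assert (Hne' : forall k, (1 <= k <= N)%nat -> t <> ganelius r N (Z.of_nat k)).
  { intros k Hk E. apply Hne. exists k. split; auto. apply in_seq; lia. }
  assert (Hlow : forall k, (k < n)%nat -> u <> c * sqrt (INR k) /\ pf (S k) = exp (- L (u - c * sqrt (INR k)))).
  { intros k Hk. assert (G := ganelius_low r N n k Hr Hn Hk). fold c in G. split.
    - intros E. apply (Hne' (S k)). lia. rewrite G, <- E. unfold u, U.
      replace (ln t + c * sqrt (INR n) - c * sqrt (INR n)) with (ln t) by ring. rewrite exp_ln; lra.
    - unfold pf. rewrite blaschke_factor_L. 2: lra. 2: apply ganelius_bounds; auto; lia. 2: apply Hne'; lia.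
      rewrite G, ln_exp. do 3 f_equal. unfold u, U. ring. }
  assert (Hmid : u <> c * sqrt (INR n - / 2) /\ pf (S n) = exp (- L (u - c * sqrt (INR n - / 2)))).
  { assert (G := ganelius_mid r N n Hr Hn Hn1). fold c in G. split.
    - intros E. apply (Hne' (S n)). lia. rewrite G, <- E. unfold u, U.
      replace (ln t + c * sqrt (INR n) - c * sqrt (INR n)) with (ln t) by ring. rewrite exp_ln; lra.
    - unfold pf. rewrite blaschke_factor_L. 2: lra. 2: apply ganelius_bounds; auto; lia. 2: apply Hne'; lia.
      rewrite G, ln_exp. do 3 f_equal. unfold u, U. ring. }
  assert (Hprod : forall m, (m <= n)%nat ->
     Rprod (seq 1 m) pf = exp (- rsum (fun k => L (u - c * sqrt (INR k))) m)).
  { intros m Hm. induction m as [|m IH]. unfold Rprod; simpl. rewrite Ropp_0, exp_0; auto.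
    rewrite seq_S, Rprod_app, IH by lia. rewrite Rprod_cons. simpl Nat.add.
    rewrite (proj2 (Hlow m ltac:(lia))). unfold Rprod at 1; simpl.
    rewrite Rmult_1_r, <- exp_plus. f_equal. ring. }
  set (m := (N - n - 1)%nat).
  assert (HmR : INR m = INR N - INR n - 1) by (unfold m; rewrite !minus_INR by lia; simpl; ring).
  set (j := J (- ln t)).
  assert (Hj : 0 <= j <= PI ^ 2 / 4).
  { assert (B := J_bounds (- ln t) ltac:(lra)). fold j in B.
    assert (E := exp_opp_le_1 (- ln t) ltac:(lra)). nra. }
  assert (Hhigh : Rprod (seq (n + 2) m) pf <= exp (- (8 / PI ^ 2 * j * INR m))).
  { replace (exp (- (8 / PI ^ 2 * j * INR m))) with (exp (- (8 / PI ^ 2 * j)) ^ length (seq (n + 2) m)).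
    - apply Rprod_le_pow. intros k Hk. apply in_seq in Hk. split. apply Rabs_pos.
      apply blaschke_factor_near_1. lra. apply (ganelius_high r N n); auto. unfold m in Hk; lia.
    - rewrite length_seq. apply exp_opp_pow. }
  assert (Hsplit : seq 1 N = seq 1 n ++ [S n] ++ seq (n + 2) m).
  { replace N with (n + (1 + m))%nat by (unfold m; lia). rewrite seq_app. f_equal.
    simpl. f_equal. f_equal. lia. }
  rewrite Hsplit, !Rprod_app, Hprod by lia. rewrite Rprod_cons, (proj2 Hmid).
  unfold Rprod at 1; simpl fold_right. rewrite Rmult_1_r.
  assert (S := HK1 n u Hn1 ltac:(unfold u; unfold U in Hu |- *; lra) (fun k h => proj1 (Hlow k h)) (proj1 Hmid)).
  fold U in S. replace (U - u) with (- ln t) in S by (unfold u; ring). fold j in S.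
  set (Sl := rsum (fun k => L (u - c * sqrt (INR k))) n) in *.
  set (Lm := L (u - c * sqrt (INR n - / 2))) in *.
  apply Rle_trans with (exp (r * ln t) * (exp (- Sl) * (exp (- Lm) * exp (- (8 / PI ^ 2 * j * INR m))))).
  { repeat (apply Rmult_le_compat_l; [left; apply exp_pos|]). exact Hhigh. }
  rewrite <- !exp_plus. apply exp_le_mono.
  (* Hence the main term [r u] cancels the weight [r ln t] and leaves [- r U]. *)
  assert (E1 : PI ^ 2 / c ^ 2 = r) by (transitivity (sqrt r * sqrt r); [unfold c; field; lra|lra]).
  assert (E2 : 2 / c ^ 2 * U = 2 / PI * (sqrt r * sqrt (INR n))) by (unfold U, c; field; lra).
  rewrite E1, E2 in S.
  assert (sqrt (INR n) <= sqrt (INR N)) by (apply sqrt_le_1_alt, le_INR; lia).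
  (* The points near [1] make up for the defect [j] of the trapezoidal sum at the right end. *)
  assert (E3 : (2 / PI * (sqrt r * sqrt (INR n)) - 8 / PI ^ 2 * INR m) * j <= 2).
  { apply Rle_trans with (8 / PI ^ 2 * j).
    - apply Rmult_le_compat_r. lra. rewrite HmR.
      assert (8 / PI ^ 2 * (PI / 4 * (sqrt (INR N) * sqrt r)) <= 8 / PI ^ 2 * (INR N - INR n)).
      { apply Rmult_le_compat_l. left; apply Rdiv_lt_0_compat; lra. lra. }
      replace (8 / PI ^ 2 * (PI / 4 * (sqrt (INR N) * sqrt r))) with (2 / PI * (sqrt r * sqrt (INR N))) in H0
        by (field; lra).
      assert (2 / PI * (sqrt r * sqrt (INR n)) <= 2 / PI * (sqrt r * sqrt (INR N))).
      { apply Rmult_le_compat_l. left; apply Rdiv_lt_0_compat; lra. apply Rmult_le_compat_l; lra. }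
      lra.
    - apply Rle_trans with (8 / PI ^ 2 * (PI ^ 2 / 4)).
      apply Rmult_le_compat_l. left; apply Rdiv_lt_0_compat; lra. lra. right; field; lra. }
  unfold K2. unfold u in S. lra.
Qed.


(** * Hyperbolic identities and the passage from [t] to the strip variable *)

Lemma Rabs_half (x : R) : Rabs (x / 2) = Rabs x / 2.
Proof. unfold Rdiv. rewrite Rabs_mult, (Rabs_pos_eq (/ 2)); lra. Qed.

Lemma tanh_exp (x : R) : tanh x = (exp (2 * x) - 1) / (exp (2 * x) + 1).
Proof.
  unfold tanh, sinh, cosh. replace (2 * x) with (x + x) by ring. rewrite exp_plus, exp_Ropp.
  assert (0 < exp x) by apply exp_pos. field. repeat split; try lra; nra.
Qed.

Lemma tanh_bounds (x : R) : -1 < tanh x < 1.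
Proof.
  rewrite tanh_exp. assert (0 < exp (2 * x)) by apply exp_pos.
  split; apply Rmult_lt_reg_r with (exp (2 * x) + 1); try lra; field_simplify; lra.
Qed.

Lemma arctanh_tanh (x : R) : arctanh (tanh x) = x.
Proof.
  unfold arctanh. rewrite tanh_exp. assert (0 < exp (2 * x)) by apply exp_pos.
  replace ((1 + (exp (2 * x) - 1) / (exp (2 * x) + 1)) / (1 - (exp (2 * x) - 1) / (exp (2 * x) + 1)))
    with (exp (2 * x)) by (field; lra).
  rewrite ln_exp. field.
Qed.

Lemma tanh_arctanh (x : R) : -1 < x < 1 -> tanh (arctanh x) = x.
Proof.
  intros H. rewrite tanh_exp. unfold arctanh.
  replace (2 * (/ 2 * ln ((1 + x) / (1 - x)))) with (ln ((1 + x) / (1 - x))) by field.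
  rewrite exp_ln by (apply Rdiv_lt_0_compat; lra). field. lra.
Qed.

Lemma tanh_opp (x : R) : tanh (- x) = - tanh x.
Proof.
  rewrite !tanh_exp. replace (2 * - x) with (- (2 * x)) by ring. rewrite exp_Ropp.
  assert (0 < exp (2 * x)) by apply exp_pos. field. repeat split; lra.
Qed.

Lemma arctanh_opp (x : R) : -1 < x < 1 -> arctanh (- x) = - arctanh x.
Proof.
  intros H. rewrite <- (tanh_arctanh x) at 1 by auto. rewrite <- tanh_opp. apply arctanh_tanh.
Qed.

Lemma tanh_inj (x y : R) : tanh x = tanh y -> x = y.
Proof. intros H. rewrite <- (arctanh_tanh x), H. apply arctanh_tanh. Qed.

Lemma Rabs_tanh_L (v : R) : v <> 0 -> Rabs (tanh v) = exp (- L (2 * v)).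
Proof.
  assert (Pos : forall v, 0 < v -> Rabs (tanh v) = exp (- L (2 * v))).
  { intros x Hx. rewrite L_pos_eq by lra. assert (E := exp_opp_lt_1 (2 * x) ltac:(lra)).
    rewrite <- ln_Rinv by (apply Rdiv_lt_0_compat; lra).
    rewrite exp_ln by (apply Rinv_0_lt_compat, Rdiv_lt_0_compat; lra).
    rewrite tanh_exp. assert (Ee : exp (2 * x) = / exp (- (2 * x))) by (rewrite exp_Ropp, Rinv_inv; auto).
    rewrite Ee. set (e := exp (- (2 * x))) in *.
    replace ((/ e - 1) / (/ e + 1)) with ((1 - e) / (1 + e)) by (field; lra).
    rewrite Rabs_pos_eq by (left; apply Rdiv_lt_0_compat; lra). field. lra. }
  intros Hv. destruct (Rlt_dec 0 v). apply Pos; auto.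
  rewrite <- (Ropp_involutive v) at 1. rewrite tanh_opp, Rabs_Ropp, Pos by lra.
  f_equal. f_equal. replace (2 * - v) with (- (2 * v)) by ring. apply L_opp.
Qed.

(* [node d r N k] is the parameter [s] with [tanh (s / 2) = beta_k]. *)
Definition node (d r : R) (N : nat) (k : Z) : R := 4 * d / PI * arctanh (b_k r N k).

Lemma beta_k_node (d r : R) (N : nat) (k : Z) : beta_k d r N k = tanh (node d r N k / 2).
Proof. unfold beta_k, node. f_equal. field. apply PI_neq0. Qed.

Lemma B_N_tanh (d r : R) (N : nat) (s : R) : 0 < d ->
  B_N d r N (tanh (s / 2)) =
  Rprod (nonzero_indices N) (fun k => tanh (PI / (4 * d) * (s - node d r N k))).
Proof.
  intros Hd. unfold B_N. apply Rprod_ext. intros k _. rewrite beta_k_node, !arctanh_tanh.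
  f_equal. field. lra.
Qed.

Lemma b_k_of_nat (r : R) (N k : nat) : (1 <= k)%nat ->
  b_k r N (Z.of_nat k) =
  sqrt ((1 - ganelius r N (Z.of_nat k)) / (1 + ganelius r N (Z.of_nat k))).
Proof.
  intros Hk. unfold b_k. rewrite Z.abs_eq, Z.sgn_pos by lia. ring.
Qed.

Lemma b_k_opp (r : R) (N : nat) (k : Z) : b_k r N (- k) = - b_k r N k.
Proof. unfold b_k. rewrite Z.abs_opp, Z.sgn_opp, opp_IZR. ring. Qed.

Lemma b_k_bounds (r : R) (N k : nat) : 0 < r -> (1 <= N_0 r N)%Z -> (1 <= k <= N)%nat ->
  0 < b_k r N (Z.of_nat k) < 1.
Proof.
  intros Hr HN Hk. rewrite b_k_of_nat by lia.
  assert (G := ganelius_bounds r N k Hr HN Hk). set (a := ganelius r N (Z.of_nat k)) in *.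
  split. apply sqrt_lt_R0, Rdiv_lt_0_compat; lra.
  apply Rlt_le_trans with (sqrt 1); [|rewrite sqrt_1; lra].
  apply sqrt_lt_1_alt. split. apply Rdiv_le_0_compat; lra.
  apply Rmult_lt_reg_r with (1 + a). lra. field_simplify; lra.
Qed.

(** The right side is [1 / cosh (2 arctanh b_k)], which inverts
    [b_k = sqrt ((1 - a_k) / (1 + a_k))]. *)
Lemma ganelius_of_arctanh (r : R) (N k : nat) : 0 < r -> (1 <= N_0 r N)%Z -> (1 <= k <= N)%nat ->
  let F := exp (2 * arctanh (b_k r N (Z.of_nat k))) in
  ganelius r N (Z.of_nat k) = 2 * F / (F ^ 2 + 1).
Proof.
  intros Hr HN Hk F. assert (B := b_k_bounds r N k Hr HN Hk).
  assert (E := b_k_of_nat r N k ltac:(lia)).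
  assert (G := ganelius_bounds r N k Hr HN Hk).
  unfold F, arctanh. set (b := b_k r N (Z.of_nat k)) in *. set (a := ganelius r N (Z.of_nat k)) in *.
  replace (2 * (/ 2 * ln ((1 + b) / (1 - b)))) with (ln ((1 + b) / (1 - b))) by field.
  rewrite exp_ln by (apply Rdiv_lt_0_compat; lra).
  assert (Hb2 : b * b = (1 - a) / (1 + a)).
  { rewrite E. apply sqrt_sqrt, Rdiv_le_0_compat; lra. }
  assert (Ha : a = (1 - b * b) / (1 + b * b)) by (rewrite Hb2; field; lra).
  rewrite Ha. field. repeat split; nra.
Qed.

(** Both sides are [(cosh (2 q) - cosh (2 tau)) / (cosh (2 q) + cosh (2 tau))]. Pairing opposite
    nodes in this way turns [2 N] factors into the [N] factors of [ganelius_product_bound]. *)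
Lemma tanh_pair (q tau : R) :
  let E := exp (2 * q) in let F := exp (2 * tau) in
  let t := 2 * E / (E ^ 2 + 1) in let a := 2 * F / (F ^ 2 + 1) in
  tanh (q + tau) * tanh (q - tau) = (a - t) / (a + t).
Proof.
  intros E F t a. unfold t, a. rewrite !tanh_exp.
  replace (2 * (q + tau)) with (2 * q + 2 * tau) by ring.
  replace (2 * (q - tau)) with (2 * q + - (2 * tau)) by ring.
  rewrite !exp_plus, exp_Ropp. fold E F.
  assert (0 < E) by apply exp_pos. assert (0 < F) by apply exp_pos.
  assert (0 < E * F) by nra.
  field. repeat split; nra.
Qed.

Lemma cosh_pos (x : R) : 0 < cosh x.
Proof. unfold cosh. generalize (exp_pos x) (exp_pos (- x)); lra. Qed.

Lemma cosh_ge_half_exp (x : R) : exp (Rabs x) / 2 <= cosh x.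
Proof.
  unfold cosh. generalize (exp_pos x) (exp_pos (- x)); intros.
  unfold Rabs. destruct Rcase_abs; lra.
Qed.

Lemma cosh_le_exp (x : R) : cosh x <= exp (Rabs x).
Proof.
  unfold cosh. unfold Rabs. destruct Rcase_abs.
  - assert (exp x <= exp (- x)) by (apply exp_le_mono; lra). lra.
  - assert (exp (- x) <= exp x) by (apply exp_le_mono; lra). lra.
Qed.

(** With [t = 1 / cosh (PI s / (2 d))], both [cosh (s / 2) ^ (- mu)] and [t ^ r] are of the order of
    [exp (- mu |s| / 2)]; this is what selects [r = d mu / PI]. The bounds
    [exp |x| / 2 <= cosh x <= exp |x|] account for the factor [2 ^ mu]. *)
Lemma weighted_B_N_bound (d mu : R) : 0 < d -> 0 < mu -> exists K, 0 < K /\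
  forall (N : nat) (s : R), (0 < N)%nat -> (1 <= N_0 (d * mu / PI) N)%Z ->
  Rpower (cosh (s / 2)) (- mu) * Rabs (B_N d (d * mu / PI) N (tanh (s / 2))) <=
  K * exp (- sqrt (PI * d * mu * INR N)).
Proof.
  intros Hd Hmu. assert (Hpi := PI_RGT_0). set (r := d * mu / PI).
  assert (Hr : 0 < r) by (apply Rdiv_lt_0_compat; nra).
  destruct (ganelius_product_bound r Hr) as [K [HK HB]].
  exists (exp (mu * ln 2) * K). split. apply Rmult_lt_0_compat; auto; apply exp_pos.
  intros N s HN HN0. rewrite B_N_tanh by auto.
  set (q := PI / (4 * d) * s). set (E := exp (2 * q)). set (t := 2 * E / (E ^ 2 + 1)).
  assert (HE : 0 < E) by apply exp_pos.
  assert (Ht : 0 < t <= 1).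
  { unfold t. split. apply Rdiv_lt_0_compat; nra.
    apply Rmult_le_reg_r with (E ^ 2 + 1). nra. field_simplify; [|nra].
    generalize (pow2_ge_0 (E - 1)); nra. }
  assert (Hprod : Rabs (Rprod (nonzero_indices N) (fun k => tanh (PI / (4 * d) * (s - node d r N k)))) =
    Rprod (seq 1 N) (fun k => Rabs ((ganelius r N (Z.of_nat k) - t) / (ganelius r N (Z.of_nat k) + t)))).
  { rewrite Rprod_nonzero_indices, Rprod_Rabs. apply Rprod_ext. intros k Hk. apply in_seq in Hk.
    f_equal. assert (Bk := b_k_bounds r N k Hr HN0 ltac:(lia)).
    rewrite (ganelius_of_arctanh r N k) by (auto; lia). unfold t, E. rewrite <- tanh_pair.
    unfold node. rewrite b_k_opp, arctanh_opp by lra. unfold q.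
    f_equal; f_equal; field; split; lra. }
  rewrite Hprod.
  assert (Hw : Rpower (cosh (s / 2)) (- mu) <= exp (mu * ln 2) * exp (r * ln t)).
  { unfold Rpower. rewrite <- exp_plus. apply exp_le_mono.
    assert (Hc : Rabs (s / 2) - ln 2 <= ln (cosh (s / 2))).
    { rewrite <- (ln_exp (Rabs (s / 2))), <- ln_div by (try apply exp_pos; lra).
      apply ln_le. apply Rdiv_lt_0_compat; [apply exp_pos|lra]. apply cosh_ge_half_exp. }
    assert (Hlt : - (2 * Rabs q) <= ln t).
    { rewrite <- (ln_exp (- (2 * Rabs q))). apply ln_le. apply exp_pos.
      assert (Et : t = / cosh (2 * q)).
      { unfold t, cosh. fold E. rewrite exp_Ropp. fold E. field. nra. }
      rewrite Et, exp_Ropp. apply Rinv_le_contravar. apply cosh_pos.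
      replace (2 * Rabs q) with (Rabs (2 * q)). apply cosh_le_exp.
      rewrite Rabs_mult, (Rabs_pos_eq 2) by lra. auto. }
    assert (Hq : r * (2 * Rabs q) = mu * Rabs (s / 2)).
    { unfold q, r. rewrite Rabs_mult, (Rabs_pos_eq (PI / (4 * d))) by (left; apply Rdiv_lt_0_compat; lra).
      rewrite Rabs_half. field. lra. }
    nra. }
  replace (sqrt (PI * d * mu * INR N)) with (PI * sqrt (r * INR N)).
  - specialize (HB N t HN HN0 Ht).
    set (P := Rprod (seq 1 N) _) in *.
    assert (0 <= P) by (apply Rprod_nonneg; intros; apply Rabs_pos).
    apply Rle_trans with (exp (mu * ln 2) * exp (r * ln t) * P).
    apply Rmult_le_compat_r; auto.
    rewrite !Rmult_assoc. apply Rmult_le_compat_l. left; apply exp_pos. exact HB.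
  - replace (PI * d * mu * INR N) with (PI ^ 2 * (r * INR N)) by (unfold r; field; lra).
    assert (HN' := pos_INR N). rewrite (sqrt_mult (PI ^ 2)), sqrt_pow2; auto; nra.
Qed.

(** * Lower bound for weighted products of [tanh] with arbitrary real nodes *)

Lemma is_derive_square_abs (x : R) : x <> 0 -> is_derive (fun x => x * Rabs x) x (2 * Rabs x).
Proof.
  intros Hx. auto_derive. auto. destruct (Rlt_dec 0 x).
  rewrite sign_eq_1, Rabs_pos_eq by lra. ring.
  rewrite sign_eq_m1, Rabs_left by lra. ring.
Qed.

(* An average of the potential: its integral over [[- R0, R0]] is computed with the antiderivative
   [A] of [L], each point [tau] contributing at most the total mass of [L]. *)
Lemma log_potential_lower (mu kap M R0 : R) (ts : list R) :
  0 < mu -> 0 < kap -> 0 < R0 ->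
  (forall s, s <> 0 -> ~ In s ts ->
     - (mu * Rabs s / 2) - fold_right Rplus 0 (map (fun tau => L (2 * kap * (s - tau))) ts) <= M) ->
  - (mu * R0 / 4) - INR (length ts) * (PI ^ 2 / (8 * kap * R0)) <= M.
Proof.
  intros Hmu Hk HR0 HM.
  (* An antiderivative of the expression in the hypothesis. It is continuous everywhere, although
     the expression has logarithmic singularities. *)
  set (Th := fun ts s => - (mu / 4) * (s * Rabs s) - fold_right Rplus 0 (map (fun tau => A (2 * kap * (s - tau)) / (2 * kap)) ts)).
  assert (HC : forall l s, continuity_pt (Th l) s).
  { intros l s. unfold Th.
    apply (continuity_pt_minus (fun s => - (mu / 4) * (s * Rabs s))
      (fun s => fold_right Rplus 0 (map (fun tau => A (2 * kap * (s - tau)) / (2 * kap)) l))).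
    - apply continuity_pt_scal. apply (continuity_pt_mult id Rabs).
      apply derivable_continuous_pt, derivable_pt_id. apply Rcontinuity_abs.
    - induction l as [|tau l IH]; simpl.
      + apply continuity_pt_const. intros a b; auto.
      + apply (continuity_pt_plus (fun s => A (2 * kap * (s - tau)) / (2 * kap))); auto.
        apply (continuity_pt_mult (fun s => A (2 * kap * (s - tau))) (fun _ => / (2 * kap))).
        * apply (continuity_pt_comp (fun s => 2 * kap * (s - tau)) A). 2: apply A_continuous.
          apply derivable_continuous_pt, ex_derive_Reals_0. auto_derive; auto.
        * apply continuity_pt_const. intros a b; auto. }
  assert (HD : forall l s, s <> 0 -> ~ In s l -> is_derive (Th l) s
    (- (mu * Rabs s / 2) - fold_right Rplus 0 (map (fun tau => L (2 * kap * (s - tau))) l))).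
  { intros l s Hs Hl. unfold Th.
    apply (is_derive_minus (fun s => - (mu / 4) * (s * Rabs s))
      (fun s => fold_right Rplus 0 (map (fun tau => A (2 * kap * (s - tau)) / (2 * kap)) l))).
    - apply is_derive_eq with (- (mu / 4) * (2 * Rabs s)); [|field].
      apply (is_derive_scal (fun s => s * Rabs s)). apply is_derive_square_abs; auto.
    - induction l as [|tau l IH]; simpl.
      + apply @is_derive_const.
      + apply (is_derive_plus (fun s => A (2 * kap * (s - tau)) / (2 * kap))).
        2: apply IH; intros h; apply Hl; right; auto.
        assert (s - tau <> 0) by (intros h; apply Hl; left; lra).
        assert (2 * kap * (s - tau) <> 0) by (apply Rmult_integral_contrapositive; split; lra).
        assert (DA := is_derive_A (2 * kap * (s - tau)) H0).
        apply is_derive_eq with (/ (2 * kap) * (2 * kap * L (2 * kap * (s - tau)))); [|field; lra].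
        apply is_derive_ext with (fun s => / (2 * kap) * A (2 * kap * (s - tau))).
        intros x. unfold Rdiv. apply Rmult_comm.
        apply (is_derive_scal (fun s => A (2 * kap * (s - tau)))).
        apply (is_derive_comp A (fun s => 2 * kap * (s - tau))). exact DA.
        auto_derive; auto. ring. }
  assert (U := mean_value_except (0 :: ts) (Th ts) (- R0) R0 M ltac:(lra) (fun x _ => HC ts x)).
  assert (U' : Th ts R0 - Th ts (- R0) <= M * (R0 - - R0)).
  { apply U. intros x _ Hn. eexists. split. apply HD. intros ->; apply Hn; left; auto.
    intros h; apply Hn; right; auto. apply HM. intros ->; apply Hn; left; auto.
    intros h; apply Hn; right; auto. }
  assert (V : - (mu / 2) * (R0 * R0) - INR (length ts) * (PI ^ 2 / (4 * kap)) <= Th ts R0 - Th ts (- R0)).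
  { clear U U' HM. unfold Th. rewrite (Rabs_pos_eq R0), (Rabs_left (- R0)) by lra.
    assert (W : fold_right Rplus 0 (map (fun tau => A (2 * kap * (R0 - tau)) / (2 * kap)) ts) -
       fold_right Rplus 0 (map (fun tau => A (2 * kap * (- R0 - tau)) / (2 * kap)) ts) <=
       INR (length ts) * (PI ^ 2 / (4 * kap))); [|lra].
    induction ts as [|tau l IH]. simpl; lra.
    cbn [length map fold_right]. rewrite S_INR.
    assert (B1 := A_bounds (2 * kap * (R0 - tau))). assert (B2 := A_bounds (2 * kap * (- R0 - tau))).
    assert (B3 := Rle_abs (A (2 * kap * (R0 - tau)))).
    assert (B4 := Rle_abs (- A (2 * kap * (- R0 - tau)))). rewrite Rabs_Ropp in B4.
    assert (A (2 * kap * (R0 - tau)) / (2 * kap) - A (2 * kap * (- R0 - tau)) / (2 * kap) <= PI ^ 2 / (4 * kap)).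
    { apply Rmult_le_reg_r with (4 * kap). lra. field_simplify; [|lra|lra]. lra. }
    lra. }
  apply Rmult_le_reg_r with (R0 - - R0). lra.
  apply Rle_trans with (2 := Rle_trans _ _ _ V U'). right. field. lra.
Qed.

(** At [R0 = 2 Q / mu] the two costs in [log_potential_lower] are [Q / 2] each. The factor [1/2]
    leaves a gap of [ln 2], which makes the contradiction strict. *)
Lemma weighted_tanh_product_lower (d mu : R) (n : nat) (ts : list R) :
  0 < d -> 0 < mu -> (0 < n)%nat -> length ts = (2 * n)%nat ->
  exists s : R, / 2 * exp (- sqrt (PI * d * mu * INR n)) <=
    Rpower (cosh (s / 2)) (- mu) * Rprod ts (fun tau => Rabs (tanh (PI / (4 * d) * (s - tau)))).
Proof.
  intros Hd Hmu Hn Hl. assert (Hpi := PI_RGT_0).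
  assert (Hn1 : 0 < INR n) by (apply lt_0_INR; auto).
  set (kap := PI / (4 * d)). assert (Hk : 0 < kap) by (apply Rdiv_lt_0_compat; lra).
  set (Q := sqrt (PI * d * mu * INR n)).
  assert (HP : 0 < PI * d * mu * INR n).
  { apply Rmult_lt_0_compat; auto. apply Rmult_lt_0_compat; nra. }
  assert (HQ : 0 < Q) by (apply sqrt_lt_R0; auto).
  assert (HQ2 : Q * Q = PI * d * mu * INR n) by (apply sqrt_sqrt; lra).
  apply NNPP. intros Hno.
  assert (H := log_potential_lower mu kap (- Q - ln 2) (2 * Q / mu) ts Hmu Hk ltac:(apply Rdiv_lt_0_compat; lra)).
  assert (Hln2 : 0 < ln 2) by (rewrite <- ln_1; apply ln_increasing; lra).
  apply (Rlt_irrefl (- Q - ln 2)).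
  apply Rlt_le_trans with (- Q); [lra|].
  apply Rle_trans with (- (mu * (2 * Q / mu) / 4) - INR (length ts) * (PI ^ 2 / (8 * kap * (2 * Q / mu)))).
  - rewrite Hl, mult_INR. simpl (INR 2). right.
    replace (INR n) with (Q * Q / (PI * d * mu)) by (rewrite HQ2; field; lra).
    unfold kap. field. lra.
  - apply H. intros s Hs Hts. apply Rnot_lt_le. intros Hlt. apply Hno. exists s.
    replace (Rprod ts (fun tau => Rabs (tanh (kap * (s - tau))))) with
      (exp (- fold_right Rplus 0 (map (fun tau => L (2 * kap * (s - tau))) ts))).
    + unfold Rpower. rewrite <- exp_plus.
      apply Rle_trans with (exp (- Q - ln 2)).
      * unfold Rminus. rewrite exp_plus, (exp_Ropp (ln 2)), exp_ln by lra. lra.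
      * apply exp_le_mono.
        assert (ln (cosh (s / 2)) <= Rabs s / 2).
        { rewrite <- (ln_exp (Rabs s / 2)). apply ln_le. apply cosh_pos.
          replace (Rabs s / 2) with (Rabs (s / 2)). apply cosh_le_exp.
          apply Rabs_half. }
        nra.
    + clear - Hts Hk. induction ts as [|tau l IH].
      * unfold Rprod; simpl. rewrite Ropp_0; apply exp_0.
      * rewrite Rprod_cons. cbn [map fold_right]. rewrite Ropp_plus_distr, exp_plus, IH.
        2: intros h; apply Hts; right; auto.
        rewrite Rabs_tanh_L. f_equal. f_equal. f_equal. f_equal. ring.
        apply Rmult_integral_contrapositive. split. lra. intros h; apply Hts; left; lra.
Qed.


(** * Complex differentiation *)

Definition cc (f : C -> C) (z : C) : Prop :=
  forall eps, 0 < eps -> exists delta, 0 < delta /\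
    forall w, Cmod (w - z) < delta -> Cmod (f w - f z) < eps.

(* Caratheodory's form of the complex derivative. *)
Definition cd (f : C -> C) (z l : C) : Prop :=
  exists phi, (forall w, f w = f z + phi w * (w - z))%C /\ phi z = l /\ cc phi z.

Lemma cd_eq (f : C -> C) (z l l' : C) : cd f z l -> l = l' -> cd f z l'.
Proof. intros H <-; exact H. Qed.

Lemma Cmod_minus_sym (x y : C) : Cmod (x - y) = Cmod (y - x).
Proof. rewrite <- Cmod_opp. f_equal. ring. Qed.

(** The function [phi] is the difference quotient, completed at [z] by the derivative. *)
Lemma cd_is_derive (f : C -> C) (z l : C) :
  cd f z l <-> @is_derive C_AbsRing C_NormedModule f z l.
Proof.
  split.
  - intros [phi [H1 [H2 H3]]]. split. apply is_linear_scal_l.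
    intros x Hx. apply (@is_filter_lim_locally_unique C_AbsRing (AbsRing_NormedModule C_AbsRing)) in Hx. subst x.
    intros eps. destruct (H3 eps (cond_pos eps)) as [d [Hd H]].
    exists (mkposreal d Hd). intros w Hw.
    change (Cmod (w - z) < d) in Hw.
    change (Cmod (f w - f z - (w - z) * l) <= eps * Cmod (w - z)).
    rewrite (H1 w), <- H2. replace (f z + phi w * (w - z) - f z - (w - z) * phi z)%C
      with ((phi w - phi z) * (w - z))%C by ring.
    rewrite Cmod_mult. apply Rmult_le_compat_r. apply Cmod_ge_0. left; apply H; auto.
  - intros [_ H]. specialize (H z (fun P HP => HP)).
    exists (fun w => if Ceq_dec w z then l else ((f w - f z) / (w - z))%C).
    split; [|split].
    + intros w. destruct (Ceq_dec w z) as [->|Hw]. ring. field.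
      apply Cminus_eq_contra; auto.
    + destruct (Ceq_dec z z); tauto.
    + intros eps He. destruct (H (mkposreal (eps / 2) ltac:(lra))) as [d Hd].
      exists d. split. apply cond_pos. intros w Hw.
      destruct (Ceq_dec z z); [|tauto]. destruct (Ceq_dec w z) as [->|Hwz].
      * replace (l - l)%C with (RtoC 0) by ring. rewrite Cmod_0; auto.
      * specialize (Hd w Hw). simpl in Hd.
        change (Cmod (f w - f z - (w - z) * l) <= eps / 2 * Cmod (w - z)) in Hd.
        assert (Hnz := Cminus_eq_contra _ _ Hwz).
        replace ((f w - f z) / (w - z) - l)%C with ((f w - f z - (w - z) * l) / (w - z))%C
          by (field; auto).
        rewrite Cmod_div by auto. assert (0 < Cmod (w - z)) by (apply Cmod_gt_0; auto).
        apply Rle_lt_trans with (eps / 2); [|lra].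
        apply Rmult_le_reg_r with (Cmod (w - z)); auto. unfold Rdiv.
        rewrite Rmult_assoc, Rinv_l by lra. lra.
Qed.

Lemma ex_derive_cd (f : C -> C) (z : C) :
  @ex_derive C_AbsRing C_NormedModule f z <-> exists l, cd f z l.
Proof.
  split; intros [l H]; exists l; apply cd_is_derive; exact H.
Qed.

Lemma C_derive_cd (f : C -> C) (z l : C) : cd f z l -> C_derive f z = l.
Proof. intros H. apply is_C_derive_unique, cd_is_derive, H. Qed.

Lemma cc_const (a z : C) : cc (fun _ => a) z.
Proof.
  intros eps He. exists 1. split; [lra|]. intros w _.
  replace (a - a)%C with (RtoC 0) by ring. rewrite Cmod_0; auto.
Qed.

Lemma cc_id (z : C) : cc (fun w => w) z.
Proof. intros eps He. exists eps. auto. Qed.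

Lemma cc_plus (f g : C -> C) (z : C) : cc f z -> cc g z -> cc (fun w => f w + g w)%C z.
Proof.
  intros Hf Hg eps He. destruct (Hf (eps / 2)) as [d1 [D1 H1]]; [lra|].
  destruct (Hg (eps / 2)) as [d2 [D2 H2]]; [lra|].
  exists (Rmin d1 d2). split. apply Rmin_pos; auto. intros w Hw.
  assert (Rmin d1 d2 <= d1) by apply Rmin_l. assert (Rmin d1 d2 <= d2) by apply Rmin_r.
  replace (f w + g w - (f z + g z))%C with ((f w - f z) + (g w - g z))%C by ring.
  apply Rle_lt_trans with (1 := Cmod_triangle _ _).
  assert (h1 := H1 w ltac:(lra)). assert (h2 := H2 w ltac:(lra)). lra.
Qed.

Lemma cc_mult (f g : C -> C) (z : C) : cc f z -> cc g z -> cc (fun w => f w * g w)%C z.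
Proof.
  intros Hf Hg eps He.
  set (a := Cmod (f z)). set (b := Cmod (g z)).
  assert (Ha : 0 <= a) by apply Cmod_ge_0. assert (Hb : 0 <= b) by apply Cmod_ge_0.
  set (e := Rmin 1 (eps / (a + b + 1))).
  assert (He1 : 0 < e). { apply Rmin_pos. lra. apply Rdiv_lt_0_compat; lra. }
  assert (He2 : e <= 1) by apply Rmin_l.
  assert (He3 : e * (a + b + 1) <= eps).
  { apply Rle_trans with (eps / (a + b + 1) * (a + b + 1)).
    apply Rmult_le_compat_r. lra. apply Rmin_r. right; field; lra. }
  destruct (Hf e He1) as [d1 [D1 H1]]. destruct (Hg e He1) as [d2 [D2 H2]].
  exists (Rmin d1 d2). split. apply Rmin_pos; auto. intros w Hw.
  assert (Rmin d1 d2 <= d1) by apply Rmin_l. assert (Rmin d1 d2 <= d2) by apply Rmin_r.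
  replace (f w * g w - f z * g z)%C with
    ((f w - f z) * (g w - g z) + (f z * (g w - g z) + (f w - f z) * g z))%C by ring.
  apply Rle_lt_trans with (1 := Cmod_triangle _ _).
  assert (T := Cmod_triangle (f z * (g w - g z)) ((f w - f z) * g z)).
  rewrite !Cmod_mult in *. fold a b in T |- *.
  assert (h1 := H1 w ltac:(lra)). assert (h2 := H2 w ltac:(lra)).
  generalize (Cmod_ge_0 (f w - f z)) (Cmod_ge_0 (g w - g z)); intros.
  assert (Cmod (f w - f z) * Cmod (g w - g z) <= Cmod (f w - f z) * 1) by (apply Rmult_le_compat_l; lra).
  assert (a * Cmod (g w - g z) <= a * e) by (apply Rmult_le_compat_l; lra).
  assert (Cmod (f w - f z) * b <= e * b) by (apply Rmult_le_compat_r; lra).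
  lra.
Qed.

Lemma cc_ext_loc (f g : C -> C) (z : C) :
  (exists delta, 0 < delta /\ forall w, Cmod (w - z) < delta -> f w = g w) ->
  cc f z -> cc g z.
Proof.
  intros [d0 [D0 E]] H eps He. destruct (H eps He) as [d [D Hd]].
  exists (Rmin d d0). split. apply Rmin_pos; auto. intros w Hw.
  assert (Rmin d d0 <= d) by apply Rmin_l. assert (Rmin d d0 <= d0) by apply Rmin_r.
  rewrite <- (E w), <- (E z). apply Hd; lra.
  replace (z - z)%C with (RtoC 0) by ring. rewrite Cmod_0; auto. lra.
Qed.

Lemma cc_inv_id (z : C) : z <> 0 -> cc Cinv z.
Proof.
  intros Hz eps He. assert (Hm : 0 < Cmod z) by (apply Cmod_gt_0; auto).
  set (m := Cmod z) in *.
  exists (Rmin (m / 2) (eps * (m * m / 2))). split.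
  { apply Rmin_pos. lra. apply Rmult_lt_0_compat. auto. nra. }
  intros w Hw. assert (H1 := Rlt_le_trans _ _ _ Hw (Rmin_l _ _)).
  assert (H2 := Rlt_le_trans _ _ _ Hw (Rmin_r _ _)).
  assert (Hw2 : m / 2 < Cmod w).
  { assert (T := Cmod_triangle w (z - w)). replace (w + (z - w))%C with z in T by ring.
    rewrite (Cmod_minus_sym z w) in T. unfold m in *. lra. }
  assert (Hwz : w <> 0) by (apply Cmod_gt_0; lra).
  replace (/ w - / z)%C with (- (w - z) / (w * z))%C by (field; auto).
  rewrite Cmod_div by (apply Cmult_neq_0; auto). rewrite Cmod_opp, Cmod_mult. fold m.
  apply Rmult_lt_reg_r with (Cmod w * m). nra. unfold Rdiv.
  rewrite Rmult_assoc, Rinv_l by nra. rewrite Rmult_1_r.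
  apply Rlt_trans with (1 := H2). apply Rmult_lt_compat_l; nra.
Qed.

Lemma cc_comp (f g : C -> C) (z : C) : cc f z -> cc g (f z) -> cc (fun w => g (f w)) z.
Proof.
  intros Hf Hg eps He. destruct (Hg eps He) as [d1 [D1 H1]].
  destruct (Hf d1 D1) as [d2 [D2 H2]]. exists d2. split; auto.
Qed.

Lemma cc_inv (f : C -> C) (z : C) : cc f z -> f z <> 0 -> cc (fun w => / f w)%C z.
Proof. intros Hf Hz. apply (cc_comp f Cinv); auto. apply cc_inv_id; auto. Qed.

Lemma cc_opp (f : C -> C) (z : C) : cc f z -> cc (fun w => - f w)%C z.
Proof.
  intros Hf eps He. destruct (Hf eps He) as [d [D H]]. exists d. split; auto.
  intros w Hw. replace (- f w - - f z)%C with (- (f w - f z))%C by ring. rewrite Cmod_opp; auto.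
Qed.

Lemma cc_minus (f g : C -> C) (z : C) : cc f z -> cc g z -> cc (fun w => f w - g w)%C z.
Proof. intros Hf Hg. apply (cc_plus f (fun w => - g w)%C); auto. apply cc_opp; auto. Qed.

Lemma cc_div (f g : C -> C) (z : C) : cc f z -> cc g z -> g z <> 0 -> cc (fun w => f w / g w)%C z.
Proof. intros Hf Hg Hz. apply (cc_mult f (fun w => / g w)%C); auto. apply cc_inv; auto. Qed.

Lemma cd_cc (f : C -> C) (z l : C) : cd f z l -> cc f z.
Proof.
  intros [phi [H1 [H2 H3]]].
  apply cc_ext_loc with (fun w => f z + phi w * (w - z))%C.
  - exists 1. split. lra. intros w _. symmetry; auto.
  - apply cc_plus. apply cc_const. apply cc_mult; auto. apply cc_minus. apply cc_id. apply cc_const.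
Qed.

Lemma cd_const (a z : C) : cd (fun _ => a) z 0.
Proof. exists (fun _ => RtoC 0). split; [|split]. intros; ring. auto. apply cc_const. Qed.

Lemma cd_id (z : C) : cd (fun w => w) z 1.
Proof. exists (fun _ => RtoC 1). split; [|split]. intros; ring. auto. apply cc_const. Qed.

Lemma cd_plus (f g : C -> C) (z a b : C) : cd f z a -> cd g z b ->
  cd (fun w => f w + g w)%C z (a + b)%C.
Proof.
  intros [p [H1 [H2 H3]]] [q [K1 [K2 K3]]]. exists (fun w => p w + q w)%C. split; [|split].
  - intros w. rewrite (H1 w), (K1 w). ring.
  - rewrite H2, K2; auto.
  - apply cc_plus; auto.
Qed.

Lemma cd_mult (f g : C -> C) (z a b : C) : cd f z a -> cd g z b ->
  cd (fun w => f w * g w)%C z (a * g z + f z * b)%C.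
Proof.
  intros Hf Hg. assert (Cg := cd_cc _ _ _ Hg).
  destruct Hf as [p [H1 [H2 H3]]], Hg as [q [K1 [K2 K3]]].
  exists (fun w => p w * g w + f z * q w)%C. split; [|split].
  - intros w. rewrite (H1 w), (K1 w). ring.
  - rewrite H2, K2; auto.
  - apply cc_plus; apply cc_mult; auto. apply cc_const.
Qed.

Lemma cd_opp (f : C -> C) (z a : C) : cd f z a -> cd (fun w => - f w)%C z (- a)%C.
Proof.
  intros [p [H1 [H2 H3]]]. exists (fun w => - p w)%C. split; [|split].
  - intros w. rewrite (H1 w). ring.
  - rewrite H2; auto.
  - apply cc_opp; auto.
Qed.

Lemma cd_minus (f g : C -> C) (z a b : C) : cd f z a -> cd g z b ->
  cd (fun w => f w - g w)%C z (a - b)%C.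
Proof. intros Hf Hg. apply (cd_plus f (fun w => - g w)%C); auto. apply cd_opp; auto. Qed.

Lemma cd_comp (f g : C -> C) (z a b : C) : cd f z a -> cd g (f z) b ->
  cd (fun w => g (f w)) z (b * a)%C.
Proof.
  intros Hf [q [K1 [K2 K3]]]. assert (Cf := cd_cc _ _ _ Hf). destruct Hf as [p [H1 [H2 H3]]].
  exists (fun w => q (f w) * p w)%C. split; [|split].
  - intros w. rewrite (K1 (f w)). rewrite (H1 w) at 2. ring.
  - rewrite H2, K2; auto.
  - apply cc_mult; auto. apply (cc_comp f q); auto.
Qed.

Lemma cd_ext_loc (f g : C -> C) (z l : C) :
  (exists delta, 0 < delta /\ forall w, Cmod (w - z) < delta -> f w = g w) ->
  cd f z l -> cd g z l.
Proof.
  intros [d [D E]] H. apply cd_is_derive. apply cd_is_derive in H.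
  apply (is_derive_ext_loc (V := C_NormedModule) f); auto.
  exists (mkposreal d D). intros w Hw. apply E. exact Hw.
Qed.

Lemma cd_ext (f g : C -> C) (z l : C) : (forall w, f w = g w) -> cd f z l -> cd g z l.
Proof. intros H. apply cd_ext_loc. exists 1. split; [lra|auto]. Qed.

(** In Caratheodory's form the factorization must hold at every [w], including 0 where the inverse
    is a default value. The function is therefore first redefined at 0, which does not affect its
    germ at [z]. *)
Lemma cd_inv_id (z : C) : z <> 0 -> cd Cinv z (- / (z * z))%C.
Proof.
  intros Hz. assert (Hm : 0 < Cmod z) by (apply Cmod_gt_0; auto).
  assert (H : cd (fun w => if Ceq_dec w 0 then (/ z + (w - z) * - / (z * z))%C else (/ w)%C) z (- / (z * z))%C).
  { exists (fun w => if Ceq_dec w 0 then (- / (z * z))%C else (- / (w * z))%C). split; [|split].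
    - intros w. destruct (Ceq_dec z 0); [contradiction|]. destruct (Ceq_dec w 0). ring. field; auto.
    - destruct (Ceq_dec z 0); [contradiction|auto].
    - apply cc_ext_loc with (fun w => - / (w * z))%C.
      + exists (Cmod z). split; auto. intros w Hw. destruct (Ceq_dec w 0) as [->|]; auto.
        exfalso. replace (0 - z)%C with (- z)%C in Hw by ring. rewrite Cmod_opp in Hw. lra.
      + apply cc_opp, cc_inv. apply cc_mult. apply cc_id. apply cc_const. apply Cmult_neq_0; auto. }
  revert H. apply cd_ext_loc. exists (Cmod z). split; auto. intros w Hw.
  destruct (Ceq_dec w 0) as [->|]; auto.
  exfalso. replace (0 - z)%C with (- z)%C in Hw by ring. rewrite Cmod_opp in Hw. lra.
Qed.

Lemma cd_inv (f : C -> C) (z a : C) : cd f z a -> f z <> 0 ->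
  cd (fun w => / f w)%C z (- a / (f z * f z))%C.
Proof.
  intros Hf Hz. apply cd_eq with (- / (f z * f z) * a)%C.
  apply (cd_comp f Cinv); auto. apply cd_inv_id; auto. field; auto.
Qed.

(* The derivative of a local inverse needs only its continuity. *)
Lemma cd_local_inverse (f g : C -> C) (z l : C) :
  cc g z -> cd f (g z) l -> l <> 0 ->
  (exists delta, 0 < delta /\ forall w, Cmod (w - z) < delta -> f (g w) = w) ->
  cd g z (/ l)%C.
Proof.
  intros Hg [p [H1 [H2 H3]]] Hl [d [D E]].
  assert (Cq : cc (fun w => p (g w)) z) by (apply (cc_comp g p); auto).
  assert (Ez : f (g z) = z).
  { apply E. replace (z - z)%C with (RtoC 0) by ring. rewrite Cmod_0; auto. }
  assert (Hpl : p (g z) <> 0) by (rewrite H2; auto).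
  assert (K : cc (fun w => / p (g w))%C z) by (apply cc_inv; auto).
  destruct (Cq (Cmod l)) as [d2 [D2 E2]]. { apply Cmod_gt_0; auto. }
  apply cd_ext_loc with (fun w => g z + / p (g w) * (w - z))%C.
  - exists (Rmin d d2). split. apply Rmin_pos; auto. intros w Hw.
    assert (h1 := Rlt_le_trans _ _ _ Hw (Rmin_l _ _)). assert (h2 := Rlt_le_trans _ _ _ Hw (Rmin_r _ _)).
    assert (Hp : p (g w) <> 0).
    { intros h. specialize (E2 w h2). rewrite h, H2 in E2.
      replace (0 - l)%C with (- l)%C in E2 by ring. rewrite Cmod_opp in E2. lra. }
    assert (F := H1 (g w)). rewrite Ez, (E w h1) in F.
    assert (F2 : (w - z)%C = (p (g w) * (g w - g z))%C).
    { transitivity ((z + p (g w) * (g w - g z)) - z)%C. rewrite <- F; auto. ring. }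
    rewrite F2. field; auto.
  - exists (fun w => / p (g w))%C. split; [|split]; auto.
    + intros w. ring.
    + rewrite H2; auto.
Qed.

(** * Exponential and logarithm *)

Lemma Cexp_plus (z w : C) : Cexp (z + w) = (Cexp z * Cexp w)%C.
Proof.
  unfold Cexp. rewrite re_plus, im_plus, exp_plus, cos_plus, sin_plus.
  unfold Cmult; simpl. f_equal; ring.
Qed.

Lemma Cexp_0 : Cexp 0 = 1.
Proof. unfold Cexp. simpl. rewrite exp_0, cos_0, sin_0. apply injective_projections; simpl; ring. Qed.

Lemma Cmod_Cexp (z : C) : Cmod (Cexp z) = exp (Re z).
Proof.
  unfold Cmod, Cexp; simpl.
  replace (_ + _) with (exp (Re z) * exp (Re z)).
  apply sqrt_square. left; apply exp_pos.
  generalize (sin2_cos2 (Im z)). unfold Rsqr. intros.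
  replace (exp (Re z) * exp (Re z)) with (exp (Re z) * exp (Re z) * (sin (Im z) * sin (Im z) + cos (Im z) * cos (Im z))).
  ring. rewrite H; ring.
Qed.

Lemma Cexp_neq_0 (z : C) : Cexp z <> 0.
Proof. apply Cmod_gt_0. rewrite Cmod_Cexp. apply exp_pos. Qed.

Lemma Cexp_opp (z : C) : Cexp (- z) = (/ Cexp z)%C.
Proof.
  assert (E : (Cexp (- z) * Cexp z)%C = 1).
  { rewrite <- Cexp_plus. replace (- z + z)%C with (RtoC 0) by ring. apply Cexp_0. }
  assert (H := Cexp_neq_0 z).
  transitivity (Cexp (- z) * Cexp z * / Cexp z)%C. field; auto. rewrite E. ring.
Qed.

Lemma Cexp_R (x : R) : Cexp (RtoC x) = RtoC (exp x).
Proof. unfold Cexp, RtoC; simpl. rewrite cos_0, sin_0. f_equal; ring. Qed.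

(** Second-order bounds for [exp x], [cos y] and [sin y] separately, all in terms of [m = |w|], make
    each component of [Cexp w - 1 - w] at most [6 m ^ 2]. *)
Lemma cd_Cexp_0 : cd Cexp 0 1.
Proof.
  apply cd_is_derive. split. apply is_linear_scal_l.
  intros x Hx. apply (@is_filter_lim_locally_unique C_AbsRing (AbsRing_NormedModule C_AbsRing)) in Hx. subst x.
  intros eps. assert (He := cond_pos eps).
  (* [1 / 2] keeps [exp x <= 2] and [cos y >= 0]; [eps / 16] absorbs the final [12 m ^ 2]. *)
  assert (Hd : 0 < Rmin (1 / 2) (eps / 16)) by (apply Rmin_pos; lra).
  exists (mkposreal _ Hd). intros w Hw.
  change (Cmod (w - 0) < Rmin (1 / 2) (eps / 16)) in Hw.
  change (Cmod (Cexp w - Cexp 0 - (w - 0) * 1) <= eps * Cmod (w - 0)).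
  rewrite Cexp_0. change C in w. assert (E0 : (w - 0)%C = w) by ring. rewrite E0 in *.
  replace (Cexp w - 1 - w * 1)%C with (Cexp w - 1 - w)%C by ring.
  assert (h1 := Rlt_le_trans _ _ _ Hw (Rmin_l _ _)). assert (h2 := Rlt_le_trans _ _ _ Hw (Rmin_r _ _)).
  destruct w as [x y]. assert (M := Rmax_Cmod (x, y)). simpl in M.
  assert (Mx := Rle_trans _ _ _ (Rmax_l _ _) M). assert (My := Rle_trans _ _ _ (Rmax_r _ _) M).
  set (m := Cmod (x, y)) in *.
  assert (Hm : 0 <= m) by apply Cmod_ge_0.
  apply Rabs_le_between in Mx. apply Rabs_le_between in My.
  assert (Ex : 0 <= exp x - 1 - x <= 2 * m ^ 2).
  { split. generalize (exp_ineq1_le x); lra.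
    assert (I := exp_ineq1_le (- x)). rewrite exp_Ropp in I. assert (P := exp_pos x).
    assert (exp x * (1 - x) <= 1).
    { apply Rmult_le_compat_l with (r := exp x) in I; [|lra]. rewrite Rinv_r in I by lra. lra. }
    assert (x ^ 2 <= m ^ 2) by nra.
    assert ((exp x - 1 - x) * (1 - x) <= x ^ 2) by nra. nra. }
  assert (Sy : Rabs (sin y) <= m).
  { assert (S : forall t, 0 <= t -> Rabs (sin t) <= t).
    { intros t Ht. apply Rabs_le. split.
      - assert (K := mean_value_le (fun t => - sin t) (fun t => - cos t) 0 t 1 Ht).
        simpl in K. rewrite sin_0 in K.
        assert (- sin t - - 0 <= 1 * (t - 0)). { apply K. intros; auto_derive; auto; ring. intros; generalize (COS_bound x0); lra. } lra.
      - assert (K := mean_value_le sin cos 0 t 1 Ht).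
        rewrite sin_0 in K.
        assert (sin t - 0 <= 1 * (t - 0)). { apply K. intros; auto_derive; auto; ring. intros; generalize (COS_bound x0); lra. } lra. }
    destruct (Rle_dec 0 y). apply Rle_trans with y. apply S; auto. lra.
    rewrite <- (Ropp_involutive y), sin_neg, Rabs_Ropp. apply Rle_trans with (- y). apply S; lra. lra. }
  apply Rabs_le_between in Sy.
  assert (Cy : 0 <= 1 - cos y <= m ^ 2).
  { split. generalize (COS_bound y); lra.
    assert (T : 1 - cos y <= sin y ^ 2).
    { assert (E := sin2_cos2 y). unfold Rsqr in E.
      assert (0 <= cos y). { apply cos_ge_0; generalize PI2_3_2; lra. }
      generalize (COS_bound y); intros. nra. }
    nra. }
  assert (Sy2 : Rabs (sin y - y) <= m ^ 2).
  { assert (G : forall t, 0 <= t <= m -> Rabs (sin t - t) <= m ^ 2).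
    { intros t Ht. assert (Cb : forall v, 0 <= v <= m -> 1 - cos v <= m ^ 2).
      { intros v Hv. assert (T : 1 - cos v <= sin v ^ 2).
        { assert (E := sin2_cos2 v). unfold Rsqr in E.
          assert (0 <= cos v). { apply cos_ge_0; generalize PI2_3_2; lra. }
          generalize (COS_bound v); intros. nra. }
        assert (0 <= sin v). { apply sin_ge_0; generalize PI2_3_2; lra. }
        destruct (Req_dec v 0) as [->|]. rewrite cos_0. nra.
        assert (sin v < v) by (apply sin_lt_x; lra). nra. }
      apply Rabs_le. split.
      - assert (K := mean_value_le (fun t => t - sin t) (fun t => 1 - cos t) 0 t (m ^ 2) ltac:(lra)).
        simpl in K. rewrite sin_0 in K.
        assert (t - sin t - (0 - 0) <= m ^ 2 * (t - 0)).
        { apply K. intros; auto_derive; auto; ring. intros; apply Cb; lra. } nra.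
      - destruct (Req_dec t 0) as [->|]. rewrite sin_0. nra.
        assert (sin t < t) by (apply sin_lt_x; lra). nra. }
    destruct (Rle_dec 0 y). apply G; lra.
    replace (sin y - y) with (- (sin (- y) - - y)) by (rewrite sin_neg; ring).
    rewrite Rabs_Ropp. apply G; lra. }
  apply Rabs_le_between in Sy2.
  apply Rle_trans with (1 := Cmod_2Rmax _).
  assert (Hs2 : sqrt 2 <= 2).
  { apply Rle_trans with (sqrt (2 * 2)). apply sqrt_le_1_alt; lra. rewrite sqrt_square; lra. }
  assert (Hmax : Rmax (Rabs (fst (Cexp (x, y) - 1 - (x, y))%C)) (Rabs (snd (Cexp (x, y) - 1 - (x, y))%C)) <= 6 * m ^ 2).
  { unfold Cexp; simpl. apply Rmax_lub; apply Rabs_le.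
    - replace (exp x * cos y + - (1) + - x) with ((exp x - 1 - x) - exp x * (1 - cos y)) by ring.
      assert (exp x <= 2) by nra. assert (P := exp_pos x). nra.
    - replace (exp x * sin y + - 0 + - y) with ((exp x - 1) * sin y + (sin y - y)) by ring.
      assert (Rabs (exp x - 1) <= 2 * m) by (apply Rabs_le; nra).
      apply Rabs_le_between in H. nra. }
  assert (0 <= Rmax (Rabs (fst (Cexp (x, y) - 1 - (x, y))%C)) (Rabs (snd (Cexp (x, y) - 1 - (x, y))%C))).
  { apply Rle_trans with (2 := Rmax_l _ _). apply Rabs_pos. }
  assert (sqrt 2 * Rmax (Rabs (fst (Cexp (x, y) - 1 - (x, y))%C)) (Rabs (snd (Cexp (x, y) - 1 - (x, y))%C)) <= 2 * (6 * m ^ 2)).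
  { apply Rmult_le_compat; auto. apply sqrt_pos. }
  nra.
Qed.

Lemma cd_Cexp (z : C) : cd Cexp z (Cexp z).
Proof.
  apply cd_ext with (fun w => Cexp z * Cexp (w - z))%C.
  - intros w. rewrite <- Cexp_plus. f_equal. ring.
  - apply cd_eq with (0 * Cexp (z - z) + Cexp z * (1 * (1 - 0)))%C; [|ring].
    apply (cd_mult (fun _ => Cexp z) (fun w => Cexp (w - z))). apply cd_const.
    apply (cd_comp (fun w => w - z)%C Cexp). apply cd_minus. apply cd_id. apply cd_const.
    replace (z - z)%C with (RtoC 0) by ring. apply cd_Cexp_0.
Qed.

(** The plane cut along the closed negative real axis, 0 included in the cut, written as the
    positivity of the denominator in the half-angle formula for the argument. *)
Definition slit (z : C) : Prop := 0 < Cmod z + Re z.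

Lemma slit_Re_pos (z : C) : 0 < Re z -> slit z.
Proof. intros H. unfold slit. generalize (Cmod_ge_0 z); lra. Qed.

Lemma slit_neq_0 (z : C) : slit z -> z <> 0.
Proof. unfold slit. intros H ->. rewrite Cmod_0 in H. simpl in H. lra. Qed.

Lemma Cmod_sqr (z : C) : Cmod z * Cmod z = Re z * Re z + Im z * Im z.
Proof. generalize (Cmod2_alt z). simpl. lra. Qed.

Lemma atan_double (T : R) :
  cos (2 * atan T) = (1 - T ^ 2) / (1 + T ^ 2) /\ sin (2 * atan T) = 2 * T / (1 + T ^ 2).
Proof.
  assert (B := atan_bound T).
  assert (Hc : 0 < cos (atan T)) by (apply cos_gt_0; lra).
  assert (Et : tan (atan T) = T) by apply tan_atan.
  assert (Es : sin (atan T) = T * cos (atan T)).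
  { rewrite <- Et at 2. unfold tan. field. lra. }
  assert (E := sin2_cos2 (atan T)). unfold Rsqr in E. rewrite Es in E.
  assert (Ec : cos (atan T) * cos (atan T) = / (1 + T ^ 2)).
  { apply Rmult_eq_reg_r with (1 + T ^ 2); [|nra]. rewrite Rinv_l by nra.
    transitivity (T * cos (atan T) * (T * cos (atan T)) + cos (atan T) * cos (atan T)); [ring|exact E]. }
  split.
  - rewrite cos_2a, Es.
    replace (cos (atan T) * cos (atan T) - T * cos (atan T) * (T * cos (atan T)))
      with (cos (atan T) * cos (atan T) * (1 - T ^ 2)) by ring. rewrite Ec. field. nra.
  - rewrite sin_2a, Es.
    replace (2 * (T * cos (atan T)) * cos (atan T)) with (2 * T * (cos (atan T) * cos (atan T))) by ring.
    rewrite Ec. field. nra.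
Qed.

Lemma slit_half_angle (z : C) : slit z ->
  cos (2 * atan (Im z / (Cmod z + Re z))) = Re z / Cmod z /\
  sin (2 * atan (Im z / (Cmod z + Re z))) = Im z / Cmod z.
Proof.
  intros H. assert (Hm : 0 < Cmod z) by (apply Cmod_gt_0, slit_neq_0, H).
  unfold slit in H. set (T := Im z / (Cmod z + Re z)).
  assert (S := Cmod_sqr z).
  assert (E : 1 + T ^ 2 = 2 * Cmod z / (Cmod z + Re z)).
  { unfold T. apply Rmult_eq_reg_r with ((Cmod z + Re z) * (Cmod z + Re z)); [|nra].
    field_simplify; [|lra|lra]. simpl. nra. }
  destruct (atan_double T) as [E1 E2]. rewrite E1, E2, E. split.
  - replace (1 - T ^ 2) with (2 - (1 + T ^ 2)) by ring. rewrite E. field. lra.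
  - unfold T. field. lra.
Qed.

(** The half-angle formula [tan (arg / 2) = Im z / (|z| + Re z)]. Unlike the case distinction in
    [Carg], it is visibly continuous across the positive real axis. *)
Lemma Carg_slit (z : C) : slit z -> Carg z = 2 * atan (Im z / (Cmod z + Re z)).
Proof.
  intros H. assert (Hm : 0 < Cmod z) by (apply Cmod_gt_0, slit_neq_0, H).
  destruct (slit_half_angle z H) as [E1 _]. unfold slit in H.
  unfold Carg. rewrite <- E1. set (T := Im z / (Cmod z + Re z)).
  assert (B := atan_bound T). destruct (Rle_dec 0 (Im z)) as [Hi|Hi].
  - apply acos_cos. assert (0 <= T) by (apply Rdiv_le_0_compat; lra).
    assert (0 <= atan T) by (destruct H0 as [H0| <-]; [rewrite <- atan_0; left; apply atan_increasing; auto|rewrite atan_0; lra]). lra.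
  - rewrite <- cos_neg. rewrite acos_cos. ring.
    assert (T < 0). { unfold T. apply Rmult_lt_reg_r with (Cmod z + Re z); auto.
      unfold Rdiv. rewrite Rmult_assoc, Rinv_l; lra. }
    assert (atan T < 0) by (rewrite <- atan_0; apply atan_increasing; auto). lra.
Qed.

Lemma Cexp_Clog (z : C) : slit z -> Cexp (Clog z) = z.
Proof.
  intros H. assert (Hm : 0 < Cmod z) by (apply Cmod_gt_0, slit_neq_0, H).
  unfold Cexp, Clog; simpl. rewrite Carg_slit, exp_ln by auto.
  destruct (slit_half_angle z H) as [E1 E2]. rewrite E1, E2.
  destruct z as [x y]; simpl in *. f_equal; field; lra.
Qed.

Lemma slit_Cexp (z : C) : Rabs (Im z) < PI -> slit (Cexp z).
Proof.
  intros H. unfold slit. rewrite Cmod_Cexp. unfold Cexp at 1; simpl.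
  assert (P := exp_pos (Re z)).
  assert (-1 < cos (Im z)).
  { rewrite <- cos_PI. unfold Rabs in H. destruct (Rcase_abs (Im z)).
    - rewrite <- (cos_neg (Im z)). apply cos_decreasing_1; lra.
    - apply cos_decreasing_1; lra. }
  nra.
Qed.

Lemma Clog_Cexp (z : C) : Rabs (Im z) < PI -> Clog (Cexp z) = z.
Proof.
  intros H. assert (P := exp_pos (Re z)). apply Rabs_def2 in H.
  unfold Clog, Carg. rewrite Cmod_Cexp, ln_exp.
  destruct z as [a b]. unfold Cexp; simpl in *. f_equal.
  replace (exp a * cos b / exp a) with (cos b) by (field; lra).
  destruct (Rle_dec 0 (exp a * sin b)) as [Hs|Hs].
  - apply acos_cos. split; [|lra]. apply Rnot_lt_le. intros Hb.
    assert (sin b < 0) by (apply sin_lt_0_var; lra). nra.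
  - rewrite <- cos_neg. rewrite acos_cos. ring. split; [|lra].
    apply Rnot_lt_le. intros Hb. apply Hs. assert (0 <= sin b) by (apply sin_ge_0; lra). nra.
Qed.

Definition rc (g : C -> R) (z : C) : Prop :=
  forall eps, 0 < eps -> exists delta, 0 < delta /\
    forall w, Cmod (w - z) < delta -> Rabs (g w - g z) < eps.

Lemma rc_comp (g : C -> R) (h : R -> R) (z : C) : rc g z -> continuity_pt h (g z) ->
  rc (fun w => h (g w)) z.
Proof.
  intros Hg Hh eps He. destruct (Hh eps He) as [d1 [D1 H1]].
  destruct (Hg d1 D1) as [d2 [D2 H2]]. exists d2. split; auto. intros w Hw.
  destruct (Req_dec (g w) (g z)) as [E|E].
  - rewrite E, Rminus_diag, Rabs_R0; auto.
  - apply (H1 (g w)). split. split; [exact I|auto]. apply H2; auto.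
Qed.

Lemma rc_cc (g : C -> R) (z : C) : rc g z <-> cc (fun w => RtoC (g w)) z.
Proof.
  split; intros H eps He; destruct (H eps He) as [d [D K]]; exists d; split; auto; intros w Hw;
    specialize (K w Hw); rewrite <- RtoC_minus, Cmod_R in *; auto.
Qed.

Lemma rc_Re (f : C -> C) (z : C) : cc f z -> rc (fun w => Re (f w)) z.
Proof.
  intros H eps He. destruct (H eps He) as [d [D K]]; exists d; split; auto. intros w Hw.
  apply Rle_lt_trans with (2 := K w Hw).
  replace (Re (f w) - Re (f z)) with (Re (f w - f z)) by (unfold Cminus; rewrite re_plus, re_opp; ring).
  apply re_le_Cmod.
Qed.

Lemma im_le_Cmod (c : C) : Rabs (Im c) <= Cmod c.
Proof. apply Rle_trans with (2 := Rmax_Cmod c). apply Rmax_r. Qed.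

Lemma rc_Im (f : C -> C) (z : C) : cc f z -> rc (fun w => Im (f w)) z.
Proof.
  intros H eps He. destruct (H eps He) as [d [D K]]; exists d; split; auto. intros w Hw.
  apply Rle_lt_trans with (2 := K w Hw).
  replace (Im (f w) - Im (f z)) with (Im (f w - f z)) by (unfold Cminus; rewrite im_plus, im_opp; ring).
  apply im_le_Cmod.
Qed.

Lemma rc_Cmod (f : C -> C) (z : C) : cc f z -> rc (fun w => Cmod (f w)) z.
Proof.
  intros H eps He. destruct (H eps He) as [d [D K]]; exists d; split; auto. intros w Hw.
  apply Rle_lt_trans with (2 := K w Hw).
  apply Rabs_le. assert (T1 := Cmod_triangle (f z) (f w - f z)).
  assert (T2 := Cmod_triangle (f w) (f z - f w)). rewrite (Cmod_minus_sym (f z)) in T2.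
  replace (f z + (f w - f z))%C with (f w) in T1 by ring.
  replace (f w + (f z - f w))%C with (f z) in T2 by ring. lra.
Qed.

Lemma rc_plus (g h : C -> R) (z : C) : rc g z -> rc h z -> rc (fun w => g w + h w) z.
Proof.
  rewrite !rc_cc. intros H K. apply cc_ext_loc with (fun w => RtoC (g w) + RtoC (h w))%C.
  exists 1; split; [lra|]. intros; rewrite RtoC_plus; auto. apply cc_plus; auto.
Qed.

Lemma rc_div (g h : C -> R) (z : C) : rc g z -> rc h z -> h z <> 0 -> rc (fun w => g w / h w) z.
Proof.
  intros H K Hz. apply rc_cc in H. apply rc_cc in K.
  assert (X : cc (fun w => RtoC (g w) / RtoC (h w))%C z).
  { apply cc_div; auto. intros E. apply Hz. apply RtoC_inj; auto. }
  intros eps He. destruct (X eps He) as [d [D Y]].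
  destruct (K (Rabs (h z))) as [d2 [D2 Y2]]. apply Rabs_pos_lt; auto.
  exists (Rmin d d2). split. apply Rmin_pos; auto. intros w Hw.
  assert (h1 := Rlt_le_trans _ _ _ Hw (Rmin_l _ _)). assert (h2 := Rlt_le_trans _ _ _ Hw (Rmin_r _ _)).
  assert (h w <> 0). { intros E. specialize (Y2 w h2). rewrite E in Y2.
    rewrite <- RtoC_minus, Cmod_R in Y2. rewrite Rminus_0_l, Rabs_Ropp in Y2. lra. }
  specialize (Y w h1). rewrite <- !RtoC_div, <- RtoC_minus, Cmod_R in Y by auto. auto.
Qed.

Lemma slit_open (z : C) : slit z ->
  exists delta, 0 < delta /\ forall w, Cmod (w - z) < delta -> slit w.
Proof.
  intros H. assert (K : rc (fun w => Cmod w + Re w) z).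
  { apply rc_plus. apply (rc_Cmod (fun w => w)), cc_id. apply (rc_Re (fun w => w)), cc_id. }
  destruct (K _ H) as [d [D E]]. exists d. split; auto. intros w Hw. specialize (E w Hw).
  apply Rabs_def2 in E. unfold slit. lra.
Qed.

Lemma cc_pair (g h : C -> R) (z : C) : rc g z -> rc h z -> cc (fun w => (g w, h w)) z.
Proof.
  rewrite !rc_cc. intros H K. apply cc_ext_loc with (fun w => RtoC (g w) + Ci * RtoC (h w))%C.
  - exists 1; split; [lra|]. intros. unfold Cplus, Cmult, RtoC; simpl. f_equal; ring.
  - apply cc_plus; auto. apply cc_mult; auto. apply cc_const.
Qed.

Lemma cc_Clog (z : C) : slit z -> cc Clog z.
Proof.
  intros H. assert (Hm : 0 < Cmod z) by (apply Cmod_gt_0, slit_neq_0, H).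
  apply cc_ext_loc with (fun z => (ln (Cmod z), 2 * atan (Im z / (Cmod z + Re z)))).
  - destruct (slit_open z H) as [d [D E]]. exists d. split; auto. intros w Hw.
    unfold Clog. rewrite Carg_slit; auto.
  - assert (Rm : rc (fun w => Cmod w) z) by (apply (rc_Cmod (fun w => w)), cc_id).
    assert (Rr : rc (fun w => Re w) z) by (apply (rc_Re (fun w => w)), cc_id).
    assert (Ri : rc (fun w => Im w) z) by (apply (rc_Im (fun w => w)), cc_id).
    apply cc_pair.
    + apply (rc_comp _ ln); auto. apply derivable_continuous_pt. exists (/ Cmod z). apply derivable_pt_lim_ln; auto.
    + apply (rc_comp (fun w => Im w / (Cmod w + Re w)) (fun x => 2 * atan x)).
      * apply rc_div; auto. apply rc_plus; auto. unfold slit in H. lra.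
      * apply derivable_continuous_pt, ex_derive_Reals_0. auto_derive; auto.
Qed.

Lemma cd_Clog (z : C) : slit z -> cd Clog z (/ z)%C.
Proof.
  intros H. rewrite <- (Cexp_Clog z H) at 2.
  apply cd_local_inverse with Cexp.
  - apply cc_Clog; auto.
  - apply cd_Cexp.
  - apply Cexp_neq_0.
  - destruct (slit_open z H) as [d [D E]]. exists d. split; auto. intros w Hw. apply Cexp_Clog; auto.
Qed.


(** * Hyperbolic functions and the region *)

Lemma C2_neq_0 : RtoC 2 <> 0.
Proof. intros H. apply RtoC_inj in H. lra. Qed.

Lemma Re_half (z : C) : Re (z / 2) = Re z / 2.
Proof. destruct z as [a b]. simpl. field. Qed.

Lemma Im_half (z : C) : Im (z / 2) = Im z / 2.
Proof. destruct z as [a b]. simpl. field. Qed.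

Lemma Ccosh_eq (z : C) : Ccosh z = (cosh (Re z) * cos (Im z), sinh (Re z) * sin (Im z)).
Proof.
  destruct z as [a b]. unfold Ccosh, Cexp, cosh, sinh; simpl. rewrite cos_neg, sin_neg.
  unfold Cdiv, Cinv, Cmult, Cplus; simpl. f_equal; field.
Qed.

Lemma Csinh_eq (z : C) : Csinh z = (sinh (Re z) * cos (Im z), cosh (Re z) * sin (Im z)).
Proof.
  destruct z as [a b]. unfold Csinh, Cexp, cosh, sinh; simpl. rewrite cos_neg, sin_neg.
  unfold Cdiv, Cinv, Cmult, Cplus, Cminus, Copp; simpl. f_equal; field.
Qed.

Lemma cosh_sqr (x : R) : cosh x * cosh x = 1 + sinh x * sinh x.
Proof.
  unfold cosh, sinh. replace (exp (- x)) with (/ exp x) by (rewrite exp_Ropp; auto).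
  generalize (exp_pos x); intros. field. lra.
Qed.

Lemma cos_sqr (x : R) : cos x * cos x = 1 - sin x * sin x.
Proof. generalize (sin2_cos2 x). unfold Rsqr. lra. Qed.

Lemma Cmod_Ccosh_sqr (z : C) :
  Cmod (Ccosh z) * Cmod (Ccosh z) = sinh (Re z) * sinh (Re z) + cos (Im z) * cos (Im z).
Proof.
  rewrite Cmod_sqr, Ccosh_eq; simpl. assert (H1 := cosh_sqr (Re z)). assert (H2 := cos_sqr (Im z)).
  transitivity ((cosh (Re z) * cosh (Re z)) * (cos (Im z) * cos (Im z)) +
    (sinh (Re z) * sinh (Re z)) * (sin (Im z) * sin (Im z))); [ring|].
  rewrite H1. replace (sin (Im z) * sin (Im z)) with (1 - cos (Im z) * cos (Im z)) by lra. ring.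
Qed.

Lemma Cmod_Csinh_sqr (z : C) :
  Cmod (Csinh z) * Cmod (Csinh z) = sinh (Re z) * sinh (Re z) + sin (Im z) * sin (Im z).
Proof.
  rewrite Cmod_sqr, Csinh_eq; simpl. assert (H1 := cosh_sqr (Re z)). assert (H2 := cos_sqr (Im z)).
  transitivity ((sinh (Re z) * sinh (Re z)) * (cos (Im z) * cos (Im z)) +
    (cosh (Re z) * cosh (Re z)) * (sin (Im z) * sin (Im z))); [ring|].
  rewrite H1, H2. ring.
Qed.

Lemma Ccosh_sqr (z : C) : (Ccosh z * Ccosh z = 1 + Csinh z * Csinh z)%C.
Proof.
  unfold Ccosh, Csinh. rewrite Cexp_opp. field. apply Cexp_neq_0.
Qed.

Lemma Re_Ccosh_half_pos (z : C) : Rabs (Im z) < PI -> 0 < Re (Ccosh (z / 2)).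
Proof.
  intros H. apply Rabs_def2 in H. rewrite Ccosh_eq, Im_half; simpl.
  apply Rmult_lt_0_compat. apply cosh_pos. apply cos_gt_0; lra.
Qed.

Lemma Ccosh_half_neq_0 (z : C) : Rabs (Im z) < PI -> Ccosh (z / 2) <> 0.
Proof. intros H. apply slit_neq_0, slit_Re_pos, Re_Ccosh_half_pos, H. Qed.

Lemma cd_Ccosh (z : C) : cd Ccosh z (Csinh z).
Proof.
  unfold Ccosh, Csinh. apply cd_eq with ((Cexp z + Cexp (- z) * - (1)) * / 2 + (Cexp z + Cexp (- z)) * 0)%C.
  - apply (cd_mult (fun z => Cexp z + Cexp (- z))%C (fun _ => / 2)%C). 2: apply cd_const.
    apply cd_plus. apply cd_Cexp. apply (cd_comp (fun z => - z)%C Cexp).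
    apply cd_opp, cd_id. apply cd_Cexp.
  - field; exact C2_neq_0.
Qed.

Lemma cd_Csinh (z : C) : cd Csinh z (Ccosh z).
Proof.
  unfold Ccosh, Csinh. apply cd_eq with ((Cexp z - Cexp (- z) * - (1)) * / 2 + (Cexp z - Cexp (- z)) * 0)%C.
  - apply (cd_mult (fun z => Cexp z - Cexp (- z))%C (fun _ => / 2)%C). 2: apply cd_const.
    apply cd_minus. apply cd_Cexp. apply (cd_comp (fun z => - z)%C Cexp).
    apply cd_opp, cd_id. apply cd_Cexp.
  - field; exact C2_neq_0.
Qed.

Lemma cd_Ctanh (z : C) : Ccosh z <> 0 -> cd Ctanh z (/ (Ccosh z * Ccosh z))%C.
Proof.
  intros H. unfold Ctanh.
  apply cd_eq with (Ccosh z * / Ccosh z + Csinh z * (- Csinh z / (Ccosh z * Ccosh z)))%C.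
  - apply (cd_mult Csinh (fun z => / Ccosh z)%C). apply cd_Csinh. apply cd_inv; auto. apply cd_Ccosh.
  - transitivity ((Ccosh z * Ccosh z - Csinh z * Csinh z) / (Ccosh z * Ccosh z))%C. field; auto.
    rewrite Ccosh_sqr at 1. field; auto.
Qed.

Lemma cd_half (z : C) : cd (fun w => w / 2)%C z (/ 2)%C.
Proof.
  apply cd_eq with (1 * / 2 + z * 0)%C; [|ring].
  apply (cd_mult (fun w => w) (fun _ => / 2)%C). apply cd_id. apply cd_const.
Qed.

Lemma Cexp_half_sqr (z : C) : (Cexp z = Cexp (z / 2) * Cexp (z / 2))%C.
Proof. rewrite <- Cexp_plus. f_equal. field; exact C2_neq_0. Qed.

Lemma Cexp_plus_1_neq_0 (z : C) : Rabs (Im z) < PI -> (Cexp z + 1)%C <> 0.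
Proof.
  intros H E. assert (S := slit_Cexp z H).
  assert (E2 : Cexp z = (- (1))%C). { transitivity ((Cexp z + 1) - 1)%C. ring. rewrite E. ring. }
  unfold slit in S. rewrite E2, Cmod_m1 in S. simpl in S. lra.
Qed.

Lemma Ctanh_half_Cexp (z : C) : Rabs (Im z) < PI -> Ctanh (z / 2) = ((Cexp z - 1) / (Cexp z + 1))%C.
Proof.
  intros H. assert (H1 := Cexp_plus_1_neq_0 z H). assert (H2 := Ccosh_half_neq_0 z H).
  unfold Ctanh. unfold Csinh, Ccosh in *. rewrite Cexp_opp in *. rewrite (Cexp_half_sqr z) in *.
  assert (H3 := Cexp_neq_0 (z / 2)). field; repeat split; auto; exact C2_neq_0.
Qed.

(** The inverse of [zeta] to [tanh (zeta / 2)]. The principal branch is the right one as long as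
    [|Im zeta| < PI], which is where [d < PI] enters. *)
Definition zt (z : C) : C := Clog ((1 + z) / (1 - z))%C.

Lemma one_plus_minus_tanh (z : C) : Rabs (Im z) < PI ->
  (1 - Ctanh (z / 2))%C <> 0 /\ ((1 + Ctanh (z / 2)) / (1 - Ctanh (z / 2)))%C = Cexp z.
Proof.
  intros H. assert (H1 := Cexp_plus_1_neq_0 z H). rewrite Ctanh_half_Cexp by auto.
  assert (E : (1 - (Cexp z - 1) / (Cexp z + 1))%C = (2 / (Cexp z + 1))%C) by (field; auto).
  split.
  - rewrite E. unfold Cdiv. apply Cmult_neq_0. exact C2_neq_0. intros E2.
    assert (X : ((Cexp z + 1) * / (Cexp z + 1))%C = 0) by (rewrite E2; ring).
    rewrite Cinv_r in X by auto. apply RtoC_inj in X. lra.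
  - rewrite E. field; repeat split; auto; exact C2_neq_0.
Qed.

Lemma zt_Ctanh (z : C) : Rabs (Im z) < PI -> zt (Ctanh (z / 2)) = z.
Proof.
  intros H. unfold zt. rewrite (proj2 (one_plus_minus_tanh z H)). apply Clog_Cexp; auto.
Qed.

(** The plane cut along the real rays from -1 to the left and from 1 to the right, on which [zt] is
    analytic. It contains every [Lambda d] with [d < PI]. *)
Definition zt_dom (z : C) : Prop := (1 - z)%C <> 0 /\ slit ((1 + z) / (1 - z))%C.

Lemma Clog_Im_bound (z : C) : slit z -> Rabs (Im (Clog z)) < PI.
Proof.
  intros H. unfold Clog; simpl. rewrite Carg_slit by auto.
  assert (B := atan_bound (Im z / (Cmod z + Re z))). apply Rabs_def1; lra.
Qed.

Lemma Ctanh_zt (z : C) : zt_dom z -> Ctanh (zt z / 2) = z.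
Proof.
  intros [H1 H2]. rewrite Ctanh_half_Cexp by (apply Clog_Im_bound; auto).
  unfold zt. rewrite Cexp_Clog by auto. field. split; auto.
  replace (1 + z + (1 - z))%C with (RtoC 2) by ring. exact C2_neq_0.
Qed.

Lemma Lambda_iff (d : R) (z : C) : d < PI ->
  Lambda d z <-> zt_dom z /\ Rabs (Im (zt z)) < d.
Proof.
  intros Hd. split.
  - intros [w [Hw ->]]. unfold strip in Hw. assert (Hw' : Rabs (Im w) < PI) by lra.
    rewrite zt_Ctanh by auto. split; auto.
    destruct (one_plus_minus_tanh w Hw') as [H1 H2]. split; auto. rewrite H2. apply slit_Cexp; auto.
  - intros [H1 H2]. exists (zt z). split. exact H2. symmetry; apply Ctanh_zt; auto.
Qed.

Lemma cd_mobius (z : C) : (1 - z)%C <> 0 ->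
  cd (fun z => (1 + z) / (1 - z))%C z (2 / ((1 - z) * (1 - z)))%C.
Proof.
  intros H. apply cd_eq with ((0 + 1) * / (1 - z) + (1 + z) * (- (0 - 1) / ((1 - z) * (1 - z))))%C.
  - apply (cd_mult (fun z => 1 + z)%C (fun z => / (1 - z))%C).
    apply cd_plus. apply cd_const. apply cd_id.
    apply cd_inv; auto. apply cd_minus. apply cd_const. apply cd_id.
  - field; auto.
Qed.

Lemma zt_dom_one_plus (z : C) : zt_dom z -> (1 + z)%C <> 0.
Proof.
  intros [H1 H2] E. apply slit_neq_0 in H2. apply H2. rewrite E. unfold Cdiv. ring.
Qed.

Lemma cd_zt (z : C) : zt_dom z -> cd zt z (2 / (1 - z * z))%C.
Proof.
  intros H. assert (H3 := zt_dom_one_plus z H). destruct H as [H1 H2].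
  apply cd_eq with (/ ((1 + z) / (1 - z)) * (2 / ((1 - z) * (1 - z))))%C.
  - apply (cd_comp (fun z => (1 + z) / (1 - z))%C Clog). apply cd_mobius; auto. apply cd_Clog; auto.
  - field. repeat split; auto. replace (1 - z * z)%C with ((1 - z) * (1 + z))%C by ring.
    apply Cmult_neq_0; auto.
Qed.

Definition Copen (D : C -> Prop) : Prop :=
  forall z, D z -> exists delta, 0 < delta /\ forall w, Cmod (w - z) < delta -> D w.

Lemma zt_dom_open : Copen zt_dom.
Proof.
  intros z [H1 H2].
  destruct (slit_open _ H2) as [d [D E]].
  destruct (cd_cc _ _ _ (cd_mobius z H1) d D) as [d1 [D1 E1]].
  assert (Hm : 0 < Cmod (1 - z)) by (apply Cmod_gt_0; auto).
  exists (Rmin d1 (Cmod (1 - z))). split. apply Rmin_pos; auto. intros w Hw.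
  assert (h1 := Rlt_le_trans _ _ _ Hw (Rmin_l _ _)). assert (h2 := Rlt_le_trans _ _ _ Hw (Rmin_r _ _)).
  split.
  - intros E0. replace (w - z)%C with ((1 - z) - (1 - w))%C in h2 by ring. rewrite E0 in h2.
    replace (1 - z - 0)%C with (1 - z)%C in h2 by ring. lra.
  - apply E. apply E1. auto.
Qed.

Lemma Lambda_open (d : R) : d < PI -> Copen (Lambda d).
Proof.
  intros Hd z Hz. apply Lambda_iff in Hz; auto. destruct Hz as [H1 H2].
  destruct (zt_dom_open z H1) as [d1 [D1 E1]].
  assert (K := rc_comp _ Rabs z (rc_Im zt z (cd_cc _ _ _ (cd_zt z H1))) (Rcontinuity_abs _)).
  destruct (K (d - Rabs (Im (zt z))) ltac:(lra)) as [d2 [D2 E2]].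
  exists (Rmin d1 d2). split. apply Rmin_pos; auto. intros w Hw.
  assert (h1 := Rlt_le_trans _ _ _ Hw (Rmin_l _ _)). assert (h2 := Rlt_le_trans _ _ _ Hw (Rmin_r _ _)).
  apply Lambda_iff; auto. split; auto. specialize (E2 w h2). apply Rabs_def2 in E2. lra.
Qed.

Lemma one_minus_sqr_Ctanh (z : C) : Rabs (Im z) < PI ->
  (1 - Ctanh (z / 2) * Ctanh (z / 2))%C = (/ (Ccosh (z / 2) * Ccosh (z / 2)))%C.
Proof.
  intros H. assert (H2 := Ccosh_half_neq_0 z H). unfold Ctanh.
  transitivity ((Ccosh (z / 2) * Ccosh (z / 2) - Csinh (z / 2) * Csinh (z / 2)) / (Ccosh (z / 2) * Ccosh (z / 2)))%C.
  field; auto. rewrite Ccosh_sqr at 1. field; auto.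
Qed.

(* [cosh_pow p z] is [cosh (zeta / 2) ^ p] for [z = tanh (zeta / 2)], that is,
   [(1 - z ^ 2) ^ (- p / 2)]. *)
Definition lcosh (z : C) : C := Clog (Ccosh (zt z / 2)).
Definition cosh_pow (p : R) (z : C) : C := Cexp (p * lcosh z)%C.

Lemma zt_dom_Im (z : C) : zt_dom z -> Rabs (Im (zt z)) < PI.
Proof. intros [H1 H2]. apply Clog_Im_bound; auto. Qed.

(** [lcosh] is a branch of [- ln (1 - z ^ 2) / 2], so its derivative is rational; this is what later
    places [cosh_pow] in the class [smooth]. *)
Lemma cd_lcosh (z : C) : zt_dom z -> cd lcosh z (z / (1 - z * z))%C.
Proof.
  intros H. assert (Hi := zt_dom_Im z H). assert (Hc := Ccosh_half_neq_0 _ Hi).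
  assert (Hz : (1 - z * z)%C <> 0).
  { replace (1 - z * z)%C with ((1 - z) * (1 + z))%C by ring.
    apply Cmult_neq_0. apply H. apply zt_dom_one_plus; auto. }
  apply cd_eq with (/ Ccosh (zt z / 2) * (Csinh (zt z / 2) * (/ 2 * (2 / (1 - z * z)))))%C.
  - apply (cd_comp (fun z => Ccosh (zt z / 2)) Clog). 2: apply cd_Clog, slit_Re_pos, Re_Ccosh_half_pos; auto.
    apply (cd_comp (fun z => zt z / 2)%C Ccosh). 2: apply cd_Ccosh.
    apply (cd_comp zt (fun w => w / 2)%C). apply cd_zt; auto. apply cd_half.
  - transitivity (Ctanh (zt z / 2) / (1 - z * z))%C. unfold Ctanh. field; repeat split; auto; exact C2_neq_0.
    rewrite Ctanh_zt; auto.
Qed.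

Lemma Cmod_cosh_pow (p : R) (z : C) :
  Cmod (cosh_pow p z) = Rpower (Cmod (Ccosh (zt z / 2))) p.
Proof. unfold cosh_pow. rewrite Cmod_Cexp, re_scal_l. reflexivity. Qed.

(** Only the modulus of the weight enters the norm, so the branches of the two complex powers never
    have to be compared. *)
Lemma Cmod_w_mu (mu : R) (z : C) : zt_dom z ->
  Cmod (w_mu mu z) = Rpower (Cmod (Ccosh (zt z / 2))) (- mu).
Proof.
  intros H. unfold w_mu, Crpow. rewrite Cmod_Cexp, re_scal_l. unfold Clog; simpl Re.
  assert (Hi := zt_dom_Im z H). assert (Hc := Ccosh_half_neq_0 _ Hi).
  assert (Hp : 0 < Cmod (Ccosh (zt z / 2))) by (apply Cmod_gt_0; auto).
  assert (E := one_minus_sqr_Ctanh _ Hi). rewrite Ctanh_zt in E by auto. rewrite E.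
  rewrite Cmod_inv by (apply Cmult_neq_0; auto). rewrite Cmod_mult, ln_Rinv, ln_mult by nra.
  unfold Rpower. f_equal. field.
Qed.

Lemma Ccosh_R (x : R) : Ccosh (RtoC x) = RtoC (cosh x).
Proof. rewrite Ccosh_eq; simpl. rewrite cos_0, sin_0. unfold RtoC. f_equal; ring. Qed.

Lemma Csinh_R (x : R) : Csinh (RtoC x) = RtoC (sinh x).
Proof. rewrite Csinh_eq; simpl. rewrite cos_0, sin_0. unfold RtoC. f_equal; ring. Qed.

Lemma Ctanh_R (x : R) : Ctanh (RtoC x) = RtoC (tanh x).
Proof.
  unfold Ctanh, tanh. rewrite Csinh_R, Ccosh_R, RtoC_div; auto.
  generalize (cosh_pos x); lra.
Qed.

Lemma RtoC_half (x : R) : (RtoC x / 2)%C = RtoC (x / 2).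
Proof. rewrite RtoC_div; auto. Qed.

Lemma Im_RtoC_lt (x b : R) : 0 < b -> Rabs (Im (RtoC x)) < b.
Proof. intros H. simpl. rewrite Rabs_R0; auto. Qed.

Lemma zt_R (s : R) : zt (RtoC (tanh (s / 2))) = RtoC s.
Proof.
  rewrite <- Ctanh_R, <- RtoC_half. apply zt_Ctanh. apply Im_RtoC_lt, PI_RGT_0.
Qed.

Lemma Lambda_R (d s : R) : 0 < d -> Lambda d (RtoC (tanh (s / 2))).
Proof.
  intros Hd. exists (RtoC s). split. apply Im_RtoC_lt; auto.
  rewrite RtoC_half, Ctanh_R; auto.
Qed.

Lemma Clog_R_pos (x : R) : 0 < x -> Clog (RtoC x) = RtoC (ln x).
Proof.
  intros H. rewrite <- (exp_ln x) at 1 by auto. rewrite <- Cexp_R. apply Clog_Cexp.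
  apply Im_RtoC_lt, PI_RGT_0.
Qed.

Lemma cosh_pow_R (p s : R) : cosh_pow p (RtoC (tanh (s / 2))) = RtoC (Rpower (cosh (s / 2)) p).
Proof.
  unfold cosh_pow, lcosh. rewrite zt_R, RtoC_half, Ccosh_R, Clog_R_pos by apply cosh_pos.
  rewrite <- RtoC_mult, Cexp_R. reflexivity.
Qed.

Lemma tanh_half_surj (x : R) : -1 < x < 1 -> exists s, x = tanh (s / 2).
Proof.
  intros H. exists (2 * arctanh x). replace (2 * arctanh x / 2) with (arctanh x) by field.
  symmetry; apply tanh_arctanh; auto.
Qed.

(** * Functions with complex derivatives of all orders *)

(** A class generated by operations under which derivatives stay in the class, so that derivatives
    of all orders exist without Cauchy's formula. [smooth_prim] admits functions such as [zt], known
    through a derivative that already belongs to the class. *)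
Inductive smooth (D : C -> Prop) : (C -> C) -> Prop :=
| smooth_const a : smooth D (fun _ => a)
| smooth_id : smooth D (fun z => z)
| smooth_plus f g : smooth D f -> smooth D g -> smooth D (fun z => f z + g z)%C
| smooth_mult f g : smooth D f -> smooth D g -> smooth D (fun z => f z * g z)%C
| smooth_inv f : smooth D f -> (forall z, D z -> f z <> 0) -> smooth D (fun z => / f z)%C
| smooth_exp f : smooth D f -> smooth D (fun z => Cexp (f z))
| smooth_prim f g : smooth D g -> (forall z, D z -> cd f z (g z)) -> smooth D f.

Lemma smooth_cd (D : C -> Prop) (f : C -> C) : smooth D f ->
  exists g, smooth D g /\ forall z, D z -> cd f z (g z).
Proof.
  induction 1 as [a| |f g Hf [f' [F1 F2]] Hg [g' [G1 G2]]|f g Hf [f' [F1 F2]] Hg [g' [G1 G2]]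
    |f Hf [f' [F1 F2]] Hz|f Hf [f' [F1 F2]]|f g Hg _ Hd].
  - exists (fun _ => RtoC 0). split. apply smooth_const. intros; apply cd_const.
  - exists (fun _ => RtoC 1). split. apply smooth_const. intros; apply cd_id.
  - exists (fun z => f' z + g' z)%C. split. apply smooth_plus; auto. intros; apply cd_plus; auto.
  - exists (fun z => f' z * g z + f z * g' z)%C. split.
    apply smooth_plus; apply smooth_mult; auto. intros; apply cd_mult; auto.
  - exists (fun z => (- (1)) * f' z * (/ f z * / f z))%C. split.
    + apply smooth_mult. apply smooth_mult; auto. apply smooth_const.
      apply smooth_mult; apply smooth_inv; auto.
    + intros z Hz'. apply cd_eq with (- f' z / (f z * f z))%C. apply cd_inv; auto. field; auto.
  - exists (fun z => Cexp (f z) * f' z)%C. split.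
    apply smooth_mult; auto. apply smooth_exp; auto.
    intros z Hz. apply (cd_comp f Cexp); auto. apply cd_Cexp.
  - exists g. auto.
Qed.

Lemma smooth_minus (D : C -> Prop) (f g : C -> C) :
  smooth D f -> smooth D g -> smooth D (fun z => f z + - (1) * g z)%C.
Proof. intros. apply smooth_plus; auto. apply smooth_mult; auto. apply smooth_const. Qed.

Lemma smooth_pow (D : C -> Prop) (f : C -> C) (n : nat) :
  smooth D f -> smooth D (fun z => f z ^ n)%C.
Proof.
  intros H. induction n as [|n IH]. apply (smooth_const D 1).
  simpl. apply (smooth_mult D f); auto.
Qed.

Lemma smooth_analytic (D : C -> Prop) (f : C -> C) : smooth D f -> analytic_on D f.
Proof.
  intros H z Hz. apply ex_derive_cd. destruct (smooth_cd D f H) as [g [_ Hg]]. exists (g z). auto.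
Qed.

Lemma cd_pow (f : C -> C) (z a : C) (n : nat) : cd f z a ->
  cd (fun w => f w ^ S n)%C z (INR (S n) * a * f z ^ n)%C.
Proof.
  intros H. induction n as [|n IH].
  - simpl. apply cd_eq with (a * 1 + f z * 0)%C; [|ring]. apply (cd_mult f (fun _ => RtoC 1)); auto. apply cd_const.
  - apply cd_eq with (a * f z ^ S n + f z * (INR (S n) * a * f z ^ n))%C.
    apply (cd_mult f (fun w => f w ^ S n)%C); auto.
    rewrite !S_INR, !RtoC_plus. simpl. ring.
Qed.

(** By the product rule each differentiation costs one power of [P]. Openness of [D] is used because
    the factorization of the previous derivative is known on [D] only and has to hold near the
    point. *)
Lemma C_derive_n_vanish (D : C -> Prop) (P : C -> C) (n k : nat) (f g : C -> C) :
  Copen D -> smooth D P -> smooth D g -> (k <= n)%nat ->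
  (forall z, D z -> f z = P z ^ n * g z)%C ->
  exists h, smooth D h /\ forall z, D z -> (C_derive_n f k z = P z ^ (n - k) * h z)%C.
Proof.
  intros HD HP Hg Hk Hf. induction k as [|k IH].
  - exists g. split; auto. intros z Hz. rewrite Nat.sub_0_r. auto.
  - destruct IH as [h [Hh E]]; [lia|].
    destruct (smooth_cd D P HP) as [P' [HP' dP]]. destruct (smooth_cd D h Hh) as [h' [Hh' dh]].
    exists (fun z => INR (S (n - S k)) * P' z * h z + P z * h' z)%C. split.
    + apply smooth_plus; apply smooth_mult; auto. apply smooth_mult; auto. apply smooth_const.
    + intros z Hz. simpl. apply C_derive_cd.
      apply cd_ext_loc with (fun z => P z ^ (S (n - S k)) * h z)%C.
      * destruct (HD z Hz) as [d [Dd H]]. exists d. split; auto. intros w Hw.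
        rewrite E by auto. do 2 f_equal. lia.
      * apply cd_eq with ((INR (S (n - S k)) * P' z * P z ^ (n - S k)) * h z + P z ^ (S (n - S k)) * h' z)%C.
        apply (cd_mult (fun z => P z ^ S (n - S k))%C h); auto. apply cd_pow; auto.
        simpl. ring.
Qed.

Lemma smooth_zt (D : C -> Prop) : (forall z, D z -> zt_dom z) -> smooth D zt.
Proof.
  intros H. apply smooth_prim with (fun z => 2 * / (1 + - (1) * (z * z)))%C.
  - apply smooth_mult. apply smooth_const. apply smooth_inv.
    apply smooth_minus. apply smooth_const. apply smooth_mult; apply smooth_id.
    intros z Hz. replace (1 + - (1) * (z * z))%C with ((1 - z) * (1 + z))%C by ring.
    apply Cmult_neq_0. apply H; auto. apply zt_dom_one_plus; auto.
  - intros z Hz. apply cd_eq with (2 / (1 - z * z))%C. apply cd_zt; auto.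
    unfold Cdiv. do 2 f_equal. ring.
Qed.

Lemma smooth_cosh_pow (D : C -> Prop) (p : R) : (forall z, D z -> zt_dom z) -> smooth D (cosh_pow p).
Proof.
  intros H. apply (smooth_exp D (fun z => p * lcosh z)%C).
  apply (smooth_mult D (fun _ => RtoC p)). apply smooth_const.
  apply smooth_prim with (fun z => z * / (1 + - (1) * (z * z)))%C.
  - apply smooth_mult. apply smooth_id. apply smooth_inv.
    apply smooth_minus. apply smooth_const. apply smooth_mult; apply smooth_id.
    intros z Hz. replace (1 + - (1) * (z * z))%C with ((1 - z) * (1 + z))%C by ring.
    apply Cmult_neq_0. apply H; auto. apply zt_dom_one_plus; auto.
  - intros z Hz. apply cd_eq with (z / (1 - z * z))%C. apply cd_lcosh; auto.
    unfold Cdiv. do 2 f_equal. ring.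
Qed.

(** * Blaschke factors of the region, through the conformal map [Wmap] onto the right half-plane *)

Definition Wmap (d : R) (z : C) : C := Cexp (RtoC (PI / (2 * d)) * zt z)%C.

Lemma Wmap_Re_pos (d : R) (z : C) : 0 < d < PI -> Lambda d z -> 0 < Re (Wmap d z).
Proof.
  intros Hd Hz. apply Lambda_iff in Hz; [|lra]. destruct Hz as [_ Hz]. apply Rabs_def2 in Hz.
  unfold Wmap, Cexp. cbn [Re fst]. rewrite im_scal_l.
  apply Rmult_lt_0_compat. apply exp_pos.
  assert (Hpi := PI_RGT_0). assert (0 < PI / (2 * d)) by (apply Rdiv_lt_0_compat; lra).
  assert (PI / (2 * d) * d = PI / 2) by (field; lra).
  apply cos_gt_0; nra.
Qed.

Lemma smooth_Wmap (D : C -> Prop) (d : R) : (forall z, D z -> zt_dom z) -> smooth D (Wmap d).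
Proof.
  intros H. apply (smooth_exp D (fun z => RtoC (PI / (2 * d)) * zt z)%C).
  apply (smooth_mult D (fun _ => RtoC (PI / (2 * d)))). apply smooth_const. apply smooth_zt; auto.
Qed.

Lemma Wmap_R (d s : R) : Wmap d (RtoC (tanh (s / 2))) = RtoC (exp (PI / (2 * d) * s)).
Proof. unfold Wmap. rewrite zt_R, <- RtoC_mult, Cexp_R. reflexivity. Qed.

(** The Blaschke factor of the right half-plane with zero [Wmap d a], pulled back to the region. *)
Definition blaschke (d : R) (a z : C) : C :=
  ((Wmap d z + - (1) * Wmap d a) * / (Wmap d z + Cconj (Wmap d a)))%C.

Lemma blaschke_den_neq_0 (d : R) (a z : C) : 0 < d < PI -> Lambda d a -> Lambda d z ->
  (Wmap d z + Cconj (Wmap d a))%C <> 0.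
Proof.
  intros Hd Ha Hz. apply slit_neq_0, slit_Re_pos. rewrite re_plus, re_conj.
  generalize (Wmap_Re_pos d a Hd Ha) (Wmap_Re_pos d z Hd Hz). lra.
Qed.

Lemma smooth_blaschke (d : R) (a : C) : 0 < d < PI -> Lambda d a ->
  smooth (Lambda d) (blaschke d a).
Proof.
  intros Hd Ha. assert (HD : forall z, Lambda d z -> zt_dom z).
  { intros z Hz. apply Lambda_iff in Hz; [tauto|lra]. }
  unfold blaschke. apply smooth_mult.
  - apply smooth_minus. apply smooth_Wmap; auto. apply smooth_const.
  - apply (smooth_inv _ (fun z => Wmap d z + Cconj (Wmap d a))%C).
    apply smooth_plus. apply smooth_Wmap; auto. apply smooth_const.
    intros z Hz. apply blaschke_den_neq_0; auto.
Qed.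

Lemma blaschke_zero (d : R) (a : C) : blaschke d a a = 0.
Proof. unfold blaschke. ring. Qed.

Lemma Cmod_blaschke_le_1 (d : R) (a z : C) : 0 < d < PI -> Lambda d a -> Lambda d z ->
  Cmod (blaschke d a z) <= 1.
Proof.
  intros Hd Ha Hz. assert (H0 := blaschke_den_neq_0 d a z Hd Ha Hz).
  assert (Pa := Wmap_Re_pos d a Hd Ha). assert (Pz := Wmap_Re_pos d z Hd Hz).
  unfold blaschke. rewrite Cmod_mult, Cmod_inv by auto.
  set (u := Wmap d z) in *. set (v := Wmap d a) in *.
  assert (Hm : 0 < Cmod (u + Cconj v)) by (apply Cmod_gt_0; auto).
  apply Rmult_le_reg_r with (Cmod (u + Cconj v)); auto. rewrite Rmult_assoc, Rinv_l by lra.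
  rewrite Rmult_1_r, Rmult_1_l. apply Rsqr_incr_0_var; [|lra]. unfold Rsqr.
  rewrite !Cmod_sqr. destruct u as [x y], v as [p q]. simpl in *. nra.
Qed.

(** For [X > 0] and [|v| = rho], the quotient [|X - v| / |X + conj v|] is smallest when [v = rho]:
    enlarging [Re v] decreases the numerator and increases the denominator. Thus complex nodes of a
    competing formula can be moved to the real axis. *)
Lemma Cmod_blaschke_R_ge (d s : R) (a : C) : 0 < d < PI -> Lambda d a ->
  Rabs (tanh (PI / (4 * d) * (s - Re (zt a)))) <= Cmod (blaschke d a (RtoC (tanh (s / 2)))).
Proof.
  intros Hd Ha. assert (Hz := Lambda_R d s (proj1 Hd)).
  assert (H0 := blaschke_den_neq_0 d a _ Hd Ha Hz). assert (Pa := Wmap_Re_pos d a Hd Ha).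
  unfold blaschke. rewrite Cmod_mult, Cmod_inv by auto. rewrite Wmap_R in *.
  assert (Hr : Cmod (Wmap d a) = exp (PI / (2 * d) * Re (zt a))) by (unfold Wmap; rewrite Cmod_Cexp, re_scal_l; auto).
  rewrite tanh_exp. replace (2 * (PI / (4 * d) * (s - Re (zt a)))) with
    (PI / (2 * d) * s + - (PI / (2 * d) * Re (zt a))) by (field; lra).
  rewrite exp_plus, exp_Ropp, <- Hr.
  assert (HX := exp_pos (PI / (2 * d) * s)). set (X := exp (PI / (2 * d) * s)) in *.
  set (v := Wmap d a) in *. assert (Hv : 0 < Cmod v) by (rewrite Hr; apply exp_pos).
  set (rho := Cmod v) in *.
  assert (Hm : 0 < Cmod (X + Cconj v)) by (apply Cmod_gt_0; auto).
  replace ((X * / rho - 1) / (X * / rho + 1)) with ((X - rho) / (X + rho)) by (field; split; nra).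
  unfold Rdiv. rewrite Rabs_mult, Rabs_inv, (Rabs_pos_eq (X + rho)) by lra.
  apply Rmult_le_reg_r with ((X + rho) * Cmod (X + Cconj v)). nra.
  replace (Rabs (X - rho) * / (X + rho) * ((X + rho) * Cmod (X + Cconj v))) with
    (Rabs (X - rho) * Cmod (X + Cconj v)) by (field; lra).
  replace (Cmod (X + - (1) * v) * / Cmod (X + Cconj v) * ((X + rho) * Cmod (X + Cconj v))) with
    (Cmod (X + - (1) * v) * (X + rho)) by (field; lra).
  assert (Hrv : rho * rho = Re v * Re v + Im v * Im v) by apply Cmod_sqr.
  assert (Hrp : Re v <= rho) by (apply Rle_trans with (1 := Rle_abs _); apply re_le_Cmod).
  apply Rsqr_incr_0_var. 2: apply Rmult_le_pos; [apply Cmod_ge_0|lra].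
  rewrite !Rsqr_mult, <- Rsqr_abs. unfold Rsqr. rewrite !Cmod_sqr.
  destruct v as [p q]. simpl in *.
  set (m := p * p + q * q) in *.
  match goal with |- _ * ?a <= ?b * _ =>
    replace a with (X * X + 2 * X * p + m) by (unfold m; ring);
    replace b with (X * X - 2 * X * p + m) by (unfold m; ring) end.
  rewrite <- Hrv.
  assert (0 <= X * (rho - p) * (X * X + rho * rho)).
  { apply Rmult_le_pos; [apply Rmult_le_pos|]; nra. }
  nra.
Qed.


(** * Lower bound for the minimum error norm *)

Lemma Rbar_sup_le {T : Type} (P : T -> Prop) (F : T -> Rbar) (M : Rbar) :
  (forall t, P t -> Rbar_le (F t) M) -> Rbar_le (Rbar_sup P F) M.
Proof.
  intros H. unfold Rbar_sup. apply (proj2 (proj2_sig (Rbar_ex_lub _))).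
  intros y [t [Ht ->]]. auto.
Qed.

Lemma Rbar_sup_ge {T : Type} (P : T -> Prop) (F : T -> Rbar) (t : T) :
  P t -> Rbar_le (F t) (Rbar_sup P F).
Proof.
  intros H. unfold Rbar_sup. apply (proj1 (proj2_sig (Rbar_ex_lub _))). exists t; auto.
Qed.

Lemma Rbar_inf_ge {T : Type} (P : T -> Prop) (F : T -> Rbar) (m : Rbar) :
  (forall t, P t -> Rbar_le m (F t)) -> Rbar_le m (Rbar_inf P F).
Proof.
  intros H. unfold Rbar_inf. apply (proj2 (proj2_sig (Rbar_ex_glb _))).
  intros y [t [Ht ->]]. auto.
Qed.

Lemma Rbar_inf_le {T : Type} (P : T -> Prop) (F : T -> Rbar) (t : T) :
  P t -> Rbar_le (Rbar_inf P F) (F t).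
Proof.
  intros H. unfold Rbar_inf. apply (proj1 (proj2_sig (Rbar_ex_glb _))). exists t; auto.
Qed.

Lemma unit_ball_intro (d mu : R) (f : C -> C) :
  analytic_on (Lambda d) f ->
  (forall z, Lambda d z -> Cmod (f z / w_mu mu z) <= 1) -> unit_ball d mu f.
Proof.
  intros Ha Hb.
  assert (H : Rbar_le (Hnorm d mu f) 1).
  { apply Rbar_sup_le. intros z Hz. simpl. auto. }
  split; auto. split; auto. apply Rbar_le_lt_trans with (Finite 1); simpl; auto.
Qed.

Lemma unit_ball_bound (d mu : R) (f : C -> C) (z : C) :
  unit_ball d mu f -> Lambda d z -> Cmod (f z / w_mu mu z) <= 1.
Proof.
  intros [_ H] Hz.
  assert (K := Rbar_sup_ge (Lambda d) (fun z => Finite (Cmod (f z / w_mu mu z))) z Hz).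
  exact (Rbar_le_trans _ _ _ K H).
Qed.

Lemma worst_error_ge (d mu : R) (Af : (C -> C) -> R -> C) (f : C -> C) (x : R) :
  unit_ball d mu f -> -1 < x < 1 ->
  Rbar_le (Cmod (f (RtoC x) - Af f x)) (worst_error d mu Af).
Proof.
  intros Hf Hx. unfold worst_error.
  refine (Rbar_le_trans _ _ _ _ (Rbar_sup_ge _ _ f Hf)).
  exact (Rbar_sup_ge _ (fun x => Finite (Cmod (f (RtoC x) - Af f x))) x Hx).
Qed.

Lemma worst_error_le (d mu : R) (Af : (C -> C) -> R -> C) (M : R) :
  (forall f x, unit_ball d mu f -> -1 < x < 1 -> Cmod (f (RtoC x) - Af f x) <= M) ->
  Rbar_le (worst_error d mu Af) M.
Proof.
  intros H. apply Rbar_sup_le. intros f Hf. apply Rbar_sup_le. intros x Hx. simpl. auto.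
Qed.

Definition Cprod {I : Type} (s : list I) (F : I -> C) : C := fold_right Cmult (RtoC 1) (map F s).

Lemma smooth_Cprod {I : Type} (D : C -> Prop) (s : list I) (F : I -> C -> C) :
  (forall i, In i s -> smooth D (F i)) -> smooth D (fun z => Cprod s (fun i => F i z)).
Proof.
  induction s as [|i s IH]; intros H.
  - apply (smooth_const D 1).
  - apply (smooth_mult D (F i) (fun z => Cprod s (fun i => F i z))).
    apply H; left; auto. apply IH. intros; apply H; right; auto.
Qed.

Lemma Cprod_cons {I : Type} (i : I) (s : list I) (F : I -> C) :
  Cprod (i :: s) F = (F i * Cprod s F)%C.
Proof. reflexivity. Qed.

Lemma Cprod_ext {I : Type} (s : list I) (F G : I -> C) :
  (forall i, In i s -> F i = G i) -> Cprod s F = Cprod s G.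
Proof. intros H. unfold Cprod. f_equal. apply map_ext_in. exact H. Qed.

Lemma Cprod_neq_0 {I : Type} (s : list I) (F : I -> C) :
  (forall i, In i s -> F i <> 0) -> Cprod s F <> 0.
Proof.
  induction s as [|i s IH]; intros H.
  - unfold Cprod; simpl. intros E. apply RtoC_inj in E. lra.
  - rewrite Cprod_cons. apply Cmult_neq_0. apply H; left; auto.
    apply IH. intros; apply H; right; auto.
Qed.

Lemma Cmod_Cprod {I : Type} (s : list I) (F : I -> C) :
  Cmod (Cprod s F) = Rprod s (fun i => Cmod (F i)).
Proof.
  induction s as [|i s IH]. apply Cmod_1. rewrite Cprod_cons, Cmod_mult, IH. reflexivity.
Qed.

Lemma Cprod_RtoC {I : Type} (s : list I) (F : I -> R) :
  Cprod s (fun i => RtoC (F i)) = RtoC (Rprod s F).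
Proof.
  induction s as [|i s IH]. reflexivity. rewrite Cprod_cons, Rprod_cons, RtoC_mult, IH. auto.
Qed.

Lemma Cprod_factor {I : Type} (D : C -> Prop) (s : list I) (F : I -> C -> C) (i : I) :
  (forall j, In j s -> smooth D (F j)) -> In i s ->
  exists g, smooth D g /\ forall z, Cprod s (fun j => F j z) = (F i z * g z)%C.
Proof.
  induction s as [|j s IH]; intros H Hi. destruct Hi.
  destruct Hi as [->|Hi].
  - exists (fun z => Cprod s (fun j => F j z)). split; auto.
    apply smooth_Cprod. intros; apply H; right; auto.
  - destruct IH as [g [Hg E]]; auto. intros; apply H; right; auto.
    exists (fun z => F j z * g z)%C. split.
    apply smooth_mult; auto. apply H; left; auto.
    intros z. rewrite Cprod_cons, E. ring.
Qed.

Lemma Csum_0 {I : Type} (s : list I) (F : I -> C) :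
  (forall i, In i s -> F i = 0) -> Csum s F = 0.
Proof.
  induction s as [|i s IH]; intros H. reflexivity.
  unfold Csum in *; simpl. rewrite H by (left; auto). rewrite IH. ring.
  intros; apply H; right; auto.
Qed.

Lemma Rprod_ge {I : Type} (s : list I) (F G : I -> R) :
  (forall i, In i s -> 0 <= F i <= G i) -> Rprod s F <= Rprod s G.
Proof.
  induction s as [|i s IH]; intros H. right; reflexivity.
  rewrite !Rprod_cons. apply Rmult_le_compat.
  - apply H; left; auto.
  - apply Rprod_nonneg. intros; apply H; right; auto.
  - apply H; left; auto.
  - apply IH. intros; apply H; right; auto.
Qed.

Lemma Rprod_flat_map_repeat {I : Type} (s : list I) (t : I -> R) (m : I -> nat) (F : R -> R) :
  Rprod (flat_map (fun j => repeat (t j) (m j)) s) F = Rprod s (fun j => F (t j) ^ m j).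
Proof.
  induction s as [|j s IH]. reflexivity.
  simpl flat_map. rewrite Rprod_app, Rprod_cons, IH. f_equal.
  induction (m j) as [|n IHn]. reflexivity. simpl repeat. rewrite Rprod_cons, IHn. reflexivity.
Qed.

Lemma length_flat_map_repeat {I : Type} (s : list I) (t : I -> R) (m : I -> nat) :
  length (flat_map (fun j => repeat (t j) (m j)) s) = list_sum (map m s).
Proof.
  induction s as [|j s IH]. reflexivity.
  simpl. rewrite length_app, repeat_length, IH. reflexivity.
Qed.

Definition test_function (d mu : R) (l : nat) (m : nat -> nat) (a : nat -> C) (z : C) : C :=
  (cosh_pow (- mu) z * Cprod (seq 1 l) (fun j => blaschke d (a j) z ^ m j))%C.

Lemma Lambda_zt_dom (d : R) (z : C) : d < PI -> Lambda d z -> zt_dom z.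
Proof. intros Hd Hz. apply Lambda_iff in Hz; [tauto|auto]. Qed.

Lemma test_function_unit_ball (d mu : R) (l : nat) (m : nat -> nat) (a : nat -> C) :
  0 < d < PI -> (forall j, (1 <= j <= l)%nat -> Lambda d (a j)) ->
  unit_ball d mu (test_function d mu l m a).
Proof.
  intros Hd Ha. apply unit_ball_intro.
  - apply smooth_analytic. apply smooth_mult.
    + apply smooth_cosh_pow. intros z; apply Lambda_zt_dom; lra.
    + apply smooth_Cprod. intros j Hj. apply in_seq in Hj. apply smooth_pow, smooth_blaschke; auto.
      apply Ha; lia.
  - intros z Hz. assert (Hzd := Lambda_zt_dom d z (proj2 Hd) Hz).
    assert (Hw : Cmod (w_mu mu z) = Cmod (cosh_pow (- mu) z)) by (rewrite Cmod_w_mu, Cmod_cosh_pow; auto).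
    assert (Hp : 0 < Cmod (w_mu mu z)) by (rewrite Hw, Cmod_cosh_pow; apply exp_pos).
    rewrite Cmod_div by (apply Cmod_gt_0; auto). unfold test_function.
    rewrite Cmod_mult, <- Hw, Cmod_Cprod.
    unfold Rdiv. replace (Cmod (w_mu mu z) * _ * / Cmod (w_mu mu z)) with
      (Rprod (seq 1 l) (fun i => Cmod (blaschke d (a i) z ^ m i))) by (field; lra).
    rewrite <- (pow1 (length (seq 1 l))). apply Rprod_le_pow. intros j Hj. apply in_seq in Hj.
    split. apply Cmod_ge_0. rewrite Cmod_pow. rewrite <- (pow1 (m j)). apply pow_incr.
    split. apply Cmod_ge_0. apply Cmod_blaschke_le_1; auto. apply Ha; lia.
Qed.

(** The factor with index [j] gives a zero of order at least [m j] at [a j], and the formula samples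
    derivatives of order below [m j] only. *)
Lemma test_function_Hermite_zero (d mu : R) (l : nat) (m : nat -> nat) (a : nat -> C) phi x :
  0 < d < PI -> (forall j, (1 <= j <= l)%nat -> Lambda d (a j)) ->
  Hermite_formula l m a phi (test_function d mu l m a) x = 0.
Proof.
  intros Hd Ha. unfold Hermite_formula. apply Csum_0. intros j Hj. apply in_seq in Hj.
  apply Csum_0. intros k Hk. apply in_seq in Hk.
  assert (Haj : Lambda d (a j)) by (apply Ha; lia).
  destruct (Cprod_factor (Lambda d) (seq 1 l) (fun j z => blaschke d (a j) z ^ m j)%C j) as [g [Hg E]].
  { intros i Hi. apply in_seq in Hi. apply smooth_pow, smooth_blaschke; auto. apply Ha; lia. }
  { apply in_seq; lia. }
  destruct (C_derive_n_vanish (Lambda d) (blaschke d (a j)) (m j) k (test_function d mu l m a)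
    (fun z => cosh_pow (- mu) z * g z)%C) as [h [_ H]].
  - apply Lambda_open; lra.
  - apply smooth_blaschke; auto.
  - apply smooth_mult; auto. apply smooth_cosh_pow. intros z; apply Lambda_zt_dom; lra.
  - lia.
  - intros z Hz. unfold test_function. rewrite E. ring.
  - rewrite H by auto. rewrite blaschke_zero. replace (m j - k)%nat with (S (m j - k - 1)) by lia.
    simpl. ring.
Qed.

Lemma Emin_lower_bound (d mu : R) (N : nat) : 0 < d < PI -> 0 < mu -> (0 < N)%nat ->
  Rbar_le (/ 2 * exp (- sqrt (PI * d * mu * INR N))) (Emin (2 * N) d mu).
Proof.
  intros Hd Hmu HN. unfold Emin.
  apply Rbar_inf_ge. intros l Hl. apply Rbar_inf_ge. intros m Hm.
  apply Rbar_inf_ge. intros a Ha. apply Rbar_inf_ge. intros phi _.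
  (* Every node is listed with its multiplicity and enters only through the real part of its strip
     coordinate, the worst case by [Cmod_blaschke_R_ge]. *)
  set (ts := flat_map (fun j => repeat (Re (zt (a j))) (m j)) (seq 1 l)).
  assert (Hts : length ts = (2 * N)%nat) by (unfold ts; rewrite length_flat_map_repeat; auto).
  destruct (weighted_tanh_product_lower d mu N ts (proj1 Hd) Hmu HN Hts) as [s Hs].
  assert (W := worst_error_ge d mu (Hermite_formula l m a phi) (test_function d mu l m a)
    (tanh (s / 2)) (test_function_unit_ball d mu l m a Hd Ha) (tanh_bounds _)).
  refine (Rbar_le_trans _ _ _ _ W). simpl.
  rewrite test_function_Hermite_zero by auto.
  apply Rle_trans with (1 := Hs).
  replace (test_function d mu l m a (tanh (s / 2)) - 0)%C with (test_function d mu l m a (tanh (s / 2))) by ring.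
  unfold test_function. rewrite Cmod_mult, cosh_pow_R, Cmod_R, Cmod_Cprod.
  rewrite (Rabs_pos_eq (Rpower _ _)) by (left; apply exp_pos).
  apply Rmult_le_compat_l. left; apply exp_pos.
  unfold ts. rewrite Rprod_flat_map_repeat. apply Rprod_ge. intros j Hj. apply in_seq in Hj. split.
  - apply pow_le, Rabs_pos.
  - rewrite Cmod_pow. apply pow_incr. split. apply Rabs_pos.
    apply Cmod_blaschke_R_ge; auto. apply Ha; lia.
Qed.


(** * The formula as a Hermite formula with analytic coefficients *)

Lemma is_derive_Re_line (F : C -> C) (z0 w l : C) (t : R) :
  cd F (z0 + t * w)%C l -> is_derive (fun t : R => Re (F (z0 + t * w)%C)) t (Re (l * w)%C).
Proof.
  intros [phi [H1 [H2 H3]]]. apply is_derive_Reals. intros eps He.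
  assert (Hw := Cmod_ge_0 w).
  destruct (H3 (eps / (Cmod w + 1))) as [d [D E]]. apply Rdiv_lt_0_compat; lra.
  assert (D' : 0 < d / (Cmod w + 1)) by (apply Rdiv_lt_0_compat; lra).
  exists (mkposreal _ D'). intros h Hh Hhd. simpl in Hhd.
  set (u := (z0 + RtoC (t + h) * w)%C). set (v := (z0 + t * w)%C) in *.
  assert (Huv : (u - v)%C = (h * w)%C) by (unfold u, v; rewrite RtoC_plus; ring).
  assert (Huv2 : Cmod (u - v) < d).
  { rewrite Huv, Cmod_mult, Cmod_R. assert (Hhp := Rabs_pos h).
    assert (Rabs h * (Cmod w + 1) < d); [|nra].
    apply Rmult_lt_compat_r with (r := Cmod w + 1) in Hhd; [|lra].
    replace (d / (Cmod w + 1) * (Cmod w + 1)) with d in Hhd by (field; lra). auto. }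
  specialize (E u Huv2). rewrite H2 in E.
  assert (EF : Re (F u) - Re (F v) = h * Re (phi u * w)%C).
  { rewrite (H1 u), Huv, re_plus. replace (phi u * (h * w))%C with (h * (phi u * w))%C by ring.
    rewrite re_scal_l. ring. }
  rewrite EF. replace (h * Re (phi u * w)%C / h - Re (l * w)%C) with (Re ((phi u - l) * w)%C).
  - apply Rle_lt_trans with (1 := re_le_Cmod _). rewrite Cmod_mult.
    assert (Hp := Cmod_ge_0 (phi u - l)).
    apply Rmult_lt_compat_r with (r := Cmod w + 1) in E; [|lra].
    replace (eps / (Cmod w + 1) * (Cmod w + 1)) with eps in E by (field; lra). nra.
  - replace ((phi u - l) * w)%C with (phi u * w - l * w)%C by ring.
    unfold Cminus. rewrite re_plus, re_opp. field. auto.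
Qed.

(** Multiplying by the conjugate of the total increment reduces the claim to the real mean value
    inequality along the segment, without loss of a constant. *)
Lemma cd_mean_value (F F' : C -> C) (z0 z : C) (M : R) :
  (forall t : R, 0 <= t <= 1 -> cd F (z0 + t * (z - z0))%C (F' (z0 + t * (z - z0))%C)) ->
  (forall t : R, 0 <= t <= 1 -> Cmod (F' (z0 + t * (z - z0))%C) <= M) ->
  Cmod (F z - F z0) <= M * Cmod (z - z0).
Proof.
  intros Hd HM. set (c := (F z - F z0)%C). set (w := (z - z0)%C) in *.
  assert (HM0 : 0 <= M) by (apply Rle_trans with (2 := HM 0 ltac:(lra)); apply Cmod_ge_0).
  destruct (Req_dec (Cmod c) 0) as [E|E].
  { rewrite E. apply Rmult_le_pos; auto. apply Cmod_ge_0. }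
  assert (Hc : 0 < Cmod c) by (generalize (Cmod_ge_0 c); lra).
  assert (K := mean_value_le (fun t : R => Re (Cconj c * F (z0 + t * w))%C)
    (fun t => Re (Cconj c * F' (z0 + t * w) * w)%C) 0 1 (Cmod c * (M * Cmod w)) ltac:(lra)).
  cbv beta in K.
  replace (z0 + 1 * w)%C with z in K by (unfold w; ring).
  replace (z0 + 0 * w)%C with z0 in K by ring.
  assert (K2 : Re (Cconj c * F z)%C - Re (Cconj c * F z0)%C <= Cmod c * (M * Cmod w) * (1 - 0)).
  { apply K.
    - intros t Ht. apply (is_derive_Re_line (fun u => Cconj c * F u)%C).
      apply cd_eq with (0 * F (z0 + t * w) + Cconj c * F' (z0 + t * w))%C; [|ring].
      apply (cd_mult (fun _ => Cconj c) F). apply cd_const. apply Hd; auto.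
    - intros t Ht. apply Rle_trans with (1 := Rle_abs _). apply Rle_trans with (1 := re_le_Cmod _).
      rewrite !Cmod_mult, Cmod_conj, Rmult_assoc. apply Rmult_le_compat_l. lra.
      apply Rmult_le_compat_r. apply Cmod_ge_0. apply HM; lra. }
  replace (Re (Cconj c * F z)%C - Re (Cconj c * F z0)%C) with (Cmod c * Cmod c) in K2.
  - apply Rmult_le_reg_l with (Cmod c); auto. lra.
  - rewrite Cmod_sqr. transitivity (Re (Cconj c * (F z - F z0))%C).
    + fold c. rewrite re_mult, re_conj, im_conj. ring.
    + replace (Cconj c * (F z - F z0))%C with (Cconj c * F z - Cconj c * F z0)%C by ring.
      unfold Cminus. rewrite re_plus, re_opp. ring.
Qed.

Lemma C_real_eq (z : C) : Im z = 0 -> RtoC (Re z) = z.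
Proof. destruct z as [u v]; simpl. intros ->. reflexivity. Qed.

Lemma cd_minus_quadratic (T : C -> C) (a c b z l : C) : cd T z l ->
  cd (fun z => T z - a * (z - b) - c * ((z - b) * (z - b)))%C z (l - a - c * (2 * (z - b)))%C.
Proof.
  intros H. assert (Hb : cd (fun z => z - b)%C z (1 - 0)%C) by (apply cd_minus; [apply cd_id|apply cd_const]).
  apply cd_eq with (l - (0 * (z - b) + a * (1 - 0)) -
    (0 * ((z - b) * (z - b)) + c * ((1 - 0) * (z - b) + (z - b) * (1 - 0))))%C; [|ring].
  apply (cd_minus (fun z => T z - a * (z - b))%C (fun z => c * ((z - b) * (z - b)))%C).
  - apply (cd_minus T (fun z => a * (z - b))%C); auto.
    apply (cd_mult (fun _ => a) (fun z => z - b)%C); auto. apply cd_const.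
  - apply (cd_mult (fun _ => c) (fun z => (z - b) * (z - b))%C). apply cd_const.
    apply (cd_mult (fun z => z - b)%C (fun z => z - b)%C); auto.
Qed.

(** The singularity is filled with the first derivative [T1 b]. Differentiability there, with
    derivative [T2 b / 2], comes from a second-order Taylor estimate, since a [smooth] function has
    as many derivatives as desired. *)
Lemma removable_quotient (D : C -> Prop) (T : C -> C) (b : C) :
  Copen D -> smooth D T -> D b -> T b = 0 ->
  exists Q, (forall z, D z -> exists l, cd Q z l) /\ (forall z, z <> b -> Q z = (T z / (z - b))%C).
Proof.
  intros HD HT Hb H0.
  destruct (smooth_cd D T HT) as [T1 [HT1 d1]]. destruct (smooth_cd D T1 HT1) as [T2 [_ d2]].
  exists (fun z => if Ceq_dec z b then T1 b else (T z / (z - b))%C). split.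
  2:{ intros z Hz. destruct (Ceq_dec z b); [contradiction|auto]. }
  intros z Hz. destruct (Ceq_dec z b) as [->|Hzb].
  - exists (T2 b / 2)%C.
    exists (fun w => if Ceq_dec w b then (T2 b / 2)%C else ((T w / (w - b) - T1 b) / (w - b))%C).
    split; [|split].
    + intros w. destruct (Ceq_dec b b); [|tauto]. destruct (Ceq_dec w b) as [->|Hw]. ring.
      assert (Hn := Cminus_eq_contra _ _ Hw). field; auto.
    + destruct (Ceq_dec b b); tauto.
    + intros eps He. destruct (d2 b Hb) as [p [P1 [P2 P3]]].
      destruct (P3 (eps / 2) ltac:(lra)) as [r1 [R1 E1]].
      destruct (HD b Hb) as [r2 [R2 E2]].
      exists (Rmin r1 r2). split. apply Rmin_pos; auto. intros w Hw.
      assert (h1 := Rlt_le_trans _ _ _ Hw (Rmin_l _ _)). assert (h2 := Rlt_le_trans _ _ _ Hw (Rmin_r _ _)).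
      destruct (Ceq_dec b b); [|tauto]. destruct (Ceq_dec w b) as [->|Hwb].
      { replace (T2 b / 2 - T2 b / 2)%C with (RtoC 0) by ring. rewrite Cmod_0; auto. }
      assert (Hn := Cminus_eq_contra _ _ Hwb).
      assert (Hseg : forall t : R, 0 <= t <= 1 -> Cmod ((b + t * (w - b)) - b) <= Cmod (w - b)).
      { intros t Ht. replace (b + t * (w - b) - b)%C with (t * (w - b))%C by ring.
        rewrite Cmod_mult, Cmod_R, Rabs_pos_eq by lra. generalize (Cmod_ge_0 (w - b)); nra. }
      (* The Taylor remainder has derivative [o (|z - b|)] on the segment, so the mean value
         inequality makes the remainder [o (|w - b| ^ 2)]. *)
      assert (K := cd_mean_value (fun z => T z - T1 b * (z - b) - T2 b / 2 * ((z - b) * (z - b)))%C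
        (fun z => T1 z - T1 b - T2 b * (z - b))%C b w (eps / 2 * Cmod (w - b))).
      cbv beta in K.
      assert (K2 := K ltac:(intros t Ht;
        apply cd_eq with (T1 (b + t * (w - b)) - T1 b - T2 b / 2 * (2 * ((b + t * (w - b)) - b)))%C;
        [apply cd_minus_quadratic, d1, E2; generalize (Hseg t Ht); lra | field; exact C2_neq_0])).
      clear K. rewrite H0 in K2.
      replace (0 - T1 b * (b - b) - T2 b / 2 * ((b - b) * (b - b)))%C with (RtoC 0) in K2 by ring.
      replace ((T w / (w - b) - T1 b) / (w - b) - T2 b / 2)%C with
        ((T w - T1 b * (w - b) - T2 b / 2 * ((w - b) * (w - b)) - 0) / ((w - b) * (w - b)))%C
        by (field; auto).
      rewrite Cmod_div by (apply Cmult_neq_0; auto). rewrite (Cmod_mult (w - b) (w - b)).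
      assert (0 < Cmod (w - b)) by (apply Cmod_gt_0; auto).
      apply Rle_lt_trans with (eps / 2); [|lra].
      apply Rmult_le_reg_r with (Cmod (w - b) * Cmod (w - b)). nra.
      unfold Rdiv at 1. rewrite Rmult_assoc, Rinv_l by nra. rewrite Rmult_1_r, <- Rmult_assoc.
      apply K2. intros t Ht.
      rewrite (P1 (b + t * (w - b))%C).
      replace (T1 b + p (b + t * (w - b)) * (b + t * (w - b) - b) - T1 b - T2 b * (b + t * (w - b) - b))%C
        with ((p (b + t * (w - b)) - T2 b) * (b + t * (w - b) - b))%C by ring.
      rewrite Cmod_mult. apply Rmult_le_compat; try apply Cmod_ge_0; [|apply Hseg; auto].
      left. rewrite <- P2. apply E1. generalize (Hseg t Ht); lra.
  - assert (Hn := Cminus_eq_contra _ _ Hzb).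
    exists (T1 z * / (z - b) + T z * (- (1 - 0) / ((z - b) * (z - b))))%C.
    apply cd_ext_loc with (fun z => T z * / (z - b))%C.
    + exists (Cmod (z - b)). split. apply Cmod_gt_0; auto. intros w Hw.
      destruct (Ceq_dec w b) as [->|]; auto. rewrite Cmod_minus_sym in Hw. lra.
    + apply (cd_mult T (fun z => / (z - b))%C); auto.
      apply (cd_inv (fun z => z - b)%C); auto. apply cd_minus. apply cd_id. apply cd_const.
Qed.

Lemma in_nonzero_indices (N : nat) (k : Z) :
  In k (nonzero_indices N) <-> (k <> 0 /\ (Z.abs k <= Z.of_nat N))%Z.
Proof.
  unfold nonzero_indices. rewrite in_flat_map. split.
  - intros [n [Hn Hk]]. apply in_seq in Hn. simpl in Hk. destruct Hk as [<-|[<-|[]]]; lia.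
  - intros [H1 H2]. exists (Z.to_nat (Z.abs k)). split. apply in_seq; lia. simpl.
    rewrite Z2Nat.id by lia. lia.
Qed.

Lemma NoDup_nonzero_indices (N : nat) : NoDup (nonzero_indices N).
Proof.
  unfold nonzero_indices.
  assert (H : forall n m, (1 <= n)%nat -> NoDup (flat_map (fun k => [(- Z.of_nat k)%Z; Z.of_nat k]) (seq n m)) /\
     forall x, In x (flat_map (fun k => [(- Z.of_nat k)%Z; Z.of_nat k]) (seq n m)) -> (Z.of_nat n <= Z.abs x)%Z).
  { intros n m. revert n. induction m as [|m IH]; intros n Hn.
    - split. constructor. intros x [].
    - destruct (IH (S n)) as [I1 I2]; [lia|]. simpl. split.
      + constructor. 2: constructor; auto.
        * simpl. intros [E|E]. lia. apply I2 in E. lia.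
        * intros E. apply I2 in E. lia.
      + intros x [<-|[<-|E]]; try lia. apply I2 in E. lia. }
  apply H; auto.
Qed.

Lemma length_nonzero_indices (N : nat) : length (nonzero_indices N) = (2 * N)%nat.
Proof.
  unfold nonzero_indices. rewrite <- (length_seq N 1) at 2. induction (seq 1 N) as [|k s IH]. reflexivity.
  simpl flat_map. cbn [length]. rewrite IH. lia.
Qed.

Lemma Rprod_filter_out (s : list Z) (k : Z) (F : Z -> R) : NoDup s -> In k s ->
  Rprod s F = F k * Rprod (filter (fun l => negb (l =? k)%Z) s) F.
Proof.
  intros Hs Hk. induction Hs as [|j s Hj Hs IH]. destruct Hk.
  simpl filter. destruct (Z.eqb_spec j k) as [->|Hjk]; simpl negb; cbn iota.
  - rewrite Rprod_cons. f_equal. f_equal. clear IH Hk. induction s as [|i s IHs]. reflexivity.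
    simpl. destruct (Z.eqb_spec i k) as [->|]. exfalso; apply Hj; left; auto.
    simpl. f_equal. apply IHs. intros h; apply Hj; right; auto. inversion Hs; auto.
  - destruct Hk as [->|Hk]; [tauto|]. rewrite !Rprod_cons, IH by auto. ring.
Qed.

Lemma blaschke_RR (d s t : R) : 0 < d ->
  blaschke d (RtoC (tanh (t / 2))) (RtoC (tanh (s / 2))) = RtoC (tanh (PI / (4 * d) * (s - t))).
Proof.
  intros Hd. unfold blaschke. rewrite !Wmap_R.
  set (X := exp (PI / (2 * d) * s)). set (Y := exp (PI / (2 * d) * t)).
  assert (HX : 0 < X) by apply exp_pos. assert (HY : 0 < Y) by apply exp_pos.
  replace (Cconj Y) with (RtoC Y) by (unfold Cconj, RtoC; simpl; f_equal; ring).
  rewrite tanh_exp. replace (2 * (PI / (4 * d) * (s - t))) with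
    (PI / (2 * d) * s + - (PI / (2 * d) * t)) by (field; lra).
  rewrite exp_plus, exp_Ropp. fold X Y.
  rewrite <- RtoC_opp, <- RtoC_mult, <- !RtoC_plus, <- RtoC_inv, <- RtoC_mult by lra.
  f_equal. field. split; nra.
Qed.

Lemma one_minus_tanh_sqr (x : R) : 1 - tanh x ^ 2 = / (cosh x * cosh x).
Proof.
  unfold tanh. assert (H := cosh_sqr x). assert (P := cosh_pos x).
  replace (1 - (sinh x / cosh x) ^ 2) with ((cosh x * cosh x - sinh x * sinh x) / (cosh x * cosh x)) by (field; lra).
  replace (cosh x * cosh x - sinh x * sinh x) with 1 by lra. unfold Rdiv. ring.
Qed.

Lemma Rpower_one_minus_tanh_sqr (x p : R) : Rpower (1 - tanh x ^ 2) p = Rpower (cosh x) (- (2 * p)).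
Proof.
  assert (P := cosh_pos x). rewrite one_minus_tanh_sqr. unfold Rpower.
  rewrite ln_Rinv, ln_mult by nra. f_equal. ring.
Qed.

(** The coefficients of the formula are defined on [(-1, 1)] only, whereas a competitor in [Emin]
    needs functions analytic on the region. One Blaschke factor cancels the pole at the node, the
    others stay as a product, and [(1 - x ^ 2) ^ nu] becomes [cosh_pow (- (2 * nu))]. *)
Lemma coefficient_function (d r nu : R) (N : nat) (k : Z) :
  0 < d < PI -> In k (nonzero_indices N) ->
  exists phi, (forall z, Lambda d z -> exists l, cd phi z l) /\
    forall x, -1 < x < 1 ->
      phi (RtoC x) = RtoC (2 * d * sigma_k r N k / PI *
           (Rpower (1 - x ^ 2) nu / Rpower (1 - beta_k d r N k ^ 2) (nu - 1)) * B_quot d r N k x).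
Proof.
  intros Hd Hk. set (beta := beta_k d r N k).
  assert (Hb : beta = tanh (node d r N k / 2)) by apply beta_k_node.
  assert (HbL : Lambda d (RtoC beta)) by (rewrite Hb; apply Lambda_R; lra).
  destruct (removable_quotient (Lambda d) (blaschke d (RtoC beta)) (RtoC beta)) as [Q [Q1 Q2]]; auto.
  { apply Lambda_open; lra. } { apply smooth_blaschke; auto. } { apply blaschke_zero. }
  set (others := filter (fun l => negb (l =? k)%Z) (nonzero_indices N)).
  set (P := fun z => Cprod others (fun l => blaschke d (RtoC (beta_k d r N l)) z)).
  assert (HP : smooth (Lambda d) P).
  { apply smooth_Cprod. intros l _. apply smooth_blaschke; auto. rewrite beta_k_node. apply Lambda_R; lra. }
  assert (HPx : forall s, P (RtoC (tanh (s / 2))) = RtoC (Rprod others (fun l => tanh (PI / (4 * d) * (s - node d r N l))))).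
  { intros s. unfold P. rewrite <- Cprod_RtoC. apply Cprod_ext. intros l _.
    rewrite beta_k_node. apply blaschke_RR; lra. }
  assert (Hq : forall x, -1 < x < 1 -> x <> beta ->
    (P (RtoC x) * Q (RtoC x))%C = RtoC (B_N d r N x / (x - beta))).
  { intros x Hx Hxb. rewrite Q2 by (intros E; apply Hxb, RtoC_inj; auto).
    destruct (tanh_half_surj x Hx) as [s ->]. rewrite HPx, B_N_tanh by lra.
    rewrite Hb, blaschke_RR by lra. rewrite <- Hb.
    rewrite (Rprod_filter_out (nonzero_indices N) k) by (auto; apply NoDup_nonzero_indices).
    fold others. rewrite <- RtoC_minus, <- RtoC_div, <- RtoC_mult by lra. f_equal. field. lra. }
  assert (HB : forall x, -1 < x < 1 -> RtoC (B_quot d r N k x) = (P (RtoC x) * Q (RtoC x))%C).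
  { intros x Hx. unfold B_quot. fold beta. destruct (Req_EM_T x beta) as [->|Hxb].
    2: rewrite Hq; auto.
    destruct (smooth_cd _ _ HP) as [P' [_ dP]]. destruct (Q1 _ HbL) as [q' dQ].
    assert (Cont : cc (fun z => P z * Q z)%C (RtoC beta)).
    { apply cc_mult. apply (cd_cc _ _ _ (dP _ HbL)). apply (cd_cc _ _ _ dQ). }
    (* Identifies the [Lim] inside [B_quot]: off the node the quotient agrees with [P * Q], which is
       continuous at the node. *)
    assert (Hlim : is_lim (fun y => B_N d r N y / (y - beta)) beta (Re (P (RtoC beta) * Q (RtoC beta))%C)).
    { apply is_lim_spec. intros eps. simpl.
      destruct (Cont eps (cond_pos eps)) as [dl [Dl E]].
      assert (Hr : 0 < Rmin dl (Rmin (1 - beta) (beta + 1))) by (repeat apply Rmin_pos; lra).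
      exists (mkposreal _ Hr). intros y Hy Hyb.
      change (Rabs (y - beta) < Rmin dl (Rmin (1 - beta) (beta + 1))) in Hy.
      assert (h1 := Rlt_le_trans _ _ _ Hy (Rmin_l _ _)).
      assert (h2 := Rlt_le_trans _ _ _ Hy (Rle_trans _ _ _ (Rmin_r _ _) (Rmin_l _ _))).
      assert (h3 := Rlt_le_trans _ _ _ Hy (Rle_trans _ _ _ (Rmin_r _ _) (Rmin_r _ _))).
      apply Rabs_def2 in h2. apply Rabs_def2 in h3.
      specialize (E (RtoC y)). rewrite <- RtoC_minus, Cmod_R in E. specialize (E h1).
      rewrite Hq in E by lra. apply Rle_lt_trans with (2 := E).
      apply Rle_trans with (2 := re_le_Cmod _). unfold Cminus. rewrite re_plus, re_opp. simpl.
      right; auto. }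
    apply is_lim_unique in Hlim. rewrite Hlim. cbn [real]. apply C_real_eq.
    (* The limit of real quotients is real. *)
    apply NNPP. intros Hne. destruct (Cont (Rabs (Im (P (RtoC beta) * Q (RtoC beta))%C))) as [dl [Dl E]].
      apply Rabs_pos_lt; auto.
      set (e := Rmin dl (1 - beta)). assert (He : 0 < e) by (apply Rmin_pos; lra).
      assert (h1 : e <= dl) by apply Rmin_l. assert (h2 : e <= 1 - beta) by apply Rmin_r.
      specialize (E (RtoC (beta + e / 2))). rewrite <- RtoC_minus, Cmod_R in E.
      rewrite Hq in E by lra. specialize (E ltac:(rewrite Rabs_pos_eq; lra)).
      assert (F := im_le_Cmod (RtoC (B_N d r N (beta + e / 2) / (beta + e / 2 - beta)) - P (RtoC beta) * Q (RtoC beta))).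
      unfold Cminus in F at 1. rewrite im_plus, im_opp, im_RtoC, Rplus_0_l, Rabs_Ropp in F. lra. }
  exists (fun z => RtoC (2 * d * sigma_k r N k / PI / Rpower (1 - beta ^ 2) (nu - 1)) *
    (cosh_pow (- (2 * nu)) z * (P z * Q z)))%C. split.
  - intros z Hz.
    destruct (smooth_cd _ _ HP) as [P' [_ dP]]. destruct (Q1 z Hz) as [q' dQ].
    assert (HC : smooth (Lambda d) (cosh_pow (- (2 * nu)))).
    { apply smooth_cosh_pow. intros w; apply Lambda_zt_dom; lra. }
    destruct (smooth_cd _ _ HC) as [C' [_ dC]].
    eexists. apply (cd_mult (fun _ => _)). apply cd_const.
    apply (cd_mult (cosh_pow (- (2 * nu))) (fun z => P z * Q z)%C). apply dC; auto.
    apply (cd_mult P Q). apply dP; auto. apply dQ.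
  - intros x Hx. rewrite <- HB by auto.
    destruct (tanh_half_surj x Hx) as [s ->]. rewrite cosh_pow_R, <- Rpower_one_minus_tanh_sqr.
    rewrite <- !RtoC_mult. f_equal. field. split. apply Rgt_not_eq, exp_pos. apply PI_neq0.
Qed.

(** Choice along a finite list. Nonemptiness provides the default value of [F] off the list, since
    [B] could be empty. *)
Lemma finite_choice_Z {B : Type} (s : list Z) (R : Z -> B -> Prop) :
  (forall k, In k s -> exists b, R k b) -> s <> [] ->
  exists F, forall k, In k s -> R k (F k).
Proof.
  induction s as [|k s IH]; intros H Hs; [tauto|].
  destruct (H k (or_introl eq_refl)) as [b Hb].
  destruct s as [|j s].
  - exists (fun _ => b). intros i [<-|[]]. exact Hb.
  - destruct IH as [F HF]. intros i Hi; apply H; right; exact Hi. discriminate.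
    exists (fun i => if Z.eq_dec i k then b else F i). intros i Hi.
    destruct (Z.eq_dec i k) as [->|Hik]. exact Hb.
    apply HF. destruct Hi as [<-|Hi]; [tauto|exact Hi].
Qed.

Lemma map_nth_seq_id {T : Type} (s : list T) (x0 : T) :
  map (fun j => nth (j - 1) s x0) (seq 1 (length s)) = s.
Proof.
  rewrite <- seq_shift, map_map.
  rewrite (map_ext _ (fun j => nth j s x0)) by (intros; f_equal; lia).
  induction s as [|x s IH]. reflexivity.
  simpl. f_equal. rewrite <- seq_shift, map_map. exact IH.
Qed.

Lemma Emin_le_worst_error (d mu nu : R) (N : nat) : 0 < d < PI -> 0 < mu -> (0 < N)%nat ->
  Rbar_le (Emin (2 * N) d mu) (worst_error d mu (f_tilde d (d * mu / PI) nu N)).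
Proof.
  intros Hd Hmu HN. set (r := d * mu / PI). set (s := nonzero_indices N).
  assert (HL := length_nonzero_indices N). fold s in HL.
  destruct (finite_choice_Z s _ (fun k Hk => coefficient_function d r nu N k Hd Hk) ltac:(intros E; rewrite E in HL; simpl in HL; lia)) as [Phi HPhi].
  (* The formula becomes a Hermite formula with [2 N] simple nodes. Those are numbered from 1 and
     list positions from 0, hence [j - 1]. *)
  set (key := fun j : nat => nth (j - 1) s 0%Z).
  assert (Hkey : forall j, (1 <= j <= 2 * N)%nat -> In (key j) s).
  { intros j Hj. apply nth_In. rewrite HL. lia. }
  unfold Emin.
  refine (Rbar_le_trans _ _ _ (Rbar_inf_le _ _ (2 * N)%nat _) _); [lia|].
  refine (Rbar_le_trans _ _ _ (Rbar_inf_le _ _ (fun _ => 1%nat) _) _).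
  { assert (G : forall a n, list_sum (map (fun _ : nat => 1%nat) (seq a n)) = n).
    { intros a n. revert a. induction n as [|n IH]; intros a. reflexivity. simpl. rewrite IH. reflexivity. }
    apply G. }
  refine (Rbar_le_trans _ _ _ (Rbar_inf_le _ _ (fun j => RtoC (beta_k d r N (key j))) _) _).
  { intros j Hj. rewrite beta_k_node. apply Lambda_R; lra. }
  refine (Rbar_le_trans _ _ _ (Rbar_inf_le _ _ (fun j _ => Phi (key j)) _) _).
  { intros j k Hj _ z Hz. apply ex_derive_cd. apply (HPhi (key j) (Hkey j Hj)); auto. }
  apply Rbar_sup_le. intros f Hf. apply Rbar_sup_le. intros x Hx.
  replace (Hermite_formula (2 * N) (fun _ : nat => 1%nat) (fun j => RtoC (beta_k d r N (key j)))
    (fun j _ => Phi (key j)) f x) with (f_tilde d r nu N f x).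
  { apply worst_error_ge; auto. }
  unfold f_tilde, Hermite_formula. fold s. unfold Csum. f_equal.
  rewrite <- (map_nth_seq_id s 0%Z) at 1. rewrite map_map, HL. apply map_ext_in.
  intros j Hj. apply in_seq in Hj. cbn [map seq fold_right C_derive_n]. fold (key j).
  rewrite (proj2 (HPhi (key j) (Hkey j ltac:(lia))) x Hx). ring.
Qed.


(** * Cauchy's integral formula on rectangles *)

Ltac eqR := match goal with |- ?x = ?y => change (@eq R x y) end.

Definition CI (g : R -> C) (a b : R) : C :=
  (RInt (fun t => Re (g t)) a b, RInt (fun t => Im (g t)) a b).

Definition lc (g : R -> C) (a b : R) : Prop :=
  forall t, a <= t <= b ->
    continuity_pt (fun t => Re (g t)) t /\ continuity_pt (fun t => Im (g t)) t.

Lemma lc_ex_RInt (g : R -> C) (a b : R) : a <= b -> lc g a b ->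
  ex_RInt (fun t => Re (g t)) a b /\ ex_RInt (fun t => Im (g t)) a b.
Proof.
  intros Hab H. split; apply (ex_RInt_continuous (V := R_CompleteNormedModule));
    rewrite Rmin_left, Rmax_right by lra; intros t Ht; apply continuity_pt_filterlim, H; auto.
Qed.

Lemma lc_sub (g : R -> C) (a b a' b' : R) : a <= a' -> b' <= b -> lc g a b -> lc g a' b'.
Proof. intros H1 H2 H t Ht. apply H; lra. Qed.

Lemma CI_Chasles (g : R -> C) (a b c : R) : a <= b -> b <= c -> lc g a c ->
  (CI g a b + CI g b c)%C = CI g a c.
Proof.
  intros Hab Hbc H.
  destruct (lc_ex_RInt g a b Hab (lc_sub g a c a b ltac:(lra) Hbc H)) as [E1 E2].
  destruct (lc_ex_RInt g b c Hbc (lc_sub g a c b c Hab ltac:(lra) H)) as [E3 E4].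
  unfold CI, Cplus; simpl. f_equal; apply (RInt_Chasles (V := R_CompleteNormedModule)); auto.
Qed.

Lemma CI_plus (g h : R -> C) (a b : R) : a <= b -> lc g a b -> lc h a b ->
  CI (fun t => g t + h t)%C a b = (CI g a b + CI h a b)%C.
Proof.
  intros Hab Hg Hh. destruct (lc_ex_RInt g a b Hab Hg) as [E1 E2].
  destruct (lc_ex_RInt h a b Hab Hh) as [E3 E4].
  unfold CI, Cplus; simpl. f_equal; apply (RInt_plus (V := R_CompleteNormedModule)); auto.
Qed.

Lemma RInt_ext_R (f g : R -> R) (a b : R) : (forall x : R, f x = g x) -> RInt f a b = RInt g a b.
Proof. intros H. apply RInt_ext. intros; apply H. Qed.

Lemma RInt_linear_combination (f g : R -> R) (a b u v : R) : ex_RInt f a b -> ex_RInt g a b ->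
  RInt (fun t => u * f t + v * g t) a b = u * RInt f a b + v * RInt g a b.
Proof.
  intros Hf Hg.
  transitivity (RInt (fun t => u * f t) a b + RInt (fun t => v * g t) a b).
  - apply (RInt_plus (V := R_CompleteNormedModule)); apply (ex_RInt_scal (V := R_NormedModule)); auto.
  - f_equal; apply (RInt_scal (V := R_CompleteNormedModule)); auto.
Qed.

Lemma CI_scal (k : C) (g : R -> C) (a b : R) : a <= b -> lc g a b ->
  CI (fun t => k * g t)%C a b = (k * CI g a b)%C.
Proof.
  intros Hab Hg. destruct (lc_ex_RInt g a b Hab Hg) as [E1 E2].
  destruct k as [u v]. unfold CI, Cmult; simpl. f_equal.
  - rewrite (RInt_ext_R _ (fun t => u * Re (g t) + (- v) * Im (g t))) by (intros; unfold Re, Im; ring).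
    rewrite RInt_linear_combination by auto. eqR. ring.
  - rewrite (RInt_ext_R _ (fun t => u * Im (g t) + v * Re (g t))) by (intros; unfold Re, Im; ring).
    apply RInt_linear_combination; auto.
Qed.

Lemma CI_ext (g h : R -> C) (a b : R) : a <= b -> (forall t, a <= t <= b -> g t = h t) ->
  CI g a b = CI h a b.
Proof.
  intros Hab H. unfold CI. f_equal; apply RInt_ext; rewrite Rmin_left, Rmax_right by lra;
    intros t Ht; rewrite H; auto; lra.
Qed.

(** The factor 2 comes from bounding the real and imaginary parts separately; it only affects
    constants. *)
Lemma CI_bound_fun (g : R -> C) (q : R -> R) (a b : R) : a <= b -> lc g a b -> ex_RInt q a b ->
  (forall t, a <= t <= b -> Cmod (g t) <= q t) -> Cmod (CI g a b) <= 2 * RInt q a b.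
Proof.
  intros Hab Hg Hq H. destruct (lc_ex_RInt g a b Hab Hg) as [E1 E2].
  assert (B1 : Rabs (RInt (fun t => Re (g t)) a b) <= RInt q a b).
  { apply (norm_RInt_le (V := R_NormedModule) (fun t => Re (g t)) q a b); auto.
    intros t Ht. apply Rle_trans with (2 := H t Ht). apply re_le_Cmod.
    apply (RInt_correct (V := R_CompleteNormedModule)); auto.
    apply (RInt_correct (V := R_CompleteNormedModule)); auto. }
  assert (B2 : Rabs (RInt (fun t => Im (g t)) a b) <= RInt q a b).
  { apply (norm_RInt_le (V := R_NormedModule) (fun t => Im (g t)) q a b); auto.
    intros t Ht. apply Rle_trans with (2 := H t Ht). apply im_le_Cmod.
    apply (RInt_correct (V := R_CompleteNormedModule)); auto.
    apply (RInt_correct (V := R_CompleteNormedModule)); auto. }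
  replace (CI g a b) with (RtoC (RInt (fun t => Re (g t)) a b) + Ci * RtoC (RInt (fun t => Im (g t)) a b))%C
    by (unfold CI, Cplus, Cmult, RtoC; simpl; f_equal; ring).
  apply Rle_trans with (1 := Cmod_triangle _ _). rewrite Cmod_mult, Cmod_Ci, !Cmod_R. lra.
Qed.

Lemma CI_bound (g : R -> C) (M a b : R) : a <= b -> lc g a b ->
  (forall t, a <= t <= b -> Cmod (g t) <= M) -> Cmod (CI g a b) <= 2 * M * (b - a).
Proof.
  intros Hab Hg H. apply Rle_trans with (2 * RInt (fun _ => M) a b).
  - apply CI_bound_fun; auto. apply (ex_RInt_const (V := R_NormedModule)).
  - rewrite (RInt_const (V := R_CompleteNormedModule)). unfold scal; simpl; unfold mult; simpl. lra.
Qed.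

Definition hor (f : C -> C) (y : R) : R -> C := fun x => f (x, y).
Definition ver (f : C -> C) (x : R) : R -> C := fun y => f (x, y).

(** The counterclockwise boundary integral: bottom minus top, and [Ci] times right minus left
    because [dz = i dy] on vertical edges. *)
Definition rect (f : C -> C) (a b c d : R) : C :=
  (CI (hor f c) a b - CI (hor f d) a b + Ci * (CI (ver f b) c d - CI (ver f a) c d))%C.

Definition rect_cc (f : C -> C) (a b c d : R) : Prop :=
  forall x y, a <= x <= b -> c <= y <= d -> cc f (x, y).

Lemma Cmod_hor (x x' y : R) : Cmod ((x', y) - (x, y)) = Rabs (x' - x).
Proof. replace ((x', y) - (x, y))%C with (RtoC (x' - x)). apply Cmod_R.
  unfold RtoC, Cminus, Cplus, Copp; simpl; f_equal; ring. Qed.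

Lemma Cmod_ver (x y y' : R) : Cmod ((x, y') - (x, y)) = Rabs (y' - y).
Proof. replace ((x, y') - (x, y))%C with (Ci * RtoC (y' - y))%C.
  rewrite Cmod_mult, Cmod_Ci, Cmod_R. ring.
  unfold Ci, RtoC, Cminus, Cplus, Copp, Cmult; simpl; f_equal; ring. Qed.

Lemma rc_line_continuity (g : C -> R) (gam : R -> C) (t : R) :
  (forall t', Cmod (gam t' - gam t) = Rabs (t' - t)) -> rc g (gam t) ->
  continuity_pt (fun t => g (gam t)) t.
Proof.
  intros Hg H eps He. destruct (H eps He) as [d [D E]]. exists d. split; auto.
  intros t' [_ Ht]. simpl in *. unfold Rdist in *. apply E. rewrite Hg. auto.
Qed.

Lemma lc_hor (f : C -> C) (y a b : R) : (forall x, a <= x <= b -> cc f (x, y)) -> lc (hor f y) a b.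
Proof.
  intros H t Ht. split.
  - apply (rc_line_continuity (fun z => Re (f z)) (fun t => (t, y))). intros; apply Cmod_hor.
    apply rc_Re; auto.
  - apply (rc_line_continuity (fun z => Im (f z)) (fun t => (t, y))). intros; apply Cmod_hor.
    apply rc_Im; auto.
Qed.

Lemma lc_ver (f : C -> C) (x c d : R) : (forall y, c <= y <= d -> cc f (x, y)) -> lc (ver f x) c d.
Proof.
  intros H t Ht. split.
  - apply (rc_line_continuity (fun z => Re (f z)) (fun t => (x, t))). intros; apply Cmod_ver.
    apply rc_Re; auto.
  - apply (rc_line_continuity (fun z => Im (f z)) (fun t => (x, t))). intros; apply Cmod_ver.
    apply rc_Im; auto.
Qed.

(** Continuity is asked for on the boundary only, so that integrands with poles inside the rectangle
    are covered. *)
Definition edge_cc (f : C -> C) (a b c d : R) : Prop :=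
  (forall x, a <= x <= b -> cc f (x, c) /\ cc f (x, d)) /\
  (forall y, c <= y <= d -> cc f (a, y) /\ cc f (b, y)).

Lemma rect_cc_edge (f : C -> C) (a b c d : R) : a <= b -> c <= d -> rect_cc f a b c d -> edge_cc f a b c d.
Proof. intros Hab Hcd H. split; intros; split; apply H; lra. Qed.

Lemma edge_cc_lc (f : C -> C) (a b c d : R) : edge_cc f a b c d ->
  lc (hor f c) a b /\ lc (hor f d) a b /\ lc (ver f a) c d /\ lc (ver f b) c d.
Proof.
  intros [H1 H2]. split; [|split; [|split]].
  apply lc_hor; intros; apply H1; auto. apply lc_hor; intros; apply H1; auto.
  apply lc_ver; intros; apply H2; auto. apply lc_ver; intros; apply H2; auto.
Qed.

Lemma rect_split_x (f : C -> C) (a m b c d : R) : a <= m -> m <= b -> c <= d ->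
  edge_cc f a b c d -> rect f a b c d = (rect f a m c d + rect f m b c d)%C.
Proof.
  intros Ham Hmb Hcd H. destruct (edge_cc_lc _ _ _ _ _ H) as [L1 [L2 [L3 L4]]].
  unfold rect. rewrite <- (CI_Chasles (hor f c) a m b), <- (CI_Chasles (hor f d) a m b); auto. ring.
Qed.

Lemma rect_split_y (f : C -> C) (a b c m d : R) : a <= b -> c <= m -> m <= d ->
  edge_cc f a b c d -> rect f a b c d = (rect f a b c m + rect f a b m d)%C.
Proof.
  intros Hab Hcm Hmd H. destruct (edge_cc_lc _ _ _ _ _ H) as [L1 [L2 [L3 L4]]].
  unfold rect. rewrite <- (CI_Chasles (ver f a) c m d), <- (CI_Chasles (ver f b) c m d); auto. ring.
Qed.

Lemma edge_cc_plus (f g : C -> C) (a b c d : R) :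
  edge_cc f a b c d -> edge_cc g a b c d -> edge_cc (fun z => f z + g z)%C a b c d.
Proof.
  intros [F1 F2] [G1 G2]. split; intros t Ht; split; apply cc_plus;
    try apply F1; try apply G1; try apply F2; try apply G2; auto.
Qed.

Lemma edge_cc_scal (k : C) (f : C -> C) (a b c d : R) :
  edge_cc f a b c d -> edge_cc (fun z => k * f z)%C a b c d.
Proof.
  intros [F1 F2]. split; intros t Ht; split; apply cc_mult; try apply cc_const;
    try apply F1; try apply F2; auto.
Qed.

Lemma rect_plus (f g : C -> C) (a b c d : R) : a <= b -> c <= d ->
  edge_cc f a b c d -> edge_cc g a b c d ->
  rect (fun z => f z + g z)%C a b c d = (rect f a b c d + rect g a b c d)%C.
Proof.
  intros Hab Hcd Hf Hg. destruct (edge_cc_lc _ _ _ _ _ Hf) as [L1 [L2 [L3 L4]]].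
  destruct (edge_cc_lc _ _ _ _ _ Hg) as [K1 [K2 [K3 K4]]].
  unfold rect.
  change (hor (fun z => f z + g z)%C c) with (fun t => hor f c t + hor g c t)%C.
  change (hor (fun z => f z + g z)%C d) with (fun t => hor f d t + hor g d t)%C.
  change (ver (fun z => f z + g z)%C a) with (fun t => ver f a t + ver g a t)%C.
  change (ver (fun z => f z + g z)%C b) with (fun t => ver f b t + ver g b t)%C.
  rewrite !CI_plus by auto. ring.
Qed.

Lemma rect_scal (k : C) (f : C -> C) (a b c d : R) : a <= b -> c <= d ->
  edge_cc f a b c d -> rect (fun z => k * f z)%C a b c d = (k * rect f a b c d)%C.
Proof.
  intros Hab Hcd Hf. destruct (edge_cc_lc _ _ _ _ _ Hf) as [L1 [L2 [L3 L4]]].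
  unfold rect.
  change (hor (fun z => k * f z)%C c) with (fun t => k * hor f c t)%C.
  change (hor (fun z => k * f z)%C d) with (fun t => k * hor f d t)%C.
  change (ver (fun z => k * f z)%C a) with (fun t => k * ver f a t)%C.
  change (ver (fun z => k * f z)%C b) with (fun t => k * ver f b t)%C.
  rewrite !CI_scal by auto. ring.
Qed.

Lemma rect_ext (f g : C -> C) (a b c d : R) : a <= b -> c <= d ->
  (forall x, a <= x <= b -> f (x, c) = g (x, c) /\ f (x, d) = g (x, d)) ->
  (forall y, c <= y <= d -> f (a, y) = g (a, y) /\ f (b, y) = g (b, y)) ->
  rect f a b c d = rect g a b c d.
Proof.
  intros Hab Hcd H1 H2. unfold rect, hor, ver.
  rewrite (CI_ext (fun x => f (x, c)) (fun x => g (x, c))), (CI_ext (fun x => f (x, d)) (fun x => g (x, d))),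
    (CI_ext (fun y => f (a, y)) (fun y => g (a, y))), (CI_ext (fun y => f (b, y)) (fun y => g (b, y)));
    auto; intros; try apply H1; try apply H2; auto.
Qed.

Lemma rect_bound (f : C -> C) (M a b c d : R) : a <= b -> c <= d -> edge_cc f a b c d ->
  (forall x, a <= x <= b -> Cmod (f (x, c)) <= M /\ Cmod (f (x, d)) <= M) ->
  (forall y, c <= y <= d -> Cmod (f (a, y)) <= M /\ Cmod (f (b, y)) <= M) ->
  Cmod (rect f a b c d) <= 4 * M * (b - a) + 4 * M * (d - c).
Proof.
  intros Hab Hcd Hf H1 H2. destruct (edge_cc_lc _ _ _ _ _ Hf) as [L1 [L2 [L3 L4]]].
  assert (B1 := CI_bound (hor f c) M a b Hab L1 (fun x Hx => proj1 (H1 x Hx))).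
  assert (B2 := CI_bound (hor f d) M a b Hab L2 (fun x Hx => proj2 (H1 x Hx))).
  assert (B3 := CI_bound (ver f a) M c d Hcd L3 (fun x Hx => proj1 (H2 x Hx))).
  assert (B4 := CI_bound (ver f b) M c d Hcd L4 (fun x Hx => proj2 (H2 x Hx))).
  unfold rect. apply Rle_trans with (1 := Cmod_triangle _ _).
  rewrite Cmod_mult, Cmod_Ci, Rmult_1_l.
  assert (T1 := Cmod_triangle (CI (hor f c) a b) (- CI (hor f d) a b)).
  assert (T2 := Cmod_triangle (CI (ver f b) c d) (- CI (ver f a) c d)).
  rewrite Cmod_opp in T1, T2. unfold Cminus. lra.
Qed.

Lemma RInt_FTC (F f : R -> R) (a b : R) : a <= b ->
  (forall x, a <= x <= b -> is_derive F x (f x)) ->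
  (forall x, a <= x <= b -> continuity_pt f x) -> RInt f a b = F b - F a.
Proof.
  intros Hab Hd Hc. apply is_RInt_unique.
  apply (is_RInt_derive F f); rewrite Rmin_left, Rmax_right by lra; auto.
  intros x Hx. apply continuity_pt_filterlim; auto.
Qed.

Lemma rect_const (k : C) (a b c d : R) : a <= b -> c <= d -> rect (fun _ => k) a b c d = 0.
Proof.
  intros Hab Hcd. unfold rect, hor, ver, CI.
  rewrite !(RInt_const (V := R_CompleteNormedModule)). ring.
Qed.

Lemma rect_id (a b c d : R) : a <= b -> c <= d -> rect (fun z => z) a b c d = 0.
Proof.
  intros Hab Hcd. unfold rect, hor, ver, CI. simpl.
  assert (I : forall u v, u <= v -> RInt (fun t : R => t) u v = v ^ 2 / 2 - u ^ 2 / 2).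
  { intros u v Huv. apply (RInt_FTC (fun t => t ^ 2 / 2)); auto.
    intros; auto_derive; auto; field. intros; apply derivable_continuous_pt, derivable_pt_id. }
  rewrite !(RInt_const (V := R_CompleteNormedModule)), !I by auto.
  unfold scal; simpl; unfold mult; simpl.
  unfold Cplus, Cminus, Cmult, Copp, Ci, RtoC; simpl. f_equal; field.
Qed.

Lemma nested_intervals (x : nat -> R) (w : R) :
  0 <= w ->
  (forall k, x k <= x (S k) /\ x (S k) + w / 2 ^ S k <= x k + w / 2 ^ k) ->
  exists X, forall k, x k <= X <= x k + w / 2 ^ k.
Proof.
  intros Hw H.
  assert (Hpos : forall k, 0 <= w / 2 ^ k) by (intros; apply Rdiv_le_0_compat; auto; apply pow_lt; lra).
  assert (Mono : forall k j, (k <= j)%nat -> x k <= x j /\ x j + w / 2 ^ j <= x k + w / 2 ^ k).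
  { intros k j Hkj. induction Hkj. lra. destruct (H m). lra. }
  destruct (completeness (fun v => exists k, v = x k)) as [X [U V]].
  - exists (x 0%nat + w / 2 ^ 0). intros v [k ->]. destruct (Mono 0%nat k); [lia|]. generalize (Hpos k); lra.
  - exists (x 0%nat), 0%nat. auto.
  - exists X. intros k. split.
    + apply U. exists k; auto.
    + apply V. intros v [j ->]. destruct (Nat.le_ge_cases k j) as [L|L].
      * destruct (Mono k j L). generalize (Hpos j); lra.
      * destruct (Mono j k L). generalize (Hpos k); lra.
Qed.

Definition sub_large (f : C -> C) (w h M : R) (k : nat) (p : R * R) : Prop :=
  M / 4 ^ k <= Cmod (rect f (fst p) (fst p + w / 2 ^ k) (snd p) (snd p + h / 2 ^ k)).

Definition bisect_step (f : C -> C) (w h M : R) (k : nat) (p : R * R) : R * R :=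
  let x' := fst p + w / 2 ^ S k in let y' := snd p + h / 2 ^ S k in
  let large q := Rle_dec (M / 4 ^ S k) (Cmod (rect f (fst q) (fst q + w / 2 ^ S k) (snd q) (snd q + h / 2 ^ S k))) in
  if large p then p else if large (x', snd p) then (x', snd p)
  else if large (fst p, y') then (fst p, y') else (x', y').

Lemma bisect_step_spec (f : C -> C) (w h M : R) (k : nat) (p : R * R) : 0 <= w -> 0 <= h ->
  rect_cc f (fst p) (fst p + w / 2 ^ k) (snd p) (snd p + h / 2 ^ k) ->
  sub_large f w h M k p ->
  let q := bisect_step f w h M k p in
  sub_large f w h M (S k) q /\
  (fst p <= fst q /\ fst q + w / 2 ^ S k <= fst p + w / 2 ^ k) /\
  (snd p <= snd q /\ snd q + h / 2 ^ S k <= snd p + h / 2 ^ k).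
Proof.
  intros Hw Hh Hc HL q. unfold q; clear q. destruct p as [x y]. unfold sub_large in *. cbn [fst snd] in *.
  assert (Hp : 0 < 2 ^ k) by (apply pow_lt; lra).
  assert (Ew : w / 2 ^ k = 2 * (w / 2 ^ S k)) by (simpl; field; lra).
  assert (Eh : h / 2 ^ k = 2 * (h / 2 ^ S k)) by (simpl; field; lra).
  assert (EM : M / 4 ^ k = 4 * (M / 4 ^ S k)) by (simpl; field; apply Rgt_not_eq, pow_lt; lra).
  rewrite Ew, Eh, EM in *. unfold bisect_step. cbn [fst snd].
  assert (Hw' : 0 <= w / 2 ^ S k) by (apply Rdiv_le_0_compat; auto; apply pow_lt; lra).
  assert (Hh' : 0 <= h / 2 ^ S k) by (apply Rdiv_le_0_compat; auto; apply pow_lt; lra).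
  set (u := w / 2 ^ S k) in *. set (v := h / 2 ^ S k) in *. set (m := M / 4 ^ S k) in *.
  (* Three quarters are tested. In the remaining case all three tests fail, and the triangle
     inequality over the four quarters forces the last one to be large. *)
  repeat destruct Rle_dec; cbn [fst snd]; (split; [try assumption|lra]).
  assert (Sub : forall a b c d, x <= a -> a <= b -> b <= x + 2 * u -> y <= c -> c <= d -> d <= y + 2 * v -> edge_cc f a b c d).
  { intros. apply rect_cc_edge; auto. intros s t Hs Ht. apply Hc; lra. }
  rewrite (rect_split_x f x (x + u) (x + 2 * u)) in HL by (try apply Sub; lra).
  rewrite (rect_split_y f x (x + u) y (y + v) (y + 2 * v)) in HL by (try apply Sub; lra).
  rewrite (rect_split_y f (x + u) (x + 2 * u) y (y + v) (y + 2 * v)) in HL by (try apply Sub; lra).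
  assert (T1 := Cmod_triangle (rect f x (x + u) y (y + v) + rect f x (x + u) (y + v) (y + 2 * v))
    (rect f (x + u) (x + 2 * u) y (y + v) + rect f (x + u) (x + 2 * u) (y + v) (y + 2 * v))).
  assert (T2 := Cmod_triangle (rect f x (x + u) y (y + v)) (rect f x (x + u) (y + v) (y + 2 * v))).
  assert (T3 := Cmod_triangle (rect f (x + u) (x + 2 * u) y (y + v)) (rect f (x + u) (x + 2 * u) (y + v) (y + 2 * v))).
  replace (x + u + u) with (x + 2 * u) in * by ring. replace (y + v + v) with (y + 2 * v) in * by ring. lra.
Qed.

Fixpoint bisect (f : C -> C) (w h M : R) (p : R * R) (k : nat) : R * R :=
  match k with O => p | S k' => bisect_step f w h M k' (bisect f w h M p k') end.

Lemma Cmod_le_ReIm (z : C) : Cmod z <= Rabs (Re z) + Rabs (Im z).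
Proof.
  replace z with (RtoC (Re z) + Ci * RtoC (Im z))%C at 1
    by (destruct z; apply injective_projections; simpl; ring).
  apply Rle_trans with (1 := Cmod_triangle _ _). rewrite Cmod_mult, Cmod_Ci, !Cmod_R. lra.
Qed.

Lemma Cmod_pair_minus_le (x y u v : R) : Cmod ((x, y) - (u, v)) <= Rabs (x - u) + Rabs (y - v).
Proof. apply Rle_trans with (1 := Cmod_le_ReIm _). right; reflexivity. Qed.

(** Bisection. At the limit point the affine part of [f] integrates to zero by an explicit
    primitive, and the remainder is of smaller order than the [M / 4 ^ k] retained by the chosen
    subrectangles. *)
Lemma goursat (f : C -> C) (a b c d : R) : a <= b -> c <= d ->
  (forall x y, a <= x <= b -> c <= y <= d -> exists l, cd f (x, y) l) ->
  rect f a b c d = 0.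
Proof.
  intros Hab Hcd Hf. apply NNPP. intros Hne. apply Cmod_gt_0 in Hne.
  set (M := Cmod (rect f a b c d)) in *. set (w := b - a). set (h := d - c).
  assert (Hcc : rect_cc f a b c d).
  { intros x y Hx Hy. destruct (Hf x y Hx Hy) as [l Hl]. apply (cd_cc _ _ _ Hl). }
  set (p := bisect f w h M (a, c)).
  assert (Hpos : forall u k, 0 <= u -> 0 <= u / 2 ^ k) by (intros; apply Rdiv_le_0_compat; auto; apply pow_lt; lra).
  assert (Inv : forall k, sub_large f w h M k (p k) /\
    (a <= fst (p k) /\ fst (p k) + w / 2 ^ k <= b) /\ (c <= snd (p k) /\ snd (p k) + h / 2 ^ k <= d)).
  { induction k as [|k [I1 [I2 I3]]].
    - unfold sub_large. simpl. replace (a + w / 1) with b by (unfold w; field).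
      replace (c + h / 1) with d by (unfold h; field). fold M. split; [|lra]. right; field.
    - assert (Hc : rect_cc f (fst (p k)) (fst (p k) + w / 2 ^ k) (snd (p k)) (snd (p k) + h / 2 ^ k)).
      { intros x y Hx Hy. apply Hcc; lra. }
      destruct (bisect_step_spec f w h M k (p k) ltac:(unfold w; lra) ltac:(unfold h; lra) Hc I1) as [J1 [J2 J3]].
      change (p (S k)) with (bisect_step f w h M k (p k)). split; auto. lra. }
  assert (Step : forall k, (fst (p k) <= fst (p (S k)) /\ fst (p (S k)) + w / 2 ^ S k <= fst (p k) + w / 2 ^ k) /\
     (snd (p k) <= snd (p (S k)) /\ snd (p (S k)) + h / 2 ^ S k <= snd (p k) + h / 2 ^ k)).
  { intros k. destruct (Inv k) as [I1 [I2 I3]].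
    assert (Hc : rect_cc f (fst (p k)) (fst (p k) + w / 2 ^ k) (snd (p k)) (snd (p k) + h / 2 ^ k)).
    { intros x y Hx Hy. apply Hcc; lra. }
    destruct (bisect_step_spec f w h M k (p k) ltac:(unfold w; lra) ltac:(unfold h; lra) Hc I1) as [J1 J2]. exact J2. }
  destruct (nested_intervals (fun k => fst (p k)) w ltac:(unfold w; lra) (fun k => proj1 (Step k))) as [X HX].
  destruct (nested_intervals (fun k => snd (p k)) h ltac:(unfold h; lra) (fun k => proj2 (Step k))) as [Y HY].
  assert (HXY : a <= X <= b /\ c <= Y <= d).
  { generalize (HX 0%nat) (HY 0%nat) (Inv 0%nat). unfold w, h. simpl. lra. }
  destruct (Hf X Y (proj1 HXY) (proj2 HXY)) as [l [phi [F1 [F2 F3]]]].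
  set (s := w + h). assert (Hs : 0 <= s) by (unfold s, w, h; lra).
  (* At level [k] the remainder integrates to at most [4 eps s ^ 2 / 4 ^ k], which this choice keeps
     below [M / 4 ^ k]. *)
  set (eps := M / (8 * (s * s + 1))).
  assert (Heps : 0 < eps) by (apply Rdiv_lt_0_compat; nra).
  destruct (F3 eps Heps) as [dl [Dl E]].
  destruct (pow_lt_1_zero (/ 2)) with (y := dl / (s + 1)) as [k Hk].
  { rewrite Rabs_pos_eq; lra. } { apply Rdiv_lt_0_compat; lra. }
  specialize (Hk k (le_n _)). rewrite Rabs_pos_eq, pow_inv in Hk by (apply pow_le; lra).
  destruct (Inv k) as [I1 [I2 I3]]. specialize (HX k). specialize (HY k). cbv beta in HX, HY.
  unfold sub_large in I1.
  set (x0 := fst (p k)) in *. set (y0 := snd (p k)) in *.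
  assert (H2k : 0 < 2 ^ k) by (apply pow_lt; lra).
  assert (Hw0 := Hpos w k ltac:(unfold w; lra)). assert (Hh0 := Hpos h k ltac:(unfold h; lra)).
  assert (Hsk : s / 2 ^ k = w / 2 ^ k + h / 2 ^ k) by (unfold s; field; lra).
  assert (Hsd : s / 2 ^ k < dl).
  { apply Rle_lt_trans with ((s + 1) * / 2 ^ k). apply Rmult_le_compat_r. left; apply Rinv_0_lt_compat; auto. lra.
    apply Rmult_lt_compat_l with (r := s + 1) in Hk; [|lra].
    replace ((s + 1) * (dl / (s + 1))) with dl in Hk by (field; lra). auto. }
  assert (Near : forall x y, x0 <= x <= x0 + w / 2 ^ k -> y0 <= y <= y0 + h / 2 ^ k ->
    Cmod ((x, y) - (X, Y)) <= s / 2 ^ k).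
  { intros x y Hx Hy.
    apply Rle_trans with (1 := Cmod_pair_minus_le _ _ _ _).
    assert (Rabs (x - X) <= w / 2 ^ k) by (apply Rabs_le; lra).
    assert (Rabs (y - Y) <= h / 2 ^ k) by (apply Rabs_le; lra). lra. }
  set (g := fun z => ((phi z - l) * (z - (X, Y)))%C).
  assert (Rg : rect f x0 (x0 + w / 2 ^ k) y0 (y0 + h / 2 ^ k) = rect g x0 (x0 + w / 2 ^ k) y0 (y0 + h / 2 ^ k)).
  { assert (Eaff : forall a b c d, edge_cc (fun _ : C => (- (f (X, Y) - l * (X, Y)))%C) a b c d).
    { intros; split; intros; split; apply cc_const. }
    assert (Eid : forall a b c d, edge_cc (fun z : C => z) a b c d).
    { intros; split; intros; split; apply cc_id. }
    transitivity (rect (fun z => f z + ((- l) * z + (- (f (X, Y) - l * (X, Y)))))%C x0 (x0 + w / 2 ^ k) y0 (y0 + h / 2 ^ k)).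
    - rewrite (rect_plus f), (rect_plus (fun z => - l * z)%C), (rect_scal _ (fun z => z)), rect_id, rect_const; auto; try lra.
      ring. apply edge_cc_scal; auto.
      apply rect_cc_edge; try lra. intros x y Hx Hy. apply Hcc; lra.
      apply edge_cc_plus; auto. apply edge_cc_scal; auto.
    - apply rect_ext; try lra; intros; split; unfold g; rewrite F1; ring. }
  assert (Cg : edge_cc g x0 (x0 + w / 2 ^ k) y0 (y0 + h / 2 ^ k)).
  { apply rect_cc_edge; try lra. intros x y Hx Hy.
    apply cc_ext_loc with (fun z => f z + ((- l) * z + (- (f (X, Y) - l * (X, Y)))))%C.
    exists 1. split; [lra|]. intros z _. unfold g. rewrite F1. ring.
    apply cc_plus. apply Hcc; lra. apply cc_plus. apply cc_mult. apply cc_const. apply cc_id. apply cc_const. }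
  assert (Bg : forall x y, x0 <= x <= x0 + w / 2 ^ k -> y0 <= y <= y0 + h / 2 ^ k ->
    Cmod (g (x, y)) <= eps * (s / 2 ^ k)).
  { intros x y Hx Hy. unfold g. rewrite Cmod_mult. apply Rmult_le_compat; try apply Cmod_ge_0.
    - rewrite <- F2. left. apply E. generalize (Near x y Hx Hy). lra.
    - apply Near; auto. }
  assert (B := rect_bound g (eps * (s / 2 ^ k)) x0 (x0 + w / 2 ^ k) y0 (y0 + h / 2 ^ k) ltac:(lra) ltac:(lra) Cg
    ltac:(intros; split; apply Bg; lra) ltac:(intros; split; apply Bg; lra)).
  rewrite Rg in I1.
  assert (M / 4 ^ k <= 4 * eps * (s / 2 ^ k) * (s / 2 ^ k)).
  { apply Rle_trans with (1 := I1). apply Rle_trans with (1 := B). rewrite Hsk. right; ring. }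
  assert (E4 : 4 ^ k = 2 ^ k * 2 ^ k) by (rewrite <- Rpow_mult_distr; f_equal; ring).
  rewrite E4 in H. apply Rmult_le_compat_r with (r := 2 ^ k * 2 ^ k) in H; [|nra].
  replace (M / (2 ^ k * 2 ^ k) * (2 ^ k * 2 ^ k)) with M in H by (field; lra).
  replace (4 * eps * (s / 2 ^ k) * (s / 2 ^ k) * (2 ^ k * 2 ^ k)) with (4 * eps * (s * s)) in H by (field; lra).
  assert (eps * (8 * (s * s + 1)) = M) by (unfold eps; field; nra). nra.
Qed.

Lemma rc_continuity_2d (g : C -> R) (x y : R) : rc g (x, y) ->
  continuity_2d_pt (fun u v => g (u, v)) x y.
Proof.
  intros H eps. destruct (H eps (cond_pos eps)) as [d [D E]].
  exists (mkposreal (d / 2) ltac:(lra)). intros u v Hu Hv. simpl in Hu, Hv. apply E.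
  apply Rle_lt_trans with (1 := Cmod_pair_minus_le _ _ _ _). lra.
Qed.

(** The integrands obtained by dividing out poles are known to be continuous on the real axis, but
    differentiable only off it. [goursat] reduces the rectangle to a thin strip around the axis,
    where uniform continuity makes the two long edges nearly cancel and the short ones are
    negligible. *)
Lemma rect_across_axis (f : C -> C) (a b c d : R) : a <= b -> c < 0 < d ->
  rect_cc f a b c d ->
  (forall x y, a <= x <= b -> c <= y <= d -> y <> 0 -> exists l, cd f (x, y) l) ->
  rect f a b c d = 0.
Proof.
  intros Hab Hcd Hcc Hf. apply NNPP. intros Hne. apply Cmod_gt_0 in Hne.
  set (M := Cmod (rect f a b c d)) in *.
  set (eta := M / (8 * (b - a + 1))). assert (Heta : 0 < eta) by (apply Rdiv_lt_0_compat; lra).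
  destruct (uniform_continuity_2d (fun u v => Re (f (u, v))) a b c d) with (eps := mkposreal eta Heta) as [d1 H1].
  { intros x y Hx Hy. apply (rc_continuity_2d (fun z => Re (f z))), rc_Re, Hcc; auto. }
  destruct (uniform_continuity_2d (fun u v => Im (f (u, v))) a b c d) with (eps := mkposreal eta Heta) as [d2 H2].
  { intros x y Hx Hy. apply (rc_continuity_2d (fun z => Im (f z))), rc_Im, Hcc; auto. }
  destruct (Hcc a 0 ltac:(lra) ltac:(lra) 1 ltac:(lra)) as [d3 [D3 H3]].
  destruct (Hcc b 0 ltac:(lra) ltac:(lra) 1 ltac:(lra)) as [d4 [D4 H4]].
  set (K := Cmod (f (a, 0)) + Cmod (f (b, 0)) + 1).
  assert (HK : 0 < K) by (unfold K; generalize (Cmod_ge_0 (f (a, 0))) (Cmod_ge_0 (f (b, 0))); lra).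
  assert (Hex : exists e, 0 < e /\ e <= - c /\ e <= d /\ 2 * e < d1 /\ 2 * e < d2 /\ e < d3 /\ e < d4 /\ 8 * K * e < M / 4).
  { assert (P1 := cond_pos d1). assert (P2 := cond_pos d2).
    assert (P3 : 0 < M / (64 * K)) by (apply Rdiv_lt_0_compat; lra).
    set (e1 := Rmin (- c) (Rmin d (Rmin (d1 / 4) (Rmin (d2 / 4) (Rmin (d3 / 2) (Rmin (d4 / 2) (M / (64 * K)))))))).
    assert (0 < e1) by (repeat apply Rmin_pos; lra).
    assert (Q1 : e1 <= - c) by apply Rmin_l.
    assert (Q2 := Rmin_r (- c) (Rmin d (Rmin (d1 / 4) (Rmin (d2 / 4) (Rmin (d3 / 2) (Rmin (d4 / 2) (M / (64 * K)))))))). fold e1 in Q2.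
    assert (Q3 := Rle_trans _ _ _ Q2 (Rmin_l _ _)). assert (Q4 := Rle_trans _ _ _ Q2 (Rmin_r _ _)).
    assert (Q5 := Rle_trans _ _ _ Q4 (Rmin_l _ _)). assert (Q6 := Rle_trans _ _ _ Q4 (Rmin_r _ _)).
    assert (Q7 := Rle_trans _ _ _ Q6 (Rmin_l _ _)). assert (Q8 := Rle_trans _ _ _ Q6 (Rmin_r _ _)).
    assert (Q9 := Rle_trans _ _ _ Q8 (Rmin_l _ _)). assert (Q10 := Rle_trans _ _ _ Q8 (Rmin_r _ _)).
    assert (Q11 := Rle_trans _ _ _ Q10 (Rmin_l _ _)). assert (Q12 := Rle_trans _ _ _ Q10 (Rmin_r _ _)).
    exists e1. repeat split; try lra.
    apply Rle_lt_trans with (8 * K * (M / (64 * K))). apply Rmult_le_compat_l; lra.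
    replace (8 * K * (M / (64 * K))) with (M / 8) by (field; lra). lra. }
  destruct Hex as [e [E0 [E1 [E2 [E3 [E4 [E5 [E6 E7]]]]]]]].
  assert (Sub : forall c' d', c <= c' -> c' <= d' -> d' <= d -> edge_cc f a b c' d').
  { intros. apply rect_cc_edge; auto. intros x y Hx Hy; apply Hcc; lra. }
  assert (Split : rect f a b c d = rect f a b (- e) e).
  { rewrite (rect_split_y f a b c (- e) d), (rect_split_y f a b (- e) e d) by (try apply Sub; lra).
    rewrite (goursat f a b c (- e)), (goursat f a b e d); try lra. ring.
    intros x y Hx Hy; apply Hf; lra. intros x y Hx Hy; apply Hf; lra. }
  destruct (edge_cc_lc f a b (- e) e) as [L1 [L2 [L3 L4]]]. { apply Sub; lra. }
  assert (Bm : Cmod (rect f a b (- e) e) < M); [|unfold M in Bm; rewrite <- Split in Bm; lra].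
  unfold rect.
  assert (Dif : Cmod (CI (hor f (- e)) a b - CI (hor f e) a b) <= 2 * (2 * eta) * (b - a)).
  { replace (CI (hor f (- e)) a b - CI (hor f e) a b)%C with
      (CI (fun t => hor f (- e) t + - (1) * hor f e t)%C a b).
    - apply CI_bound; auto.
      + intros t Ht. destruct (L1 t Ht) as [A1 A2]. destruct (L2 t Ht) as [A3 A4]. split.
        * apply continuity_pt_ext with (fun t => Re (hor f (- e) t) - Re (hor f e t)).
          intros x. rewrite re_plus, re_mult. simpl. ring. apply continuity_pt_minus; auto.
        * apply continuity_pt_ext with (fun t => Im (hor f (- e) t) - Im (hor f e t)).
          intros x. rewrite im_plus, im_mult. simpl. ring. apply continuity_pt_minus; auto.
      + intros t Ht. apply Rle_trans with (1 := Cmod_le_ReIm _).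
        rewrite re_plus, im_plus, re_mult, im_mult. unfold hor.
        specialize (H1 t e t (- e) Ht ltac:(lra) Ht ltac:(lra)).
        rewrite Rminus_diag, Rabs_R0 in H1.
        specialize (H1 ltac:(lra) ltac:(rewrite Rabs_left; lra)).
        specialize (H2 t e t (- e) Ht ltac:(lra) Ht ltac:(lra)).
        rewrite Rminus_diag, Rabs_R0 in H2.
        specialize (H2 ltac:(lra) ltac:(rewrite Rabs_left; lra)).
        simpl in H1, H2. simpl.
        match goal with |- Rabs ?u + Rabs ?v <= _ =>
          replace u with (Re (f (t, - e)) - Re (f (t, e))) by ring;
          replace v with (Im (f (t, - e)) - Im (f (t, e))) by ring end.
        lra.
    - rewrite CI_plus, CI_scal; auto. ring.
      intros t Ht. destruct (L2 t Ht) as [A3 A4]. split.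
      + apply continuity_pt_ext with (fun t => - Re (hor f e t)).
        intros x. rewrite re_mult. simpl. ring. apply continuity_pt_opp; auto.
      + apply continuity_pt_ext with (fun t => - Im (hor f e t)).
        intros x. rewrite im_mult. simpl. ring. apply continuity_pt_opp; auto. }
  assert (Side : forall x, (x = a \/ x = b) -> Cmod (CI (ver f x) (- e) e) <= 2 * K * (e - - e)).
  { intros x Hx. apply CI_bound. lra. destruct Hx as [->| ->]; auto.
    intros y Hy. unfold ver.
    assert (Hy' : Rabs (y - 0) <= e) by (apply Rabs_le; lra).
    assert (T := Cmod_triangle (f (x, 0)) (f (x, y) - f (x, 0))).
    replace (f (x, 0) + (f (x, y) - f (x, 0)))%C with (f (x, y)) in T by ring.
    generalize (Cmod_ge_0 (f (a, 0))) (Cmod_ge_0 (f (b, 0))); intros. unfold K.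
    destruct Hx as [->| ->].
    - assert (Cmod (f (a, y) - f (a, 0)) < 1) by (apply H3; rewrite Cmod_ver; lra). lra.
    - assert (Cmod (f (b, y) - f (b, 0)) < 1) by (apply H4; rewrite Cmod_ver; lra). lra. }
  apply Rle_lt_trans with (1 := Cmod_triangle _ _). rewrite Cmod_mult, Cmod_Ci, Rmult_1_l.
  assert (T2 := Cmod_triangle (CI (ver f b) (- e) e) (- CI (ver f a) (- e) e)).
  rewrite Cmod_opp in T2. assert (S1 := Side a (or_introl eq_refl)). assert (S2 := Side b (or_intror eq_refl)).
  assert (eta * (8 * (b - a + 1)) = M) by (unfold eta; field; lra).
  unfold Cminus in *. nra.
Qed.

(** Each edge of a square centred at the pole contributes a quarter turn, that is [Ci * PI / 2]; the
    other component vanishes by symmetry. *)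
Lemma rect_inv_square (p e : R) : 0 < e ->
  rect (fun z => / (z - p))%C (p - e) (p + e) (- e) e = (2 * PI * Ci)%C.
Proof.
  intros He.
  assert (Hq : forall v, 0 < v * (v * 1) + e * (e * 1)).
  { intros v. generalize (Rle_0_sqr v) (Rmult_lt_0_compat e e He He). unfold Rsqr. lra. }
  assert (I0 : forall s, RInt (fun t => (t - s) / ((t - s) ^ 2 + e ^ 2)) (s - e) (s + e) = 0).
  { intros s. rewrite (RInt_FTC (fun t => / 2 * ln ((t - s) ^ 2 + e ^ 2))).
    - replace (s + e - s) with e by ring. replace (s - e - s) with (- e) by ring.
      replace ((- e) ^ 2) with (e ^ 2) by ring. apply Rminus_diag.
    - lra.
    - intros x _. auto_derive. apply Hq. unfold Rminus. field. generalize (Hq (x + - s)). lra.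
    - intros x _. apply derivable_continuous_pt, ex_derive_Reals_0. auto_derive. generalize (Hq (x + - s)). lra. }
  assert (I1 : forall s, RInt (fun t => e / ((t - s) ^ 2 + e ^ 2)) (s - e) (s + e) = PI / 2).
  { intros s. rewrite (RInt_FTC (fun t => atan ((t - s) / e))).
    - replace ((s + e - s) / e) with 1 by (field; lra). replace ((s - e - s) / e) with (- (1)) by (field; lra).
      rewrite atan_opp, atan_1. eqR. field.
    - lra.
    - intros x _. auto_derive. lra. unfold Rminus. field. split; generalize (Hq (x + - s)); lra.
    - intros x _. apply derivable_continuous_pt, ex_derive_Reals_0. auto_derive. generalize (Hq (x + - s)). lra. }
  assert (I0' := I0 0). assert (I1' := I1 0).
  replace (0 - e) with (- e) in I0', I1' by ring. replace (0 + e) with e in I0', I1' by ring.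
  specialize (I0 p). specialize (I1 p).
  assert (Re_ : forall x y, Re (/ ((x, y) - RtoC p))%C = (x - p) / ((x - p) ^ 2 + y ^ 2)).
  { intros x y. simpl. f_equal. f_equal. ring. }
  assert (Im_ : forall x y, Im (/ ((x, y) - RtoC p))%C = - y / ((x - p) ^ 2 + y ^ 2)).
  { intros x y. simpl. f_equal. ring. f_equal. ring. }
  assert (N : forall f g a b v, a <= b -> (forall x, f x = - g x) -> ex_RInt g a b -> RInt g a b = v -> RInt f a b = - v).
  { intros f g a b v Hab E Hex <-. rewrite <- (RInt_opp (V := R_CompleteNormedModule)) by auto.
    apply RInt_ext_R. intros x. apply E. }
  assert (X0 : forall s, ex_RInt (fun t => (t - s) / ((t - s) ^ 2 + e ^ 2)) (s - e) (s + e)).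
  { intros s. apply (ex_RInt_continuous (V := R_CompleteNormedModule)). intros x _.
    apply continuity_pt_filterlim, derivable_continuous_pt, ex_derive_Reals_0. auto_derive. generalize (Hq (x + - s)). lra. }
  assert (X1 : forall s, ex_RInt (fun t => e / ((t - s) ^ 2 + e ^ 2)) (s - e) (s + e)).
  { intros s. apply (ex_RInt_continuous (V := R_CompleteNormedModule)). intros x _.
    apply continuity_pt_filterlim, derivable_continuous_pt, ex_derive_Reals_0. auto_derive. generalize (Hq (x + - s)). lra. }
  assert (X0' := X0 0). assert (X1' := X1 0).
  replace (0 - e) with (- e) in X0', X1' by ring. replace (0 + e) with e in X0', X1' by ring.
  assert (J1 : CI (hor (fun z => / (z - p))%C (- e)) (p - e) (p + e) = (0, PI / 2)).
  { unfold CI, hor. f_equal.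
    - rewrite <- I0. apply RInt_ext_R. intros x. rewrite Re_. f_equal. f_equal. ring.
    - rewrite <- I1. apply RInt_ext_R. intros x. rewrite Im_. f_equal. ring. f_equal. ring. }
  assert (J2 : CI (hor (fun z => / (z - p))%C e) (p - e) (p + e) = (0, - (PI / 2))).
  { unfold CI, hor. f_equal.
    - rewrite <- I0. apply RInt_ext_R. intros x. rewrite Re_. auto.
    - apply (N _ (fun t => e / ((t - p) ^ 2 + e ^ 2))); auto. lra. intros x. rewrite Im_.
      unfold Rdiv. ring. }
  assert (J3 : CI (ver (fun z => / (z - p))%C (p + e)) (- e) e = (PI / 2, - 0)).
  { unfold CI, ver. f_equal.
    - rewrite <- I1'. apply RInt_ext_R. intros x. rewrite Re_.
      replace ((p + e - p) ^ 2 + x ^ 2) with ((x - 0) ^ 2 + e ^ 2) by ring. unfold Rdiv. ring.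
    - apply (N _ (fun t => (t - 0) / ((t - 0) ^ 2 + e ^ 2))); auto. lra. intros x. rewrite Im_.
      replace ((p + e - p) ^ 2 + x ^ 2) with ((x - 0) ^ 2 + e ^ 2) by ring. unfold Rdiv. ring. }
  assert (J4 : CI (ver (fun z => / (z - p))%C (p - e)) (- e) e = (- (PI / 2), - 0)).
  { unfold CI, ver. f_equal.
    - apply (N _ (fun t => e / ((t - 0) ^ 2 + e ^ 2))); auto. lra. intros x. rewrite Re_.
      replace ((p - e - p) ^ 2 + x ^ 2) with ((x - 0) ^ 2 + e ^ 2) by ring. unfold Rdiv. ring.
    - apply (N _ (fun t => (t - 0) / ((t - 0) ^ 2 + e ^ 2))); auto. lra. intros x. rewrite Im_.
      replace ((p - e - p) ^ 2 + x ^ 2) with ((x - 0) ^ 2 + e ^ 2) by ring. unfold Rdiv. ring. }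
  unfold rect. rewrite J1, J2, J3, J4.
  unfold Cplus, Cminus, Copp, Cmult, RtoC, Ci; simpl. f_equal; field.
Qed.


Lemma C_pair_eq_RtoC (x y p : R) : ((x, y) - RtoC p)%C = 0 -> x = p /\ y = 0.
Proof.
  intros H. assert (H1 := f_equal fst H). assert (H2 := f_equal snd H). simpl in *. lra.
Qed.

(** The contour is shrunk to a small square around [p], where [g] may be replaced by [g p].
    Continuity of [g] at [p] is enough, in accordance with what [rect_across_axis] assumes on the
    axis. *)
Lemma cauchy_rect (g : C -> C) (a b c d p : R) : a < p < b -> c < 0 < d ->
  rect_cc g a b c d ->
  (forall x y, a <= x <= b -> c <= y <= d -> y <> 0 -> exists l, cd g (x, y) l) ->
  rect (fun z => g z * / (z - p))%C a b c d = (2 * PI * Ci * g p)%C.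
Proof.
  intros Hp Hcd Hcc Hg. apply Ceq_minus. apply NNPP. intros Hne. apply Cmod_gt_0 in Hne.
  set (q := fun z => (g z * / (z - p))%C) in *.
  set (M := Cmod (rect q a b c d - 2 * PI * Ci * g p)) in *.
  assert (Cp : cc (fun z => (z - p)%C) (RtoC p)) by (apply cc_minus; [apply cc_id|apply cc_const]).
  assert (Hq : forall x y, a <= x <= b -> c <= y <= d -> x <> p \/ y <> 0 -> cc q (x, y)).
  { intros x y Hx Hy Hxy. unfold q. apply cc_mult. apply Hcc; auto.
    apply (cc_inv (fun z => z - p)%C). apply cc_minus. apply cc_id. apply cc_const.
    intros E. apply C_pair_eq_RtoC in E. tauto. }
  assert (Hqd : forall x y, a <= x <= b -> c <= y <= d -> y <> 0 -> exists l, cd q (x, y) l).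
  { intros x y Hx Hy Hy0. destruct (Hg x y Hx Hy Hy0) as [l Hl]. eexists. unfold q.
    apply (cd_mult g (fun z => / (z - p))%C). exact Hl.
    apply (cd_inv (fun z => z - p)%C). apply cd_minus. apply cd_id. apply cd_const.
    intros E. apply C_pair_eq_RtoC in E. tauto. }
  (* On the boundary of the square [|z - p| >= e], so an oscillation of [M / 32] gives an integral
     of at most [M / 2], which contradicts its value [M]. *)
  destruct (Hcc p 0 ltac:(lra) ltac:(lra) (M / 32) ltac:(lra)) as [dl [Dl E]].
  assert (Hex : exists e, 0 < e /\ e < p - a /\ e < b - p /\ e < - c /\ e < d /\ 2 * e < dl).
  { set (e1 := Rmin (p - a) (Rmin (b - p) (Rmin (- c) (Rmin d (dl / 2))))).
    assert (0 < e1) by (repeat apply Rmin_pos; lra).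
    assert (Q1 : e1 <= p - a) by apply Rmin_l.
    assert (Q2 := Rmin_r (p - a) (Rmin (b - p) (Rmin (- c) (Rmin d (dl / 2))))). fold e1 in Q2.
    assert (Q3 := Rle_trans _ _ _ Q2 (Rmin_l _ _)). assert (Q4 := Rle_trans _ _ _ Q2 (Rmin_r _ _)).
    assert (Q5 := Rle_trans _ _ _ Q4 (Rmin_l _ _)). assert (Q6 := Rle_trans _ _ _ Q4 (Rmin_r _ _)).
    assert (Q7 := Rle_trans _ _ _ Q6 (Rmin_l _ _)). assert (Q8 := Rle_trans _ _ _ Q6 (Rmin_r _ _)).
    exists (e1 / 2). repeat split; lra. }
  destruct Hex as [e [E0 [E1 [E2 [E3 [E4 E5]]]]]].
  assert (Edge : forall a' b' c' d', a <= a' -> a' <= b' -> b' <= b -> c <= c' -> c' <= d' -> d' <= d ->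
    c' <> 0 -> d' <> 0 -> a' <> p -> b' <> p -> edge_cc q a' b' c' d').
  { intros. split; intros t Ht; split; apply Hq; try lra; auto. }
  assert (Split : rect q a b c d = rect q (p - e) (p + e) (- e) e).
  { rewrite (rect_split_x q a (p - e) b c d), (rect_split_x q (p - e) (p + e) b c d) by (try apply Edge; lra).
    rewrite (rect_across_axis q a (p - e) c d), (rect_across_axis q (p + e) b c d); try lra.
    - rewrite (rect_split_y q (p - e) (p + e) c (- e) d), (rect_split_y q (p - e) (p + e) (- e) e d)
        by (try apply Edge; lra).
      rewrite (goursat q (p - e) (p + e) c (- e)), (goursat q (p - e) (p + e) e d); try lra. ring.
      intros x y Hx Hy; apply Hqd; lra. intros x y Hx Hy; apply Hqd; lra.
    - intros x y Hx Hy. apply Hq; lra.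
    - intros x y Hx Hy. apply Hqd; lra.
    - intros x y Hx Hy. apply Hq; lra.
    - intros x y Hx Hy. apply Hqd; lra. }
  assert (Bnd : forall x y, p - e <= x <= p + e -> - e <= y <= e -> (Rabs (x - p) = e \/ Rabs y = e) ->
     cc (fun z => (g z + - g p) * / (z - p))%C (x, y) /\ cc (fun z => / (z - p))%C (x, y) /\
     Cmod ((g (x, y) + - g p) * / ((x, y) - p)) <= M / 32 / e).
  { intros x y Hx Hy Hb.
    assert (Hz : ((x, y) - RtoC p)%C <> 0).
    { intros H. apply C_pair_eq_RtoC in H. destruct H as [-> ->].
      rewrite Rminus_diag, Rabs_R0 in Hb. lra. }
    assert (C2 : cc (fun z => / (z - p))%C (x, y)).
    { apply (cc_inv (fun z => z - p)%C); auto. apply cc_minus. apply cc_id. apply cc_const. }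
    split; [|split]; auto.
    - apply (cc_mult (fun z => g z + - g p)%C (fun z => / (z - p))%C); auto.
      apply cc_plus. apply Hcc; lra. apply cc_const.
    - rewrite Cmod_mult, Cmod_inv by auto.
      assert (Hge : e <= Cmod ((x, y) - p)).
      { assert (R1 := re_le_Cmod ((x, y) - p)). assert (R2 := im_le_Cmod ((x, y) - p)).
        simpl in R1, R2. replace (x + - p) with (x - p) in R1 by ring.
        replace (y + - 0) with y in R2 by ring. lra. }
      assert (Hle : Cmod ((x, y) - p) <= 2 * e).
      { apply Rle_trans with (1 := Cmod_pair_minus_le x y p 0).
        assert (Rabs (x - p) <= e) by (apply Rabs_le; lra).
        assert (Rabs (y - 0) <= e) by (apply Rabs_le; lra). lra. }
      unfold Rdiv. apply Rmult_le_compat.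
      + apply Cmod_ge_0.
      + left; apply Rinv_0_lt_compat; lra.
      + left. apply (E (x, y)). change (p, 0) with (RtoC p). lra.
      + apply Rinv_le_contravar; lra. }
  assert (Ed1 : edge_cc (fun z => (g z + - g p) * / (z - p))%C (p - e) (p + e) (- e) e).
  { split; intros t Ht; split; apply Bnd; try lra; rewrite ?Rabs_Ropp, ?(Rabs_pos_eq e) by lra; try (right; reflexivity); left.
    replace (p - e - p) with (- e) by ring. rewrite Rabs_Ropp. apply Rabs_pos_eq; lra.
    replace (p + e - p) with e by ring. apply Rabs_pos_eq; lra. }
  assert (Ed2 : edge_cc (fun z => / (z - p))%C (p - e) (p + e) (- e) e).
  { split; intros t Ht; split; apply Bnd; try lra; rewrite ?Rabs_Ropp, ?(Rabs_pos_eq e) by lra; try (right; reflexivity); left.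
    replace (p - e - p) with (- e) by ring. rewrite Rabs_Ropp. apply Rabs_pos_eq; lra.
    replace (p + e - p) with e by ring. apply Rabs_pos_eq; lra. }
  assert (Sum : rect q (p - e) (p + e) (- e) e =
    (rect (fun z => (g z + - g p) * / (z - p))%C (p - e) (p + e) (- e) e + 2 * PI * Ci * g p)%C).
  { transitivity (rect (fun z => (g z + - g p) * / (z - p) + g p * / (z - p))%C (p - e) (p + e) (- e) e).
    - apply rect_ext; try lra; intros; split; unfold q; ring.
    - rewrite rect_plus, (rect_scal (g p)), rect_inv_square; auto; try lra. ring.
      apply edge_cc_scal; auto. }
  assert (B := rect_bound _ (M / 32 / e) (p - e) (p + e) (- e) e ltac:(lra) ltac:(lra) Ed1).
  assert (B2 : Cmod (rect (fun z => (g z + - g p) * / (z - p))%C (p - e) (p + e) (- e) e) <=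
    4 * (M / 32 / e) * (p + e - (p - e)) + 4 * (M / 32 / e) * (e - - e)).
  { apply B; intros t Ht; split; apply Bnd; try lra; rewrite ?Rabs_Ropp, ?(Rabs_pos_eq e) by lra; try (right; reflexivity); left.
    replace (p - e - p) with (- e) by ring. rewrite Rabs_Ropp. apply Rabs_pos_eq; lra.
    replace (p + e - p) with e by ring. apply Rabs_pos_eq; lra. }
  replace (4 * (M / 32 / e) * (p + e - (p - e)) + 4 * (M / 32 / e) * (e - - e)) with (M / 2) in B2 by (field; lra).
  assert (M = Cmod (rect (fun z => (g z + - g p) * / (z - p))%C (p - e) (p + e) (- e) e)).
  { unfold M. rewrite Split, Sum. f_equal. ring. }
  lra.
Qed.

(** * Partial fractions and the residue theorem for simple real poles *)

Lemma Csum_cons {I : Type} (i : I) (s : list I) (F : I -> C) : Csum (i :: s) F = (F i + Csum s F)%C.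
Proof. reflexivity. Qed.

Lemma Csum_ext {I : Type} (s : list I) (F G : I -> C) :
  (forall i, In i s -> F i = G i) -> Csum s F = Csum s G.
Proof. intros H. unfold Csum. f_equal. apply map_ext_in. exact H. Qed.

Lemma Csum_scal {I : Type} (s : list I) (F : I -> C) (k : C) :
  (k * Csum s F)%C = Csum s (fun i => k * F i)%C.
Proof.
  induction s as [|i s IH]. unfold Csum; simpl; ring. rewrite !Csum_cons, <- IH. ring.
Qed.

Lemma Csum_plus {I : Type} (s : list I) (F G : I -> C) :
  (Csum s F + Csum s G)%C = Csum s (fun i => F i + G i)%C.
Proof.
  induction s as [|i s IH]. unfold Csum; simpl; ring. rewrite !Csum_cons, <- IH. ring.
Qed.

(** The reciprocal of the derivative at [t k] of the polynomial with roots [t l]. *)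
Definition pf_coef (s : list Z) (t : Z -> R) (k : Z) : C :=
  (/ Cprod (filter (fun l => negb (l =? k)%Z) s) (fun l => RtoC (t k) - RtoC (t l)))%C.

Lemma filter_notin (s : list Z) (k : Z) : ~ In k s -> filter (fun l => negb (l =? k)%Z) s = s.
Proof.
  induction s as [|j s IH]; intros H. reflexivity.
  simpl. destruct (Z.eqb_spec j k) as [->|]. exfalso; apply H; left; auto.
  simpl. f_equal. apply IH. intros h; apply H; right; auto.
Qed.

(* Passing from the poles [t k] to one more pole [p]: the coefficient at [p] comes from
   the expansion evaluated at [p]. *)
Lemma partial_fractions_step (s : list Z) (t : Z -> R) (lam : Z -> C) (Q : C -> C) (z p : C) :
  (forall w : C, (forall k, In k s -> w <> t k) -> Q w = Csum s (fun k => lam k * / (w - t k))%C) ->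
  (forall k, In k s -> z <> t k) -> z <> p -> (forall k, In k s -> p <> t k) ->
  (/ (z - p) * Q z)%C =
  (Q p * / (z - p) + Csum s (fun k => lam k * / (t k - p) * / (z - t k)))%C.
Proof.
  intros HQ Hz Hzp Hp. rewrite (HQ z Hz), (HQ p Hp).
  replace (Csum s (fun k => lam k * / (p - t k)) * / (z - p))%C with
    (/ (z - p) * Csum s (fun k => lam k * / (p - t k)))%C by ring.
  rewrite !Csum_scal, Csum_plus. apply Csum_ext. intros k Hk.
  assert (z - t k <> 0)%C by (apply Cminus_eq_contra; auto).
  assert (z - p <> 0)%C by (apply Cminus_eq_contra; auto).
  assert (p - t k <> 0)%C by (apply Cminus_eq_contra; auto).
  assert (t k - p <> 0)%C by (apply Cminus_eq_contra; intros E; apply (Hp k Hk); auto).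
  field. repeat split; auto.
Qed.

Lemma partial_fractions (s : list Z) (t : Z -> R) (z : C) : NoDup s -> s <> [] ->
  (forall k l, In k s -> In l s -> t k = t l -> k = l) ->
  (forall k, In k s -> z <> t k) ->
  (/ Cprod s (fun k => z - t k))%C = Csum s (fun k => pf_coef s t k * / (z - t k))%C.
Proof.
  intros Hnd. revert z. induction Hnd as [|k s Hk Hnd IH]; intros z Hs Ht Hz; [tauto|].
  destruct s as [|j s'].
  - unfold pf_coef, Cprod, Csum. simpl. rewrite Z.eqb_refl. simpl.
    assert (H := Cminus_eq_contra _ _ (Hz k (or_introl eq_refl))). field; auto.
  - set (s := j :: s') in *.
    assert (Ht' : forall a b, In a s -> In b s -> t a = t b -> a = b) by (intros; apply Ht; auto; right; auto).
    assert (Hp : forall a, In a s -> RtoC (t k) <> RtoC (t a)).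
    { intros a Ha E. apply RtoC_inj in E. apply Hk. rewrite (Ht k a); auto. left; auto. right; auto. }
    rewrite Cprod_cons, Csum_cons.
    assert (Hz1 : (z - t k)%C <> 0) by (apply Cminus_eq_contra, Hz; left; auto).
    assert (Hz2 : Cprod s (fun a => z - t a)%C <> 0).
    { apply Cprod_neq_0. intros a Ha. apply Cminus_eq_contra, Hz; right; auto. }
    replace (/ ((z - t k) * Cprod s (fun a => z - t a)))%C with (/ (z - t k) * / Cprod s (fun a => z - t a))%C
      by (field; auto).
    rewrite (partial_fractions_step s t (pf_coef s t) (fun w => / Cprod s (fun a => w - t a))%C z (t k)).
    + f_equal.
      * f_equal. unfold pf_coef. simpl filter. rewrite Z.eqb_refl. simpl negb. cbn iota.
        fold s. change (if negb (j =? k)%Z then j :: filter (fun l : Z => negb (l =? k)%Z) s' else filter (fun l : Z => negb (l =? k)%Z) s')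
          with (filter (fun l : Z => negb (l =? k)%Z) s).
        rewrite filter_notin; auto.
      * apply Csum_ext. intros a Ha. f_equal. unfold pf_coef.
        change (filter (fun l => negb (l =? a)%Z) (k :: s)) with
          (if negb (k =? a)%Z then k :: filter (fun l => negb (l =? a)%Z) s else filter (fun l => negb (l =? a)%Z) s).
        destruct (Z.eqb_spec k a) as [->|]; [tauto|]. simpl negb. cbn iota.
        rewrite Cprod_cons.
        assert (X1 : (RtoC (t a) - RtoC (t k))%C <> 0) by (apply Cminus_eq_contra; intros E; apply (Hp a Ha); auto).
        assert (X2 : Cprod (filter (fun l => negb (l =? a)%Z) s) (fun l => RtoC (t a) - RtoC (t l))%C <> 0).
        { apply Cprod_neq_0. intros b Hb. apply filter_In in Hb. destruct Hb as [Hb1 Hb2].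
          apply Cminus_eq_contra. intros E. apply RtoC_inj in E. rewrite (Ht' a b Ha Hb1 E), Z.eqb_refl in Hb2.
          discriminate. }
        field; auto.
    + intros w Hw. apply IH; auto. discriminate.
    + intros a Ha. apply Hz; right; auto.
    + apply Hz; left; auto.
    + exact Hp.
Qed.

Lemma edge_cc_Csum (s : list Z) (F : Z -> C -> C) (a b c d : R) :
  (forall k, In k s -> edge_cc (F k) a b c d) -> edge_cc (fun z => Csum s (fun k => F k z)) a b c d.
Proof.
  induction s as [|k s IH]; intros H.
  - split; intros; split; apply (cc_const 0).
  - apply (edge_cc_plus (F k) (fun z => Csum s (fun k => F k z))). apply H; left; auto.
    apply IH; intros; apply H; right; auto.
Qed.

Lemma rect_Csum (s : list Z) (F : Z -> C -> C) (a b c d : R) : a <= b -> c <= d ->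
  (forall k, In k s -> edge_cc (F k) a b c d) ->
  rect (fun z => Csum s (fun k => F k z)) a b c d = Csum s (fun k => rect (F k) a b c d).
Proof.
  intros Hab Hcd. induction s as [|k s IH]; intros H.
  - apply rect_const; auto.
  - rewrite Csum_cons, <- IH by (intros; apply H; right; auto).
    apply (rect_plus (F k) (fun z => Csum s (fun k => F k z))); auto.
    apply H; left; auto. apply edge_cc_Csum. intros; apply H; right; auto.
Qed.

(** Partial fractions reduce everything to integrals with a single pole over the same rectangle, so
    the contour never has to be cut between poles. *)
Lemma residue_sum (g : C -> C) (a b c d p : R) (s : list Z) (t : Z -> R) :
  NoDup s -> s <> [] -> (forall k l, In k s -> In l s -> t k = t l -> k = l) ->
  (forall k, In k s -> a < t k < b) -> a < p < b -> (forall k, In k s -> p <> t k) ->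
  c < 0 < d -> rect_cc g a b c d ->
  (forall x y, a <= x <= b -> c <= y <= d -> y <> 0 -> exists l, cd g (x, y) l) ->
  rect (fun z => g z * / ((z - p) * Cprod s (fun k => z - t k)))%C a b c d =
  (2 * PI * Ci * (g p * / Cprod s (fun k => RtoC p - t k) +
     Csum s (fun k => pf_coef s t k * / (RtoC (t k) - p) * g (t k))))%C.
Proof.
  intros Hnd Hs Ht Hts Hp Hpt Hcd Hcc Hg.
  assert (Edge : forall q, a < q < b -> edge_cc (fun z => g z * / (z - q))%C a b c d).
  { intros q Hq. split; intros v Hv; split; (apply (cc_mult g (fun z => / (z - q))%C); [apply Hcc; lra|]);
      (apply (cc_inv (fun z => z - q)%C); [apply cc_minus; [apply cc_id|apply cc_const]|]);
      intros E; apply C_pair_eq_RtoC in E; lra. }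
  transitivity (rect (fun z => / Cprod s (fun k => RtoC p - t k) * (g z * / (z - p)) +
     Csum s (fun k => (pf_coef s t k * / (RtoC (t k) - p)) * (g z * / (z - t k))))%C a b c d).
  { assert (Id : forall x y, (forall q, a < q < b -> (x, y) <> RtoC q) ->
      (g (x, y) * / (((x, y) - p) * Cprod s (fun k => (x, y) - t k)) =
       / Cprod s (fun k => RtoC p - t k) * (g (x, y) * / ((x, y) - p)) +
       Csum s (fun k => (pf_coef s t k * / (RtoC (t k) - p)) * (g (x, y) * / ((x, y) - t k))))%C).
    { intros x y Hxy. set (z := (x, y)) in *.
      assert (Hz1 : (z - p)%C <> 0) by (apply Cminus_eq_contra, Hxy; auto).
      assert (Hz2 : Cprod s (fun a => z - t a)%C <> 0).
      { apply Cprod_neq_0. intros k Hk. apply Cminus_eq_contra, Hxy; auto. }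
      replace (/ ((z - p) * Cprod s (fun k => z - t k)))%C with (/ (z - p) * / Cprod s (fun k => z - t k))%C
        by (field; auto).
      rewrite (partial_fractions_step s t (pf_coef s t) (fun w => / Cprod s (fun a => w - t a))%C z p).
      - rewrite Cmult_plus_distr_l, Csum_scal. f_equal. ring. apply Csum_ext. intros k Hk. ring.
      - intros w Hw. apply partial_fractions; auto.
      - intros k Hk. apply Hxy; auto.
      - apply Hxy; auto.
      - intros k Hk E. apply (Hpt k Hk), RtoC_inj; auto. }
    apply rect_ext; try lra; intros v Hv; split; apply Id; intros q Hq E; injection E; lra. }
  rewrite (rect_plus (fun z => / Cprod s (fun k => RtoC p - t k) * (g z * / (z - p)))%C); try lra.
  - rewrite (rect_scal _ (fun z => g z * / (z - p))%C), (cauchy_rect g a b c d p); auto; try lra.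
    rewrite (rect_Csum s (fun k z => (pf_coef s t k * / (RtoC (t k) - p)) * (g z * / (z - t k)))%C); try lra.
    + rewrite Cmult_plus_distr_l. f_equal. ring. rewrite Csum_scal. apply Csum_ext. intros k Hk.
      rewrite (rect_scal _ (fun z => g z * / (z - t k))%C), (cauchy_rect g a b c d (t k)); auto; try lra. ring.
    + intros k Hk. apply edge_cc_scal. auto.
  - apply edge_cc_scal. auto.
  - apply (edge_cc_Csum s (fun k z => (pf_coef s t k * / (RtoC (t k) - p)) * (g z * / (z - t k)))%C).
    intros k Hk. apply edge_cc_scal. auto.
Qed.


(** * The contour estimate *)

(** For a simple zero of [h] at 0 with [l] its derivative there, this fills in the removable
    singularity. It writes [/ h] as a continuous function times [/ z], the form required by
    [residue_sum]. *)
Definition theta (h : C -> C) (l z : C) : C := if Ceq_dec z 0 then (/ l)%C else (z * / h z)%C.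

Lemma cc_theta_0 (h : C -> C) (l : C) : cd h 0 l -> l <> 0 -> h 0 = 0 -> cc (theta h l) 0.
Proof.
  intros [phi [H1 [H2 H3]]] Hl H0.
  destruct (H3 (Cmod l)) as [d [D E]]. { apply Cmod_gt_0; auto. }
  apply cc_ext_loc with (fun z => / phi z)%C.
  - exists d. split; auto. intros w Hw. unfold theta. destruct (Ceq_dec w 0) as [->|Hw0].
    + rewrite H2; auto.
    + assert (Hp : phi w <> 0).
      { intros h0. specialize (E w Hw). rewrite h0, H2 in E.
        replace (0 - l)%C with (- l)%C in E by ring. rewrite Cmod_opp in E. lra. }
      rewrite (H1 w), H0. replace (0 + phi w * (w - 0))%C with (phi w * w)%C by ring. field; auto.
  - apply cc_inv; auto. rewrite H2; auto.
Qed.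

Lemma cd_theta (h : C -> C) (l z a : C) : cd h z a -> z <> 0 -> h z <> 0 ->
  exists b, cd (theta h l) z b.
Proof.
  intros Ha Hz Hh. exists (1 * / h z + z * (- a / (h z * h z)))%C.
  apply cd_ext_loc with (fun w => w * / h w)%C.
  - exists (Cmod z). split. apply Cmod_gt_0; auto. intros w Hw. unfold theta.
    destruct (Ceq_dec w 0) as [->|]; auto. exfalso.
    replace (0 - z)%C with (- z)%C in Hw by ring. rewrite Cmod_opp in Hw. lra.
  - apply (cd_mult (fun w => w) (fun w => / h w)%C). apply cd_id. apply cd_inv; auto.
Qed.

Lemma theta_div (h : C -> C) (l z : C) : z <> 0 -> h z <> 0 -> (theta h l z * / z)%C = (/ h z)%C.
Proof. intros Hz Hh. unfold theta. destruct (Ceq_dec z 0); [contradiction|]. field; auto. Qed.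

Definition htan (kap : R) (z : C) : C := Ctanh (kap * z).
Definition hsin (z : C) : C := Csinh (z / 2).

Lemma Csinh_neq_0 (z : C) : z <> 0 -> Rabs (Im z) < PI -> Csinh z <> 0.
Proof.
  intros Hz Hi E. apply Rabs_def2 in Hi.
  assert (S := Cmod_Csinh_sqr z). rewrite E, Cmod_0 in S.
  assert (0 <= sinh (Re z) * sinh (Re z)) by apply Rle_0_sqr.
  assert (0 <= sin (Im z) * sin (Im z)) by apply Rle_0_sqr.
  assert (S1 : sinh (Re z) = 0) by (apply Rsqr_0_uniq; unfold Rsqr; lra).
  assert (S2 : sin (Im z) = 0) by (apply Rsqr_0_uniq; unfold Rsqr; lra).
  apply Hz. apply injective_projections; simpl.
  - destruct (Rtotal_order (Re z) 0) as [L|[L|L]]; auto.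
    generalize (sinh_neg _ L); lra. generalize (sinh_pos _ L); lra.
  - destruct (Rtotal_order (Im z) 0) as [L|[L|L]]; auto.
    assert (sin (Im z) < 0) by (apply sin_lt_0_var; lra). lra.
    assert (0 < sin (Im z)) by (apply sin_gt_0; lra). lra.
Qed.

Lemma Ccosh_neq_0 (z : C) : Rabs (Im z) < PI / 2 -> Ccosh z <> 0.
Proof.
  intros Hi. apply Rabs_def2 in Hi. apply slit_neq_0, slit_Re_pos. rewrite Ccosh_eq; simpl.
  apply Rmult_lt_0_compat. apply cosh_pos. apply cos_gt_0; lra.
Qed.

Lemma Csinh_0 : Csinh 0 = 0.
Proof. rewrite Csinh_R, sinh_0; auto. Qed.

Lemma Ccosh_0 : Ccosh 0 = 1.
Proof. rewrite Ccosh_R. unfold cosh. rewrite Ropp_0, exp_0. f_equal. field. Qed.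

Lemma cd_scal_id (k z : C) : cd (fun z => k * z)%C z k.
Proof.
  apply cd_eq with (0 * z + k * 1)%C; [|ring].
  apply (cd_mult (fun _ => k) (fun z => z)). apply cd_const. apply cd_id.
Qed.

Lemma Cscal_neq_0 (k : R) (z : C) : 0 < k -> z <> 0 -> (k * z)%C <> 0.
Proof. intros Hk Hz. apply Cmult_neq_0; auto. intros E; apply RtoC_inj in E; lra. Qed.

(** In this strip [tanh (kap z)] has no pole and no zero other than 0, where its derivative is
    [kap]. At 0 only continuity of the quotient is claimed. *)
Lemma htan_strip (kap : R) (z : C) : 0 < kap -> kap * Rabs (Im z) < PI / 2 ->
  cc (theta (htan kap) kap) z /\
  (z <> 0 -> htan kap z <> 0 /\ exists l, cd (theta (htan kap) kap) z l).
Proof.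
  intros Hk Hz. assert (Hi : Rabs (Im (kap * z)) < PI / 2).
  { rewrite im_scal_l, Rabs_mult, (Rabs_pos_eq kap); lra. }
  assert (Hd : forall w : C, Rabs (Im (kap * w)) < PI / 2 ->
    cd (htan kap) w (/ (Ccosh (kap * w) * Ccosh (kap * w)) * kap)%C).
  { intros w Hw. apply (cd_comp (fun w => kap * w)%C Ctanh). apply cd_scal_id.
    apply cd_Ctanh, Ccosh_neq_0; auto. }
  assert (X : z <> 0 -> htan kap z <> 0 /\ exists l, cd (theta (htan kap) kap) z l).
  { intros Hz0. assert (Hn : htan kap z <> 0).
    { unfold htan, Ctanh, Cdiv. apply Cmult_neq_0.
      apply Csinh_neq_0. apply Cscal_neq_0; auto. generalize PI_RGT_0; lra.
      apply Cmod_gt_0. rewrite Cmod_inv by (apply Ccosh_neq_0; auto).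
      apply Rinv_0_lt_compat, Cmod_gt_0, Ccosh_neq_0; auto. }
    split; auto. apply (cd_theta _ _ _ _ (Hd z Hi)); auto. }
  split; auto. destruct (Ceq_dec z 0) as [->|Hz0].
  - apply cc_theta_0.
    + apply cd_eq with (/ (Ccosh (kap * 0) * Ccosh (kap * 0)) * kap)%C. apply Hd; auto.
      rewrite Cmult_0_r, Ccosh_0. field.
    + intros E; apply RtoC_inj in E; lra.
    + unfold htan, Ctanh. rewrite Cmult_0_r, Csinh_0. unfold Cdiv. ring.
  - destruct (X Hz0) as [_ [l Hl]]. apply (cd_cc _ _ _ Hl).
Qed.

Lemma hsin_strip (z : C) : Rabs (Im z) < PI ->
  cc (theta hsin (/ 2)) z /\
  (z <> 0 -> hsin z <> 0 /\ exists l, cd (theta hsin (/ 2)) z l).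
Proof.
  intros Hz. assert (Hi : Rabs (Im (z / 2)) < PI).
  { rewrite Im_half, Rabs_half. generalize (Rabs_pos (Im z)); lra. }
  assert (Hd : forall w : C, cd hsin w (Ccosh (w / 2) * / 2)%C).
  { intros w. apply (cd_comp (fun w => w / 2)%C Csinh). apply cd_half. apply cd_Csinh. }
  assert (X : z <> 0 -> hsin z <> 0 /\ exists l, cd (theta hsin (/ 2)) z l).
  { intros Hz0. assert (Hn : hsin z <> 0).
    { unfold hsin. apply Csinh_neq_0; auto. unfold Cdiv. apply Cmult_neq_0; auto.
      apply Cmod_gt_0. rewrite Cmod_inv by exact C2_neq_0. apply Rinv_0_lt_compat, Cmod_gt_0, C2_neq_0. }
    split; auto. apply (cd_theta _ _ _ _ (Hd z)); auto. }
  split; auto. destruct (Ceq_dec z 0) as [->|Hz0].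
  - apply cc_theta_0.
    + apply cd_eq with (Ccosh (0 / 2) * / 2)%C. apply Hd.
      rewrite RtoC_half. replace (0 / 2) with 0 by field. rewrite Ccosh_0. ring.
    + apply Cmod_gt_0. rewrite Cmod_inv by exact C2_neq_0. apply Rinv_0_lt_compat, Cmod_gt_0, C2_neq_0.
    + unfold hsin. rewrite RtoC_half. replace (0 / 2) with 0 by field. apply Csinh_0.
  - destruct (X Hz0) as [_ [l Hl]]. apply (cd_cc _ _ _ Hl).
Qed.

Lemma cc_Cprod {I : Type} (s : list I) (F : I -> C -> C) (z : C) :
  (forall i, In i s -> cc (F i) z) -> cc (fun z => Cprod s (fun i => F i z)) z.
Proof.
  induction s as [|i s IH]; intros H. apply (cc_const 1).
  apply (cc_mult (F i) (fun z => Cprod s (fun i => F i z))). apply H; left; auto.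
  apply IH; intros; apply H; right; auto.
Qed.

Lemma cd_Cprod {I : Type} (s : list I) (F : I -> C -> C) (z : C) :
  (forall i, In i s -> exists l, cd (F i) z l) -> exists l, cd (fun z => Cprod s (fun i => F i z)) z l.
Proof.
  induction s as [|i s IH]; intros H. exists (RtoC 0). apply (cd_const 1).
  destruct (H i (or_introl eq_refl)) as [a Ha]. destruct IH as [b Hb]. intros; apply H; right; auto.
  eexists. apply (cd_mult (F i) (fun z => Cprod s (fun i => F i z))); eauto.
Qed.

Lemma Cprod_mult {I : Type} (s : list I) (F G : I -> C) :
  (Cprod s F * Cprod s G)%C = Cprod s (fun i => F i * G i)%C.
Proof.
  induction s as [|i s IH]. unfold Cprod; simpl; ring. rewrite !Cprod_cons, <- IH. ring.
Qed.

Lemma Cprod_inv {I : Type} (s : list I) (F : I -> C) : (forall i, In i s -> F i <> 0) ->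
  (/ Cprod s F)%C = Cprod s (fun i => / F i)%C.
Proof.
  induction s as [|i s IH]; intros H.
  - unfold Cprod; simpl. field.
  - rewrite !Cprod_cons, <- IH by (intros; apply H; right; auto).
    assert (F i <> 0) by (apply H; left; auto).
    assert (Cprod s F <> 0) by (apply Cprod_neq_0; intros; apply H; right; auto).
    field; auto.
Qed.

(** The exponent used later is [2 nu - 1]: it is what remains of the powers of [1 - x ^ 2] and
    [1 - beta_k ^ 2] once [x - beta_k] is expressed through [sinh]. *)
Definition pull (f : C -> C) (p : R) (z : C) : C :=
  (f (Ctanh (z / 2)) * cosh_pow p (Ctanh (z / 2)))%C.

Lemma pull_cd (d : R) (f : C -> C) (p : R) (z : C) : 0 < d < PI -> analytic_on (Lambda d) f ->
  Rabs (Im z) < d -> exists l, cd (pull f p) z l.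
Proof.
  intros Hd Hf Hz. assert (HL : Lambda d (Ctanh (z / 2))) by (exists z; split; auto).
  assert (HT : cd (fun z => Ctanh (z / 2)) z (/ (Ccosh (z / 2) * Ccosh (z / 2)) * / 2)%C).
  { apply (cd_comp (fun w => w / 2)%C Ctanh). apply cd_half. apply cd_Ctanh, Ccosh_half_neq_0; lra. }
  destruct (proj1 (ex_derive_cd _ _) (Hf _ HL)) as [a Ha].
  destruct (smooth_cd (Lambda d) (cosh_pow p)) as [g [_ Hg]].
  { apply smooth_cosh_pow. intros w; apply Lambda_zt_dom; lra. }
  eexists. apply (cd_mult (fun z => f (Ctanh (z / 2))) (fun z => cosh_pow p (Ctanh (z / 2)))).
  - apply (cd_comp (fun z => Ctanh (z / 2)) f). exact HT. exact Ha.
  - apply (cd_comp (fun z => Ctanh (z / 2)) (cosh_pow p)). exact HT. apply Hg; auto.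
Qed.

Lemma Cmod_pull_le (d mu p : R) (f : C -> C) (z : C) : 0 < d < PI -> unit_ball d mu f ->
  Rabs (Im z) < d -> Cmod (pull f p z) <= Rpower (Cmod (Ccosh (z / 2))) (p - mu).
Proof.
  intros Hd Hf Hz. assert (HL : Lambda d (Ctanh (z / 2))) by (exists z; split; auto).
  assert (Hzd := Lambda_zt_dom d _ (proj2 Hd) HL).
  assert (B := unit_ball_bound d mu f _ Hf HL).
  assert (W := Cmod_w_mu mu _ Hzd). rewrite zt_Ctanh in W by lra.
  assert (Wp : 0 < Cmod (w_mu mu (Ctanh (z / 2)))) by (rewrite W; apply exp_pos).
  rewrite Cmod_div in B by (apply Cmod_gt_0; auto).
  assert (B2 : Cmod (f (Ctanh (z / 2))) <= Cmod (w_mu mu (Ctanh (z / 2)))).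
  { apply Rmult_le_reg_r with (/ Cmod (w_mu mu (Ctanh (z / 2)))). apply Rinv_0_lt_compat; auto.
    rewrite Rinv_r by lra. exact B. }
  unfold pull. rewrite Cmod_mult, Cmod_cosh_pow, zt_Ctanh by lra. rewrite W in B2.
  replace (p - mu) with (- mu + p) by ring. rewrite Rpower_plus.
  apply Rmult_le_compat_r; auto. left; apply exp_pos.
Qed.

Lemma cosh_le_double (a b : R) : cosh (a + b) <= 2 * cosh a * cosh b.
Proof.
  assert (cosh (a + b) + cosh (a - b) = 2 * cosh a * cosh b).
  { unfold cosh. replace (- (a + b)) with (- a + - b) by ring. replace (a - b) with (a + - b) by ring.
    replace (- (a + - b)) with (- a + b) by ring. rewrite !exp_plus. field. }
  generalize (cosh_pos (a - b)); lra.
Qed.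

Lemma cosh_opp (x : R) : cosh (- x) = cosh x.
Proof. unfold cosh. rewrite Ropp_involutive. field. Qed.

(** [cosh (s + v)] and [cosh s] differ at most by the factor [2 cosh v], in either direction, so
    both signs of [p] are covered by [|p|]. *)
Lemma cosh_weight_le (a s v p : R) : a = s + v -> -1 < p < 1 ->
  Rpower (cosh a) p <= 2 * Rpower (cosh s) p * Rpower (cosh v) (Rabs p).
Proof.
  intros Ha Hp. assert (Pa := cosh_pos a). assert (Ps := cosh_pos s). assert (Pv := cosh_pos v).
  assert (L1 : ln (cosh a) <= ln 2 + ln (cosh s) + ln (cosh v)).
  { rewrite <- !ln_mult by nra. apply ln_le; auto. rewrite Ha. apply cosh_le_double. }
  assert (L2 : ln (cosh s) <= ln 2 + ln (cosh a) + ln (cosh v)).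
  { rewrite <- !ln_mult by nra. apply ln_le; auto. replace s with (a + - v) by lra.
    rewrite <- (cosh_opp v). apply cosh_le_double. }
  unfold Rpower. replace 2 with (exp (ln 2)) at 1 by (apply exp_ln; lra).
  rewrite <- !exp_plus. apply exp_le_mono.
  assert (0 < ln 2) by (rewrite <- ln_1; apply ln_increasing; lra).
  destruct (Rle_dec 0 p).
  - rewrite Rabs_pos_eq by auto. nra.
  - rewrite Rabs_left by lra. nra.
Qed.

(** Exponential decay is traded for a multiple of the Cauchy density in [2 v], whose integral is an
    arctangent. *)
Lemma cosh_decay (th v : R) : 0 < th <= 1 ->
  Rpower (cosh v) (- th) <= 32 / th ^ 2 / (1 + (2 * v) ^ 2).
Proof.
  intros Hth. assert (Pv := cosh_pos v).
  assert (L1 : Rabs v - ln 2 <= ln (cosh v)).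
  { rewrite <- (ln_exp (Rabs v)), <- ln_div by (try apply exp_pos; lra).
    apply ln_le. apply Rdiv_lt_0_compat; [apply exp_pos|lra]. apply cosh_ge_half_exp. }
  assert (0 < ln 2) by (rewrite <- ln_1; apply ln_increasing; lra).
  apply Rle_trans with (2 * exp (- (th * Rabs v))).
  - unfold Rpower. replace 2 with (exp (ln 2)) by (apply exp_ln; lra).
    rewrite <- exp_plus. apply exp_le_mono. nra.
  - rewrite exp_Ropp.
    assert (E : (1 + th * Rabs v / 2) ^ 2 <= exp (th * Rabs v)).
    { replace (th * Rabs v) with (th * Rabs v / 2 + th * Rabs v / 2) at 2 by field.
      rewrite exp_plus. assert (I := exp_ineq1_le (th * Rabs v / 2)).
      assert (0 <= th * Rabs v) by (apply Rmult_le_pos; [lra|apply Rabs_pos]).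
      simpl. rewrite Rmult_1_r. apply Rmult_le_compat; lra. }
    assert (Hv : Rabs v * Rabs v = v * v) by (rewrite <- Rabs_mult; apply Rabs_pos_eq; nra).
    assert (E2 : th ^ 2 / 16 * (1 + (2 * v) ^ 2) <= exp (th * Rabs v)).
    { apply Rle_trans with (2 := E).
      assert (0 <= th * Rabs v) by (apply Rmult_le_pos; [lra|apply Rabs_pos]).
      replace ((1 + th * Rabs v / 2) ^ 2) with (1 + th * Rabs v + th * th * (Rabs v * Rabs v) / 4) by field.
      rewrite Hv. nra. }
    assert (0 < th ^ 2 / 16 * (1 + (2 * v) ^ 2)) by (apply Rmult_lt_0_compat; nra).
    replace (32 / th ^ 2 / (1 + (2 * v) ^ 2)) with (2 * / (th ^ 2 / 16 * (1 + (2 * v) ^ 2))) by (field; nra).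
    apply Rmult_le_compat_l. lra. apply Rinv_le_contravar; auto.
Qed.

(** From [|cosh (x + i y)| ^ 2 = sinh x ^ 2 + cos y ^ 2]. The lower constant is positive because
    [d < PI]. *)
Lemma Cmod_Ccosh_half_bounds (d : R) (z : C) : 0 < d < PI -> Rabs (Im z) < d ->
  cos (d / 2) * cosh (Re z / 2) <= Cmod (Ccosh (z / 2)) <= cosh (Re z / 2).
Proof.
  intros Hd Hz. assert (S := Cmod_Ccosh_sqr (z / 2)). rewrite Re_half, Im_half in S.
  assert (E := cosh_sqr (Re z / 2)). assert (P := cosh_pos (Re z / 2)).
  assert (M := Cmod_ge_0 (Ccosh (z / 2))).
  assert (Hc : cos (d / 2) <= cos (Im z / 2) <= 1).
  { split; [|apply COS_bound]. unfold Rabs in Hz. destruct (Rcase_abs (Im z)).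
    - rewrite <- (cos_neg (Im z / 2)). left; apply cos_decreasing_1; lra.
    - left; apply cos_decreasing_1; lra. }
  assert (Hc0 : 0 < cos (d / 2)) by (apply cos_gt_0; lra).
  assert (0 <= sinh (Re z / 2) * sinh (Re z / 2)) by apply Rle_0_sqr.
  split; apply Rsqr_incr_0_var; try lra; unfold Rsqr; rewrite S.
  - replace (cos (d / 2) * cosh (Re z / 2) * (cos (d / 2) * cosh (Re z / 2))) with
      (cos (d / 2) * cos (d / 2) * (cosh (Re z / 2) * cosh (Re z / 2))) by ring.
    rewrite E. assert (cos (d / 2) * cos (d / 2) <= cos (Im z / 2) * cos (Im z / 2)) by nra.
    assert (cos (Im z / 2) * cos (Im z / 2) <= 1) by nra. nra.
  - rewrite E. nra.
Qed.

Lemma Rpower_between (g x y p : R) : 0 < g <= 1 -> 0 < y -> g * y <= x <= y -> -1 < p < 1 ->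
  Rpower x p <= / g * Rpower y p.
Proof.
  intros Hg Hy Hx Hp. assert (Hx0 : 0 < x) by nra.
  unfold Rpower. replace (/ g) with (exp (- ln g)) by (rewrite exp_Ropp, exp_ln; lra).
  rewrite <- exp_plus. apply exp_le_mono.
  assert (ln x <= ln y) by (apply ln_le; lra).
  assert (ln g + ln y <= ln x) by (rewrite <- ln_mult by lra; apply ln_le; nra).
  assert (ln g <= 0) by (rewrite <- ln_1; apply ln_le; lra).
  destruct (Rle_dec 0 p); nra.
Qed.

(** Moving the weight from [Re z] to [s] costs [cosh v ^ |p|]; against the decay [1 / cosh v] of the
    kernel there remains the exponent [|p| - 1], negative exactly when [|p| < 1]. *)
Lemma Cmod_pull_decay (d mu q : R) (f : C -> C) (z : C) (s : R) : 0 < d < PI -> unit_ball d mu f ->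
  -1 < q - mu < 1 -> Rabs (Im z) < d ->
  Cmod (pull f q z) * / cosh ((Re z - s) / 2) <=
  / cos (d / 2) * 64 / (1 - Rabs (q - mu)) ^ 2 * Rpower (cosh (s / 2)) (q - mu) / (1 + (Re z - s) ^ 2).
Proof.
  intros Hd Hf Hp Hz. set (p := q - mu) in *. set (v := (Re z - s) / 2).
  assert (Pv := cosh_pos v).
  assert (Hc0 : 0 < cos (d / 2) <= 1) by (split; [apply cos_gt_0; lra|apply COS_bound]).
  assert (B1 := Cmod_pull_le d mu q f z Hd Hf Hz). fold p in B1.
  assert (B2 := Rpower_between (cos (d / 2)) (Cmod (Ccosh (z / 2))) (cosh (Re z / 2)) p Hc0 (cosh_pos _)
    (Cmod_Ccosh_half_bounds d z Hd Hz) Hp).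
  assert (B3 := cosh_weight_le (Re z / 2) (s / 2) v p ltac:(unfold v; field) Hp).
  assert (Hab : Rabs p < 1) by (apply Rabs_def1; lra).
  assert (Hab0 := Rabs_pos p).
  assert (B4 := cosh_decay (1 - Rabs p) v ltac:(lra)).
  replace (2 * v) with (Re z - s) in B4 by (unfold v; field).
  assert (E : Rpower (cosh v) (Rabs p) * / cosh v = Rpower (cosh v) (- (1 - Rabs p))).
  { replace (- (1 - Rabs p)) with (Rabs p + - (1)) by ring. rewrite Rpower_plus, Rpower_Ropp, Rpower_1; auto. }
  assert (Ps : 0 < Rpower (cosh (s / 2)) p) by apply exp_pos.
  assert (Hi : 0 < / cos (d / 2)) by (apply Rinv_0_lt_compat; lra).
  assert (Hiv : 0 < / cosh v) by (apply Rinv_0_lt_compat; lra).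
  apply Rle_trans with (/ cos (d / 2) * (2 * Rpower (cosh (s / 2)) p * Rpower (cosh v) (Rabs p)) * / cosh v).
  - apply Rmult_le_compat_r. lra. apply Rle_trans with (1 := B1). apply Rle_trans with (1 := B2).
    apply Rmult_le_compat_l; lra.
  - replace (/ cos (d / 2) * (2 * Rpower (cosh (s / 2)) p * Rpower (cosh v) (Rabs p)) * / cosh v) with
      (/ cos (d / 2) * (2 * Rpower (cosh (s / 2)) p) * (Rpower (cosh v) (Rabs p) * / cosh v)) by ring.
    rewrite E.
    apply Rle_trans with (/ cos (d / 2) * (2 * Rpower (cosh (s / 2)) p) * (32 / (1 - Rabs p) ^ 2 / (1 + (Re z - s) ^ 2))).
    + apply Rmult_le_compat_l; auto. apply Rmult_le_pos; lra.
    + right. field. generalize (pow2_ge_0 (Re z - s)). intros. repeat split; lra.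
Qed.

(** [|tanh (x + i y)| ^ 2 = (sinh x ^ 2 + sin y ^ 2) / (sinh x ^ 2 + cos y ^ 2)], which for
    [|y| < PI / 4] is smallest at [x = 0]. This serves the horizontal edges of the contour. *)
Lemma Cmod_Ctanh_lower_Im (z : C) (b : R) : 0 <= b < PI / 4 -> Rabs (Im z) = b ->
  tan b <= Cmod (Ctanh z).
Proof.
  intros Hb Hz. assert (HP := PI_RGT_0).
  assert (Hc := Ccosh_neq_0 z ltac:(lra)).
  assert (Hcp : 0 < Cmod (Ccosh z)) by (apply Cmod_gt_0; auto).
  assert (S1 := Cmod_Csinh_sqr z). assert (S2 := Cmod_Ccosh_sqr z).
  assert (Es : sin (Im z) * sin (Im z) = sin b * sin b).
  { rewrite <- Hz. unfold Rabs. destruct Rcase_abs; auto. rewrite sin_neg. ring. }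
  assert (Ec : cos (Im z) * cos (Im z) = cos b * cos b) by (rewrite !cos_sqr, Es; auto).
  rewrite Es in S1. rewrite Ec in S2.
  assert (Cb : 0 < cos b) by (apply cos_gt_0; lra).
  assert (Sb : 0 <= sin b) by (apply sin_ge_0; lra).
  assert (Sc : sin b <= cos b).
  { rewrite <- (sin_shift b). apply sin_incr_1; lra. }
  unfold Ctanh. rewrite Cmod_div by auto.
  apply Rmult_le_reg_r with (Cmod (Ccosh z) * cos b). nra.
  unfold tan, Rdiv.
  replace (sin b * / cos b * (Cmod (Ccosh z) * cos b)) with (sin b * Cmod (Ccosh z)) by (field; lra).
  replace (Cmod (Csinh z) * / Cmod (Ccosh z) * (Cmod (Ccosh z) * cos b)) with (Cmod (Csinh z) * cos b) by (field; lra).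
  apply Rsqr_incr_0_var; [|apply Rmult_le_pos; [apply Cmod_ge_0|lra]].
  unfold Rsqr.
  replace (sin b * Cmod (Ccosh z) * (sin b * Cmod (Ccosh z))) with (sin b * sin b * (Cmod (Ccosh z) * Cmod (Ccosh z))) by ring.
  replace (Cmod (Csinh z) * cos b * (Cmod (Csinh z) * cos b)) with (cos b * cos b * (Cmod (Csinh z) * Cmod (Csinh z))) by ring.
  rewrite S1, S2.
  assert (0 <= sinh (Re z) * sinh (Re z)) by apply Rle_0_sqr.
  assert (sin b * sin b <= cos b * cos b) by nra. nra.
Qed.

Lemma sinh_sqr_ge_1 (x : R) : 2 <= Rabs x -> 1 <= sinh x * sinh x.
Proof.
  assert (Pos : forall x, 2 <= x -> 1 <= sinh x).
  { intros y Hy. unfold sinh. generalize (exp_ineq1_le y) (exp_opp_le_1 y ltac:(lra)). lra. }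
  intros H. unfold Rabs in H. destruct (Rcase_abs x).
  - assert (P := Pos (- x) H). assert (E : sinh (- x) = - sinh x) by (unfold sinh; rewrite Ropp_involutive; field). nra.
  - assert (P := Pos x H). nra.
Qed.

(** For the vertical edges any fixed positive constant will do, as they are moved to infinity for a
    fixed number of nodes. *)
Lemma Cmod_Ctanh_lower_Re (z : C) : Rabs (Im z) < PI / 2 -> 2 <= Rabs (Re z) ->
  / 2 <= Cmod (Ctanh z).
Proof.
  intros Hi Hr. assert (Hc := Ccosh_neq_0 z Hi).
  assert (Hcp : 0 < Cmod (Ccosh z)) by (apply Cmod_gt_0; auto).
  assert (S1 := Cmod_Csinh_sqr z). assert (S2 := Cmod_Ccosh_sqr z). assert (H := sinh_sqr_ge_1 _ Hr).
  unfold Ctanh. rewrite Cmod_div by auto.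
  apply Rmult_le_reg_r with (Cmod (Ccosh z)); auto. unfold Rdiv. rewrite Rmult_assoc, Rinv_l, Rmult_1_r by lra.
  apply Rsqr_incr_0_var; [|apply Cmod_ge_0]. unfold Rsqr.
  replace (/ 2 * Cmod (Ccosh z) * (/ 2 * Cmod (Ccosh z))) with (/ 4 * (Cmod (Ccosh z) * Cmod (Ccosh z))) by field.
  rewrite S1, S2. assert (0 <= sin (Im z) * sin (Im z)) by apply Rle_0_sqr.
  generalize (cos_sqr (Im z)). intros. lra.
Qed.

(** The first alternative serves the horizontal edges, the second the vertical ones; both rest on
    [|sinh z| ^ 2 = sinh (Re z) ^ 2 + sin (Im z) ^ 2]. *)
Lemma Cmod_Csinh_lower (z : C) (c : R) : 0 <= c ->
  c * c <= sin (Im z) * sin (Im z) \/ (c = / 2 /\ 2 <= Rabs (Re z)) -> c * cosh (Re z) <= Cmod (Csinh z).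
Proof.
  intros Hc H. apply Rsqr_incr_0_var; [|apply Cmod_ge_0]. unfold Rsqr. rewrite Cmod_Csinh_sqr.
  replace (c * cosh (Re z) * (c * cosh (Re z))) with (c * c * (cosh (Re z) * cosh (Re z))) by ring.
  rewrite cosh_sqr. assert (0 <= sinh (Re z) * sinh (Re z)) by apply Rle_0_sqr.
  assert (0 <= sin (Im z) * sin (Im z) <= 1).
  { split. apply Rle_0_sqr. generalize (cos_sqr (Im z)) (Rle_0_sqr (cos (Im z))). unfold Rsqr. lra. }
  destruct H as [H|[-> H]].
  - nra.
  - assert (K := sinh_sqr_ge_1 _ H). lra.
Qed.


Lemma Cprod_filter_out (s : list Z) (k : Z) (F : Z -> C) : NoDup s -> In k s ->
  Cprod s F = (F k * Cprod (filter (fun l => negb (l =? k)%Z) s) F)%C.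
Proof.
  intros Hs Hk. induction Hs as [|j s Hj Hs IH]. destruct Hk.
  simpl filter. destruct (Z.eqb_spec j k) as [->|Hjk]; simpl negb; cbn iota.
  - rewrite Cprod_cons, filter_notin; auto.
  - destruct Hk as [->|Hk]; [tauto|]. rewrite !Cprod_cons, IH by auto. ring.
Qed.

Lemma Cprod_ge_pow {I : Type} (s : list I) (F : I -> C) (m : R) : 0 <= m ->
  (forall i, In i s -> m <= Cmod (F i)) -> m ^ length s <= Cmod (Cprod s F).
Proof.
  intros Hm. induction s as [|i s IH]; intros H.
  - unfold Cprod; simpl. rewrite Cmod_1. lra.
  - rewrite Cprod_cons, Cmod_mult. simpl. apply Rmult_le_compat; auto. apply pow_le; auto.
    apply H; left; auto. apply IH; intros; apply H; right; auto.
Qed.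

Lemma list_Rabs_bound (s : list Z) (t : Z -> R) : exists M, 0 <= M /\ forall k, In k s -> Rabs (t k) <= M.
Proof.
  induction s as [|k s [M [HM H]]].
  - exists 0. split. lra. intros k [].
  - exists (Rmax (Rabs (t k)) M). split. apply Rle_trans with (1 := HM), Rmax_r.
    intros j [<-|Hj]. apply Rmax_l. apply Rle_trans with (2 := Rmax_r _ _). auto.
Qed.

(** [tan (PI / 4) = 1], and the power is continuous at [d]. Requiring [d / 2 <= eta] keeps
    [sin (eta / 2)] away from 0 independently of [n]. *)
Lemma tan_pow_near_one (kap d : R) (n : nat) : 0 < d -> kap * d = PI / 4 ->
  exists eta, d / 2 <= eta < d /\ / 2 <= tan (kap * eta) ^ n.
Proof.
  intros Hd Hk. assert (HP := PI_RGT_0). assert (Hkp : 0 < kap) by nra.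
  assert (C1 : continuity_pt (fun x => tan (kap * x) ^ n) d).
  { apply (continuity_pt_comp (fun x => kap * x) (fun y => tan y ^ n)).
    - apply derivable_continuous_pt, ex_derive_Reals_0. auto_derive; auto.
    - apply (continuity_pt_comp tan (fun v => v ^ n)).
      + apply derivable_continuous_pt, derivable_pt_tan. rewrite Hk. lra.
      + apply derivable_continuous_pt, derivable_pt_pow. }
  destruct (C1 (/ 2)) as [a [Ha E]]; [lra|].
  set (eta := Rmax (d / 2) (d - a / 2)).
  assert (H1 : d / 2 <= eta) by apply Rmax_l. assert (H2 : d - a / 2 <= eta) by apply Rmax_r.
  assert (H3 : eta < d) by (apply Rmax_lub_lt; lra).
  exists eta. split; [lra|].
  assert (X : Rabs (tan (kap * eta) ^ n - tan (kap * d) ^ n) < / 2).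
  { apply (E eta). split. split; [exact I|lra]. simpl. unfold Rdist. rewrite Rabs_left; lra. }
  rewrite Hk, tan_PI4, pow1 in X. apply Rabs_def2 in X. lra.
Qed.

Lemma RInt_cauchy_density (s c a b : R) : a <= b -> 0 <= c ->
  ex_RInt (fun u => c / (1 + (u - s) ^ 2)) a b /\
  RInt (fun u => c / (1 + (u - s) ^ 2)) a b <= c * PI.
Proof.
  intros Hab Hc.
  assert (Hq : forall u, 0 < 1 + (u + - s) * ((u + - s) * 1)).
  { intros u. generalize (Rle_0_sqr (u - s)). unfold Rsqr. lra. }
  assert (Cont : forall u, continuity_pt (fun u => c / (1 + (u - s) ^ 2)) u).
  { intros u. apply derivable_continuous_pt, ex_derive_Reals_0. auto_derive.
    generalize (Hq u); lra. }
  split.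
  - apply (ex_RInt_continuous (V := R_CompleteNormedModule)). intros u _.
    apply continuity_pt_filterlim, Cont.
  - rewrite (RInt_FTC (fun u => c * atan (u - s))); auto.
    + generalize (atan_bound (b - s)) (atan_bound (a - s)). intros. nra.
    + intros u _. auto_derive; auto. unfold Rminus. field.
      generalize (Hq u). lra.
Qed.

(* The residue theorem on a thin rectangle around [- RR, RR] for
   [pull f q z / (hsin (z - s) * prod htan (z - t k))], whose residues are the terms on the left.
   [|Ctanh| = 1] on the line [Im = PI / 4], so the product is at least 1/2 on the horizontal edges
   once the half-thickness [eta] is close enough to [d]. *)
Lemma contour_bound (d mu q : R) : 0 < d < PI -> -1 < q - mu < 1 -> exists K, 0 < K /\
  forall (idx : list Z) (t : Z -> R) (f : C -> C) (s : R),
  NoDup idx -> idx <> [] -> (forall k l, In k idx -> In l idx -> t k = t l -> k = l) ->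
  (forall k, In k idx -> s <> t k) -> unit_ball d mu f ->
  let kap := PI / (4 * d) in
  Cmod (pull f q s * 2 * / Cprod idx (fun k => htan kap (RtoC s - t k)) +
    Csum idx (fun k => pull f q (t k) * / kap * / hsin (RtoC (t k) - s) *
      / Cprod (filter (fun l => negb (l =? k)%Z) idx) (fun l => htan kap (RtoC (t k) - t l)))%C) <=
  K * Rpower (cosh (s / 2)) (q - mu).
Proof.
  intros Hd Hp. set (p := q - mu) in *. assert (HP := PI_RGT_0).
  assert (Hcd : 0 < cos (d / 2)) by (apply cos_gt_0; lra).
  (* [S0] bounds [|hsin (z - s)|] from below relative to [cosh] on the horizontal edges, because
     [eta / 2 >= d / 4]. *)
  assert (HS : 0 < sin (d / 4)) by (apply sin_gt_0; lra). set (S0 := sin (d / 4)) in *.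
  assert (Hab : Rabs p < 1) by (apply Rabs_def1; lra).
  set (C1 := / cos (d / 2) * 64 / (1 - Rabs p) ^ 2).
  assert (HC1 : 0 < C1).
  { unfold C1. apply Rdiv_lt_0_compat. apply Rmult_lt_0_compat; [apply Rinv_0_lt_compat; auto|lra].
    apply pow_lt; lra. }
  exists (4 / S0 * C1). split. { apply Rmult_lt_0_compat; auto. apply Rdiv_lt_0_compat; lra. }
  intros idx t f s Hnd Hne Hinj Hst Hf kap.
  assert (Hk : 0 < kap) by (apply Rdiv_lt_0_compat; lra).
  assert (Hkd : kap * d = PI / 4) by (unfold kap; field; lra).
  assert (Hfa : analytic_on (Lambda d) f) by apply Hf.
  set (X := (_ + Csum idx _)%C).
  set (n := length idx).
  destruct (tan_pow_near_one kap d n (proj1 Hd) Hkd) as [eta [He1 He2]].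
  (* [g] is the integrand with its poles divided out; it is continuous on the whole strip. *)
  set (g := fun z => (pull f q z * theta hsin (/ 2) (z - s) *
     Cprod idx (fun k => theta (htan kap) kap (z - t k)))%C).
  assert (ImS : forall (z : C) (x : R), Im (z - x) = Im z).
  { intros z x. unfold Cminus. rewrite im_plus, im_opp, im_RtoC. ring. }
  assert (ReS : forall (z : C) (x : R), Re (z - x) = Re z - x).
  { intros z x. unfold Cminus. rewrite re_plus, re_opp, re_RtoC. ring. }
  assert (Csub : forall (z : C) (x : R), cd (fun z => z - x)%C z (1 - 0)%C).
  { intros. apply cd_minus. apply cd_id. apply cd_const. }
  assert (Hkz : forall y, Rabs y < d -> kap * Rabs y < PI / 2) by (intros; nra).
  assert (Hgcc : forall z, Rabs (Im z) < d -> cc g z).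
  { intros z Hz. unfold g. apply cc_mult. apply cc_mult.
    - destruct (pull_cd d f q z Hd Hfa Hz) as [l Hl]. apply (cd_cc _ _ _ Hl).
    - apply (cc_comp (fun z => z - s)%C (theta hsin (/ 2))). apply (cd_cc _ _ _ (Csub z s)).
      apply hsin_strip. rewrite ImS; lra.
    - apply cc_Cprod. intros k _.
      apply (cc_comp (fun z => z - t k)%C (theta (htan kap) kap)). apply (cd_cc _ _ _ (Csub z (t k))).
      apply htan_strip; auto. rewrite ImS. auto. }
  assert (Hnz : forall (z : C) (x : R), z <> RtoC x -> (z - x)%C <> 0) by (intros; apply Cminus_eq_contra; auto).
  assert (Hgcd : forall z, Rabs (Im z) < d -> Im z <> 0 -> exists l, cd g z l).
  { intros z Hz Hz0. assert (Hzx : forall x : R, z <> RtoC x) by (intros x E; apply Hz0; rewrite E; apply im_RtoC).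
    destruct (pull_cd d f q z Hd Hfa Hz) as [l1 Hl1].
    assert (h1 : Rabs (Im (z - s)) < PI) by (rewrite ImS; lra).
    destruct (proj2 (hsin_strip _ h1) (Hnz z s (Hzx s))) as [_ [l2 Hl2]].
    destruct (cd_Cprod idx (fun k z => theta (htan kap) kap (z - t k)%C) z) as [l3 Hl3].
    { intros k _. assert (h2 : kap * Rabs (Im (z - t k)) < PI / 2) by (rewrite ImS; auto).
      destruct (proj2 (htan_strip kap _ Hk h2) (Hnz z (t k) (Hzx _))) as [_ [l Hl]].
      eexists. apply (cd_comp (fun z => z - t k)%C (theta (htan kap) kap)). apply Csub. exact Hl. }
    eexists. unfold g. apply cd_mult. apply cd_mult. exact Hl1.
    apply (cd_comp (fun z => z - s)%C (theta hsin (/ 2))). apply Csub. exact Hl2. exact Hl3. }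
  set (G := fun z => (g z * / ((z - s) * Cprod idx (fun k => z - t k)))%C).
  assert (HG : forall z, Rabs (Im z) < d -> z <> RtoC s -> (forall k, In k idx -> z <> RtoC (t k)) ->
    G z = (pull f q z * / hsin (z - s) * / Cprod idx (fun k => htan kap (z - t k)))%C /\ cc G z).
  { intros z Hz Hzs Hzt.
    assert (N1 := Hnz z s Hzs).
    assert (N2 : Cprod idx (fun k => z - t k)%C <> 0) by (apply Cprod_neq_0; intros; apply Hnz; auto).
    assert (h1 : Rabs (Im (z - s)) < PI) by (rewrite ImS; lra).
    destruct (proj2 (hsin_strip _ h1) N1) as [N3 _].
    assert (N4 : forall k, In k idx -> htan kap (z - t k) <> 0).
    { intros k Hki. assert (h2 : kap * Rabs (Im (z - t k)) < PI / 2) by (rewrite ImS; auto).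
      apply (proj2 (htan_strip kap _ Hk h2)). auto. }
    split.
    - unfold G, g.
      transitivity (pull f q z * (theta hsin (/ 2) (z - s) * / (z - s)) *
        (Cprod idx (fun k => theta (htan kap) kap (z - t k)) * / Cprod idx (fun k => z - t k)))%C.
      field; auto.
      rewrite theta_div by auto. rewrite (Cprod_inv idx (fun k => z - t k)%C), Cprod_mult by auto.
      rewrite (Cprod_inv idx (fun k => htan kap (z - t k))) by auto. f_equal.
      apply Cprod_ext. intros k Hki. apply theta_div; auto.
    - unfold G. apply cc_mult. apply Hgcc; auto.
      apply (cc_inv (fun z => (z - s) * Cprod idx (fun k => z - t k))%C).
      + apply cc_mult. apply (cd_cc _ _ _ (Csub z s)). apply (cc_Cprod idx (fun k z => z - t k)%C).
        intros k _. apply (cd_cc _ _ _ (Csub z (t k))).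
      + apply Cmult_neq_0; auto. }
  set (C0 := C1 * Rpower (cosh (s / 2)) p).
  assert (HC0 : 0 < C0) by (apply Rmult_lt_0_compat; auto; apply exp_pos).
  assert (Bpull : forall z, Rabs (Im z) < d ->
     Cmod (pull f q z) * / cosh ((Re z - s) / 2) <= C0 / (1 + (Re z - s) ^ 2)).
  { intros z Hz. apply (Cmod_pull_decay d mu q f z s Hd Hf Hp Hz). }
  assert (BG : forall z c m, Rabs (Im z) < d -> z <> RtoC s -> (forall k, In k idx -> z <> RtoC (t k)) ->
     0 < c -> 0 < m -> c * cosh ((Re z - s) / 2) <= Cmod (hsin (z - s)) ->
     m <= Cmod (Cprod idx (fun k => htan kap (z - t k))) ->
     Cmod (G z) <= / (c * m) * (C0 / (1 + (Re z - s) ^ 2))).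
  { intros z c m Hz Hzs Hzt Hc Hm H1 H2. rewrite (proj1 (HG z Hz Hzs Hzt)), !Cmod_mult.
    assert (Pv := cosh_pos ((Re z - s) / 2)).
    assert (0 < Cmod (hsin (z - s))) by nra.
    rewrite !Cmod_inv by (apply Cmod_gt_0; lra).
    assert (I1 : / Cmod (hsin (z - s)) <= / c * / cosh ((Re z - s) / 2)).
    { rewrite <- Rinv_mult. apply Rinv_le_contravar; nra. }
    assert (I2 : / Cmod (Cprod idx (fun k => htan kap (z - t k))) <= / m) by (apply Rinv_le_contravar; lra).
    assert (Hi1 : 0 < / c) by (apply Rinv_0_lt_compat; auto). assert (Hi2 : 0 < / m) by (apply Rinv_0_lt_compat; auto).
    apply Rle_trans with (Cmod (pull f q z) * (/ c * / cosh ((Re z - s) / 2)) * / m).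
    - apply Rmult_le_compat.
      + apply Rmult_le_pos. apply Cmod_ge_0. left; apply Rinv_0_lt_compat; lra.
      + left; apply Rinv_0_lt_compat; lra.
      + apply Rmult_le_compat_l; auto. apply Cmod_ge_0.
      + exact I2.
    - rewrite Rinv_mult.
      replace (Cmod (pull f q z) * (/ c * / cosh ((Re z - s) / 2)) * / m) with
        (/ c * / m * (Cmod (pull f q z) * / cosh ((Re z - s) / 2))) by ring.
      apply Rmult_le_compat_l. nra. apply Bpull; auto. }
  assert (Hhor : forall u y, y = eta \/ y = - eta -> Cmod (G (u, y)) <= 2 / S0 * C0 / (1 + (u - s) ^ 2) /\ cc G (u, y)).
  { intros u y Hy. assert (Hya : Rabs y = eta) by (destruct Hy as [->| ->]; rewrite ?Rabs_Ropp; apply Rabs_pos_eq; lra).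
    assert (Hz : Rabs (Im (u, y)) < d) by (simpl; lra).
    assert (Hzx : forall x : R, (u, y) <> RtoC x).
    { intros x E. apply (f_equal snd) in E. simpl in E. rewrite E, Rabs_R0 in Hya. lra. }
    split; [|apply HG; auto].
    apply Rle_trans with (/ (S0 * / 2) * (C0 / (1 + (u - s) ^ 2))).
    - apply (BG (u, y) S0 (/ 2)); auto; try lra.
      + unfold hsin. simpl Re at 1.
        replace ((u - s) / 2) with (Re (((u, y) - s) / 2)%C) by (rewrite Re_half, ReS; reflexivity).
        apply Cmod_Csinh_lower. lra. left. rewrite Im_half, ImS. simpl Im.
        assert (Hsy : sin (y / 2) * sin (y / 2) = sin (eta / 2) * sin (eta / 2)).
        { destruct Hy as [->| ->]; auto. replace (- eta / 2) with (- (eta / 2)) by field. rewrite sin_neg. ring. }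
        rewrite Hsy. assert (S0 <= sin (eta / 2)) by (apply sin_incr_1; lra). nra.
      + apply Rle_trans with (1 := He2). apply Cprod_ge_pow.
        * apply Rlt_le, tan_gt_0; nra.
        * intros k Hki. unfold htan. apply Cmod_Ctanh_lower_Im. split; nra.
          rewrite im_scal_l, ImS, Rabs_mult, (Rabs_pos_eq kap) by lra. simpl Im. rewrite Hya; auto.
    - right. field. generalize (pow2_ge_0 (u - s)). lra. }
  destruct (list_Rabs_bound idx t) as [T0 [HT0 HT]].
  (* Each horizontal edge gives at most [4 / S0 * C0 * PI]. The length [ext] is chosen so that each
     vertical edge gives at most [e / 2]; it may depend on the number of nodes, because [e] is
     arbitrary and disappears at the end. *)
  assert (HXe : forall e, 0 < e -> 2 * PI * Cmod X <= 8 / S0 * C0 * PI + e).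
  { intros e Hee.
    set (ext := 2 ^ n * 2 * C0 * 8 * eta / e).
    assert (H2n : 0 < 2 ^ n) by (apply pow_lt; lra).
    assert (Hext : 0 < ext).
    { unfold ext. apply Rdiv_lt_0_compat; auto.
      assert (0 < 2 ^ n * 2 * C0) by (apply Rmult_lt_0_compat; lra). nra. }
    set (RR := T0 + Rabs s + 4 + 2 / kap + ext).
    assert (H2k : 0 < 2 / kap) by (apply Rdiv_lt_0_compat; lra).
    assert (Hs0 := Rabs_pos s).
    assert (Hsb : - Rabs s <= s <= Rabs s) by (apply Rabs_le_between; lra).
    assert (HTb : forall k, In k idx -> - T0 <= t k <= T0) by (intros k Hki; apply Rabs_le_between, HT, Hki).
    assert (Hver : forall x y, x = RR \/ x = - RR -> - eta <= y <= eta ->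
      Cmod (G (x, y)) <= 2 ^ n * 2 * C0 / ext /\ cc G (x, y)).
    { intros x y Hx Hy.
      assert (Hz : Rabs (Im (x, y)) < d) by (simpl; apply Rabs_def1; lra).
      assert (Hfar : forall v, - (T0 + Rabs s) <= v <= T0 + Rabs s -> 4 + 2 / kap + ext <= Rabs (x - v)).
      { intros v Hv. destruct Hx as [->| ->]. rewrite Rabs_pos_eq; unfold RR; lra. rewrite Rabs_left; unfold RR; lra. }
      assert (Hfs := Hfar s ltac:(lra)).
      assert (Hzs : (x, y) <> RtoC s). { intros E. apply (f_equal fst) in E. simpl in E.
        rewrite E, Rminus_diag, Rabs_R0 in Hfs. lra. }
      assert (Hzt : forall k, In k idx -> (x, y) <> RtoC (t k)).
      { intros k Hki E. apply (f_equal fst) in E. simpl in E.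
        assert (Hft := Hfar (t k) ltac:(specialize (HTb k Hki); lra)).
        rewrite E, Rminus_diag, Rabs_R0 in Hft. lra. }
      split; [|apply HG; auto].
      apply Rle_trans with (/ (/ 2 * (/ 2) ^ n) * (C0 / (1 + (x - s) ^ 2))).
      - apply (BG (x, y) (/ 2) ((/ 2) ^ n)); auto; try lra.
        + apply pow_lt; lra.
        + unfold hsin. simpl Re at 1.
          replace ((x - s) / 2) with (Re (((x, y) - s) / 2)%C) by (rewrite Re_half, ReS; reflexivity).
          apply Cmod_Csinh_lower. lra. right. split; auto. rewrite Re_half, ReS, Rabs_half. simpl Re. lra.
        + apply Cprod_ge_pow. lra. intros k Hki. unfold htan. apply Cmod_Ctanh_lower_Re.
          rewrite im_scal_l, ImS, Rabs_mult, (Rabs_pos_eq kap) by lra. auto.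
          rewrite re_scal_l, ReS, Rabs_mult, (Rabs_pos_eq kap) by lra. simpl Re.
          assert (Hft := Hfar (t k) ltac:(specialize (HTb k Hki); lra)).
          apply Rle_trans with (kap * (2 / kap)). right; field; lra. apply Rmult_le_compat_l; lra.
      - rewrite pow_inv. replace (/ (/ 2 * / 2 ^ n)) with (2 ^ n * 2) by (field; lra).
        unfold Rdiv. rewrite <- Rmult_assoc. apply Rmult_le_compat_l. apply Rmult_le_pos; lra.
        apply Rinv_le_contravar; auto.
        assert (Hsq : Rabs (x - s) * Rabs (x - s) = (x - s) ^ 2).
        { rewrite <- Rabs_mult, Rabs_pos_eq by (apply Rle_0_sqr). ring. }
        assert (Rabs (x - s) * 1 <= Rabs (x - s) * Rabs (x - s)) by (apply Rmult_le_compat_l; lra). lra. }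
    assert (HRR : 0 < RR) by (unfold RR; lra).
    assert (RS := residue_sum g (- RR) RR (- eta) eta s idx t Hnd Hne Hinj).
    assert (RS' : rect G (- RR) RR (- eta) eta = (2 * PI * Ci * (g s * / Cprod idx (fun k => RtoC s - t k) +
       Csum idx (fun k => pf_coef idx t k * / (RtoC (t k) - s) * g (t k))))%C).
    { apply RS; auto; try lra.
      - intros k Hki. specialize (HTb k Hki). unfold RR; lra.
      - unfold RR; lra.
      - intros x y _ Hy. apply Hgcc. simpl. apply Rabs_def1; lra.
      - intros x y _ Hy Hy0. apply Hgcd; auto. simpl. apply Rabs_def1; lra. }
    clear RS.
    (* At its own pole each [theta] has the value filled in at 0: 2 for [hsin] and [/ kap] for
       [htan]. These are the constants in [X]. *)
    assert (EX : (g s * / Cprod idx (fun k => RtoC s - t k) +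
       Csum idx (fun k => pf_coef idx t k * / (RtoC (t k) - s) * g (t k)))%C = X).
    { unfold X.
      assert (Th0 : forall h l, theta h l 0 = (/ l)%C) by (intros; unfold theta; destruct (Ceq_dec 0 0); tauto).
      assert (R0 : forall x y : R, x <> y -> (RtoC x - y)%C <> 0).
      { intros x y Hxy. apply Hnz. intros E; apply Hxy, RtoC_inj; auto. }
      assert (Rt : forall x y : R, x <> y -> htan kap (RtoC x - y) <> 0).
      { intros x y Hxy. assert (h2 : kap * Rabs (Im (RtoC x - y)) < PI / 2).
        { rewrite ImS, im_RtoC, Rabs_R0. lra. }
        apply (proj2 (htan_strip kap _ Hk h2)). auto. }
      f_equal.
      - unfold g. replace (RtoC s - s)%C with (RtoC 0) by ring. rewrite Th0.
        replace (/ / 2)%C with (RtoC 2) by (field; exact C2_neq_0).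
        rewrite (Cprod_inv idx (fun k => RtoC s - t k)%C) by auto.
        rewrite (Cprod_inv idx (fun k => htan kap (RtoC s - t k))) by auto.
        rewrite <- Cmult_assoc, Cprod_mult. f_equal. apply Cprod_ext. intros k Hki. apply theta_div; auto.
      - apply Csum_ext. intros k Hki. unfold g, pf_coef.
        rewrite (Cprod_filter_out idx k) by auto.
        replace (RtoC (t k) - t k)%C with (RtoC 0) by ring. rewrite Th0.
        set (oth := filter (fun l => negb (l =? k)%Z) idx).
        assert (Hoth : forall l, In l oth -> t k <> t l).
        { intros l Hl E. apply filter_In in Hl. destruct Hl as [Hl1 Hl2].
          rewrite (Hinj k l Hki Hl1 E), Z.eqb_refl in Hl2. discriminate. }
        assert (Hsk : t k <> s) by (intros E; apply (Hst k Hki); auto).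
        rewrite (Cprod_inv oth (fun l => RtoC (t k) - RtoC (t l))%C) by auto.
        rewrite (Cprod_inv oth (fun l => htan kap (RtoC (t k) - t l))) by auto.
        assert (h1 : Rabs (Im (RtoC (t k) - s)) < PI) by (rewrite ImS, im_RtoC, Rabs_R0; lra).
        destruct (proj2 (hsin_strip _ h1) (R0 _ _ Hsk)) as [N3 _].
        rewrite <- (theta_div hsin (/ 2) (RtoC (t k) - s)) by auto.
        rewrite <- (Cprod_ext oth (fun l => / (RtoC (t k) - t l) * theta (htan kap) kap (RtoC (t k) - t l))%C
          (fun l => / htan kap (RtoC (t k) - t l))%C).
        + rewrite <- Cprod_mult. ring.
        + intros l Hl. rewrite Cmult_comm. apply theta_div; auto. }
    rewrite EX in RS'.
    assert (Emod : Cmod (rect G (- RR) RR (- eta) eta) = 2 * PI * Cmod X).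
    { rewrite RS', !Cmod_mult, Cmod_Ci, !Cmod_R, !Rabs_pos_eq by lra. ring. }
    rewrite <- Emod.
    assert (Hlh : forall y, y = eta \/ y = - eta -> lc (hor G y) (- RR) RR) by (intros y Hy; apply lc_hor; intros; apply Hhor; auto).
    assert (Hlv : forall x, x = RR \/ x = - RR -> lc (ver G x) (- eta) eta) by (intros x Hx; apply lc_ver; intros; apply Hver; auto).
    destruct (RInt_cauchy_density s (2 / S0 * C0) (- RR) RR ltac:(lra)) as [Ex Bd].
    { apply Rmult_le_pos; [|lra]. left; apply Rdiv_lt_0_compat; lra. }
    assert (B1 : forall y, y = eta \/ y = - eta -> Cmod (CI (hor G y) (- RR) RR) <= 2 * (2 / S0 * C0 * PI)).
    { intros y Hy. apply Rle_trans with (2 * RInt (fun u => 2 / S0 * C0 / (1 + (u - s) ^ 2)) (- RR) RR).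
      - apply CI_bound_fun; auto. lra. intros u _. exact (proj1 (Hhor u y Hy)).
      - lra. }
    assert (B2 : forall x, x = RR \/ x = - RR -> Cmod (CI (ver G x) (- eta) eta) <= e / 2).
    { intros x Hx. apply Rle_trans with (2 * (2 ^ n * 2 * C0 / ext) * (eta - - eta)).
      - apply CI_bound; auto. lra. intros y Hy. exact (proj1 (Hver x y Hx Hy)).
      - right. unfold ext. field. repeat split; lra. }
    unfold rect. apply Rle_trans with (1 := Cmod_triangle _ _). rewrite Cmod_mult, Cmod_Ci, Rmult_1_l.
    assert (T1 := Cmod_triangle (CI (hor G (- eta)) (- RR) RR) (- CI (hor G eta) (- RR) RR)).
    assert (T2 := Cmod_triangle (CI (ver G RR) (- eta) eta) (- CI (ver G (- RR)) (- eta) eta)).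
    rewrite Cmod_opp in T1, T2. unfold Cminus.
    assert (D1 := B1 eta (or_introl eq_refl)). assert (D2 := B1 (- eta) (or_intror eq_refl)).
    assert (D3 := B2 RR (or_introl eq_refl)). assert (D4 := B2 (- RR) (or_intror eq_refl)).
    replace (8 / S0 * C0 * PI) with (2 * (2 * (2 / S0 * C0 * PI))) by (field; lra). lra. }
  apply Rmult_le_reg_l with (2 * PI). lra.
  replace (2 * PI * (4 / S0 * C1 * Rpower (cosh (s / 2)) p)) with (8 / S0 * C0 * PI) by (unfold C0; field; lra).
  apply Rnot_lt_le. intros Hlt.
  assert (H := HXe ((2 * PI * Cmod X - 8 / S0 * C0 * PI) / 2) ltac:(lra)). lra.
Qed.


(** * The error of the formula *)

Lemma list_avoid_right (l : list R) (x b : R) : x < b ->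
  exists c, x < c <= b /\ forall y, x < y < c -> ~ In y l.
Proof.
  intros Hxb. induction l as [|a l [c [Hc IH]]].
  - exists b. split. lra. intros y _ [].
  - destruct (Rlt_le_dec x a) as [Ha|Ha].
    + exists (Rmin a c). split.
      split. apply Rmin_glb_lt; lra. apply Rle_trans with (1 := Rmin_r _ _); lra.
      intros y Hy [E|Hin]. assert (h := Rmin_l a c). lra.
      apply (IH y); auto. assert (h := Rmin_r a c). lra.
    + exists c. split; auto. intros y Hy [E|Hin]. lra. apply (IH y); auto.
Qed.

(** The contour estimate is available only off the nodes; points slightly to the right of a node
    carry the bound over by continuity. *)
Lemma Cmod_le_off_finite (F : C -> C) (l : list R) (x M : R) : cc F (RtoC x) -> -1 < x < 1 ->
  (forall y, -1 < y < 1 -> ~ In y l -> Cmod (F (RtoC y)) <= M) -> Cmod (F (RtoC x)) <= M.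
Proof.
  intros Hc Hx H. apply Rnot_lt_le. intros Hlt.
  destruct (Hc (Cmod (F (RtoC x)) - M) ltac:(lra)) as [dl [Dl E]].
  destruct (list_avoid_right l x (Rmin (x + dl) 1)) as [c [Hxc Hl]].
  { apply Rmin_glb_lt; lra. }
  assert (h1 := Rmin_l (x + dl) 1). assert (h2 := Rmin_r (x + dl) 1).
  set (y := (x + c) / 2). assert (Hy : x < y < c) by (unfold y; lra).
  specialize (H y ltac:(lra) (Hl y Hy)). specialize (E (RtoC y)).
  rewrite <- RtoC_minus, Cmod_R, Rabs_pos_eq in E by lra. specialize (E ltac:(lra)).
  assert (T := Cmod_triangle (F (RtoC y)) (F (RtoC x) - F (RtoC y))).
  replace (F (RtoC y) + (F (RtoC x) - F (RtoC y)))%C with (F (RtoC x)) in T by ring.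
  rewrite (Cmod_minus_sym (F (RtoC x))) in T. lra.
Qed.

Lemma b_k_lt_1 (r : R) (N : nat) (k : Z) : 0 < r -> (1 <= N_0 r N)%Z -> In k (nonzero_indices N) ->
  -1 < b_k r N k < 1.
Proof.
  intros Hr HN Hk. apply in_nonzero_indices in Hk.
  destruct (Z_lt_le_dec k 0).
  - assert (H := b_k_bounds r N (Z.to_nat (- k)) Hr HN ltac:(lia)).
    rewrite Z2Nat.id, b_k_opp in H by lia. lra.
  - assert (H := b_k_bounds r N (Z.to_nat k) Hr HN ltac:(lia)).
    rewrite Z2Nat.id in H by lia. lra.
Qed.

Lemma b_k_inj (r : R) (N : nat) (j k : Z) : 0 < r -> formula_defined r N ->
  In j (nonzero_indices N) -> In k (nonzero_indices N) -> b_k r N j = b_k r N k -> j = k.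
Proof.
  intros Hr [HN Hinj] Hj Hk E. apply in_nonzero_indices in Hj. apply in_nonzero_indices in Hk.
  assert (P : forall j k, (1 <= j <= Z.of_nat N)%Z -> (1 <= k <= Z.of_nat N)%Z ->
    b_k r N j = b_k r N k -> j = k).
  { clear - Hr HN Hinj. intros j k Hj Hk E.
    assert (Hgj := ganelius_bounds r N (Z.to_nat j) Hr HN ltac:(lia)).
    assert (Hgk := ganelius_bounds r N (Z.to_nat k) Hr HN ltac:(lia)).
    rewrite !Z2Nat.id in Hgj, Hgk by lia. apply Hinj; auto.
    unfold b_k in E. rewrite !Z.abs_eq, !Z.sgn_pos, !Rmult_1_l in E by lia.
    apply sqrt_inj in E; try (left; apply Rdiv_lt_0_compat; lra).
    set (a := ganelius r N j) in *. set (b := ganelius r N k) in *.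
    assert (h : (1 - a) * (1 + b) = (1 - b) * (1 + a)).
    { replace (1 - a) with ((1 - a) / (1 + a) * (1 + a)) by (field; lra). rewrite E. field. lra. }
    lra. }
  assert (S : forall j, (1 <= j <= Z.of_nat N)%Z -> 0 < b_k r N j).
  { intros i Hi. assert (H := b_k_bounds r N (Z.to_nat i) Hr HN ltac:(lia)).
    rewrite Z2Nat.id in H by lia. lra. }
  assert (O : forall j, b_k r N j = - b_k r N (- j)).
  { intros i. rewrite b_k_opp. ring. }
  destruct (Z_lt_le_dec j 0); destruct (Z_lt_le_dec k 0).
  - assert (- j = - k)%Z; [|lia]. apply P; try lia. rewrite (O j), (O k) in E. lra.
  - exfalso. rewrite O in E. assert (h := S (- j)%Z ltac:(lia)). assert (h' := S k ltac:(lia)). lra.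
  - exfalso. rewrite (O k) in E. assert (h := S (- k)%Z ltac:(lia)). assert (h' := S j ltac:(lia)). lra.
  - apply P; auto; lia.
Qed.

Lemma tanh_minus_arctanh (a b : R) : -1 < a < 1 -> -1 < b < 1 ->
  tanh (arctanh a - arctanh b) = (a - b) / (1 - a * b).
Proof.
  intros Ha Hb. rewrite <- (tanh_arctanh a) at 2 3 by auto. rewrite <- (tanh_arctanh b) at 2 3 by auto.
  set (x := arctanh a). set (y := arctanh b). rewrite !tanh_exp.
  replace (2 * (x - y)) with (2 * x + - (2 * y)) by ring. rewrite exp_plus, exp_Ropp.
  assert (0 < exp (2 * x)) by apply exp_pos. assert (0 < exp (2 * y)) by apply exp_pos.
  set (u := exp (2 * x)) in *. set (v := exp (2 * y)) in *.
  field. repeat split; try lra.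
Qed.

Lemma tanh_half_minus (s t : R) :
  tanh (s / 2) - tanh (t / 2) = sinh ((s - t) / 2) / (cosh (s / 2) * cosh (t / 2)).
Proof.
  unfold tanh. assert (h1 := cosh_pos (s / 2)). assert (h2 := cosh_pos (t / 2)).
  apply Rmult_eq_reg_r with (cosh (s / 2) * cosh (t / 2)). 2: nra.
  field_simplify; try lra.
  unfold sinh, cosh. replace ((s - t) / 2) with (s / 2 + - (t / 2)) by field.
  rewrite !Ropp_plus_distr, !exp_plus, !Ropp_involutive. field.
Qed.

Lemma Rinv_Rprod {I : Type} (s : list I) (F : I -> R) : / Rprod s F = Rprod s (fun i => / F i).
Proof.
  induction s as [|i s IH]. apply Rinv_1. rewrite !Rprod_cons, Rinv_mult, IH; auto.
Qed.

Lemma Cinv_RtoC (x : R) : (/ RtoC x)%C = RtoC (/ x).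
Proof.
  destruct (Req_dec x 0) as [->|Hx]. 2: rewrite RtoC_inv; auto.
  rewrite Rinv_0. unfold Cinv, RtoC; simpl. f_equal; unfold Rdiv; ring.
Qed.

(** Up to a common factor, [f] is the residue at [s], and each summand of the formula is minus the
    residue at a node, of the integrand in [contour_bound]. The nodes are excluded because the
    bracket divides by a product that vanishes there. *)
Lemma error_representation (d r nu : R) (N : nat) (f : C -> C) (s : R) :
  0 < d -> 0 < r -> formula_defined r N ->
  (forall k, In k (nonzero_indices N) -> s <> node d r N k) ->
  let idx := nonzero_indices N in let t := node d r N in
  let kap := PI / (4 * d) in let q := 2 * nu - 1 in
  (f (RtoC (tanh (s / 2))) - f_tilde d r nu N f (tanh (s / 2)))%C =
  (RtoC (B_N d r N (tanh (s / 2)) / 2 * Rpower (cosh (s / 2)) (- q)) *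
   (pull f q s * 2 * / Cprod idx (fun k => htan kap (RtoC s - t k)) +
    Csum idx (fun k => pull f q (t k) * / kap * / hsin (RtoC (t k) - s) *
      / Cprod (filter (fun l => negb (l =? k)%Z) idx) (fun l => htan kap (RtoC (t k) - t l)))))%C.
Proof.
  intros Hd Hr Hdef Hs idx t kap q. assert (Hpi := PI_RGT_0).
  assert (Hkap : 0 < kap) by (apply Rdiv_lt_0_compat; lra).
  assert (Hh : forall x y : R, htan kap (RtoC x - RtoC y) = RtoC (tanh (kap * (x - y)))).
  { intros. unfold htan. rewrite <- RtoC_minus, <- RtoC_mult. apply Ctanh_R. }
  assert (Hpull : forall x, pull f q (RtoC x) = (f (RtoC (tanh (x / 2))) * RtoC (Rpower (cosh (x / 2)) q))%C).
  { intros. unfold pull. rewrite RtoC_half, Ctanh_R, cosh_pow_R. auto. }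
  set (cs := cosh (s / 2)). assert (Hcs : 0 < cs) by apply cosh_pos.
  assert (Hpow : forall y, 0 < y -> Rpower y q * Rpower y (- q) = 1).
  { intros y Hy. rewrite <- Rpower_plus. replace (q + - q) with 0 by ring. apply Rpower_O; auto. }
  set (B := B_N d r N (tanh (s / 2))).
  assert (HB : Cprod idx (fun k => htan kap (RtoC s - t k)) = RtoC B).
  { unfold B. rewrite B_N_tanh, <- Cprod_RtoC by auto. apply Cprod_ext. intros k _. apply Hh. }
  assert (HB0 : B <> 0).
  { intros E. assert (E' : Cprod idx (fun k => htan kap (RtoC s - t k)) = 0) by (rewrite HB, E; auto).
    revert E'. apply Cprod_neq_0. intros k Hk. rewrite Hh. intros E'. apply RtoC_inj in E'.
    apply (Hs k Hk). fold (t k).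
    assert (E0 : tanh 0 = 0) by (unfold tanh; rewrite sinh_0; unfold Rdiv; ring).
    rewrite <- E0 in E'. apply tanh_inj in E'. nra. }
  rewrite HB, Hpull, Cmult_plus_distr_l. unfold Cminus at 1. f_equal.
  { transitivity (f (RtoC (tanh (s / 2))) * RtoC (Rpower cs q * Rpower cs (- q)))%C.
    rewrite Hpow by auto. ring. fold cs.
    rewrite !RtoC_mult, RtoC_div by lra. field. intros E; apply HB0, RtoC_inj; auto. }
  unfold f_tilde. fold idx.
  rewrite Csum_scal. replace (- Csum _ _)%C with (- (1) * Csum idx (fun k => f (RtoC (beta_k d r N k)) *
    RtoC (2 * d * sigma_k r N k / PI * (Rpower (1 - tanh (s / 2) ^ 2) nu / Rpower (1 - beta_k d r N k ^ 2) (nu - 1)) *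
      B_quot d r N k (tanh (s / 2)))))%C by ring.
  rewrite Csum_scal. apply Csum_ext. intros k Hk.
  rewrite Hpull, <- RtoC_minus, beta_k_node. fold (t k).
  set (ct := cosh (t k / 2)). assert (Hct : 0 < ct) by apply cosh_pos.
  (* [(b_k - b_l) / (1 - b_k b_l)] is the [tanh] of the difference of the [arctanh] values, so
     [sigma_k] is the reciprocal of the product of the other factors at the node. *)
  assert (Hsig : (/ Cprod (filter (fun l => negb (l =? k)%Z) idx) (fun l => htan kap (RtoC (t k) - t l)))%C
    = RtoC (sigma_k r N k)).
  { rewrite (Cprod_ext _ _ (fun l => RtoC (tanh (kap * (t k - t l))))) by (intros; apply Hh).
    rewrite Cprod_RtoC, Cinv_RtoC, Rinv_Rprod. f_equal. unfold sigma_k. apply Rprod_ext. intros l Hl. apply filter_In in Hl. destruct Hl as [Hl _].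
    replace (kap * (t k - t l)) with (arctanh (b_k r N k) - arctanh (b_k r N l)).
    2:{ unfold t, node, kap. field. lra. }
    rewrite tanh_minus_arctanh by (apply b_k_lt_1; auto; apply Hdef).
    rewrite Rinv_div. f_equal. ring. }
  rewrite Hsig.
  assert (Hst : s - t k <> 0) by (intros E; apply (Hs k Hk); fold (t k); lra).
  assert (Hsh : sinh ((s - t k) / 2) <> 0).
  { intros E. assert (h := tanh_half_minus s (t k)). rewrite E in h.
    apply Hst. assert (E1 : s / 2 = t k / 2); [|lra]. apply tanh_inj. lra. }
  unfold hsin. rewrite RtoC_half, Csinh_R. unfold B_quot. rewrite beta_k_node. fold (t k).
  destruct (Req_EM_T (tanh (s / 2)) (tanh (t k / 2))) as [E|_].
  { apply tanh_inj in E. exfalso. apply Hst. lra. }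
  rewrite tanh_half_minus, !Rpower_one_minus_tanh_sqr. fold cs ct. fold B.
  replace ((t k - s) / 2) with (- ((s - t k) / 2)) by field.
  assert (Hopp : forall x, sinh (- x) = - sinh x).
  { intros x. unfold sinh. rewrite Ropp_involutive. field. }
  rewrite Hopp.
  set (S := sinh ((s - t k) / 2)) in *.
  (* The single powers of [cosh] split off here cancel those in [tanh (s / 2) - tanh (t k / 2) =
     sinh ((s - t k) / 2) / (cosh (s / 2) * cosh (t k / 2))]; only the exponent [q] remains. *)
  replace (- (2 * nu)) with (- q + - (1)) by (unfold q; ring).
  replace (- (2 * (nu - 1))) with (1 + - q) by (unfold q; ring).
  rewrite !Rpower_plus, (Rpower_Ropp cs 1), !Rpower_1, (Rpower_Ropp ct q) by auto.
  assert (P1 : 0 < Rpower ct q) by apply exp_pos. assert (P2 : 0 < Rpower cs (- q)) by apply exp_pos.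
  set (w := Rpower ct q) in *. set (v := Rpower cs (- q)) in *.
  symmetry. transitivity (f (RtoC (tanh (t k / 2))) * RtoC (B / 2 * v * (w * / kap * / - S * sigma_k r N k)))%C.
  { rewrite !RtoC_mult, <- !Cinv_RtoC. ring. }
  symmetry. rewrite <- RtoC_opp, !(Cmult_assoc (RtoC (- (1)))), (Cmult_comm (RtoC (- (1)))), <- !Cmult_assoc, <- !RtoC_mult.
  f_equal. f_equal.
  unfold kap. field. repeat split; lra.
Qed.

Lemma formula_error_bound (d mu nu : R) : 0 < d < PI -> 0 < mu -> mu / 2 < nu < mu / 2 + 1 ->
  exists K, 0 < K /\ forall N, (0 < N)%nat -> formula_defined (d * mu / PI) N ->
    forall f x, unit_ball d mu f -> -1 < x < 1 ->
    Cmod (f (RtoC x) - f_tilde d (d * mu / PI) nu N f x) <= K * exp (- sqrt (PI * d * mu * INR N)).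
Proof.
  intros Hd Hmu Hnu. assert (Hpi := PI_RGT_0).
  destruct (weighted_B_N_bound d mu ltac:(lra) Hmu) as [K1 [HK1 H1]].
  destruct (contour_bound d mu (2 * nu - 1) Hd ltac:(lra)) as [K2 [HK2 H2]].
  exists (K2 / 2 * K1). split. apply Rmult_lt_0_compat; lra.
  intros N HN Hdef f x Hf Hx. set (r := d * mu / PI) in *.
  assert (Hr : 0 < r) by (unfold r; apply Rdiv_lt_0_compat; [apply Rmult_lt_0_compat|]; lra).
  set (idx := nonzero_indices N).
  assert (Hinj : forall j k, In j idx -> In k idx -> node d r N j = node d r N k -> j = k).
  { intros j k Hj Hk E. apply (b_k_inj r N); auto.
    rewrite <- (tanh_arctanh (b_k r N j)), <- (tanh_arctanh (b_k r N k)) by (apply b_k_lt_1; auto; apply Hdef).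
    f_equal. unfold node in E. apply Rmult_eq_reg_l with (1 := E).
    apply Rgt_not_eq. apply Rdiv_lt_0_compat; lra. }
  assert (Hne : idx <> []).
  { intros E. assert (h := length_nonzero_indices N). fold idx in h. rewrite E in h. simpl in h. lia. }
  assert (Hoff : forall y, -1 < y < 1 -> ~ In y (map (beta_k d r N) idx) ->
    Cmod (f (RtoC y) - f_tilde d r nu N f y) <= K2 / 2 * K1 * exp (- sqrt (PI * d * mu * INR N))).
  { intros y Hy Hyn. destruct (tanh_half_surj y Hy) as [s ->].
    assert (Hs : forall k, In k idx -> s <> node d r N k).
    { intros k Hk E. apply Hyn. apply in_map_iff. exists k. split; auto. rewrite beta_k_node, E. auto. }
    rewrite error_representation by (auto; lra). fold idx.
    specialize (H2 idx (node d r N) f s (NoDup_nonzero_indices N) Hne Hinj Hs Hf).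
    specialize (H1 N s HN (proj1 Hdef)). fold r in H1. cbv zeta in H2.
    rewrite Cmod_mult, Cmod_R, Rabs_mult, (Rabs_pos_eq (Rpower _ _)) by (left; apply exp_pos).
    unfold Rdiv at 1. rewrite Rabs_mult, (Rabs_pos_eq (/ 2)) by lra.
    set (B := Rabs (B_N d r N (tanh (s / 2)))) in *. assert (0 <= B) by apply Rabs_pos.
    set (u := Rpower (cosh (s / 2)) (- (2 * nu - 1))). assert (0 < u) by apply exp_pos.
    apply Rle_trans with (B * / 2 * u * (K2 * Rpower (cosh (s / 2)) (2 * nu - 1 - mu))).
    { apply Rmult_le_compat_l; auto. apply Rmult_le_pos; lra. }
    (* The exponents [- (2 nu - 1)] and [2 nu - 1 - mu] add up to [- mu], the weight under which
       [weighted_B_N_bound] controls the product. *)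
    replace (B * / 2 * u * (K2 * Rpower (cosh (s / 2)) (2 * nu - 1 - mu)))
      with (K2 / 2 * (Rpower (cosh (s / 2)) (- mu) * B)).
    2:{ replace (- mu) with (- (2 * nu - 1) + (2 * nu - 1 - mu)) by ring. rewrite Rpower_plus. fold u. field. }
    rewrite Rmult_assoc. apply Rmult_le_compat_l. lra. exact H1. }
  destruct (finite_choice_Z idx _ (fun k Hk => coefficient_function d r nu N k Hd Hk) Hne) as [phi Hphi].
  (* With the analytic coefficients in place of the real ones, the error is continuous on the
     interval, nodes included. *)
  set (F := fun z => (f z - Csum idx (fun k => f (RtoC (beta_k d r N k)) * phi k z))%C).
  assert (HF : forall y, -1 < y < 1 -> F (RtoC y) = (f (RtoC y) - f_tilde d r nu N f y)%C).
  { intros y Hy. unfold F, f_tilde. fold idx. apply (f_equal (Cminus _)), Csum_ext. intros k Hk.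
    f_equal. apply (proj2 (Hphi k Hk)); auto. }
  rewrite <- HF by auto. apply Cmod_le_off_finite with (l := map (beta_k d r N) idx); auto.
  2:{ intros y Hy Hyn. rewrite HF; auto. }
  assert (HL : Lambda d (RtoC x)).
  { destruct (tanh_half_surj x Hx) as [s ->]. apply Lambda_R; lra. }
  apply cc_minus.
  - destruct Hf as [[Hf _] _]. destruct (proj1 (ex_derive_cd _ _) (Hf _ HL)) as [l Hl]. apply (cd_cc _ _ _ Hl).
  - assert (Hall : forall s, (forall k, In k s -> In k idx) ->
      cc (fun z => Csum s (fun k => f (RtoC (beta_k d r N k)) * phi k z)%C) (RtoC x)).
    { induction s as [|k s IH]; intros Hin. apply (cc_const 0).
      apply (cc_plus (fun z => (f (RtoC (beta_k d r N k)) * phi k z)%C)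
        (fun z => Csum s (fun k => f (RtoC (beta_k d r N k)) * phi k z)%C)).
      - apply cc_mult. apply cc_const.
        destruct (proj1 (Hphi k (Hin k (or_introl eq_refl))) _ HL) as [l Hl]. apply (cd_cc _ _ _ Hl).
      - apply IH. intros; apply Hin; right; auto. }
    apply Hall; auto.
Qed.

Theorem mainTheorem2 (d mu nu : R)
  (hd : 0 < d < PI) (hmu : 0 < mu) (hnu : 0 < nu)
  (hmunu : mu / 2 < nu < mu / 2 + 1) :
  exists c K : R, 0 < c /\ 0 < K /\
    forall N : nat, (0 < N)%nat -> formula_defined (d * mu / PI) N ->
      Rbar_le (Finite (c * exp (- sqrt (PI * d * mu * INR N))))
              (Emin (2 * N) d mu) /\
      Rbar_le (Emin (2 * N) d mu)
              (worst_error d mu (f_tilde d (d * mu / PI) nu N)) /\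
      Rbar_le (worst_error d mu (f_tilde d (d * mu / PI) nu N))
              (Finite (K * exp (- sqrt (PI * d * mu * INR N)))).
Proof.
  destruct (formula_error_bound d mu nu hd hmu hmunu) as [K [HK H]].
  exists (/ 2), K. split. lra. split; auto. intros N HN Hdef. repeat split.
  - apply Emin_lower_bound; auto.
  - apply Emin_le_worst_error; auto.
  - apply worst_error_le. intros f x Hf Hx. apply H; auto.
Qed.
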